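(* Let $\Sigma$ be a complete, connected, $n$-dimensional manifold, $n\ge3$, and let $\iota:\Sigma\to\mathbb R^{n+1}$ be a two-sided, proper, minimal immersion with finite total curvature, $$\int_\Sigma|A_\Sigma|^n<+\infty,$$ and Euclidean volume growth at infinity, $$\limsup_{r\to\infty}\frac{\mathcal H^n(\iota(\Sigma)\cap B^{n+1}_r(0))}{r^n}<+\infty .$$ Then $$\text{anl-nul}(\Sigma):=\dim\{f\in W^{1,2}(\Sigma):\Delta f+|A_\Sigma|^2f=0\}<+\infty .$$
   Context: $\Sigma$ carries the Riemannian metric induced by $\iota$, with respect to which it is complete; $\Delta$ is its Laplace–Beltrami operator and $A_\Sigma$ the second fundamental form of $\iota$. $B^{n+1}_r(0)$ is the open ball in $\mathbb R^{n+1}$ and $\mathcal H^n$ is $n$-dimensional Hausdorff measure. The equation $\Delta f+|A_\Sigma|^2f=0$ is understood weakly (equivalently, classically, by elliptic regularity). *)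

(* Defs.v *)
From HB Require Import structures.
From mathcomp Require Import all_boot all_order all_algebra.
From mathcomp Require Import all_classical all_reals all_analysis.

Set Implicit Arguments.
Unset Strict Implicit.
Unset Printing Implicit Defensive.

Import Order.TTheory GRing.Theory Num.Theory.
Import numFieldNormedType.Exports.

Local Open Scope classical_set_scope.
Local Open Scope ring_scope.

(* Points of R^n are row vectors 'rV[R]_n.  The norm that the library puts on *)
(* them is the sup norm: it is used for topology and differentiation only,    *)
(* and every metric quantity below uses the Euclidean dot product.            *)

Section Euclidean.
Context {R : realType}.

Definition dotv {m : nat} (u v : 'rV[R]_m) : R := \sum_j u 0 j * v 0 j.

Definition enorm {m : nat} (v : 'rV[R]_m) : R := Num.sqrt (dotv v v).

Definition eball {m : nat} (r : R) : set 'rV[R]_m := [set y | enorm y < r].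

End Euclidean.

(* n-dimensional Lebesgue measure, built as an iterated product measure on    *)
(* n.-tuple, the type that the library equips with a product sigma-algebra.   *)
Section Lebesgue.
Context {R : realType}.
Local Notation Rm := (measurableTypeR R).

Section cons_measure.
Variables (n : nat) (m : {sigma_finite_measure set (n.-tuple Rm) -> \bar R}).

Definition consp (p : Rm * n.-tuple Rm) : n.+1.-tuple Rm :=
  [tuple of p.1 :: p.2].

Let measurable_consp : measurable_fun [set: Rm * n.-tuple Rm] consp.
Proof. by apply: measurable_cons. Qed.

Definition leb_cons : set (n.+1.-tuple Rm) -> \bar R :=
  pushforward (@lebesgue_measure R \x m)%E consp.

Let leb_cons0 : leb_cons set0 = 0%E.
Proof. by rewrite /leb_cons /pushforward preimage_set0 measure0. Qed.

Let leb_cons_ge0 A : (0 <= leb_cons A)%E.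
Proof. exact: measure_ge0. Qed.

Let leb_cons_sigma_additive : semi_sigma_additive leb_cons.
Proof.
move=> F mF tF mUF; rewrite /leb_cons /pushforward preimage_bigcup.
apply: measure_semi_sigma_additive.
- by move=> k; rewrite -[X in measurable X]setTI; exact: measurable_consp.
- apply/trivIsetP => /= i j _ _ ij; rewrite -preimage_setI.
  by move/trivIsetP : tF => /(_ _ _ _ _ ij) ->//; rewrite preimage_set0.
- by rewrite -preimage_bigcup -[X in measurable X]setTI; exact: measurable_consp.
Qed.

HB.instance Definition _ := isMeasure.Build _ _ _
  leb_cons leb_cons0 leb_cons_ge0 leb_cons_sigma_additive.

Let leb_cons_sigma_finite : sigma_finite setT leb_cons.
Proof.
pose l : {sigma_finite_measure set Rm -> \bar R} := @lebesgue_measure R.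
have /sigma_finiteP[F [TF ndF Foo]] := sigma_finiteT l.
have /sigma_finiteP[G [TG ndG Goo]] := sigma_finiteT m.
have mth : measurable_fun [set: n.+1.-tuple Rm] (@thead n Rm).
  exact: measurable_tnth.
have mbh := @measurable_behead _ Rm n.
exists (fun k => [set t : n.+1.-tuple Rm | F k (thead t)] `&`
    [set t : n.+1.-tuple Rm | G k [tuple of behead t]]).
  apply/esym; rewrite -subTset => t _.
  have : [set: Rm] (thead t) by []. rewrite TF => -[i _ Fi].
  have : [set: n.-tuple Rm] [tuple of behead t] by []. rewrite TG => -[j _ Gj].
  exists (maxn i j) => //; split => /=.
    by move: Fi; exact/subsetPset/ndF/leq_maxl.
  by move: Gj; exact/subsetPset/ndG/leq_maxr.
move=> k; have [mF Fk] := Foo k; have [mG Gk] := Goo k; split.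
  apply: measurableI; rewrite -[X in measurable X]setTI; first exact: mth.
  exact: mbh.
rewrite /leb_cons /pushforward.
rewrite (_ : _ @^-1` _ = F k `*` G k).
  rewrite (product_measure1E l m) // lte_mul_pinfty// ge0_fin_numE//.
apply/seteqP; split => -[x t] /=; rewrite theadE.
  by move=> [? Gt]; split => //; move: Gt; congr (G k _); exact: val_inj.
by move=> [? Gt]; split => //; move: Gt; congr (G k _); exact: val_inj.
Qed.

HB.instance Definition _ := Measure_isSigmaFinite.Build _ _ _
  leb_cons leb_cons_sigma_finite.

End cons_measure.

Fixpoint leb (n : nat) :
    {sigma_finite_measure set (n.-tuple Rm) -> \bar R} :=
  match n with
  | 0 => \d_ [tuple]
  | n.+1 => leb_cons (leb n)
  end.

Definition rv {n : nat} (t : n.-tuple Rm) : 'rV[R]_n := \row_j tnth t j.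

End Lebesgue.

Section Smooth.
Context {R : realType} {n : nat} {W : normedModType R}.

Definition partial (i : 'I_n) (f : 'rV[R]_n -> W) : 'rV[R]_n -> W :=
  fun x => 'D_(delta_mx 0 i) f x.

(* C^k on an open set U: the iterated partial derivatives up to order k exist *)
(* and are continuous on U.                                                   *)
Fixpoint Ck (k : nat) (U : set 'rV[R]_n) (f : 'rV[R]_n -> W) : Prop :=
  (forall x, U x -> {for x, continuous f}) /\
  match k with
  | 0 => True
  | k.+1 => forall i,
      (forall x, U x -> derivable f x (delta_mx 0 i)) /\ Ck k U (partial i f)
  end.

Definition smooth_on (U : set 'rV[R]_n) (f : 'rV[R]_n -> W) : Prop :=
  forall k, Ck k U f.

End Smooth.

Section Manifold.
Context {R : realType}.

(* A chart cmap : cdom -> cimg with inverse cinv; the values of cmap and cinv *)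
(* outside cdom and cimg are irrelevant.                                      *)
Record chart (n : nat) (M : ptopologicalType) := Chart {
  cdom : set M ;
  cimg : set 'rV[R]_n ;
  cmap : M -> 'rV[R]_n ;
  cinv : 'rV[R]_n -> M ;
  open_cdom : open cdom ;
  open_cimg : open cimg ;
  cmap_img : forall p, cdom p -> cimg (cmap p) ;
  cinv_dom : forall x, cimg x -> cdom (cinv x) ;
  cmapK : forall p, cdom p -> cinv (cmap p) = p ;
  cinvK : forall x, cimg x -> cmap (cinv x) = x ;
  cmap_continuous : forall p, cdom p -> {for p, continuous cmap} ;
  cinv_continuous : forall x, cimg x -> {for x, continuous cinv} }.

Record smooth_manifold (n : nat) (M : ptopologicalType) := SmoothManifold {
  atlas : set (chart n M) ;
  manifold_hausdorff : hausdorff_space M ;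
  manifold_second_countable : @second_countable M ;
  atlas_cover : forall p, exists2 c, atlas c & cdom c p ;
  atlas_smooth : forall c d, atlas c -> atlas d ->
    smooth_on [set x | cimg c x /\ cdom d (cinv c x)] (cmap d \o cinv c) }.

Definition chart_at n M (S : smooth_manifold n M) (p : M) : chart n M :=
  s2val (cid2 (atlas_cover S p)).

Definition smooth_fun n M (S : smooth_manifold n M) (phi : M -> R) : Prop :=
  forall c, atlas S c -> smooth_on (cimg c) (phi \o cinv c : _ -> R^o).

End Manifold.

Arguments chart : clear implicits.
Arguments smooth_manifold : clear implicits.

(* Quantities attached to iota : M -> R^(n+1) are written in a chart c, at a  *)
(* point x of cimg c, in terms of F = iota \o cinv c.                         *)
Section Immersion.
Context {R : realType} {n : nat} {M : ptopologicalType}.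
Variables (S : smooth_manifold R n M) (iota : M -> 'rV[R]_n.+1).
Implicit Types (c : chart R n M) (x : 'rV[R]_n).

(* Jacobian matrix: row i is d_i F(x).  With row vectors, v *m tangent_mx c x *)
(* is the image of the coordinate vector v under the differential of iota.    *)
Definition tangent_mx c x : 'M[R]_(n, n.+1) :=
  \matrix_(i, j) partial i (iota \o cinv c) x 0 j.

Definition is_immersion : Prop :=
  forall c, atlas S c ->
    smooth_on (cimg c) (iota \o cinv c) /\
    forall x, cimg c x -> row_free (tangent_mx c x).

Definition is_proper : Prop :=
  continuous iota /\ forall K, compact K -> compact (iota @^-1` K).

Definition two_sided : Prop :=
  exists nu : M -> 'rV[R]_n.+1,
    [/\ continuous nu, forall p, enorm (nu p) = 1 &
      forall c p, atlas S c -> cdom c p ->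
        tangent_mx c (cmap c p) *m (nu p)^T = 0].

(* Induced metric g_ij = <d_i F, d_j F>. *)
Definition metric_mx c x : 'M[R]_n := tangent_mx c x *m (tangent_mx c x)^T.

Definition normal_part c x (v : 'rV[R]_n.+1) : 'rV[R]_n.+1 :=
  v - v *m (tangent_mx c x)^T *m invmx (metric_mx c x) *m tangent_mx c x.

(* Vector-valued second fundamental form A(d_i, d_j) = (d_i d_j F)^perp. *)
Definition sff c x (i j : 'I_n) : 'rV[R]_n.+1 :=
  normal_part c x (partial i (partial j (iota \o cinv c)) x).

(* |A|^2 = g^ik g^jl <A_ij, A_kl>, the squared norm with respect to g. *)
Definition sff_sqnorm c x : R :=
  let h := invmx (metric_mx c x) in
  \sum_i \sum_j \sum_k \sum_l h i k * h j l * dotv (sff c x i j) (sff c x k l).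

Definition mean_curvature c x : 'rV[R]_n.+1 :=
  \sum_i \sum_j invmx (metric_mx c x) i j *: sff c x i j.

Definition is_minimal : Prop :=
  forall c x, atlas S c -> cimg c x -> mean_curvature c x = 0.

(* |A_Sigma|^2 and, below, the gradient do not depend on the chart; they are  *)
(* evaluated in a chosen chart around each point.                             *)
Definition A2 (p : M) : R :=
  let c := chart_at S p in sff_sqnorm c (cmap c p).

(* Gradient of phi for the induced metric, as a tangent vector in R^(n+1):    *)
(* g^ij (d_i phi) (d_j F).                                                    *)
Definition grad (phi : M -> R) (p : M) : 'rV[R]_n.+1 :=
  let c := chart_at S p in
  let x := cmap c p in
  (\row_i partial i (phi \o cinv c : _ -> R^o) x)
    *m invmx (metric_mx c x) *m tangent_mx c x.

(* C^1 curves in M.  A regular parametrization is not required, so that a     *)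
(* piecewise C^1 path can be reparametrized into such a curve and the infimum *)
(* in gdist is the usual one.                                                 *)
Definition C1_curve (gam : R -> M) : Prop :=
  continuous gam /\
  forall c t, atlas S c -> cdom c (gam t) ->
    derivable (cmap c \o gam) t 1 /\
    {for t, continuous (derive1 (cmap c \o gam))}.

(* For the induced metric the speed of gam is |(iota \o gam)'|. *)
Definition curve_length (gam : R -> M) : \bar R :=
  (\int[@lebesgue_measure R]_(t in `[0%R, 1%R]%classic)
     (enorm (derive1 (iota \o gam) t))%:E)%E.

Definition gdist (p q : M) : \bar R :=
  ereal_inf [set curve_length gam | gam in
    [set gam | [/\ C1_curve gam, gam 0 = p & gam 1 = q]]].

Definition is_complete : Prop :=
  forall u : nat -> M,
    (forall e : R, 0 < e -> exists N, forall i j,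
      (N <= i)%N -> (N <= j)%N -> (gdist (u i) (u j) < e%:E)%E) ->
    exists p, forall e : R, 0 < e -> exists N, forall i,
      (N <= i)%N -> (gdist (u i) p < e%:E)%E.

End Immersion.

Section Hausdorff.
Context {R : realType} {m : nat}.

Definition ediam (C : set 'rV[R]_m) : \bar R :=
  ereal_sup ([set 0%E] `|`
    [set (enorm (xy.1 - xy.2))%:E | xy in [set xy | C xy.1 /\ C xy.2]]).

(* Size-delta s-dimensional Hausdorff premeasure (s an integer), without the  *)
(* normalizing constant; the sets C k have finite diameter, whence fine.      *)
Definition hausdorff_pre (s : nat) (delta : R) (A : set 'rV[R]_m) : \bar R :=
  ereal_inf [set (\sum_(0 <= k <oo) ((fine (ediam (C k)) / 2) ^+ s)%:E)%E | C in
    [set C : nat -> set 'rV[R]_m |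
      A `<=` \bigcup_k C k /\ forall k, (ediam (C k) <= delta%:E)%E]].

(* Normalized by the volume of the unit ball of R^s. *)
Definition hausdorff_measure (s : nat) (A : set 'rV[R]_m) : \bar R :=
  (@leb R s (rv @^-1` eball 1%R) *
   ereal_sup [set hausdorff_pre s delta A | delta in [set d : R | (0 < d)%R]])%E.

End Hausdorff.

Definition borelType (M : ptopologicalType) := g_sigma_algebraType (@open M).

Section Analysis.
Context {R : realType} {n : nat} {M : ptopologicalType}.
Variables (S : smooth_manifold R n M) (iota : M -> 'rV[R]_n.+1).
Variable mu : {measure set (borelType M) -> \bar R}.

(* mu is the Riemannian volume of the induced metric: the unique Borel        *)
(* measure equal to sqrt(det g) dx in every chart of the atlas.               *)
Definition is_riemannian_volume : Prop :=
  forall c (B : set (borelType M)), atlas S c -> measurable B ->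
    B `<=` cdom c ->
    mu B = (\int[@leb R n]_(t in rv @^-1` (cmap c @` B))
              (Num.sqrt (\det (metric_mx iota c (rv t))))%:E)%E.

Definition compactly_supported (T : topologicalType) (D : set T)
    (f : T -> R) : Prop :=
  exists2 K, compact K /\ K `<=` D & forall p, ~ K p -> f p = 0.

Definition in_L2 (f : M -> R) : Prop :=
  measurable_fun [set: borelType M] f /\
  (\int[mu]_p (f p ^+ 2)%:E < +oo)%E.

(* G is the weak gradient of f: a tangent vector field whose components       *)
(* <G, d_i F> in each chart are the weak partial derivatives of f.            *)
Definition weak_grad (f : M -> R) (G : M -> 'rV[R]_n.+1) : Prop :=
  (forall c p, atlas S c -> cdom c p ->
     (G p <= tangent_mx iota c (cmap c p))%MS) /\
  forall c (i : 'I_n) (psi : 'rV[R]_n -> R), atlas S c ->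
    smooth_on setT (psi : _ -> R^o) -> compactly_supported (cimg c) psi ->
    (\int[@leb R n]_(t in rv @^-1` cimg c)
       (f (cinv c (rv t)) * partial i (psi : _ -> R^o) (rv t))) =
    - (\int[@leb R n]_(t in rv @^-1` cimg c)
       (dotv (G (cinv c (rv t))) (row i (tangent_mx iota c (rv t))) *
        psi (rv t))).

(* f belongs to W^{1,2} and has weak gradient G. *)
Definition W12_grad (f : M -> R) (G : M -> 'rV[R]_n.+1) : Prop :=
  [/\ in_L2 f, forall j, in_L2 (fun p => G p 0 j) & weak_grad f G].

(* Weak form of Delta f + |A|^2 f = 0 with test functions in C_c^oo(M):       *)
(* - \int <grad f, grad phi> + \int |A|^2 f phi = 0.                          *)
Definition weak_jacobi (f : M -> R) (G : M -> 'rV[R]_n.+1) : Prop :=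
  forall phi : M -> R, smooth_fun S phi -> compactly_supported setT phi ->
    - (\int[mu]_p dotv (G p) (grad S iota phi p)) +
      (\int[mu]_p (A2 S iota p * f p * phi p)) = 0.

(* {f in W^{1,2} : Delta f + |A|^2 f = 0}; functions are not identified a.e.  *)
Definition jacobi_null : set (M -> R) :=
  [set f | exists2 G, W12_grad f G & weak_jacobi f G].

(* Finite dimension of a space of functions modulo equality a.e. *)
Definition finite_dim_ae (V : set (M -> R)) : Prop :=
  exists (N : nat) (b : 'I_N -> M -> R),
    (forall k, V (b k)) /\
    forall f, V f -> exists a : 'I_N -> R,
      \forall p \ae mu, f p = \sum_k a k * b k p.

End Analysis.

(* Main.v *)
(* A minimal immersion satisfies the divergence formula for tangential fields, hence monotonicity of
   weighted area ratios; a covering argument turns this into a measure estimate for the level sets of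
   compactly supported functions, and a dyadic sum over level sets gives the weighted Sobolev inequality
   \int q^2 phi^2 <= C (\int q^n)^(2/n) \int |grad phi|^2, which is all that is needed of the
   Michael-Simon inequality. Finite total curvature makes \int |A|^n small off a compact set, so testing the
   Jacobi equation with cutoffs gives a compact K such that, on every compact K', the L^2 norm and the energy
   of a W^{1,2} solution f are bounded by a multiple of \int_K f^2. Conversely, approximating f in charts by
   mollifications, finitely many linear functionals (values of the mollifications on a net) vanish on f only
   if \int_K f^2 is at most a small multiple of the norm and energy of f on a compact K'. Together these force f = 0,
   so the solution space has dimension at most the number of functionals. *)
Require Import Defs.
From HB Require Import structures.
From mathcomp Require Import all_boot all_order all_algebra.
From mathcomp Require Import all_classical all_reals all_analysis.
From mathcomp Require Import perm measurable_realfun ring lra.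
Set Implicit Arguments.
Unset Strict Implicit.
Unset Printing Implicit Defensive.
Import Order.TTheory GRing.Theory Num.Theory.
Import numFieldNormedType.Exports.
Local Open Scope classical_set_scope.
Local Open Scope ring_scope.

(** * Differential calculus in coordinates *)

(** The potential |A|^2 is controlled only through the L^n norm of |A|, which dictates the form of
    the Sobolev inequality: an L^n weight [q] against a squared function. Two weights are used. The
    curvature outside a compact set has so small a norm that the potential term is absorbed by the
    energy; the indicator of a compact set turns energy into a local L^2 bound. The divergence
    formula concerns smooth compactly supported functions, so sharp balls and |phi| give way to the
    smooth weight (s^2 + |y|^2)^(-1/2) and to smooth steps of phi^2. The gradient of a truncation
    lives on a shell of values, and the shells of doubled levels are disjoint, which is why their
    energies add up. The condition n > 2 enters through the exponent n - 2 of the level-set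
    measures. The order of choices matters: the compact sets, the absorbing constant and the
    functionals are fixed before any solution is given, so that one list of functionals serves the
    whole space. The dimension is then read off as a maximal rank of the matrices of their
    values. *)

Notation L1 mu f := (integrable mu setT (EFin \o f)).

Ltac via y := apply: (@le_trans _ _ y).

Lemma le_of_eq {d} {T : porderType d} (x y : T) : x = y -> (x <= y)%O.
Proof. by move=> ->. Qed.

Lemma sqr_le_sqr {R : realDomainType} (x y : R) : `|x| <= y -> x ^+ 2 <= y ^+ 2.
Proof. by move=> h; rewrite -real_normK ?num_real// lerXn2r ?nnegrE// (le_trans _ h). Qed.

(** * Directional derivatives as derivatives in one real variable *)

Section LineDerivative.
Context {R : realType}.

(** The two difference quotients are the same function of the increment, so derivability along [v]
    can be moved to the real line, where the chain rule and the mean value theorem are at hand. *)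
Lemma line_quotient {V W : normedModType R} (f : V -> W) (x v : V) (s : R) :
 (fun h : R => h^-1 *: (((fun t : R => f (x + t *: v)) \o shift s) (h *: (1 : R)) - f (x + s *: v))) =
 (fun h => h^-1 *: ((f \o shift (x + s *: v)) (h *: v) - f (x + s *: v))).
Proof. by apply/funext => h /=; rewrite scaler1 scalerDl addrCA. Qed.

Lemma is_derive_line {V W : normedModType R} (f : V -> W) (x v : V) (s : R) :
 derivable f (x + s *: v) v ->
 is_derive s (1 : R) (fun t : R => f (x + t *: v)) ('D_v f (x + s *: v)).
Proof. by split; rewrite /derivable /derive line_quotient. Qed.

Lemma derivable_line {V W : normedModType R} (f : V -> W) (x v : V) :
 derivable (fun t : R => f (x + t *: v)) 0 1 -> derivable f x v.
Proof. by rewrite /derivable line_quotient scale0r addr0. Qed.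

Lemma derive_line {V W : normedModType R} (f : V -> W) (x v : V) :
 'D_1 (fun t : R => f (x + t *: v)) 0 = 'D_v f x.
Proof. by rewrite /derive line_quotient scale0r addr0. Qed.

(** Only derivability along [v] is assumed, so linearity of a differential cannot be invoked; the
    scaling is a chain rule for the reparametrized line t -> t * c. *)
Lemma is_derive_scale {V : normedModType R} {W : normedModType R} (f : V -> W)
  (x v : V) (c : R) :
 derivable f x v -> is_derive x (c *: v) f (c *: 'D_v f x).
Proof.
move=> df.
have dg : derivable (fun t : R => f (x + t *: v)) 0 1.
{ have := @is_derive_line _ _ f x v 0; rewrite scale0r addr0 => /(_ df) [] //. }
have dfg : differentiable (fun t : R => f (x + t *: v)) 0 by exact/derivable1_diffP.
have dfg' : differentiable (fun t : R => f (x + t *: v)) ((fun t : R => t * c) 0).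
{ by rewrite mul0r. }
have E : (fun t : R => f (x + t *: (c *: v))) =
  (fun t : R => f (x + t *: v)) \o (fun t : R => t * c).
{ by apply/funext => t /=; rewrite scalerA. }
split.
 apply: derivable_line; rewrite E; apply/derivable1_diffP.
 exact: differentiable_comp.
rewrite -derive_line E deriveE; last exact: differentiable_comp.
rewrite diff_comp//= mul0r.
have -> : 'd (fun t : R => t * c) 0 1 = c.
{ by rewrite -deriveE// deriveMr// derive_id; exact: mulr1. }
by rewrite -[X in 'd _ 0 X]mulr1 linearZ -deriveE// derive_line.
Qed.

Lemma mean_value_line {V : normedModType R} (f : V -> R^o) (x v : V) :
 (forall s : R, 0 <= s <= 1 -> derivable f (x + s *: v) v) ->
 exists2 s : R, 0 <= s <= 1 & f (x + v) - f x = 'D_v f (x + s *: v).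
Proof.
move=> df.
have D (s : R) : s \in `]0, 1[ -> is_derive s (1 : R) (fun t : R => f (x + t *: v) : R)
  ('D_v f (x + s *: v)).
{ move=> /[!in_itv]/= /andP[s0 s1]; apply: is_derive_line; apply: df.
 by lra. }
have C : {within `[0, 1], continuous (fun t : R => f (x + t *: v) : R)}.
{ apply: derivable_within_continuous => s /[!in_itv]/= s01.
 by have [] := @is_derive_line V _ f x v s (df s s01). }
have [s s01 E] := MVT_segment ler01 D C.
exists s; first by [].
by move: E; rewrite scale1r scale0r addr0 subr0 mulr1.
Qed.

End LineDerivative.

(** * Closure properties of the classes C^k *)

Section CkBasic.
Context {R : realType} {n : nat} {W : normedModType R}.
Implicit Types (U V : set 'rV[R]_n) (f g : 'rV[R]_n -> W).

Lemma Ck_continuous k U f x : Ck k U f -> U x -> {for x, continuous f}.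
Proof. by case: k => [|k] [cf _]; exact: cf. Qed.

Lemma CkS k U f i : Ck k.+1 U f -> Ck k U (partial i f).
Proof. by move=> [_] /(_ i) []. Qed.

Lemma Ck_derivable k U f i x : Ck k.+1 U f -> U x -> derivable f x 'e_i.
Proof. by move=> [_] /(_ i) [df _]; exact: df. Qed.

Lemma Ck_pred k U f : Ck k.+1 U f -> Ck k U f.
Proof.
elim: k f => [|k IH] f [cf df]; split => // i.
by have [df1 df2] := df i; split => //; exact: IH.
Qed.

Lemma Ck_le k l U f : (k <= l)%N -> Ck l U f -> Ck k U f.
Proof.
move=> /subnKC <-; elim: (l - k)%N => [|j IH]; rewrite ?addn0// addnS => /Ck_pred.
exact: IH.
Qed.

Lemma Ck_sub k U V f : V `<=` U -> Ck k U f -> Ck k V f.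
Proof.
move=> VU; elim: k f => [|k IH] f [cf df]; split => //; try by move=> x /VU; exact: cf.
move=> i; have [df1 df2] := df i; split; last exact: IH.
by move=> x /VU; exact: df1.
Qed.

(** Used to glue a function that is C^k on a chart image to the zero function off a compact set. *)
Lemma CkU k U V f : Ck k U f -> Ck k V f -> Ck k (U `|` V) f.
Proof.
elim: k f => [|k IH] f [cf df] [cf' df']; split => //; try by
 move=> x [] Ux; [exact: cf|exact: cf'].
move=> i; have [df1 df2] := df i; have [df1' df2'] := df' i; split.
 by move=> x [] Ux; [exact: df1|exact: df1'].
exact: IH.
Qed.

Lemma near_eq_open U f g x : open U -> (forall x, U x -> f x = g x) -> U x ->
 {near x, f =1 g}.
Proof. by move=> oU fg Ux; apply: filterS (open_nbhs_nbhs (conj oU Ux)). Qed.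

Lemma partial_eq_open U f g i x : open U -> (forall x, U x -> f x = g x) -> U x ->
 partial i f x = partial i g x.
Proof.
move=> oU fg Ux; apply: near_eq_derive; exact: near_eq_open fg Ux.
Qed.

Lemma continuous_eq_open U f g x : open U -> (forall x, U x -> f x = g x) -> U x ->
 {for x, continuous f} -> {for x, continuous g}.
Proof.
move=> oU fg Ux cf.
have H : f @ x --> g x by rewrite -(fg x Ux).
apply: cvg_trans H; apply: (@near_eq_cvg _ _ (nbhs x) (nbhs_filter x)).
by have := near_eq_open oU fg Ux.
Qed.

Lemma Ck_eq k U f g : open U -> (forall x, U x -> f x = g x) ->
 Ck k U f -> Ck k U g.
Proof.
move=> oU; elim: k f g => [|k IH] f g fg [cf df]; split => //.
- by move=> x Ux; exact: continuous_eq_open fg Ux (cf x Ux).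
- by move=> x Ux; exact: continuous_eq_open fg Ux (cf x Ux).
move=> i; have [df1 df2] := df i; split.
 move=> x Ux; have := df1 x Ux; apply: near_eq_derivable; exact: near_eq_open fg Ux.
by apply: IH df2 => x Ux; exact: partial_eq_open fg Ux.
Qed.

Lemma Ck_cst k U (a : W) : open U -> Ck k U (cst a).
Proof.
elim: k a => [|k IH] a; split => //; try by move=> x _; exact: cst_continuous.
split; first by [].
rewrite (_ : partial i (cst a) = cst 0); first exact: IH.
by apply/funext => x; rewrite /partial derive_cst.
Qed.

Lemma CkD k U f g : open U -> Ck k U f -> Ck k U g -> Ck k U (f \+ g).
Proof.
move=> oU; elim: k f g => [|k IH] f g [cf df] [cg dg]; split => //;
 try by move=> x Ux; apply: continuousD; [exact: cf|exact: cg].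
move=> i; have [df1 df2] := df i; have [dg1 dg2] := dg i; split.
 by move=> x Ux; apply: derivableD; [exact: df1|exact: dg1].
apply: Ck_eq (IH _ _ df2 dg2) => // x Ux.
by rewrite /partial deriveD//; [exact: df1|exact: dg1].
Qed.

End CkBasic.

Section CkReal.
Context {R : realType} {n : nat}.
Implicit Types (U V : set 'rV[R]_n) (f g : 'rV[R]_n -> R^o).

Lemma CkM k U f g : open U -> Ck k U f -> Ck k U g -> Ck k U (f \* g : _ -> R^o).
Proof.
move=> oU; elim: k f g => [|k IH] f g Cf Cg; have [cf df] := Cf; have [cg dg] := Cg;
 split => //; try by move=> x Ux; apply: (@continuousM R _ f g);
 [exact: cf|exact: cg].
move=> i; have [df1 df2] := df i; have [dg1 dg2] := dg i; split.
 by move=> x Ux; apply: derivableM; [exact: df1|exact: dg1].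
have /= Cf' := Ck_pred Cf; have Cg' := Ck_pred Cg.
apply: Ck_eq (CkD oU (IH _ _ Cf' dg2) (IH _ _ Cg' df2)) => // x Ux.
by rewrite /partial deriveM//; [exact: df1|exact: dg1].
Qed.

Lemma Ck_big (op : R -> R -> R) idx (I : Type) (r : seq I) (P : pred I) k U (F : I -> 'rV[R]_n -> R^o) :
 open U -> (forall f g, Ck k U f -> Ck k U g -> Ck k U (fun x => op (f x) (g x) : R^o)) ->
 (forall i, P i -> Ck k U (F i)) -> Ck k U (fun x => \big[op/idx]_(i <- r | P i) F i x : R^o).
Proof.
move=> oU opC FC; elim: r => [|i r IH].
 by apply: Ck_eq (Ck_cst k (idx : R^o) oU) => // x _; rewrite big_nil.
have [Pi|Pi] := boolP (P i); last by apply: Ck_eq IH => // x _; rewrite big_cons (negbTE Pi).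
by apply: Ck_eq (opC _ _ (FC i Pi) IH) => // x _; rewrite big_cons Pi.
Qed.

Lemma Ck_sum (I : Type) (r : seq I) (P : pred I) k U (F : I -> 'rV[R]_n -> R^o) :
 open U -> (forall i, P i -> Ck k U (F i)) ->
 Ck k U (fun x => \sum_(i <- r | P i) F i x : R^o).
Proof. by move=> oU; apply: Ck_big => // f g; exact: CkD. Qed.

Lemma Ck_prod (I : Type) (r : seq I) (P : pred I) k U (F : I -> 'rV[R]_n -> R^o) :
 open U -> (forall i, P i -> Ck k U (F i)) ->
 Ck k U (fun x => \prod_(i <- r | P i) F i x : R^o).
Proof. by move=> oU; apply: Ck_big => // f g; exact: CkM. Qed.

Lemma CkN k U f : open U -> Ck k U f -> Ck k U (fun x => - f x : R^o).
Proof.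
move=> oU Cf; apply: Ck_eq (CkM oU (Ck_cst k (-1 : R^o) oU) Cf) => // x _ /=.
by lra.
Qed.

(** The derivative of 1/f is -(1/f)(1/f) f', so the induction hypothesis for 1/f itself, one order
    lower, closes the induction. *)
Lemma CkV k U f : open U -> (forall x, U x -> f x != 0) -> Ck k U f ->
 Ck k U (fun x => (f x)^-1 : R^o).
Proof.
move=> oU f0; elim: k => [|k IH] Cf; have [cf df] := Cf;
 split => //; try by move=> x Ux; apply: (@continuousV R _ f x); [exact: f0|exact: cf].
move=> i; have [df1 df2] := df i; split.
 by move=> x Ux; apply: derivableV; [exact: f0|exact: df1].
have IH' := IH (Ck_pred Cf).
apply: Ck_eq (CkN oU (CkM oU (CkM oU IH' IH') df2)) => // x Ux /=.
rewrite /partial deriveV//; [|exact: f0|exact: df1].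
by rewrite invfM scaleNr.
Qed.

Lemma Ck_coord k U (i : 'I_n) : open U -> Ck k U (fun x : 'rV[R]_n => x 0 i : R^o).
Proof.
move=> oU; case: k => [|k]; split => //; try by move=> x _; exact: coord_continuous.
move=> j; have D x : derivable (fun x : 'rV[R]_n => x 0 i : R^o) x 'e_j.
{ by apply: diff_derivable; exact: differentiable_coord. }
split; first by [].
apply: Ck_eq (Ck_cst k ((i == j)%:R : R^o) oU) => // x _.
rewrite /partial -derive_line.
rewrite (_ : (fun t : R => _) = (fun t : R => x 0 i + t * (i == j)%:R)); last first.
{ by apply/funext => t; rewrite !mxE. }
by have /= := @derive_line _ R^o R^o id (x 0 i) ((i == j)%:R); rewrite derive_id => ->.
Qed.

End CkReal.

(** * C^1 functions are Fréchet differentiable *)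

Section Frechet.
Context {R : realType} {n : nat}.
Implicit Types (f : 'rV[R]_n -> R^o).

Lemma coord_le_norm (v : 'rV[R]_n) i : `|v 0 i| <= `|v|.
Proof. by rewrite /Num.Def.normr/= mx_normrE; exact: (le_bigmax _ (fun ij => `|v ij.1 ij.2|) (0, i)). Qed.

Lemma norm_coord_le (v : 'rV[R]_n) (e : R) : 0 <= e ->
 (forall i, `|v 0 i| <= e) -> `|v| <= e.
Proof.
move=> e0 ve; rewrite /Num.Def.normr/= mx_normrE; apply: bigmax_le => // -[i j] _ /=.
by rewrite ord1.
Qed.

(** The k-th vertex of the path from 0 to [h] that follows the coordinate axes one after the
    other. *)
Definition lead (k : nat) (h : 'rV[R]_n) : 'rV[R]_n := \row_j (if (j < k)%N then h 0 j else 0).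

Lemma norm_lead_le k h (s : R) i : 0 <= s <= 1 ->
 `|lead k h + s *: (h 0 i *: 'e_i)| <= `|h| *+ 2.
Proof.
move=> /andP[s0 s1]; apply: le_trans (ler_normD _ _) _; apply: lerD.
 apply: norm_coord_le => // j; rewrite mxE; case: ifP => _; last by rewrite normr0.
 exact: coord_le_norm.
apply: norm_coord_le => // j; rewrite !mxE normrM.
apply: le_trans (_ : 1 * `|h 0 i * (j == i)%:R| <= _).
 by apply: ler_wpM2r => //; rewrite ger0_norm.
rewrite mul1r; case: eqP => _; rewrite ?mulr1 ?mulr0 ?normr0//; exact: coord_le_norm.
Qed.

Lemma lead_succ k (h : 'rV[R]_n) (i : 'I_n) : i = k :> nat ->
 lead k.+1 h = lead k h + h 0 i *: 'e_i.
Proof.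
move=> ik; apply/rowP => j; rewrite !mxE ltnS leq_eqVlt -ik.
have [->|/eqP ji] := eqVneq j i; first by rewrite eqxx ltnn mulr1 add0r.
by rewrite mulr0 addr0 (_ : (j == i :> nat) = false)//; apply/eqP => /val_inj.
Qed.

(** The segment from x to x + h is replaced by the axis-parallel path of [lead]. On each edge the
    mean value theorem produces one partial derivative at a nearby point, which continuity compares
    with its value at x. *)
Lemma Ck1_estimate (U : set 'rV[R]_n) f x (e : R) : open U -> Ck 1 U f -> U x -> 0 < e ->
 \forall h \near (0 : 'rV[R]_n),
  `|f (h + x) - f x - \sum_i h 0 i * partial i f x| <= e * `|h|.
Proof.
move=> oU Cf Ux e0.
have n1 : 0 < n.+1%:R :> R by [].
have /nbhs_norm0P[d /= d0 dP] : \forall h \near (0 : 'rV[R]_n), U (x + h) /\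
  forall i, `|partial i f (x + h) - partial i f x| <= e / n.+1%:R.
{ have H1 : \forall h \near (0 : 'rV[R]_n), U (x + h).
 { by apply/(@nbhs0P _ _ U x); exact: open_nbhs_nbhs. }
 have H2 : \forall h \near (0 : 'rV[R]_n), forall i, `|partial i f (x + h) - partial i f x| <= e / n.+1%:R.
 { apply: (@filter_forall _ _ (fun (i : 'I_n) (h : 'rV[R]_n) => `|partial i f (x + h) - partial i f x| <= e / n.+1%:R) (nbhs (0 : 'rV[R]_n)) (nbhs_filter _)) => i.
  have ci : {for x, continuous (partial i f)} by exact: Ck_continuous (CkS i Cf) Ux.
  have /cvgrPdist_le/(_ (e / n.+1%:R)) := ci.
  move=> /(_ (divr_gt0 e0 n1))/nbhs0P; apply: filterS => h; by rewrite distrC. }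
 by apply: (@filterS2 _ _ (nbhs_filter (0 : 'rV[R]_n)) _ _ _ _ H1 H2) => h ? ?. }
(* The path leaves the ball of radius |h| but stays within 2|h| of its start, hence half the
   radius. *)
apply/nbhs_norm0P; exists (d / 2); first by rewrite /= divr_gt0.
move=> h /= hd.
have hd2 : `|h| *+ 2 < d by lra.
have step (k : nat) : (k <= n)%N ->
 `|f (lead k h + x) - f x - \sum_(i < n | (i < k)%N) h 0 i * partial i f x| <=
  e / n.+1%:R * `|h| * k%:R.
{ elim: k => [_|k IH kn].
  rewrite mulr0 (_ : lead 0 h = 0); last by apply/rowP => j; rewrite !mxE.
  by rewrite add0r subrr sub0r normrN big_pred0// normr0.
 pose i := Ordinal kn.
 have nb (s : R) : 0 <= s <= 1 -> U (x + (lead k h + s *: (h 0 i *: 'e_i))) /\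
   `|partial i f (x + (lead k h + s *: (h 0 i *: 'e_i))) - partial i f x| <= e / n.+1%:R.
 { move=> s01; have := dP (lead k h + s *: (h 0 i *: 'e_i)).
  rewrite /= => /(_ (le_lt_trans (norm_lead_le _ _ _ s01) hd2)).
  by move=> [? H]. }
 have D s : 0 <= s <= 1 -> derivable f ((x + lead k h) + s *: (h 0 i *: 'e_i)) (h 0 i *: 'e_i).
 { move=> /nb [Us _]; rewrite -addrA; apply: ex_derive; apply: is_derive_scale.
  exact: Ck_derivable Cf Us. }
 have [s s01 E] := mean_value_line D.
 have [Us Ps] := nb s s01.
 have E2 : 'D_(h 0 i *: 'e_i) f ((x + lead k h) + s *: (h 0 i *: 'e_i)) =
   h 0 i * partial i f (x + (lead k h + s *: (h 0 i *: 'e_i))).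
 { rewrite -addrA; apply: derive_val; apply: is_derive_scale.
  exact: Ck_derivable Cf Us. }
 rewrite (lead_succ h (erefl : i = k :> nat)).
 rewrite (bigD1 i)//=.
 rewrite (eq_bigl (fun j : 'I_n => (j < k)%N)); last first.
 { move=> j; rewrite ltnS ltn_neqAle andbC; congr andb. }
 rewrite -[k.+1%:R]natr1 mulrDr mulr1.
 rewrite [X in `|X|](_ : _ = (f (lead k h + x) - f x -
   \sum_(i < n | (i < k)%N) h 0 i * partial i f x) +
   h 0 i * (partial i f (x + (lead k h + s *: (h 0 i *: 'e_i))) - partial i f x)).
  apply: le_trans (ler_normD _ _) _; apply: lerD; first exact: (IH (ltnW kn)).
  rewrite normrM mulrC; apply: ler_pM => //; exact: coord_le_norm.
 rewrite mulrBr -E2 -E.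
 rewrite [x + _]addrC [lead k h + x + _]addrAC; ring. }
have := step n (leqnn n).
rewrite (_ : lead n h = h); last by apply/rowP => j; rewrite !mxE ltn_ord.
move=> H; rewrite (eq_bigl (fun j : 'I_n => (j < n)%N)); last by move=> j; rewrite ltn_ord.
apply: le_trans H _.
rewrite -mulrA [`|h| * _]mulrC mulrA; apply: ler_wpM2r => //.
rewrite -mulrA ler_piMr//; first exact: ltW.
by rewrite ler_pdivrMl// mulr1 ler_nat.
Unshelve. Qed.

Definition dlin (a : 'I_n -> R) (v : 'rV[R]_n) : R^o := \sum_i v 0 i * a i.

Lemma dlin_is_linear a : linear (dlin a).
Proof.
move=> k u v; rewrite scaler_sumr -big_split; apply: eq_bigr => i _.
by rewrite !mxE mulrDl -mulrA.
Qed.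

HB.instance Definition _ a := GRing.isLinear.Build R 'rV[R]_n R^o _ (dlin a) (dlin_is_linear a).

Lemma dlin_continuous a : continuous (dlin a).
Proof.
move=> v; apply: (@Ck_continuous _ _ _ 0 setT) => //.
apply: (@Ck_sum R n _ (index_enum _) predT 0 setT (fun i x => x 0 i * a i) openT) => i _; apply: (CkM openT (Ck_coord _ _ openT)).
exact: (@Ck_cst _ _ R^o 0 _ (a i) openT).
Qed.

Lemma Ck1_differentiable (U : set 'rV[R]_n) f x : open U -> Ck 1 U f -> U x ->
 is_diff x f (dlin (fun i => partial i f x)).
Proof.
move=> oU Cf Ux.
have E : f \o shift x = cst (f x) + (dlin (fun i => partial i f x)) +o_ (0 : 'rV[R]_n) id.
{ apply/eqaddoP => e e0; have := Ck1_estimate oU Cf Ux e0.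
 by rewrite opprD addrA. }
have D := diff_unique (@dlin_continuous (fun i => partial i f x)) E.
split => //; apply/diff_locallyP; rewrite D; split => //.
exact: dlin_continuous.
Qed.

End Frechet.

(** * The chain rule for C^k maps *)

Section Chain.
Context {R : realType}.

Lemma continuous_rowP {m : nat} {X : topologicalType} (tau : X -> 'rV[R]_m) (x : X) :
 (forall b, {for x, continuous (fun y => tau y 0 b : R^o)}) -> {for x, continuous tau}.
Proof.
move=> ct; apply/cvgrPdist_le => e e0.
have := @filter_forall _ _ (fun (b : 'I_m) y => `|tau x 0 b - tau y 0 b| <= e) (nbhs x) (nbhs_filter x).
have H b : \forall y \near x, `|tau x 0 b - tau y 0 b| <= e.
{ by have /cvgrPdist_le/(_ e e0) := ct b. }
move=> /(_ H); apply: filterS => y ty; apply: norm_coord_le; first exact: ltW.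
by move=> b; rewrite !mxE.
Qed.

(** The outer function is Fréchet differentiable because it is C^1; the inner map need only be
    derivable along [v], since everything is restricted to the line through x. *)
Lemma chain_rule_line {m : nat} {X : normedModType R} (U : set 'rV[R]_m) (psi : 'rV[R]_m -> R^o)
  (tau : X -> 'rV[R]_m) (x v : X) :
 open U -> Ck 1 U psi -> U (tau x) -> (forall b, derivable (fun y => tau y 0 b : R^o) x v) ->
 is_derive x v (psi \o tau)
  (\sum_b partial b psi (tau x) * 'D_v (fun y => tau y 0 b : R^o) x).
Proof.
move=> oU Cpsi Ux dtau.
have dt : derivable tau x v.
{ by apply/derivable_mxP => i b; rewrite ord1. }
pose l := fun t : R => tau (x + t *: v).
have dl : derivable l 0 1.
{ by have := @is_derive_line _ _ _ tau x v 0; rewrite scale0r addr0 => /(_ dt) []. }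
have dl' : differentiable l 0 by exact/derivable1_diffP.
have [dpsi Epsi] : is_diff (l 0) psi (dlin (fun i => partial i psi (tau x))).
{ by rewrite /l scale0r addr0; exact: Ck1_differentiable Ux. }
have dc : differentiable (psi \o l) 0 by exact: differentiable_comp.
split; first by apply: derivable_line; exact/derivable1_diffP.
rewrite -derive_line -[(fun t : R => _)]/(psi \o l) deriveE// diff_comp//= Epsi.
have -> : 'd l 0 1 = 'D_v tau x by rewrite -deriveE//; exact: derive_line.
apply: eq_bigr => b _.
by rewrite mulrC (derive_mx dt) mxE.
Qed.

(** By the chain rule each partial derivative is a sum of products of (d_b psi) o tau, of class C^k
    by the induction hypothesis, with a partial derivative of a component of tau. *)
Lemma Ck_comp {m n : nat} k (U : set 'rV[R]_m) (V : set 'rV[R]_n) (psi : 'rV[R]_m -> R^o)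
  (tau : 'rV[R]_n -> 'rV[R]_m) :
 open U -> open V -> (forall x, V x -> U (tau x)) -> Ck k U psi ->
 (forall b, Ck k V (fun y => tau y 0 b : R^o)) -> Ck k V (psi \o tau : _ -> R^o).
Proof.
move=> oU oV VU; elim: k psi => [|k IH] psi Cp Ct.
 split => // x Vx; apply: continuous_comp; last exact: Ck_continuous Cp (VU x Vx).
 by apply: continuous_rowP => b; exact: Ck_continuous (Ct b) Vx.
split.
 move=> x Vx; apply: continuous_comp; last exact: Ck_continuous Cp (VU x Vx).
 by apply: continuous_rowP => b; exact: Ck_continuous (Ct b) Vx.
move=> i; split.
 move=> x Vx; apply: ex_derive; apply: (@chain_rule_line _ _ U) => //.
 - exact: Ck_le Cp.
 - exact: VU.
 - by move=> b; exact: Ck_derivable (Ct b) Vx.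
have Ct' b := Ck_pred (Ct b).
have Csum := @Ck_sum R n _ (index_enum 'I_m) predT k V (fun b x => partial b psi (tau x) *
  partial i (fun y => tau y 0 b : R^o) x) oV.
apply: Ck_eq (Csum _) => //.
 move=> x Vx; apply/esym/derive_val; apply: chain_rule_line (VU x Vx) _ => //.
 - exact: Ck_le Cp.
 - by move=> b; exact: Ck_derivable (Ct b) Vx.
move=> b _; apply: (@CkM R n k V (partial b psi \o tau)) => //.
 by apply: IH => //; exact: CkS.
exact: CkS.
Qed.

End Chain.

Section CkMore.
Context {R : realType}.

Lemma Ck_row {n m : nat} k (U : set 'rV[R]_n) (f : 'rV[R]_n -> 'rV[R]_m) j :
 open U -> Ck k U f -> Ck k U (fun x => f x 0 j : R^o).
Proof.
move=> oU; elim: k f => [|k IH] f [cf df]; split => //; try by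
 move=> x Ux; apply: (@continuous_comp _ _ _ f (fun v : 'rV[R]_m => v 0 j));
 [exact: cf|exact: coord_continuous].
move=> i; have [df1 df2] := df i; split.
 by move=> x /df1 /derivable_mxP.
apply: Ck_eq (IH _ df2) => // x Ux.
by rewrite /partial derive_mx ?mxE//; exact: df1.
Qed.

Lemma partial_row {n m : nat} (f : 'rV[R]_n -> 'rV[R]_m) i j x :
 derivable f x 'e_i ->
 partial i f x 0 j = partial i (fun x => f x 0 j : R^o) x.
Proof. by move=> df; rewrite /partial derive_mx// mxE. Qed.

(** Smoothness of the one-variable [g] is given by an explicit sequence of successive derivatives,
    because [Ck] speaks of functions of row vectors. The function is transported to ['rV_1], and
    [Ck_comp] applies there. *)
Lemma Ck_comp1 {n : nat} k (V : set 'rV[R]_n) (A : set R) (g : R -> R) (f : 'rV[R]_n -> R^o) :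
 open V -> open A -> (forall x, V x -> A (f x)) ->
 (exists G : nat -> R -> R, G 0%N = g /\ forall k x, A x -> is_derive x (1 : R) (G k) (G k.+1 x)) ->
 Ck k V f -> Ck k V (fun x => g (f x) : R^o).
Proof.
move=> oV oA VA [G [<- dG]] Cf.
pose U := [set y : 'rV[R]_1 | A (y 0 0)].
have oU : open U.
{ by apply: (@open_comp _ _ (fun y : 'rV[R]_1 => y 0 0)) => // y _; exact: coord_continuous. }
have Cg j l : Ck l U (fun y => G j (y 0 0) : R^o).
{ elim: l j => [|l IH] j.
  split => // y Uy; apply: (@continuous_comp _ _ _ (fun y : 'rV[R]_1 => y 0 0) (G j)).
   exact: coord_continuous.
  apply: differentiable_continuous; apply/derivable1_diffP.
  by have [] := dG j _ Uy.
 have dy y : U y -> forall i, is_derive y 'e_i (fun y : 'rV[R]_1 => G j (y 0 0) : R^o) (G j.+1 (y 0 0)).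
 { move=> Uy i; rewrite ord1.
  have E : (fun t : R => G j ((y + t *: ('e_0 : 'rV[R]_1)) 0 0) : R^o) =
   (fun t : R => G j (y 0 0 + t *: (1 : R))).
  { by apply/funext => t; rewrite !mxE. }
  have [D1 D2] := dG j _ Uy.
  have [D3 D4] := @is_derive_line _ R^o R^o (G j) (y 0 0) 1 0 (ltac:(by rewrite scale0r addr0)).
  split; first by apply: derivable_line; rewrite E.
  by rewrite -derive_line E D4 scale0r addr0. }
 split.
  move=> y Uy; apply: (@continuous_comp _ _ _ (fun y : 'rV[R]_1 => y 0 0) (G j)).
   exact: coord_continuous.
  apply: differentiable_continuous; apply/derivable1_diffP.
  by have [] := dG j _ Uy.
 split; first by move=> y Uy; have [] := dy y Uy i.
 apply: Ck_eq (IH j.+1) => // y Uy.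
 by have [_ E] := dy y Uy i. }
have := @Ck_comp R 1 n k U V _ (fun x => \row_(_ < 1) f x) oU oV _ (Cg 0%N k).
rewrite /comp/=.
rewrite (_ : (fun x => _ (_ 0 0)) = (fun x => G 0%N (f x))); last first.
{ by apply/funext => x; rewrite mxE. }
apply; first by move=> x Vx; rewrite /U /= mxE; exact: VA.
move=> b; apply: Ck_eq Cf => // x _; by rewrite mxE.
Qed.

Lemma norm_scaled_dist_le (k a b e : R) : 0 < k -> `|b - a| <= e -> `|k * (k * a) - k * k * b| <= k * k * e.
Proof. by move=> k0 ab; rewrite mulrA -mulrBr normrM gtr0_norm ?mulr_gt0// ler_pM2l ?mulr_gt0// distrC. Qed.

Lemma quotient_dist_le (k q a b e : R) : 0 < k -> `|q - k * a| <= k * (e / 2) -> `|q - k * b| <= k * (e / 2) ->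
 `|a - b| <= e.
Proof.
move=> k0 h1 h2; rewrite -(ler_pM2l k0) -{1}(gtr0_norm k0) -normrM.
have -> : k * (a - b) = q - k * b - (q - k * a) by ring.
by apply: le_trans (ler_normB _ _) _; lra.
Qed.

(* Second difference quotients: both mixed derivatives are limits of
  (f(x+s+t) - f(x+s) - f(x+t) + f(x)) / h^2 by two mean value theorems. *)
Lemma partial_comm {n : nat} (U : set 'rV[R]_n) (f : 'rV[R]_n -> R^o) i j x :
 open U -> Ck 2 U f -> U x ->
 partial i (partial j f) x = partial j (partial i f) x.
Proof.
move=> oU Cf Ux; pose e_ k : 'rV[R]_n := 'e_k.
pose Q (h : R) a b : R := f (x + h *: e_ a + h *: e_ b) - f (x + h *: e_ a) - f (x + h *: e_ b) + f x.
have key a b e : 0 < e -> \forall h \near (0 : R)^'+,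
 `|Q h a b - h * h * partial a (partial b f) x| <= h * h * e.
{ move=> e0; have Cab := Ck_continuous (CkS a (CkS b Cf)) Ux.
 have /nbhs_ballP[d /= d0 dP] : nbhs x [set y | U y /\ `|partial a (partial b f) x - partial a (partial b f) y| <= e].
 { by apply: filterI; [exact: open_nbhs_nbhs|move/cvgrPdist_le : Cab => /(_ e e0)]. }
 exists (d / 2); first by rewrite /= divr_gt0.
 move=> h /=; rewrite sub0r normrN => hd h0; rewrite gtr0_norm// in hd.
 pose A : 'rV[R]_n := h *: e_ a; pose B : 'rV[R]_n := h *: e_ b.
 have inb s t : 0 <= s <= 1 -> 0 <= t <= 1 ->
  U (x + s *: A + t *: B) /\ `|partial a (partial b f) x - partial a (partial b f) (x + s *: A + t *: B)| <= e.
 { move=> /andP[s0 s1] /andP[t0 t1]; apply: dP; rewrite mx_norm_ball /ball_/=.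
  rewrite -addrA opprD addrA subrr sub0r normrN.
  apply: le_lt_trans (_ : h *+ 2 < d); last by lra.
  apply: norm_coord_le => [|l]; first by lra.
  rewrite !mxE /=; apply: le_trans (ler_normD _ _) _.
  rewrite !normrM !(ger0_norm (ltW h0)) (ger0_norm s0) (ger0_norm t0) !normr_nat.
  by apply: lerD; rewrite mulrCA ler_piMr ?(ltW h0)// mulr_ile1//; case: eqP. }
 have DB y : U y -> is_derive y B f (h * partial b f y) by move=> Uy; apply: is_derive_scale; exact: Ck_derivable Cf Uy.
 pose g (t : R) : R := f (x + A + t *: B) - f (x + t *: B).
 have Dg (t : R) : 0 <= t <= 1 -> is_derive t (1 : R) g (h * partial b f (x + A + t *: B) - h * partial b f (x + t *: B)).
 { move=> t01; have [U1 _] := inb 1 t (ltac:(by rewrite ler01 lexx)) t01; have [U2 _] := inb 0 t (ltac:(by rewrite ler01 lexx)) t01.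
  rewrite scale1r in U1; rewrite scale0r addr0 in U2; have [D1 <-] := DB _ U1; have [D2 <-] := DB _ U2.
  by apply: is_deriveB; exact: is_derive_line. }
 have [|t /[!in_itv]/= t01] := MVT_segment ler01 (fun t t01 => Dg t (ltac:(move: t01; rewrite /= => /andP[? ?]; by rewrite !ltW))).
  by apply: derivable_within_continuous => s /[!in_itv]/= /Dg[].
 have Dab s : 0 <= s <= 1 -> is_derive (x + t *: B + s *: A) A (partial b f) (h * partial a (partial b f) (x + t *: B + s *: A)).
 { by move=> s01; apply: is_derive_scale; have [U1 _] := inb s t s01 t01; rewrite addrAC; exact: Ck_derivable (CkS b Cf) U1. }
 have [s s01 Es] := @mean_value_line _ _ (partial b f) (x + t *: B) A (fun s s01 => @ex_derive _ _ _ _ _ _ _ (Dab s s01)).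
 have [_ ] := Dab s s01; rewrite -Es => E2; have [_ H] := inb s t s01 t01.
 rewrite -mulrBr [x + A + _]addrAC E2 /g scale1r scale0r !addr0 subr0 mulr1 => Et.
 have -> : Q h a b = h * (h * partial a (partial b f) (x + t *: B + s *: A)) by rewrite -Et /Q; ring.
 by rewrite [x + t *: B + _]addrAC; exact: norm_scaled_dist_le H. }
apply/eqP; rewrite -subr_eq0 -normr_le0; apply/ler_addgt0Pr => e e0; rewrite add0r.
have e20 : 0 < e / 2 by lra.
have [h [h0 [H1 H2]]] := filter_ex (filterI (nbhs_right_gt (0 : R)) (filterI (key i j _ e20) (key j i _ e20))).
apply: quotient_dist_le H1 _; first by rewrite mulr_gt0.
by move: H2; rewrite (_ : Q h j i = Q h i j)// /Q [x + h *: e_ j + _]addrAC [X in X + _]addrAC.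
Qed.

End CkMore.

(** * Integration over tuples, cutoffs and convolutions *)

Section RealIntegrable.
Context {d} {T : measurableType d} {R : realType}.
Variable mu : {measure set T -> \bar R}.
Implicit Types u v : T -> R.

Lemma L1D u v : L1 mu u -> L1 mu v ->
 L1 mu (fun t => u t + v t).
Proof. by move=> iu iv; have := integrableD measurableT iu iv. Qed.

Lemma L1Z (k : R) u : L1 mu u ->
 L1 mu (fun t => k * u t).
Proof. by move=> iu; have := integrableZl measurableT k iu. Qed.

Lemma EFin_Rintegral u : L1 mu u ->
 (\int[mu]_t (u t)%:E = (\int[mu]_t u t)%:E)%E.
Proof. by move=> iu; rewrite fineK//; exact: integrable_fin_num. Qed.

Lemma L1_sum (I : Type) (s : seq I) (u : I -> T -> R) : (forall i, L1 mu (u i)) ->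
 L1 mu (fun t => \sum_(i <- s) u i t).
Proof.
move=> iu; have := integrable_sum measurableT s (fun i (_ : xpredT i) => iu i).
by apply: eq_integrable => // t _; rewrite sumEFin.
Qed.

Lemma Rintegral_sum (I : Type) (s : seq I) (u : I -> T -> R) : (forall i, L1 mu (u i)) ->
 \int[mu]_t (\sum_(i <- s) u i t) = \sum_(i <- s) \int[mu]_t u i t.
Proof.
move=> iu; apply: EFin_inj; rewrite -EFin_Rintegral; last exact: L1_sum.
under eq_integral do rewrite -sumEFin.
rewrite (integral_sum measurableT iu) -sumEFin; apply: eq_bigr => i _; rewrite EFin_Rintegral//.
Qed.
End RealIntegrable.

(** * Lebesgue measure on tuples: open sets, translations, cubes *)

Section TupleLebesgue.
Context {R : realType}.
Local Notation Rm := (measurableTypeR R).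

Definition vr {n : nat} (v : 'rV[R]_n) : n.-tuple Rm := [tuple (v 0 i : Rm) | i < n].

Lemma vrK {n : nat} : cancel vr (@rv R n).
Proof. by move=> v; apply/rowP => i; rewrite mxE tnth_mktuple. Qed.

Lemma measurable_box {n : nat} (A : 'I_n -> set Rm) : (forall i, measurable (A i)) ->
 measurable [set t : n.-tuple Rm | forall i, A i (tnth t i)].
Proof.
move=> mA.
rewrite (_ : [set t : n.-tuple Rm | _] =
 \bigcap_(i in [set: 'I_n]) ((fun t : n.-tuple Rm => tnth t i) @^-1` A i)).
 apply: fin_bigcap_measurable => // i _.
 by rewrite -[X in measurable X]setTI; exact: measurable_tnth.
by apply/seteqP; split => t /= H i; [move=> _; exact: H|exact: (H i I)].
Qed.

(** Boxes are measurable for the product sigma-algebra, and an open set is the countable union of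
    the cubes with rational centre and radius 1/(k+1) that it contains. *)
Lemma measurable_rv_open {n : nat} (U : set 'rV[R]_n) : open U ->
 measurable (rv @^-1` U : set (n.-tuple Rm)).
Proof.
move=> oU.
pose B (q : {ffun 'I_n -> rat} * nat) : set 'rV[R]_n :=
 [set y | forall i, ball (ratr (q.1 i) : R) (q.2.+1%:R^-1) (y 0 i)].
pose F q : set (n.-tuple Rm) := if `[< B q `<=` U >] then rv @^-1` B q else set0.
rewrite (_ : _ @^-1` U = \bigcup_q F q).
 apply: countable_bigcupT_measurable; first exact: countableP.
 move=> q; rewrite /F; case: asboolP => // _.
 rewrite (_ : _ @^-1` _ = [set t : n.-tuple Rm | forall i, ball (ratr (q.1 i) : R) (q.2.+1%:R^-1) (tnth t i)]).
  by apply: (@measurable_box n (fun i => ball (ratr (q.1 i) : R) (q.2.+1%:R^-1))) => i; exact: measurable_ball.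
 by apply/seteqP; split => t /= H i; move: (H i); rewrite mxE.
apply/seteqP; split => [t Ut|t [q _]]; last first.
{ by rewrite /F; case: asboolP => // BU Bt; exact: BU. }
have /nbhs_ballP[e /= e0 eU] : nbhs (rv t) U by exact: open_nbhs_nbhs.
have e20 : 0 < e / 2 by lra.
have [k ke] : exists k : nat, k.+1%:R^-1 < e / 2.
{ have [k _ kP] := @near_infty_natSinv_lt R (PosNum e20); exists k; exact: (kP k (leqnn k)). }
have /choice[q qP] : forall i : 'I_n, exists q : rat, ratr q \in `](tnth t i - k.+1%:R^-1), (tnth t i + k.+1%:R^-1)[.
{ by move=> i; apply: rat_in_itvoo; rewrite ltrD2l gtrN. }
exists ([ffun i => q i], k) => //; rewrite /F ifT.
 move=> i; rewrite ffunE mxE /ball/=; have := qP i; rewrite in_itv/= => /andP[q1 q2].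
 by rewrite ltr_distl q1.
apply/asboolP => y By; apply: eU; rewrite mx_norm_ball.
apply: (@le_lt_trans _ _ (k.+1%:R^-1 *+ 2)); last by rewrite [ltRHS]splitr ltrD.
apply: norm_coord_le; first by [].
move=> i; rewrite !mxE; have := By i; rewrite ffunE => H1.
have := qP i; rewrite in_itv/= => /andP[q1 q2].
apply: le_trans (ler_distD (ratr (q i)) _ _) _; rewrite lerD// ltW//.
by rewrite distrC ltr_distl q1.
Qed.

Lemma measurable_rv_continuous {n : nat} (U : set 'rV[R]_n) (f : 'rV[R]_n -> R) :
 open U -> (forall x, U x -> {for x, continuous f}) ->
 measurable_fun (rv @^-1` U : set (n.-tuple Rm)) (f \o rv).
Proof.
move=> oU cf; apply: (measurability _ (RGenOInfty.measurableE R)).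
move=> _ [_ [a ->] <-].
rewrite (_ : _ `&` _ = rv @^-1` (U `&` f @^-1` `]a, +oo[)); last first.
{ by []. }
apply: measurable_rv_open; rewrite openE => x [Ux /= fx].
apply: filterI; first exact: open_nbhs_nbhs.
apply: (cf x Ux); apply: open_nbhs_nbhs; split => //.
Qed.

Lemma measurable_comp_rv {n : nat} (f : 'rV[R]_n -> R) : continuous f ->
 measurable_fun setT (fun t : n.-tuple Rm => f (rv t)).
Proof. by move=> cf; apply: (@measurable_rv_continuous n setT f openT) => x _; exact: cf. Qed.

Lemma consp_tnth0 {n : nat} (x : Rm) (t : n.-tuple Rm) : tnth (consp (x, t)) ord0 = x.
Proof. by []. Qed.

Lemma consp_tnthS {n : nat} (x : Rm) (t : n.-tuple Rm) i :
 tnth (consp (x, t)) (lift ord0 i) = tnth t i.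
Proof. by rewrite tnthS. Qed.

Lemma measurable_consp {n : nat} : measurable_fun [set: Rm * n.-tuple Rm] (@consp R n).
Proof. by apply: measurable_cons. Qed.

Lemma ge0_integral_leb_prod {n : nat} (f : n.+1.-tuple Rm -> \bar R) :
 measurable_fun setT f -> (forall t, 0 <= f t)%E ->
 (\int[leb n.+1]_t f t = \int[@lebesgue_measure R \x leb n]_z f (consp z))%E.
Proof.
move=> mf f0.
rewrite -(@ge0_integral_pushforward _ _ _ _ R (@consp R n) measurable_consp
 (@lebesgue_measure R \x leb n)%E setT f)//.
Qed.

Lemma ge0_integral_leb_cons {n : nat} (f : n.+1.-tuple Rm -> \bar R) :
 measurable_fun setT f -> (forall t, 0 <= f t)%E ->
 (\int[leb n.+1]_t f t = \int[leb n]_t \int[@lebesgue_measure R]_x f (consp (x, t)))%E.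
Proof.
move=> mf f0; rewrite ge0_integral_leb_prod// fubini_tonelli2//.
by apply: measurableT_comp => //; exact: measurable_consp.
Qed.

Lemma measurable_fun_leb_inner {n : nat} (f : n.+1.-tuple Rm -> \bar R) :
 measurable_fun setT f -> (forall t, 0 <= f t)%E ->
 measurable_fun setT (fun t : n.-tuple Rm => \int[@lebesgue_measure R]_x f (consp (x, t)))%E.
Proof.
move=> mf f0.
apply: (@measurable_fun_fubini_tonelli_G _ _ _ _ R (@lebesgue_measure R) (fun z => f (consp z))) => //.
by apply: measurableT_comp => //; exact: measurable_consp.
Qed.

(** The image of Lebesgue measure under a translation agrees with it on half-open intervals, hence
    everywhere by uniqueness. *)
Lemma ge0_integral_translation (f : Rm -> \bar R) (a : R) :
 measurable_fun setT f -> (forall x, 0 <= f x)%E ->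
 (\int[@lebesgue_measure R]_x f (x + a)%R = \int[@lebesgue_measure R]_x f x)%E.
Proof.
move=> mf f0.
have ms : measurable_fun [set: Rm] (fun x : Rm => (x + a)%R : Rm).
{ exact: measurable_funD. }
rewrite -[LHS](@ge0_integral_pushforward _ _ _ _ R (fun x : Rm => (x + a)%R : Rm) ms
 (@lebesgue_measure R) setT f)//.
apply: eq_measure_integral => A mA _.
apply/esym; apply: (@lebesgue_measure_unique R (pushforward (@lebesgue_measure R) (fun x : Rm => (x + a)%R : Rm))) => //.
move=> X [[b c] _ <-].
change (lebesgue_measure `]b, c]%classic = lebesgue_measure ((fun x : R => x + a) @^-1` `]b, c]%classic)).
rewrite (_ : _ @^-1` _ = `](b - a), (c - a)]%classic); last first.
{ by apply/seteqP; split => x /=; rewrite !in_itv/= ltrBlDr lerBrDr. }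
rewrite !lebesgue_measure_itv/= !lte_fin ltrD2r; case: ifP => // _.
by congr EFin; ring.
Qed.

Definition shiftt {n : nat} (v : 'rV[R]_n) (t : n.-tuple Rm) : n.-tuple Rm :=
 [tuple (tnth t i + v 0 i : Rm) | i < n].

Lemma rv_shiftt {n : nat} (v : 'rV[R]_n) t : rv (shiftt v t) = rv t + v.
Proof. by apply/rowP => i; rewrite !mxE tnth_mktuple. Qed.

Lemma measurable_shiftt {n : nat} (v : 'rV[R]_n) :
 measurable_fun [set: n.-tuple Rm] (shiftt v).
Proof.
apply/measurable_fun_tnthP => i.
rewrite (_ : _ \o _ = (fun t : n.-tuple Rm => tnth t i + v 0 i)); last first.
{ by apply/funext => t; rewrite /= tnth_mktuple. }
by apply: measurable_funD => //; exact: measurable_tnth.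
Qed.

Lemma shiftt_consp {n : nat} (v : 'rV[R]_n.+1) x t :
 shiftt v (consp (x, t)) = consp (x + v 0 ord0, shiftt (\row_j v 0 (lift ord0 j)) t).
Proof.
apply: eq_from_tnth => i; rewrite tnth_mktuple.
case: (unliftP ord0 i) => [j ->|->]; last by [].
by rewrite !consp_tnthS tnth_mktuple mxE.
Qed.

(** Induction on the dimension: Tonelli splits off the first coordinate, which is translated on the
    line, and the induction hypothesis translates the others. *)
Lemma ge0_integral_leb_shift {n : nat} (f : n.-tuple Rm -> \bar R) (v : 'rV[R]_n) :
 measurable_fun setT f -> (forall t, 0 <= f t)%E ->
 (\int[leb n]_t f (shiftt v t) = \int[leb n]_t f t)%E.
Proof.
elim: n f v => [|n IH] f v mf f0.
 by apply: eq_integral => t _; congr f; apply: eq_from_tnth => -[].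
have mfs : measurable_fun setT (fun t => f (shiftt v t)).
{ by apply: measurableT_comp => //; exact: measurable_shiftt. }
rewrite ge0_integral_leb_cons// ge0_integral_leb_cons//.
rewrite -[RHS](IH _ (\row_j v 0 (lift ord0 j))); last 2 first.
- exact: (measurable_fun_leb_inner mf).
- by move=> t; exact: integral_ge0.
apply: eq_integral => t _.
rewrite -[RHS](ge0_integral_translation (v 0 ord0)); last 2 first.
- apply: (measurableT_comp mf).
 apply: (measurableT_comp (@measurable_consp n)).
 exact: measurable_pair2.
- by [].
by apply: eq_integral => x _; rewrite shiftt_consp.
Qed.

Lemma leb_box {n : nat} (A : 'I_n -> set Rm) (m : 'I_n -> R) :
 (forall i, measurable (A i)) -> (forall i, @lebesgue_measure R (A i) = (m i)%:E) ->
 leb n [set t | forall i, A i (tnth t i)] = (\prod_i m i)%:E.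
Proof.
elim: n A m => [|n IH] A m mA Am.
 rewrite big_ord0 /= diracE mem_set// => -[] //.
rewrite big_ord_recl /= /leb_cons /pushforward.
rewrite (_ : _ @^-1` _ = A ord0 `*` [set t : n.-tuple Rm | forall i, A (lift ord0 i) (tnth t i)]).
 rewrite product_measure1E//; last by apply: (@measurable_box n (fun i => A (lift ord0 i))).
 rewrite EFinM; congr (_ * _)%E; first exact: Am.
 by apply: (IH (fun i => A (lift ord0 i))).
apply/seteqP; split => -[x t] /=.
 split; first by [].
 by move=> i; have := H (lift ord0 i); rewrite consp_tnthS.
move=> [H1 H2] i; case: (unliftP ord0 i) => [j ->|->]; last by [].
by rewrite consp_tnthS.
Qed.

Definition cube {n : nat} (a : 'rV[R]_n) (h : R) : set 'rV[R]_n :=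
 [set x | forall i, a 0 i <= x 0 i < a 0 i + h].

Lemma rv_cubeE {n : nat} (a : 'rV[R]_n) (h : R) : rv @^-1` cube a h =
 [set t : n.-tuple Rm | forall i, `[a 0 i, (a 0 i + h)[%classic (tnth t i)].
Proof. by apply/seteqP; split => t /= H i; have := H i; rewrite mxE/=. Qed.

Lemma measurable_cube {n : nat} (a : 'rV[R]_n) (h : R) :
 measurable (rv @^-1` cube a h : set (n.-tuple Rm)).
Proof. by rewrite rv_cubeE; apply: (@measurable_box n (fun i => `[a 0 i, (a 0 i + h)[%classic)). Qed.

Lemma leb_cube {n : nat} (a : 'rV[R]_n) (h : R) : 0 <= h ->
 leb n (rv @^-1` cube a h) = (h ^+ n)%:E.
Proof.
move=> h0; rewrite rv_cubeE (@leb_box n (fun i => `[a 0 i, (a 0 i + h)[%classic) (fun=> h))//.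
 by rewrite prodr_const card_ord.
move=> i; rewrite lebesgue_measure_itv/= lte_fin.
case: ltP => H; first by rewrite -EFinB addrAC subrr add0r.
by congr EFin; lra.
Qed.

Lemma leb_bounded {n : nat} (A : set (n.-tuple Rm)) (r : R) :
 measurable A -> (forall t, A t -> `|rv t| < r) -> (leb n A < +oo)%E.
Proof.
move=> mA Ar; have [->|/set0P[t0 At0]] := eqVneq A set0; first by rewrite measure0.
have r0 : 0 < r by apply: le_lt_trans (Ar _ At0).
apply: (@le_lt_trans _ _ (leb n (rv @^-1` cube (const_mx (- r)) (r *+ 2)))).
 apply: le_measure; rewrite ?inE//; first exact: measurable_cube.
 move=> t /Ar tr i; rewrite !mxE.
 have := le_lt_trans (coord_le_norm (rv t) i) tr; rewrite mxE ltr_norml => /andP[t1 t2].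
 by lra.
by rewrite leb_cube ?ltry// mulrn_wge0// ltW.
Qed.

End TupleLebesgue.

(** * Finite covers, bounds and uniform continuity on compact sets *)

Section CompactSupport.
Context {R : realType} {n : nat}.
Local Notation Rm := (measurableTypeR R).

Lemma compact_seq_cover {T : ptopologicalType} (I : choiceType) (D : set I) (K : set T) (f : I -> set T) :
 compact K -> (forall i, D i -> open (f i)) -> (forall x, K x -> exists2 i, D i & f i x) ->
 exists s : seq I, (forall i, i \in s -> D i) /\ forall x, K x -> exists2 i, i \in s & f i x.
Proof.
rewrite compact_cover => cK fo Kf.
have [|x /Kf[i Di fi]|E ED KE] := cK I D f; [exact: fo|by exists i|].
exists (finmap.enum_fset E); split; first by move=> i iE; have := ED i iE; rewrite inE.
by [].
Qed.

Lemma compact_bounded_rV (K : set 'rV[R]_n) : compact K -> exists2 r : R, 0 < r & forall x, K x -> `|x| < r.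
Proof.
move=> /compact_bounded[r [rr Kr]]; exists (`|r| + 2); first by [].
move=> x Kx; have rM : r < `|r| + 1 by rewrite (le_lt_trans (ler_norm _))// ltrDl.
by have /= := Kr _ rM x Kx; lra.
Qed.

Lemma compact_ubound {T : ptopologicalType} (K : set T) (f : T -> R) :
 compact K -> (forall x, K x -> {for x, continuous f}) ->
 exists2 B : R, 0 < B & forall x, K x -> `|f x| <= B.
Proof.
move=> cK cf; have [->|/set0P K0] := eqVneq K set0; first by exists 1.
have [x _ H] := @compact_EVT_max T R (fun x => `|f x|) K K0 cK (ltac:(
 apply: continuous_in_subspaceT => x /set_mem Kx; apply: (@continuous_comp _ _ _ f); [exact: cf|exact: norm_continuous])).
exists (`|f x| + 1); first by [].
by move=> y Ky; rewrite (le_trans (H y _))// ?inE// lerDl.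
Qed.

(** A Lebesgue number argument: K is covered by balls of half the local radius of continuity, and
    the smallest of finitely many halves works. When neither point lies in K both values vanish. *)
Lemma compact_supp_unif_cont (f : 'rV[R]_n -> R) (K : set 'rV[R]_n) :
 continuous f -> compact K -> (forall x, ~ K x -> f x = 0) ->
 forall e : R, 0 < e -> exists2 d : R, 0 < d & forall x y, `|x - y| < d -> `|f x - f y| <= e.
Proof.
move=> cf cK f0 e e0; have e20 : 0 < e / 2 by rewrite divr_gt0.
have /choice[d dP] : forall x : 'rV[R]_n, exists d : R, 0 < d /\ forall y, `|x - y| < d -> `|f x - f y| < e / 2.
{ move=> x; have /cvgrPdist_lt/(_ _ e20)/nbhs_ballP[d /= d0 H] := cf x.
 by exists d; split => // y xy; apply: H; rewrite mx_norm_ball. }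
have [x _|x Kx|D [_ DK]] := @compact_seq_cover _ _ setT K (fun x : 'rV[R]_n => [set y | `|x - y| < d x / 2]) cK.
- rewrite openE => y /= yx; apply/nbhs_ballP; exists (d x / 2 - `|x - y|); first by rewrite /= subr_gt0.
 move=> z; rewrite mx_norm_ball /ball_ /= => yz.
 have := ler_distD y x z; lra.
- exists x => //=; rewrite subrr normr0 divr_gt0//; by have [] := dP x.
exists (\big[Order.min/1]_(x <- D) (d x / 2)).
{ elim/big_ind : _ => //; first by move=> a b a0 b0; rewrite lt_min a0.
 by move=> x _; rewrite divr_gt0//; have [] := dP x. }
have key x y : K x -> `|x - y| < \big[Order.min/1]_(x <- D) (d x / 2) -> `|f x - f y| <= e.
{ move=> /DK[z /= zD xz] xy; have [dz0 dz] := dP z.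
 have mz : \big[Order.min/1]_(x <- D) (d x / 2) <= d z / 2 by exact: ge_bigmin_seq.
 have H1 : `|f z - f x| < e / 2 by apply: dz; apply: lt_trans xz _; rewrite gtr_pMr// invf_lt1// ltr1n.
 have H2 : `|f z - f y| < e / 2.
 { apply: dz; have := ler_distD x z y; lra. }
 have := ler_distD (f z) (f x) (f y); rewrite [`|f x - f z|]distrC; lra. }
move=> x y xy.
have [Kx|nKx] := pselect (K x); first exact: key.
have [Ky|nKy] := pselect (K y); first by rewrite distrC; apply: key => //; rewrite distrC.
by rewrite !f0// subrr normr0 ltW.
Qed.

Lemma bounded_integrable {d} {T : measurableType d} (mu : {measure set T -> \bar R})
  (f : T -> R) (D A : set T) (B : R) :
 measurable D -> measurable A -> (mu A < +oo)%E ->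
 measurable_fun D f -> (forall x, D x -> ~ A x -> f x = 0) -> (forall x, D x -> `|f x| <= B) ->
 mu.-integrable D (EFin \o f).
Proof.
move=> mD mA Aoo mf fA fB.
apply: (@le_integrable _ _ _ mu D mD _ (fun x => (B * \1_A x)%:E)).
- exact/measurable_EFinP.
- move=> x Dx /=; rewrite lee_fin indicE; have [Ax|nAx] := pselect (A x).
  by rewrite mem_set//= mulr1 (le_trans (fB x Dx))// ler_norm.
 by rewrite fA// memNset//= mulr0 normr0.
- have : mu.-integrable D (EFin \o \1_A).
 { apply/integrableP; split; first exact/measurable_EFinP.
  rewrite (eq_integral (fun x => (\1_A x)%:E)); last first.
  { by move=> x _; rewrite /= ger0_norm. }
  rewrite integral_indic//; apply: le_lt_trans Aoo.
  by apply: le_measure; rewrite ?inE//; exact: measurableI. }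
 by move/(integrableZl mD B).
Qed.

End CompactSupport.

Lemma continuous_addr {R : realType} {V : normedModType R} (v : V) : continuous (fun x : V => x + v).
Proof. by move=> x; apply: cvgD; [exact: cvg_id|exact: cvg_cst]. Qed.

(** * Uniform difference quotients and integrals of derivatives *)

Section UniformDifferentiability.
Context {R : realType} {n : nat}.
Local Notation Rm := (measurableTypeR R).
Implicit Types (f : 'rV[R]_n -> R^o).

Lemma partial_support f (K : set 'rV[R]_n) i : closed K -> (forall x, ~ K x -> f x = 0) ->
 forall x, ~ K x -> partial i f x = 0.
Proof.
move=> cK f0 x nKx; rewrite (@partial_eq_open _ _ _ (~` K) f (cst 0))//.
- by rewrite /partial derive_cst.
- exact: closed_openC.
Qed.

(** The mean value theorem replaces the difference quotient by a partial derivative at distance at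
    most |h|, and that derivative is uniformly continuous. Uniformity in x is what permits
    integration of the estimate. *)
Lemma uniform_derivative f (K : set 'rV[R]_n) i : Ck 1 setT f -> compact K ->
 (forall x, ~ K x -> f x = 0) -> forall e : R, 0 < e -> exists2 d : R, 0 < d &
 forall (h : R) x, `|h| < d -> `|f (x + h *: 'e_i) - f x - h * partial i f x| <= `|h| * e.
Proof.
move=> Cf cK f0 e e0.
have clK : closed K by apply: compact_closed => //.
have cpf : continuous (partial i f).
{ by move=> x; apply: (Ck_continuous (CkS i Cf)). }
have [d d0 H] := compact_supp_unif_cont cpf cK (partial_support i clK f0) e0.
exists d => // h x hd.
have D s : 0 <= s <= 1 -> is_derive (x + s *: (h *: 'e_i)) (h *: 'e_i) f (h * partial i f (x + s *: (h *: 'e_i))).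
{ by move=> _; apply: is_derive_scale; exact: (Ck_derivable Cf). }
have [s s01 E] := mean_value_line (fun s s01 => (@ex_derive _ _ _ _ _ _ _ (D s s01))).
rewrite E (@derive_val _ _ _ _ _ _ _ (D s s01)) -mulrBr normrM.
apply: ler_wpM2l => //.
apply: H; rewrite addrAC subrr add0r !normrZ.
case/andP: s01 => s0 s1; rewrite ger0_norm//.
apply: le_lt_trans hd; rewrite mulrA; via (s * `|h| * 1).
 apply: ler_wpM2l; first by rewrite mulr_ge0.
 apply: norm_coord_le => // j; rewrite mxE /=; case: eqP => _; by rewrite ?normr1 ?normr0.
by rewrite mulr1 ler_piMl.
Qed.

Lemma leb_compact (K : set 'rV[R]_n) : compact K ->
 measurable (rv @^-1` K : set (n.-tuple Rm)) /\ (leb n (rv @^-1` K) < +oo)%E.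
Proof.
move=> cK.
have clK : closed K by apply: compact_closed => //.
have mK : measurable (rv @^-1` K : set (n.-tuple Rm)).
{ rewrite (_ : rv @^-1` K = ~` (rv @^-1` (~` K))); last by rewrite setCK.
 apply: measurableC.
 by apply: measurable_rv_open; exact: closed_openC. }
split => //; have [r r0 Kr] := compact_bounded_rV cK.
by apply: (@leb_bounded _ _ _ r mK) => t; exact: Kr.
Qed.

Lemma indic_compact_integrable (K : set 'rV[R]_n) : compact K ->
 L1 (leb n) (\1_(rv @^-1` K) : n.-tuple Rm -> R).
Proof.
move=> /leb_compact[mK Koo]; apply: (@bounded_integrable _ _ _ (leb n) _ setT (rv @^-1` K) 1) => //.
 by move=> t _ nK; rewrite indicE memNset.
by move=> t _; rewrite indicE; case: (_ \in _); rewrite ?normr1 ?normr0.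
Qed.

Lemma compact_supp_integrable (f : 'rV[R]_n -> R) (K : set 'rV[R]_n) : continuous f -> compact K ->
 (forall x, ~ K x -> f x = 0) -> (leb n).-integrable setT (fun t => (f (rv t))%:E).
Proof.
move=> cf cK f0; have [mK Koo] := leb_compact cK.
have [B B0 fB] := compact_ubound cK (fun x _ => cf x).
apply: (@bounded_integrable R _ _ (leb n) (f \o rv) setT _ B _ mK Koo) => //.
- by apply: (@measurable_rv_continuous R n setT f openT) => x _; exact: cf.
- by move=> t _ nK; exact: f0.
- move=> t _; have [Kt|nKt] := pselect (K (rv t)); first exact: fB.
 by rewrite /= f0// normr0 ltW.
Qed.

Lemma Rintegral_leb_shift (f : 'rV[R]_n -> R) (v : 'rV[R]_n) :
 measurable_fun setT (fun t : n.-tuple Rm => f (rv t)) ->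
 \int[leb n]_t f (rv t + v) = \int[leb n]_t f (rv t).
Proof.
move=> mf; congr fine; rewrite [in LHS]integralE [in RHS]integralE; congr (_ - _)%E.
 rewrite -[RHS](@ge0_integral_leb_shift _ _ _ v)//; last first.
  by apply: measurable_funepos; apply/measurable_EFinP.
 by apply: eq_integral => t _; rewrite !funeposE rv_shiftt.
rewrite -[RHS](@ge0_integral_leb_shift _ _ _ v)//; last first.
 by apply: measurable_funeneg; apply/measurable_EFinP.
by apply: eq_integral => t _; rewrite !funenegE rv_shiftt.
Qed.

(* Differentiate the translation invariance of the integral. *)
Lemma Rintegral_partial f (K : set 'rV[R]_n) i : Ck 1 setT f -> compact K ->
 (forall x, ~ K x -> f x = 0) -> \int[leb n]_t partial i f (rv t) = 0.
Proof.
move=> Cf cK f0.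
have clK : closed K by apply: compact_closed => //; exact: norm_hausdorff.
have cf : continuous f by move=> x; exact: (Ck_continuous Cf).
have cpf : continuous (partial i f) by move=> x; exact: (Ck_continuous (CkS i Cf)).
have [r r0 Kr] := compact_bounded_rV cK.
pose C := closed_ball (0 : 'rV[R]_n) (r + 1).
have cC : compact C.
{ apply: bounded_closed_compact; last exact: closed_ball_closed.
 exists (r + 1); split; first exact: num_real.
 move=> y ry x; rewrite /C closed_ballE ?addr_gt0// /closed_ball_ /= sub0r normrN => xr.
 by rewrite (le_trans xr)// ltW. }
have [mC Coo] := leb_compact cC.
have C0 x : ~ C x -> r + 1 < `|x|.
{ by rewrite /C closed_ballE ?addr_gt0// /closed_ball_ /= sub0r normrN => /negP; rewrite -ltNge. }
set V := fine (leb n (rv @^-1` C)).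
have V0 : 0 <= V by apply: fine_ge0; exact: measure_ge0.
apply/eqP; rewrite -normr_le0; apply/ler_addgt0Pr => e e0; rewrite add0r.
have e'0 : 0 < e / (V + 1) by rewrite divr_gt0// ltr_wpDl.
have [d d0 H] := uniform_derivative i Cf cK f0 e'0.
pose h := Order.min (d / 2) 1.
have h0 : 0 < h by rewrite lt_min divr_gt0//= ltr01.
have hd : `|h| < d by rewrite gtr0_norm// gt_min (_ : d / 2 < d)// gtr_pMr// invf_lt1// ltr1n.
have h1 : h <= 1 by rewrite ge_min lexx orbT.
pose v : 'rV[R]_n := h *: 'e_i.
have vr1 : `|v| <= 1.
{ rewrite /v normrZ gtr0_norm//; via (h * 1); last by rewrite mulr1.
 apply: ler_wpM2l; first exact: ltW.
 by apply: norm_coord_le => // j; rewrite mxE eqxx /=; case: eqP => _; rewrite ?normr1 ?normr0. }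
have fv0 x : ~ C x -> f (x + v) = 0.
{ move=> /C0 xr; apply: f0 => /Kr xvr; have := ler_normB (x + v) v; rewrite addrK; lra. }
have f0C x : ~ C x -> f x = 0 by move=> /C0 xr; apply: f0 => /Kr; lra.
have cfv : continuous (fun x : 'rV[R]_n => f (x + v) : R).
{ by move=> x; apply: (@continuous_comp _ _ R^o (fun x : 'rV[R]_n => x + v) f); [exact: continuous_addr|exact: cf]. }
have p0 x : ~ C x -> partial i f x = 0.
{ by move=> /C0 xr; apply: (partial_support i clK f0) => /Kr; lra. }
have I1 := compact_supp_integrable cf cC f0C.
have I2 := compact_supp_integrable cfv cC fv0.
have I3 := compact_supp_integrable cpf cC p0.
have I4 : (leb n).-integrable setT (fun t => (h * partial i f (rv t))%:E).
{ by have := integrableZl measurableT h I3; apply: eq_integrable. }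
have I5 : (leb n).-integrable setT (fun t => (f (rv t + v) - f (rv t))%:E).
{ by have := integrableB measurableT I2 I1; apply: eq_integrable. }
have I6 : (leb n).-integrable setT (fun t => (f (rv t + v) - f (rv t) - h * partial i f (rv t))%:E).
{ by have := integrableB measurableT I5 I4; apply: eq_integrable. }
have E : h * \int[leb n]_t partial i f (rv t) = - \int[leb n]_t (f (rv t + v) - f (rv t) - h * partial i f (rv t)).
{ rewrite RintegralB// RintegralB// RintegralZl// Rintegral_leb_shift//; first by rewrite subrr sub0r opprK.
 by move/measurable_int : I1 => /measurable_EFinP. }
rewrite -(ler_pM2l h0) -{1}[h](gtr0_norm h0) -normrM E normrN.
apply: le_trans (le_normr_Rintegral _ _) _ => //.
via (\int[leb n]_t (h * (e / (V + 1)) * \1_(rv @^-1` C) t)).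
 apply: le_Rintegral => //.
 - exact: integrable_norm.
 - apply: (@bounded_integrable R _ _ (leb n) (fun t => h * (e / (V + 1)) * \1_(rv @^-1` C) t) setT _ (h * (e / (V + 1))) _ mC Coo) => //.
  + by apply: measurable_funM => //; exact: measurable_indic.
  + by move=> t _ nC; rewrite indicE memNset// mulr0.
  + move=> t _; rewrite indicE; case: (_ \in _); rewrite ?mulr1 ?mulr0 ?normr0 ?ger0_norm// mulr_ge0// ltW//.
 move=> t _; rewrite indicE; have [Ct|nCt] := pselect (C (rv t)).
  by rewrite mem_set// mulr1 -{2}(gtr0_norm h0); exact: H.
 by rewrite memNset// mulr0 fv0// f0C// p0// mulr0 !subr0 normr0.
rewrite RintegralZl//; last first.
{ apply: (@bounded_integrable R _ _ (leb n) (\1_(rv @^-1` C)) setT _ 1 _ mC Coo) => //.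
 - by move=> t _ nC; rewrite indicE memNset.
 - by move=> t _; rewrite indicE; case: (_ \in _); rewrite ?normr1 ?normr0. }
rewrite /Rintegral integral_indic// setIT -mulrA; apply: ler_wpM2l; first exact: ltW.
rewrite mulrAC ler_pdivrMr ?ltr_wpDl//; apply: ler_wpM2l; first exact: ltW.
by rewrite lerDl.
Qed.

End UniformDifferentiability.

(** * A smooth step function and smooth bumps *)

Section SmoothStep.
Context {R : realType}.

Lemma is_derive_of_bound {V : normedModType R} (f : V -> R^o) (x v : V) (L : R) :
 (forall e : R, 0 < e -> exists2 d : R, 0 < d & forall h : R, `|h| < d ->
   `|f (x + h *: v) - f x - h * L| <= `|h| * e) -> is_derive x v f L.
Proof.
move=> H.
suff C : (fun h : R => h^-1 *: ((f \o shift x) (h *: v) - f x)) @ 0^' --> (L : R^o).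
{ by split; [apply/cvg_ex; exists L|exact: cvg_lim C]. }
apply/cvgrPdist_le => e e0; have [d d0 Hd] := H e e0.
exists d => // h /=; rewrite sub0r normrN => hd h0.
rewrite -[X in `|X|](_ : - (h^-1 * (f (x + h *: v) - f x - h * L)) = _).
 rewrite normrN normrM normfV ler_pdivrMl ?normr_gt0//; exact: Hd.
by rewrite [h *: v + x]addrC mulrBr mulKf// opprB.
Qed.

(** The classical exp(-1/x), multiplied by a polynomial in 1/x so that the family is closed under
    differentiation. *)
Definition flat (p : {poly R}) (x : R) : R :=
 if 0 < x then p.[x^-1] * expR (- x^-1) else 0.

(** One term y^(k+1)/(k+1)! of the exponential series already bounds exp(y) from below. *)
Lemma exprn_expRN_le (y : R) k : 0 <= y -> y ^+ k.+1 * expR (- y) <= k.+1`!%:R.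
Proof.
move=> y0; have := expR_ge1Dxn k y0; rewrite expRN => H.
rewrite ler_pdivrMr ?expR_gt0//; apply: le_trans (ler_wpM2l _ H) => //.
rewrite mulrDr mulr1 mulrCA divff ?fact_gt0// mulr1.
by rewrite lerDr.
Qed.

(** The quadratic decay at the origin is what makes the derivative there exist and vanish. *)
Lemma flat_bound p : exists2 C : R, 0 <= C & forall x, `|flat p x| <= C * x ^+ 2.
Proof.
exists (\sum_(i < size p) `|p`_i| * i.+2`!%:R); first by apply: sumr_ge0 => i _.
move=> x; rewrite /flat; case: ltP => x0; last first.
{ by rewrite normr0 mulr_ge0 ?sqr_ge0// sumr_ge0// => i _. }
rewrite horner_coef mulr_suml mulr_suml.
apply: le_trans (ler_norm_sum _ _ _) _; apply: ler_sum => i _.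
rewrite -mulrA normrM -mulrA; apply: ler_wpM2l => //.
have y0 : 0 < x^-1 by rewrite invr_gt0.
rewrite ger0_norm; last by rewrite mulr_ge0 ?exprn_ge0 ?(ltW y0).
have x20 : 0 <= x ^+ 2 by rewrite sqr_ge0.
apply: le_trans (ler_wpM2r x20 (@exprn_expRN_le x^-1 i.+1 (ltW y0))).
rewrite mulrAC -[i.+2]addn2 exprD -[_ * x ^+ 2]mulrA -exprMn mulVf ?gt_eqF//.
by lra.
Qed.

(** For x > 0, the derivative of p(1/x) exp(-1/x) is x^(-2) (p - p')(1/x) exp(-1/x), which explains
    the polynomial X^2 (p - p'). *)
Lemma flat_is_derive p x : is_derive x (1 : R) (flat p) (flat ('X^2 * (p - p^`())) x).
Proof.
have [x0|x0|x0] := ltgtP x 0.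
- rewrite {2}/flat ltNge (ltW x0)/=.
 have E : {near x, cst (0 : R) =1 flat p}.
 { by near=> y; rewrite /flat ltNge; rewrite (ltW (_ : y < 0))//; near: y; exact: lt_nbhsl. }
 by apply: near_eq_is_derive E _; exact: is_derive_cst.
- rewrite {2}/flat x0.
 have E : {near x, (fun y : R => p.[y^-1] * expR (- y^-1)) =1 flat p}.
 { by near=> y; rewrite /flat; have -> : 0 < y by near: y; exact: lt_nbhsr. }
 apply: near_eq_is_derive E _.
 have xn0 : x != 0 by rewrite gt_eqF.
 have D1 : is_derive x (1 : R) (fun y : R => y^-1) (- x ^- 2).
 { split; first exact: derivableV.
  by rewrite deriveV// derive_id [LHS]mulr1. }
 have D2 := @is_derive1_comp R (horner p) (fun y : R => y^-1) x _ _ (is_derive_poly p x^-1) D1.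
 have D3 : is_derive x (1 : R) (fun y : R => - y^-1) (x ^- 2).
 { by rewrite -[x ^- 2]opprK; exact: is_deriveN. }
 have D4 := @is_derive1_comp R expR (fun y : R => - y^-1) x _ _ (is_derive_expR _) D3.
 apply: is_derive_eq (is_deriveM D2 D4) _.
 rewrite /= !hornerE /= exprVn /GRing.scale /=; ring.
- rewrite x0; apply: is_derive_of_bound => e e0.
 have [C C0 HC] := flat_bound p.
 exists (e / (C + 1)); first by rewrite divr_gt0// ltr_wpDl.
 move=> h hd; rewrite /flat ltxx mulr0 !subr0 add0r [h *: 1]mulr1.
 apply: le_trans (HC h) _; rewrite -normr_id -real_normK ?num_real// mulrA mulrC normr_id.
 apply: ler_wpM2l => //; via (C * (e / (C + 1))); first by rewrite ler_wpM2l// ltW.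
 rewrite mulrCA ler_piMr ?(ltW e0)// ler_pdivrMr ?ltr_wpDl// mul1r lerDl//.
Unshelve. all: by end_near. Qed.

Definition flat1 : R -> R := flat 1.

Lemma flat1_family : exists G : nat -> R -> R, G 0%N = flat1 /\
 forall k x, True -> is_derive x (1 : R) (G k) (G k.+1 x).
Proof.
exists (fun k => flat (iter k (fun p => 'X^2 * (p - p^`())) 1)); split => // k x _.
exact: flat_is_derive.
Qed.

Lemma flat1E x : 0 < x -> flat1 x = expR (- x^-1).
Proof. by move=> x0; rewrite /flat1 /flat x0 hornerC mul1r. Qed.

Lemma flat1_0 x : x <= 0 -> flat1 x = 0.
Proof. by move=> x0; rewrite /flat1 /flat ltNge x0. Qed.

Lemma flat1_ge0 x : 0 <= flat1 x.
Proof.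
case: (leP x 0) => x0; first by rewrite flat1_0.
by rewrite flat1E//.
Qed.

Lemma flat1_gt0 x : 0 < x -> 0 < flat1 x.
Proof. by move=> x0; rewrite flat1E ?expR_gt0. Qed.

Lemma flat1_le x y : x <= y -> flat1 x <= flat1 y.
Proof.
move=> xy; case: (leP x 0) => x0; first by rewrite flat1_0// flat1_ge0.
have y0 := lt_le_trans x0 xy.
by rewrite !flat1E// ler_expR lerN2 lef_pV2.
Qed.

(** With y = 1/x the derivative is y^2 exp(-y), and the bound 2 is 2!. *)
Lemma flat1_derive : exists2 g : R -> R, (forall x, is_derive x (1 : R) flat1 (g x)) &
 forall x, 0 <= g x <= 2.
Proof.
exists (flat ('X^2 * (1 - 1^`()))); first by exact: flat_is_derive.
move=> x; rewrite /flat; case: ltP => x0; last by lra.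
have y0 : 0 <= x^-1 by rewrite invr_ge0 ltW.
rewrite derivC subr0 mulr1 hornerXn; apply/andP; split; last exact: (exprn_expRN_le 1 y0).
by rewrite mulr_ge0 ?exprn_ge0.
Qed.

(** The inner expression 1 - flat1 x / flat1 1 equals 1 for x <= 0 and is nonpositive for x >= 1;
    feeding it to the same function once more gives a smooth passage from 0 to 1. *)
Definition step (x : R) : R := 1 - flat1 (1 - flat1 x / flat1 1) / flat1 1.

Lemma flat11_gt0 : 0 < flat1 1. Proof. exact: flat1_gt0. Qed.
Local Hint Resolve flat11_gt0 : core.

Lemma step0 x : x <= 0 -> step x = 0.
Proof. by move=> x0; rewrite /step (flat1_0 x0) mul0r subr0 divff ?subrr// gt_eqF. Qed.

Lemma step1 x : 1 <= x -> step x = 1.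
Proof.
move=> x1; rewrite /step [flat1 (1 - _)]flat1_0 ?mul0r ?subr0//.
by rewrite subr_le0 ler_pdivlMr// mul1r flat1_le.
Qed.

Lemma step_ge0 x : 0 <= step x.
Proof.
rewrite subr_ge0 ler_pdivrMr// mul1r flat1_le// gerBl divr_ge0 ?flat1_ge0//.
Qed.

Lemma step_le1 x : step x <= 1.
Proof. by rewrite gerBl divr_ge0 ?flat1_ge0//. Qed.

Lemma step_derive : exists2 g : R -> R, (forall x, is_derive x (1 : R) step (g x)) &
 exists2 C : R, 0 < C & forall x, `|g x| <= C.
Proof.
have [g Dg gb] := flat1_derive.
set a := (flat1 1)^-1; have a0 : 0 < a by rewrite invr_gt0.
exists (fun x => g (1 - flat1 x / flat1 1) * (g x * a) * a).
 move=> x.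
 have D1 : is_derive x (1 : R) (fun y => 1 - flat1 y * a) (- (g x * a)).
 { apply: is_derive_eq (is_deriveB (is_derive_cst (1 : R) x 1) (is_deriveM (Dg x) (is_derive_cst a x 1))) _.
  by rewrite /GRing.scale /= mulr0 !add0r mulrC. }
 have D2 := @is_derive1_comp R flat1 (fun y => 1 - flat1 y * a) x _ _ (Dg _) D1.
 apply: is_derive_eq (is_deriveB (is_derive_cst (1 : R) x 1) (is_deriveM D2 (is_derive_cst a x 1))) _.
 rewrite /GRing.scale /=; ring.
exists (2 * (2 * a) * a); first by rewrite !mulr_gt0.
move=> x; have /andP[g0 g2] := gb x; have /andP[h0 h2] := gb (1 - flat1 x / flat1 1).
rewrite ger0_norm; last by rewrite !mulr_ge0// ltW.
apply: ler_wpM2r; first exact: ltW.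
apply: ler_pM => //; first by rewrite mulr_ge0// ltW.
by apply: ler_wpM2r => //; exact: ltW.
Qed.

Lemma Ck_step {n : nat} k (V : set 'rV[R]_n) (f : 'rV[R]_n -> R^o) :
 open V -> Ck k V f -> Ck k V (fun x => step (f x) : R^o).
Proof.
move=> oV Cf.
have fl (g : 'rV[R]_n -> R^o) : Ck k V g -> Ck k V (fun x => flat1 (g x) : R^o).
{ apply: (@Ck_comp1 R n k V setT flat1 g oV openT (fun _ _ => I)) => //.
 have [G [G0 dG]] := flat1_family; exists G; split => // j x _. }
have aff (a b : R) (g : 'rV[R]_n -> R^o) : Ck k V g -> Ck k V (fun x => a + b * g x : R^o).
{ move=> Cg; exact: (CkD oV (Ck_cst k (a : R^o) oV) (CkM oV (Ck_cst k (b : R^o) oV) Cg)). }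
have := aff 1 (- (flat1 1)^-1) _ (fl _ (aff 1 (- (flat1 1)^-1) _ (fl _ Cf))).
apply: Ck_eq => // x _; by rewrite !mulNr ![(flat1 1)^-1 * _]mulrC.
Qed.

(* Equal to 1 on the sup-norm ball of radius r around a, and to 0 outside that of radius 2r. *)
Definition bump {n : nat} (a : 'rV[R]_n) (r : R) (x : 'rV[R]_n) : R :=
 \prod_i step (2 - (r^-1 * (x 0 i - a 0 i)) ^+ 2).

Lemma Ck_bump {n : nat} k (a : 'rV[R]_n) r : Ck k setT (bump a r : _ -> R^o).
Proof.
apply: (@Ck_prod R n _ (index_enum 'I_n) predT k setT
 (fun i x => step (2 - (r^-1 * (x 0 i - a 0 i)) ^+ 2)) openT) => i _.
apply: Ck_step; first exact: openT.
have Cl : Ck k setT (fun x : 'rV[R]_n => r^-1 * (x 0 i - a 0 i) : R^o).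
{ apply: (@CkM R n k setT (cst r^-1) (fun x => x 0 i - a 0 i) openT (Ck_cst _ _ openT)).
 exact: (CkD openT (Ck_coord _ _ openT) (Ck_cst k (- a 0 i : R^o) openT)). }
have := CkD openT (Ck_cst k (2 : R^o) openT) (CkN openT (CkM openT Cl Cl)).
by [].
Qed.

Lemma bump_ge0 {n : nat} (a : 'rV[R]_n) r x : 0 <= bump a r x.
Proof. by apply: prodr_ge0 => i _; exact: step_ge0. Qed.

Lemma bump_le1 {n : nat} (a : 'rV[R]_n) r x : bump a r x <= 1.
Proof. by apply: prodr_ile1 => i _; rewrite step_ge0 step_le1. Qed.

Lemma bump1 {n : nat} (a : 'rV[R]_n) r x : 0 < r -> `|x - a| <= r -> bump a r x = 1.
Proof.
move=> r0 xa; rewrite /bump big1// => i _; apply: step1.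
have : `|r^-1 * (x 0 i - a 0 i)| <= 1.
{ rewrite normrM gtr0_norm ?invr_gt0// ler_pdivrMl// mulr1.
 by have := coord_le_norm (x - a) i; rewrite !mxE => /le_trans; apply. }
by move=> H; have := sqr_ge0 (r^-1 * (x 0 i - a 0 i)); rewrite -real_normK ?num_real// => H2;
 have := exprn_ile1 2 (normr_ge0 _) H; lra.
Qed.

Lemma bump0 {n : nat} (a : 'rV[R]_n) r x : 0 < r -> 2 * r <= `|x - a| -> bump a r x = 0.
Proof.
move=> r0 xa; have [i xi] : exists i, 2 * r <= `|x 0 i - a 0 i|.
{ apply/not_existsP => H; move: xa; apply/negP; rewrite -ltNge.
 case: n a x H => [|n] a x H.
  by rewrite (_ : x - a = 0) ?normr0 ?mulr_gt0//; apply/rowP => -[].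
 rewrite (le_lt_trans (y := \big[Order.max/0]_i `|x 0 i - a 0 i|))//.
  apply: norm_coord_le; first by apply: bigmax_ge_id.
  by move=> i; rewrite !mxE; exact: le_bigmax.
 apply: bigmax_lt => [|i _]; first by lra.
 by rewrite ltNge; apply/negP/H. }
rewrite /bump (bigD1 i)//= step0 ?mul0r//.
have : 2 <= `|r^-1 * (x 0 i - a 0 i)|.
{ by rewrite normrM gtr0_norm ?invr_gt0// ler_pdivlMl// mulrC. }
move: (r^-1 * _) => y y2; rewrite -real_normK ?num_real// subr_le0.
by apply: le_trans (_ : 2 ^+ 2 <= _); [rewrite expr2; lra|rewrite ler_pXn2r// nnegrE].
Qed.

Lemma bump_even {n : nat} (r : R) (x : 'rV[R]_n) : bump 0 r (- x) = bump 0 r x.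
Proof. by apply: eq_bigr => i _; rewrite !mxE !subr0 mulrN sqrrN. Qed.

End SmoothStep.

Lemma continuous_at_dist {R : realType} {V : normedModType R} (f : V -> R) (x : V) :
 (forall e : R, 0 < e -> exists2 d : R, 0 < d & forall y, `|x - y| < d -> `|f x - f y| <= e) ->
 {for x, continuous f}.
Proof.
move=> H; apply/cvgrPdist_le => e e0; have [d d0 Hd] := H e e0.
by apply/nbhs_normP; exists d => // y.
Qed.

(** * Convolution with smooth kernels and mollifiers *)

Section Convolution.
Context {R : realType} {n : nat}.
Local Notation Rm := (measurableTypeR R).
Implicit Types (w : n.-tuple Rm -> R) (ka : 'rV[R]_n -> R^o).

Definition kernel_fun ka := smooth_on setT ka /\ exists2 K, compact K & forall x, ~ K x -> ka x = 0.

(** The kernel is evaluated at t - x, not x - t, so that a translate of the kernel is directly a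
    test function; the price is a minus sign when the derivative falls on the kernel. *)
Definition conv w ka (x : 'rV[R]_n) : R^o := \int[leb n]_t (w t * ka (rv t - x)).

Lemma kernel_continuous ka : kernel_fun ka -> continuous ka.
Proof. by move=> [ska _] x; exact: (Ck_continuous (ska 0%N)). Qed.

Lemma kernel_bounded ka : kernel_fun ka -> exists2 B, 0 < B & forall x, `|ka x| <= B.
Proof.
move=> kk; have [ska [K cK ka0]] := kk.
have ck := kernel_continuous kk.
have [B B0 kB] := compact_ubound cK (fun x _ => ck x).
exists B => // x; have [Kx|nKx] := pselect (K x); first exact: kB.
by rewrite ka0// normr0 ltW.
Qed.

Lemma kernel_partial ka i : kernel_fun ka -> kernel_fun (partial i ka).
Proof.
move=> [ska [K cK ka0]]; split; first by move=> k; exact: CkS.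
exists K => //; apply: partial_support => //.
by apply: compact_closed => //.
Qed.

Lemma kernelN ka : kernel_fun ka -> kernel_fun (fun x => - ka x : R^o).
Proof.
move=> [ska [K cK ka0]]; split; first by move=> k; apply: CkN => //; exact: openT.
by exists K => // x nK; rewrite ka0// oppr0.
Qed.

Lemma measurable_shift_fun (f : 'rV[R]_n -> R) x : continuous f ->
 measurable_fun setT (fun t : n.-tuple Rm => f (rv t - x)).
Proof.
move=> cf; apply: (@measurable_rv_continuous R n setT (fun y => f (y - x)) openT) => y _.
by apply: (@continuous_comp _ _ _ (fun y : 'rV[R]_n => y - x) f); [exact: continuous_addr|exact: cf].
Qed.

Lemma integrable_mul_bounded {d} {T : measurableType d} (mu : {measure set T -> \bar R})
  (w f : T -> R) (B : R) :
 L1 mu w -> measurable_fun setT f -> (forall x, `|f x| <= B) ->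
 L1 mu (fun x => w x * f x).
Proof.
move=> iw mf fB; have /measurable_EFinP mw := measurable_int _ iw.
apply: (@le_integrable _ _ _ mu setT measurableT _ (fun x => (B * `|w x|)%:E)) => //.
- by apply/measurable_EFinP; exact: measurable_funM.
- move=> x _ /=; rewrite lee_fin normrM mulrC.
 by apply: le_trans (ler_norm _); apply: ler_wpM2r.
- have := integrableZl measurableT B (integrable_norm iw); exact: eq_integrable.
Qed.

Lemma conv_integrable w (f : 'rV[R]_n -> R) B x : L1 (leb n) w ->
 continuous f -> (forall x, `|f x| <= B) ->
 L1 (leb n) (fun t => w t * f (rv t - x)).
Proof.
move=> iw cf fB; apply: (@integrable_mul_bounded _ _ _ _ (fun t => f (rv t - x)) B) => //.
exact: measurable_shift_fun.
Qed.

Lemma kernel_integrable w ka x : L1 (leb n) w ->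
 kernel_fun ka -> L1 (leb n) (fun t => w t * ka (rv t - x)).
Proof.
move=> iw kk; have [B _ kB] := kernel_bounded kk.
exact: conv_integrable iw (kernel_continuous kk) kB.
Qed.

Lemma Rintegral_norm_le {d} {T : measurableType d} (mu : {measure set T -> \bar R})
  (w f : T -> R) (e : R) :
 L1 mu w -> measurable_fun setT f -> (forall x, `|f x| <= e * `|w x|) ->
 `|\int[mu]_x f x| <= e * \int[mu]_x `|w x|.
Proof.
move=> iw mf fw; have iw' := integrable_norm iw.
have iew : L1 mu (fun x => e * `|w x|).
{ by have := integrableZl measurableT e iw'. }
have fi : L1 mu f.
{ apply: (@le_integrable _ _ _ mu setT measurableT _ _ _ _ iew) => //.
  exact/measurable_EFinP.
 by move=> x _ /=; rewrite lee_fin (le_trans (fw x))// ler_norm. }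
apply: le_trans (le_normr_Rintegral measurableT fi) _.
rewrite -RintegralZl//; apply: le_Rintegral => //; exact: integrable_norm.
Qed.

Lemma conv_continuous w ka : L1 (leb n) w -> kernel_fun ka ->
 continuous (conv w ka).
Proof.
move=> iw kk x; have [ska [K cK ka0]] := kk.
set N := \int[leb n]_t `|w t|.
have N0 : 0 <= N by apply: Rintegral_ge0.
apply: continuous_at_dist => e e0.
have e'0 : 0 < e / (N + 1) by rewrite divr_gt0// ltr_wpDl.
have [d d0 H] := compact_supp_unif_cont (kernel_continuous kk) cK ka0 e'0.
exists d => // y xy.
have i1 := kernel_integrable x iw kk; have i2 := kernel_integrable y iw kk.
rewrite -RintegralB//.
via (e / (N + 1) * N).
 apply: Rintegral_norm_le => //.
  apply: measurable_funB; apply/measurable_EFinP; [exact: measurable_int i1|exact: measurable_int i2].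
 move=> t; rewrite -mulrBr normrM mulrC; apply: ler_wpM2r => //; apply: H.
 by rewrite opprB addrC subrKA distrC.
rewrite mulrAC ler_pdivrMr ?ltr_wpDl//; apply: ler_wpM2l; first exact: ltW.
by lra.
Qed.

Lemma convN w ka x : L1 (leb n) w -> kernel_fun ka ->
 conv w (fun y => - ka y : R^o) x = - conv w ka x.
Proof.
move=> iw kk; rewrite -mulN1r -RintegralZl//; last exact: kernel_integrable.
by apply: eq_Rintegral => t _; rewrite mulN1r mulrN.
Qed.

(** Differentiation under the integral sign: the difference quotients of the kernel converge
    uniformly, and the error is multiplied by the L^1 norm of [w]. *)
Lemma conv_is_derive w ka x i : L1 (leb n) w -> kernel_fun ka ->
 is_derive x 'e_i (conv w ka) (conv w (fun y => - partial i ka y : R^o) x).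
Proof.
move=> iw kk; have [ska [K cK ka0]] := kk.
set N := \int[leb n]_t `|w t|.
have N0 : 0 <= N by apply: Rintegral_ge0.
apply: is_derive_of_bound => e e0.
have e'0 : 0 < e / (N + 1) by rewrite divr_gt0// ltr_wpDl.
have [d d0 H] := uniform_derivative i (ska 1%N) cK ka0 e'0.
exists d => // h hd.
have kp := kernel_partial i kk.
have i1 := kernel_integrable (x + h *: 'e_i) iw kk.
have i2 := kernel_integrable x iw kk.
have i3 := kernel_integrable x iw (kernelN kp).
have i4 : L1 (leb n) (fun t => h * (w t * (- partial i ka (rv t - x)))).
{ by have := integrableZl measurableT h i3. }
have i5 : L1 (leb n) (fun t => w t * ka (rv t - (x + h *: 'e_i)) - w t * ka (rv t - x)).
{ by have := integrableB measurableT i1 i2. }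
rewrite -RintegralB// -RintegralZl// -RintegralB//.
via (`|h| * (e / (N + 1)) * N).
 apply: Rintegral_norm_le => //.
  apply: measurable_funB; apply/measurable_EFinP; [exact: measurable_int i5|exact: measurable_int i4].
 move=> t; rewrite [X in `|X|](_ : _ = w t * (ka (rv t - x + (- h) *: 'e_i) - ka (rv t - x) - (- h) * partial i ka (rv t - x))).
  rewrite normrM mulrC; apply: ler_wpM2r => //; rewrite -[`|h|]normrN; apply: H.
  by rewrite normrN.
 rewrite scaleNr opprD addrA.
 ring.
rewrite -mulrA; apply: ler_wpM2l => //.
rewrite mulrAC ler_pdivrMr ?ltr_wpDl//; apply: ler_wpM2l; first exact: ltW.
by rewrite lerDl.
Qed.

Lemma conv_smooth w ka : L1 (leb n) w -> kernel_fun ka ->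
 smooth_on setT (conv w ka).
Proof.
move=> iw kk k; elim: k ka kk => [|k IH] ka kk; split => //; try by move=> x _; exact: conv_continuous.
split; first by move=> x _; have [] := conv_is_derive x i iw kk.
apply: Ck_eq (IH _ (kernelN (kernel_partial i kk))); first exact: openT.
by move=> x _; have [_ <-] := conv_is_derive x i iw kk.
Qed.

(** Evenness ensures that eta(t - x) also has integral 1 as a function of x, as the Tonelli argument
    for the L^2 contraction requires. *)
Definition mollifier (e : R) (eta : 'rV[R]_n -> R^o) :=
 [/\ kernel_fun eta, forall x, 0 <= eta x, forall x, e <= `|x| -> eta x = 0,
   forall x, eta (- x) = eta x & \int[leb n]_t eta (rv t) = 1].

Lemma compact_closed_ball (r : R) : 0 < r -> compact [set x : 'rV[R]_n | `|x| <= r].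
Proof.
move=> r0; rewrite (_ : [set x | _] = closed_ball (0 : 'rV[R]_n) r); last first.
{ by rewrite closed_ballE//; apply/seteqP; split => x; rewrite /closed_ball_ /= sub0r normrN. }
apply: bounded_closed_compact; last exact: closed_ball_closed.
exists r; split; first exact: num_real.
move=> y ry x; rewrite closed_ballE// /closed_ball_ /= sub0r normrN => xr.
by lra.
Qed.

Lemma mollifier_exists (e : R) : 0 < e -> exists eta, mollifier e eta.
Proof.
move=> e0; have e20 : 0 < e / 2 by rewrite divr_gt0.
pose b : 'rV[R]_n -> R^o := bump 0 (e / 2).
have b0 x : e <= `|x| -> b x = 0.
{ by move=> ex; apply: bump0 => //; rewrite subr0 mulrC divfK. }
have cb : continuous b by move=> x; exact: (Ck_continuous (Ck_bump 0 0 (e / 2))).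
have cK := compact_closed_ball e0.
have b0' x : ~ `|x| <= e -> b x = 0 by move/negP; rewrite -ltNge => /ltW /b0.
have ib := compact_supp_integrable cb cK b0'.
set Z := \int[leb n]_t b (rv t).
(* On the cube [C'] with corner 0 and side e/2 the bump equals 1, so Z is at least (e/2)^n. *)
have Z0 : 0 < Z.
{ pose C : set (n.-tuple Rm) := rv @^-1` cube (const_mx (- (e / 2))) e.
 pose C' : set (n.-tuple Rm) := rv @^-1` cube 0 (e / 2).
 have mC' : measurable C' by exact: measurable_cube.
 have LC : leb n C' = ((e / 2) ^+ n)%:E by apply: leb_cube; exact: ltW.
 have I : (e / 2) ^+ n = \int[leb n]_t \1_C' t.
 { transitivity (fine (leb n C')); first by rewrite LC.
  by rewrite /Rintegral integral_indic// setIT. }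
 apply: (@lt_le_trans _ _ ((e / 2) ^+ n)); first by rewrite exprn_gt0.
 rewrite I; apply: le_Rintegral => //.
  apply: (@bounded_integrable R _ _ (leb n) (\1_C') setT C' 1) => //.
  - by have := ltry ((e / 2) ^+ n); rewrite -LC.
  - by move=> t _ nC; rewrite indicE memNset.
  - by move=> t _; rewrite indicE; case: (_ \in _); rewrite ?normr1 ?normr0.
 move=> t _; rewrite indicE; have [Ct|nCt] := pselect (C' t).
  rewrite mem_set// /b bump1// subr0; apply: norm_coord_le; first exact: ltW.
  by move=> i; have := Ct i; rewrite !mxE add0r => /andP[t0 te]; rewrite ger0_norm// ltW.
 by rewrite memNset// bump_ge0. }
exists (fun x => Z^-1 * b x); split.
- split.
  move=> k; apply: (CkM openT (Ck_cst k (Z^-1 : R^o) openT)); exact: Ck_bump.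
 by exists [set x : 'rV[R]_n | `|x| <= e] => // x nx; rewrite b0'// mulr0.
- by move=> x; rewrite mulr_ge0 ?invr_ge0 ?(ltW Z0)// bump_ge0.
- by move=> x /b0 ->; rewrite mulr0.
- by move=> x; rewrite /b bump_even.
- by rewrite RintegralZl// -/Z mulVf// gt_eqF.
Qed.

End Convolution.

(** * Geometry in charts *)

Section DeterminantDerivative.
Context {R : realType}.

Lemma is_derive_prod {V : normedModType R} (I : eqType) (s : seq I) (f : I -> V -> R^o) (df : I -> R) (x v : V) :
 uniq s -> (forall i, i \in s -> is_derive x v (f i) (df i)) ->
 is_derive x v (fun y => \prod_(i <- s) f i y : R^o)
   (\sum_(i <- s) df i * \prod_(j <- s | j != i) f j x).
Proof.
elim: s => [|i s IH] /= us Df.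
 rewrite big_nil (_ : (fun y => _) = cst (1 : R^o)); first exact: is_derive_cst.
 by apply/funext => y; rewrite big_nil.
case/andP: us => si us.
have D1 := Df i (mem_head _ _).
have D2 := IH us (fun j js => Df j (ltac:(by rewrite inE js orbT))).
rewrite (_ : (fun y => _) = (fun y => f i y * \prod_(i0 <- s) f i0 y)); last first.
{ by apply/funext => y; rewrite big_cons. }
apply: is_derive_eq (is_deriveM D1 D2) _.
rewrite big_cons big_cons eqxx addrC /GRing.scale /=; congr (_ + _).
 rewrite mulrC; congr (_ * _); rewrite big_seq_cond [RHS]big_seq_cond.
 apply: eq_bigl => j; case js : (j \in s) => //=.
 by have [ji|//] := eqVneq j i; move: si; rewrite -ji js.
rewrite mulr_sumr; apply: eq_big_seq => j js.
rewrite big_cons (_ : i != j); last by apply/eqP => ij; move: si; rewrite ij js.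
by lra.
Qed.

(** In the Leibniz expansion, the terms where the factor of row i is differentiated form the
    determinant of the matrix whose row i is replaced by that of [dA]; expansion along that row
    produces the cofactors. *)
Lemma is_derive_det {V : normedModType R} {m : nat} (A : V -> 'M[R]_m) (dA : 'M[R]_m) (x v : V) :
 (forall i j, is_derive x v (fun y => A y i j : R^o) (dA i j)) ->
 is_derive x v (fun y => \det (A y) : R^o) (\sum_i \sum_j dA i j * cofactor (A x) i j).
Proof.
move=> DA.
have Dp (s : 'S_m) : is_derive x v (fun y => (-1) ^+ s * \prod_i A y i (s i) : R^o)
 ((-1) ^+ s * \sum_i dA i (s i) * \prod_(j | j != i) A x j (s j)).
{ have := @is_derive_prod V _ (index_enum 'I_m) (fun i y => A y i (s i)) (fun i => dA i (s i)) x v (index_enum_uniq _) (fun i _ => DA i (s i)).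
 move=> D; apply: is_derive_eq (is_deriveM (is_derive_cst ((-1) ^+ s : R^o) x v) D) _.
 by rewrite /GRing.scale /= mulr0 addr0. }
pose F (s : 'S_m) := fun y => (-1) ^+ s * \prod_i A y i (s i) : R^o.
have D (l : seq 'S_m) : is_derive x v (fun y => \sum_(s <- l) F s y : R^o)
  (\sum_(s <- l) (-1) ^+ s * \sum_i dA i (s i) * \prod_(j | j != i) A x j (s j)).
{ elim: l => [|s l IH].
  rewrite big_nil (_ : (fun y => _) = cst (0 : R^o)); first exact: is_derive_cst.
  by apply/funext => y; rewrite big_nil.
 rewrite big_cons (_ : (fun y => _) = (fun y => F s y + \sum_(s <- l) F s y)); last first.
 { by apply/funext => y; rewrite big_cons. }
 exact: is_deriveD. }
apply: is_derive_eq (D _) _.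
under eq_bigr do rewrite mulr_sumr.
rewrite exchange_big; apply: eq_bigr => i _.
pose B : 'M[R]_m := \matrix_(k, l) (if k == i then dA i l else A x k l).
have EB : \det B = \sum_j dA i j * cofactor (A x) i j.
{ rewrite (expand_det_row B i); apply: eq_bigr => j _; rewrite mxE eqxx; congr (_ * _).
 congr (_ * \det _); apply/matrixP => k l; rewrite !mxE.
 by rewrite [lift i k == i]eq_sym (negbTE (neq_lift _ _)). }
rewrite -EB; apply: eq_bigr => s _; congr (_ * _).
rewrite [RHS](bigD1 i)//= mxE eqxx; congr (_ * _).
by apply: eq_bigr => j ji; rewrite mxE (negbTE ji).
Qed.

(** Jacobi's formula: cofactors are determinant times inverse. *)
Lemma is_derive_det_unit {V : normedModType R} {m : nat} (A : V -> 'M[R]_m) (dA : 'M[R]_m) (x v : V) :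
 (forall i j, is_derive x v (fun y => A y i j : R^o) (dA i j)) -> A x \in unitmx ->
 is_derive x v (fun y => \det (A y) : R^o) (\det (A x) * \sum_i \sum_j dA i j * invmx (A x) j i).
Proof.
move=> DA uA; apply: is_derive_eq (is_derive_det DA) _.
rewrite mulr_sumr; apply: eq_bigr => i _; rewrite mulr_sumr; apply: eq_bigr => j _.
rewrite /invmx uA !mxE [RHS]mulrA [_ * dA i j]mulrC -mulrA mulVKf//.
by move: uA; rewrite unitmxE unitfE.
Qed.

Lemma invmx_deriv {m : nat} (h g dh dg : 'M[R]_m) : h *m g = 1%:M -> dh *m g + h *m dg = 0 ->
 dh = - (h *m dg *m h).
Proof.
move=> hg E; have gh := mulmx1C hg.
have : (dh *m g + h *m dg) *m h = 0 by rewrite E mul0mx.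
by rewrite mulmxDl -mulmxA gh mulmx1 => /eqP; rewrite addr_eq0 => /eqP.
Qed.

End DeterminantDerivative.

(** * The induced metric in a chart and harmonicity of the coordinates *)

Section ChartGeometry.
Context {R : realType} {n : nat} {M : ptopologicalType}.
Variables (iota : M -> 'rV[R]_n.+1) (c : chart R n M).
Hypothesis sF : smooth_on (cimg c) (iota \o cinv c).
Hypothesis freeT : forall x, cimg c x -> row_free (tangent_mx iota c x).

Let F := iota \o cinv c.
Let oU := @open_cimg _ _ _ c.
Local Notation T := (tangent_mx iota c).
Local Notation g := (metric_mx iota c).
Local Notation h := (fun x => invmx (metric_mx iota c x)).

Lemma Ck_F k j : Ck k (cimg c) (fun x => F x 0 j : R^o).
Proof. exact: Ck_row oU (sF k). Qed.

Lemma tangentE x i j : cimg c x -> T x i j = partial i (fun x => F x 0 j : R^o) x.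
Proof. by move=> Ux; rewrite mxE partial_row//; exact: (Ck_derivable (sF 1%N) Ux). Qed.

Lemma Ck_tangent k i j : Ck k (cimg c) (fun x => T x i j : R^o).
Proof.
apply: Ck_eq (CkS i (Ck_F k.+1 j)); first exact: oU.
by move=> x Ux; rewrite tangentE.
Qed.

Lemma Ck_metric k i j : Ck k (cimg c) (fun x => g x i j : R^o).
Proof.
have := @Ck_sum R n _ (index_enum 'I_n.+1) predT k _ (fun a x => T x i a * T x j a) oU
 (fun a _ => CkM oU (Ck_tangent k i a) (Ck_tangent k j a)).
apply: Ck_eq; first exact: oU.
by move=> x Ux; rewrite [RHS]mxE; apply: eq_bigr => a _; rewrite [X in _ = _ * X]mxE.
Qed.

Lemma metric_sym x : (g x)^T = g x.
Proof. by rewrite trmx_mul trmxK. Qed.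

Lemma dotv_ge0 {m} (v : 'rV[R]_m) : 0 <= dotv v v.
Proof. by apply: sumr_ge0 => i _; rewrite sqr_ge0. Qed.

Lemma dotv_eq0 {m} (v : 'rV[R]_m) : (dotv v v == 0) = (v == 0).
Proof.
apply/idP/eqP => [|->]; last by rewrite /dotv big1// => i _; rewrite mxE mul0r.
rewrite psumr_eq0; last by move=> i _; rewrite sqr_ge0.
move/allP => H; apply/rowP => i; rewrite mxE.
by have := H i (mem_index_enum _); rewrite mulf_eq0 => /orP[] /eqP.
Qed.

Lemma dotvE {m} (u v : 'rV[R]_m) : dotv u v = (u *m v^T) 0 0.
Proof. by rewrite mxE; apply: eq_bigr => i _; rewrite mxE. Qed.

Lemma metric_quad (v : 'rV[R]_n) x : (v *m g x *m v^T) 0 0 = dotv (v *m T x) (v *m T x).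
Proof. by rewrite dotvE trmx_mul !mulmxA. Qed.

(** A vector v in the kernel of the Gram matrix satisfies |v T|^2 = 0, and the rows of T are
    independent. *)
Lemma metric_unit x : cimg c x -> g x \in unitmx.
Proof.
move=> Ux; rewrite -row_free_unit -kermx_eq0; apply/eqP/row_matrixP => i.
rewrite row0; set v := row i _.
have vg : v *m g x = 0 by apply/eqP; rewrite -sub_kermx; exact: row_sub.
have : dotv (v *m T x) (v *m T x) == 0 by rewrite -metric_quad vg mul0mx mxE.
rewrite dotv_eq0 => /eqP vT; apply: (row_free_inj (freeT Ux)).
by rewrite mul0mx.
Qed.

Lemma det_metric_pos_aux x (t : R) : cimg c x -> 0 <= t <= 1 -> \det (t *: g x + (1 - t) *: 1%:M) != 0.
Proof.
move=> Ux /andP[t0 t1].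
have : (t *: g x + (1 - t) *: 1%:M) \in unitmx.
 rewrite -row_free_unit -kermx_eq0; apply/eqP/row_matrixP => i.
 rewrite row0; set v := row i _.
 have vg : v *m (t *: g x + (1 - t) *: 1%:M) = 0 by apply/eqP; rewrite -sub_kermx; exact: row_sub.
 have H : t * dotv (v *m T x) (v *m T x) + (1 - t) * dotv v v = 0.
 { have : (v *m (t *: g x + (1 - t) *: 1%:M) *m v^T) 0 0 = 0 by rewrite vg mul0mx mxE.
  by rewrite mulmxDr mulmxDl -!scalemxAr -!scalemxAl mulmx1 mxE [X in X + _]mxE [X in _ + X]mxE metric_quad -dotvE. }
 have H1 : 0 <= t * dotv (v *m T x) (v *m T x) by rewrite mulr_ge0 ?dotv_ge0.
 have H2 : 0 <= (1 - t) * dotv v v by rewrite mulr_ge0 ?dotv_ge0 ?subr_ge0.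
 have /eqP := H; rewrite paddr_eq0// !mulf_eq0 => /andP[].
 case/orP => [/eqP t00|].
  rewrite t00 subr0 oner_eq0/= dotv_eq0 => /eqP -> //.
 rewrite dotv_eq0 => /eqP vT _; apply: (row_free_inj (freeT Ux)).
 by rewrite mul0mx.
by rewrite unitmxE unitfE.
Qed.

(* The determinant does not vanish on the segment from the identity to g. *)
Lemma det_metric_gt0 x : cimg c x -> 0 < \det (g x).
Proof.
move=> Ux; pose f := fun t : R => \det (t *: g x + (1 - t) *: 1%:M).
have cf : continuous f.
{ move=> t.
 have D : is_derive t (1 : R) (f : R -> R^o) (\sum_i \sum_j (g x - 1%:M) i j * cofactor (t *: g x + (1 - t) *: 1%:M) i j).
 { apply: (@is_derive_det R R^o n (fun t => t *: g x + (1 - t) *: 1%:M)) => i j.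
  rewrite (_ : (fun y : R => _) = (fun y : R => (1%:M : 'M[R]_n) i j + y *: ((g x - 1%:M) i j : R^o))); last first.
  { apply/funext => y; rewrite !mxE; rewrite /GRing.scale /=; ring. }
  have := @is_derive_line R R^o R^o id ((1%:M : 'M[R]_n) i j) ((g x - 1%:M) i j) t (ltac:(exact: derivable_id)).
  by rewrite derive_id. }
 by apply: differentiable_continuous; apply/derivable1_diffP. }
have f0 : f 0 = 1 by rewrite /f scale0r add0r subr0 scale1r det1.
have f1 : f 1 = \det (g x) by rewrite /f subrr scale0r addr0 scale1r.
rewrite -f1 ltNge; apply/negP => f10.
have [|t] := @IVT R f 0 1 0 ler01 (continuous_subspaceT cf).
 by rewrite ge_min f10 orbT/= le_max f0 ler01.
rewrite /= => t01 ft; have := det_metric_pos_aux Ux t01.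
by rewrite -/(f t) ft eqxx.
Qed.

Definition vol x : R := Num.sqrt (\det (g x)).

Lemma vol_gt0 x : cimg c x -> 0 < vol x.
Proof. by move=> Ux; rewrite sqrtr_gt0 det_metric_gt0. Qed.

Lemma Ck_det_of {k m} (A : 'rV[R]_n -> 'M[R]_m) :
 (forall i j, Ck k (cimg c) (fun x => A x i j : R^o)) -> Ck k (cimg c) (fun x => \det (A x) : R^o).
Proof.
move=> CA; have := @Ck_sum R n _ (index_enum {perm 'I_m}) predT k _
 (fun s x => (-1) ^+ s * \prod_i A x i (s i)) oU.
apply => s _; apply: (CkM oU (Ck_cst k ((-1) ^+ s : R^o) oU)).
by apply: (@Ck_prod R n _ (index_enum 'I_m) predT k _ (fun i x => A x i (s i)) oU).
Qed.

Lemma Ck_detg k : Ck k (cimg c) (fun x => \det (g x) : R^o).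
Proof. by apply: Ck_det_of => i j; exact: Ck_metric. Qed.

Lemma Ck_sqrt k (f : 'rV[R]_n -> R^o) : (forall x, cimg c x -> 0 < f x) ->
 Ck k (cimg c) f -> Ck k (cimg c) (fun x => Num.sqrt (f x) : R^o).
Proof.
move=> f0 Cf.
have cs x : cimg c x -> {for x, continuous f} -> {for x, continuous (fun x => Num.sqrt (f x) : R^o)}.
{ move=> Ux cfx; apply: (@continuous_comp _ _ _ f (@Num.sqrt R)) => //; exact: sqrt_continuous. }
elim: k Cf => [|k IH] Cf; have [cf df] := Cf; split => //; try by move=> x Ux; apply: cs => //; exact: cf.
have D x i : cimg c x -> is_derive x 'e_i (fun x => Num.sqrt (f x) : R^o)
  ((2 * Num.sqrt (f x))^-1 * partial i f x).
{ move=> Ux; have df1 := Ck_derivable Cf Ux.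
 have D1 : is_derive (0 : R) (1 : R) (fun t : R => f (x + t *: 'e_i) : R) (partial i f x).
 { have := @is_derive_line R _ _ f x 'e_i 0; rewrite scale0r addr0; apply; exact: df1. }
 have fx0 : 0 < f (x + 0 *: 'e_i) by rewrite scale0r addr0; exact: f0.
 have D2 := is_derive1_comp (is_derive1_sqrt fx0) D1.
 split; first by apply: derivable_line.
 by rewrite -derive_line; case: D2 => _; rewrite scale0r addr0. }
split; first by move=> x Ux; case: (D x i Ux).
have s0 x : cimg c x -> 2 * Num.sqrt (f x) != 0.
{ by move=> Ux; rewrite gt_eqF// mulr_gt0// sqrtr_gt0 f0. }
apply: Ck_eq (CkM oU (CkV oU s0 (CkM oU (Ck_cst k (2 : R^o) oU) (IH (Ck_pred Cf)))) (CkS i Cf)); first exact: oU.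
by move=> x Ux; rewrite /partial; case: (D x i Ux) => _ ->.
Qed.

Lemma Ck_vol k : Ck k (cimg c) (vol : _ -> R^o).
Proof. by apply: Ck_sqrt => //; [exact: det_metric_gt0|exact: Ck_detg]. Qed.

(** Cramer's rule writes the entries of the inverse as cofactors over the determinant, all of them
    C^k. *)
Lemma Ck_invmetric k i j : Ck k (cimg c) (fun x => h x i j : R^o).
Proof.
have C1 : Ck k (cimg c) (fun x => cofactor (g x) j i : R^o).
{ apply: (CkM oU (Ck_cst k ((-1) ^+ (j + i) : R^o) oU)).
 apply: Ck_det_of => a b; apply: Ck_eq (Ck_metric k (lift j a) (lift i b)); first exact: oU.
 by move=> x _; rewrite !mxE. }
have d0 x : cimg c x -> \det (g x) != 0 by move=> Ux; rewrite gt_eqF// det_metric_gt0.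
apply: Ck_eq (CkM oU (CkV oU d0 (Ck_detg k)) C1); first exact: oU.
by move=> x Ux; rewrite /invmx metric_unit// !mxE.
Qed.

Definition hess x (i j : 'I_n) (a : 'I_n.+1) : R := partial i (fun y => T y j a : R^o) x.

Lemma hess_sym x i j a : cimg c x -> hess x i j a = hess x j i a.
Proof.
move=> Ux; rewrite /hess.
have E k l : partial k (fun y => T y l a : R^o) x = partial k (partial l (fun y => F y 0 a : R^o)) x.
{ have H y (Uy : cimg c y) : T y l a = partial l (fun y => F y 0 a : R^o) y by rewrite tangentE.
 exact: (@partial_eq_open R n R^o (cimg c) _ _ k x oU H Ux). }
rewrite (E i j) (E j i).
exact: (@partial_comm R n (cimg c) (fun y => F y 0 a : R^o) i j x oU (Ck_F 2 a) Ux).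
Qed.

(** Christoffel symbols of the first kind: the product of d_i d_k F with d_l F. *)
Definition Gam x i k l : R := \sum_a hess x i k a * T x l a.

Lemma is_derive_tangent x i j a : cimg c x ->
 is_derive x 'e_i (fun y => T y j a : R^o) (hess x i j a).
Proof. by move=> Ux; apply: derivableP; exact: (Ck_derivable (Ck_tangent 1 j a) Ux). Qed.

Lemma is_derive_bigsum {V : normedModType R} (I : Type) (s : seq I) (f : I -> V -> R^o) (df : I -> R) (x v : V) :
 (forall i, is_derive x v (f i) (df i)) ->
 is_derive x v (fun y => \sum_(i <- s) f i y : R^o) (\sum_(i <- s) df i).
Proof.
move=> Df; elim: s => [|i s IH].
 rewrite big_nil (_ : (fun y => _) = cst (0 : R^o)); first exact: is_derive_cst.
 by apply/funext => y; rewrite big_nil.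
rewrite big_cons (_ : (fun y => _) = (fun y => f i y + \sum_(j <- s) f j y)); last first.
{ by apply/funext => y; rewrite big_cons. }
exact: is_deriveD.
Qed.

Lemma is_derive_metric x i k l : cimg c x ->
 is_derive x 'e_i (fun y => g y k l : R^o) (Gam x i k l + Gam x i l k).
Proof.
move=> Ux.
rewrite (_ : (fun y => _) = (fun y => \sum_a T y k a * T y l a)); last first.
{ by apply/funext => y; rewrite mxE; apply: eq_bigr => a _; rewrite [X in _ * X]mxE. }
rewrite -big_split; apply: is_derive_bigsum => a.
apply: is_derive_eq (is_deriveM (is_derive_tangent i k a Ux) (is_derive_tangent i l a Ux)) _.
by rewrite [LHS]addrC; congr (_ + _); exact: mulrC.
Qed.

Definition dmetric x i : 'M[R]_n := \matrix_(k, l) (Gam x i k l + Gam x i l k).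

Lemma half_sqrt_logderiv (d z : R) : 0 < d -> (2 * Num.sqrt d)^-1 * (d * z) = Num.sqrt d * (2^-1 * z).
Proof.
move=> d0; have s0 : Num.sqrt d != 0 by rewrite gt_eqF// sqrtr_gt0.
by rewrite -{2}[d](sqr_sqrtr (ltW d0)); field.
Qed.

Lemma is_derive_vol x i : cimg c x ->
 is_derive x 'e_i (vol : _ -> R^o)
  (vol x * (2^-1 * \sum_k \sum_l dmetric x i k l * h x l k)).
Proof.
move=> Ux; have d0 := det_metric_gt0 Ux.
have D1 : is_derive x 'e_i (fun y => \det (g y) : R^o)
  (\det (g x) * \sum_k \sum_l dmetric x i k l * h x l k).
{ apply: is_derive_det_unit; last exact: metric_unit.
 by move=> k l; rewrite mxE; exact: is_derive_metric. }
have D2 : is_derive (0 : R) (1 : R) (fun t : R => \det (g (x + t *: 'e_i)) : R)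
  (\det (g x) * \sum_k \sum_l dmetric x i k l * h x l k).
{ case: D1 => D1 E1; have := @is_derive_line R _ _ (fun y => \det (g y) : R^o) x 'e_i 0.
 by rewrite scale0r addr0 E1; apply. }
have fx0 : 0 < \det (g (x + 0 *: 'e_i)) by rewrite scale0r addr0.
have D3 := is_derive1_comp (is_derive1_sqrt fx0) D2.
have E : (2 * Num.sqrt (\det (g (x + 0 *: 'e_i))))^-1 * (\det (g x) * \sum_k \sum_l dmetric x i k l * h x l k) =
 vol x * (2^-1 * \sum_k \sum_l dmetric x i k l * h x l k).
{ by rewrite scale0r addr0; exact: half_sqrt_logderiv. }
rewrite -E; split; first by apply: derivable_line.
by rewrite -derive_line; case: D3.
Qed.

Lemma is_derive_invmetric x i j k : cimg c x ->
 is_derive x 'e_i (fun y => h y j k : R^o) (- (h x *m dmetric x i *m h x) j k).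
Proof.
move=> Ux; pose dh : 'M[R]_n := \matrix_(j, k) partial i (fun y => h y j k : R^o) x.
have Dh a b : is_derive x 'e_i (fun y => h y a b : R^o) (dh a b).
{ by rewrite mxE; apply: derivableP; exact: (Ck_derivable (Ck_invmetric 1 a b) Ux). }
suff E : dh = - (h x *m dmetric x i *m h x).
{ by have := Dh j k; rewrite E mxE. }
apply: (@invmx_deriv _ _ _ (g x)); first by rewrite mulVmx// metric_unit.
apply/matrixP => a b; rewrite [RHS]mxE.
have D : is_derive x 'e_i (fun y => \sum_l h y a l * g y l b : R^o)
  (\sum_l (h x a l * dmetric x i l b + g x l b * dh a l)).
{ apply: is_derive_bigsum => l; have := is_derive_metric i l b Ux.
 rewrite -[Gam _ _ _ _ + _](mxE matrix_key (fun l b => Gam x i l b + Gam x i b l)) => Dg.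
 exact: (is_deriveM (Dh a l) Dg). }
have C0 : 'D_'e_i (fun y => \sum_l h y a l * g y l b : R^o) x = 0.
{ rewrite (@near_eq_derive _ _ _ _ (cst ((1%:M : 'M[R]_n) a b : R^o))) ?derive_cst//.
 have := @near_eq_open R n R^o _ (fun y => \sum_l h y a l * g y l b) (cst ((1%:M : 'M[R]_n) a b)) x oU.
 apply => // y Uy; rewrite -(mulVmx (metric_unit Uy)) mxE; by []. }
case: D => _; rewrite C0 => E; rewrite [RHS]E [LHS]mxE [X in X + _]mxE [X in _ + X]mxE -big_split.
by apply: eq_bigr => l _; rewrite addrC [g x l b * _]mulrC.
Qed.

Lemma invmetric_sym x i j : h x i j = h x j i.
Proof.
have E : (h x)^T = h x by rewrite trmx_inv metric_sym.
by rewrite -[in LHS]E mxE.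
Qed.

(** The index algebra behind the contracted Christoffel identity. By symmetry the halved trace in
    the first sum (derivative of the volume density) is the trace of [G i j l]; the first sum then
    equals the [G i l j] half of the second (derivative of the inverse metric), and the third
    cancels the other half. *)
Lemma christoffel_sum (G : 'I_n -> 'I_n -> 'I_n -> R) (k : 'I_n -> 'I_n -> R) m :
 (forall i j l, G i j l = G j i l) -> (forall i j, k i j = k j i) ->
 (\sum_i (2^-1 * \sum_j \sum_l (G i j l + G i l j) * k l j) * k i m) -
 (\sum_i \sum_j \sum_l k i j * (G i j l + G i l j) * k l m) +
 (\sum_i \sum_j \sum_l k i j * G i j l * k l m) = 0.
Proof.
move=> Gs ks.
have E1 i : 2^-1 * \sum_j \sum_l (G i j l + G i l j) * k l j = \sum_j \sum_l G i j l * k j l.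
{ have -> : \sum_j \sum_l (G i j l + G i l j) * k l j =
  \sum_j \sum_l G i j l * k j l + \sum_j \sum_l G i j l * k j l.
 { rewrite [X in _ + X]exchange_big -big_split; apply: eq_bigr => j _.
  rewrite -big_split; apply: eq_bigr => l _; by rewrite mulrDl (ks l j). }
 by lra. }
have E2 : \sum_i \sum_j \sum_l k i j * (G i j l + G i l j) * k l m =
 (\sum_i \sum_j \sum_l k i j * G i j l * k l m) + \sum_i \sum_j \sum_l k i j * G i l j * k l m.
{ rewrite -big_split; apply: eq_bigr => i _; rewrite -big_split; apply: eq_bigr => j _.
 by rewrite -big_split; apply: eq_bigr => l _; rewrite mulrDr mulrDl. }
have HA : \sum_i (2^-1 * \sum_j \sum_l (G i j l + G i l j) * k l j) * k i m =
 \sum_i \sum_j \sum_l k i j * G i l j * k l m.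
{ under eq_bigr => i _ do rewrite E1 mulr_suml.
 under eq_bigr => i _ do under eq_bigr => j _ do rewrite mulr_suml.
 rewrite exchange_big; apply: eq_bigr => i _.
 rewrite exchange_big; apply: eq_bigr => j _.
 by apply: eq_bigr => l _; rewrite (Gs l i j) [k i j * _]mulrC. }
by lra.
Qed.

(** The i-th component of sqrt(det g) times the gradient of the coordinate function F^a; its
    coordinate divergence is sqrt(det g) times the Laplacian of F^a. *)
Definition flux i a x : R := vol x * \sum_j h x i j * T x j a.

Lemma Ck_flux k i a : Ck k (cimg c) (flux i a : _ -> R^o).
Proof.
apply: (CkM oU (Ck_vol k)).
exact: (@Ck_sum R n _ (index_enum 'I_n) predT k _ (fun j x => h x i j * T x j a) oU
 (fun j _ => CkM oU (Ck_invmetric k i j) (Ck_tangent k j a))).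
Qed.

(** Minimality says that the metric trace of the normal part of the second derivatives vanishes, so
    the traced second derivatives equal their own tangential projection. *)
Lemma minimal_hess x a : cimg c x -> mean_curvature iota c x = 0 ->
 \sum_i \sum_j h x i j * hess x i j a =
 \sum_m (\sum_i \sum_j \sum_l h x i j * Gam x i j l * h x l m) * T x m a.
Proof.
move=> Ux H0.
have HE i j b : partial i (partial j F) x 0 b = hess x i j b.
{ rewrite partial_row; last exact: (Ck_derivable (CkS j (sF 2%N)) Ux).
 have H y (Uy : cimg c y) : partial j F y 0 b = T y j b by rewrite [RHS]mxE.
 exact: (@partial_eq_open R n R^o (cimg c) _ _ i x oU H Ux). }
have E i j : sff iota c x i j 0 a = hess x i j a - \sum_m (\sum_l Gam x i j l * h x l m) * T x m a.
{ rewrite mxE [X in _ + X]mxE HE; congr (_ - _).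
 rewrite mxE; apply: eq_bigr => m _; congr (_ * _).
 rewrite mxE; apply: eq_bigr => l _; congr (_ * _).
 by rewrite mxE; apply: eq_bigr => b _; rewrite HE mxE. }
have : mean_curvature iota c x 0 a = 0 by rewrite H0 mxE.
rewrite summxE.
under eq_bigr => i _.
 rewrite summxE.
 under eq_bigr => j _ do rewrite mxE E mulrBr.
 rewrite sumrB.
over.
rewrite sumrB => /eqP; rewrite subr_eq0 => /eqP ->.
under [RHS]eq_bigr => m _.
 rewrite mulr_suml.
 under eq_bigr => i _ do rewrite mulr_suml.
over.
rewrite [RHS]exchange_big; apply: eq_bigr => i _.
rewrite [RHS]exchange_big; apply: eq_bigr => j _.
rewrite mulr_sumr; apply: eq_bigr => m _.
rewrite mulrA; congr (_ * _); rewrite mulr_sumr; apply: eq_bigr => l _.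
by lra.
Qed.

Lemma Ck_zero_ext k (f : 'rV[R]_n -> R^o) (K : set 'rV[R]_n) : compact K -> K `<=` cimg c ->
 (forall x, cimg c x -> ~ K x -> f x = 0) -> Ck k (cimg c) f -> Ck k setT (f \_ (cimg c) : _ -> R^o).
Proof.
move=> cK KU f0 Cf.
have clK : closed K by apply: compact_closed => //.
apply: (@Ck_sub _ _ _ k (cimg c `|` ~` K)).
 by move=> x _; have [Kx|nKx] := pselect (K x); [left; exact: KU|right].
apply: CkU.
 by apply: Ck_eq Cf; [exact: oU|move=> x Ux; rewrite patchE mem_set].
apply: Ck_eq (Ck_cst k (0 : R^o) (closed_openC clK)); first exact: closed_openC.
move=> x nKx; rewrite patchE; case: ifPn => // /set_mem Ux; by rewrite f0.
Qed.

(** The coordinate functions of a minimal immersion are harmonic. By [minimal_hess] all terms become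
    multiples of the tangent vectors d_m F, and the coefficient of each vanishes by
    [christoffel_sum]. *)
Lemma div_flux_eq0 x a : cimg c x -> mean_curvature iota c x = 0 ->
 \sum_i partial i (flux i a : _ -> R^o) x = 0.
Proof.
move=> Ux H0.
have Di i : partial i (flux i a : _ -> R^o) x =
 vol x * (\sum_m ((2^-1 * \sum_k \sum_l dmetric x i k l * h x l k) * h x i m - (h x *m dmetric x i *m h x) i m) * T x m a
  + \sum_j h x i j * hess x i j a).
{ have D1 : is_derive x 'e_i (fun y => \sum_j h y i j * T y j a : R^o)
  (\sum_j (h x i j * hess x i j a + T x j a * - (h x *m dmetric x i *m h x) i j)).
 { apply: is_derive_bigsum => j.
  exact: (is_deriveM (is_derive_invmetric i i j Ux) (is_derive_tangent i j a Ux)). }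
 have [_ D2] := is_deriveM (is_derive_vol i Ux) D1.
 rewrite /partial /flux [LHS]D2 /GRing.scale /= big_split /= [RHS]mulrDr.
 rewrite mulrDr -addrA addrC; congr (_ + _).
 rewrite [X in _ + X = _]mulrC -mulrA -mulrDr; congr (_ * _).
 rewrite mulr_sumr -big_split /=; apply: eq_bigr => m _; ring. }
under eq_bigr => i _ do rewrite Di.
rewrite -mulr_sumr big_split /= minimal_hess// exchange_big /= -big_split /= big1 ?mulr0// => m _.
rewrite -mulr_suml -mulrDl.
suff -> : \sum_i ((2^-1 * \sum_k \sum_l dmetric x i k l * h x l k) * h x i m - (h x *m dmetric x i *m h x) i m) +
  \sum_i \sum_j \sum_l h x i j * Gam x i j l * h x l m = 0 by rewrite mul0r.
rewrite sumrB -[RHS](@christoffel_sum (Gam x) (h x) m); last 2 first.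
- by move=> i j l; apply: eq_bigr => b _; rewrite hess_sym.
- exact: invmetric_sym.
congr (_ - _ + _); apply: eq_bigr => i _.
 congr (_ * _ * _); apply: eq_bigr => k _; apply: eq_bigr => l _; by rewrite mxE.
rewrite mxE; under eq_bigr => l _ do rewrite mxE mulr_suml.
rewrite exchange_big; apply: eq_bigr => j _; apply: eq_bigr => l _.
by rewrite mxE.
Qed.

(** The divergence of psi times the flux integrates to zero because psi has compact support, and the
    part in which the flux is differentiated vanishes by harmonicity. *)
Lemma chart_first_variation (psi : 'rV[R]_n -> R^o) (K : set 'rV[R]_n) a :
 (forall x, cimg c x -> mean_curvature iota c x = 0) ->
 Ck 1 (cimg c) psi -> compact K -> K `<=` cimg c -> (forall x, cimg c x -> ~ K x -> psi x = 0) ->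
 \int[leb n]_(t in rv @^-1` cimg c) (\sum_i partial i psi (rv t) * flux i a (rv t)) = 0.
Proof.
move=> H0 Cpsi cK KU psi0.
have clK : closed K by apply: compact_closed => //; exact: norm_hausdorff.
pose Z i : 'rV[R]_n -> R^o := (psi \* flux i a) \_ (cimg c).
have Z0 i x : cimg c x -> ~ K x -> (psi \* flux i a) x = 0 by move=> Ux nKx; rewrite /= psi0// mul0r.
have CZ i : Ck 1 setT (Z i).
{ exact: Ck_zero_ext cK KU (Z0 i) (CkM oU Cpsi (Ck_flux 1 i a)). }
have ZK i x : ~ K x -> Z i x = 0.
{ by move=> nKx; rewrite /Z patchE; case: ifPn => // /set_mem Ux; exact: Z0. }
have IZ i : \int[leb n]_t partial i (Z i) (rv t) = 0 by exact: Rintegral_partial (CZ i) cK (ZK i).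
have intZ i : (leb n).-integrable setT (fun t => (partial i (Z i) (rv t))%:E).
{ apply: (compact_supp_integrable (K := K)) => //.
  by move=> x; exact: (Ck_continuous (CkS i (CZ i))).
 exact: (partial_support i clK (ZK i)). }
have sumI (s : seq 'I_n) : \int[leb n]_t (\sum_(i <- s) partial i (Z i) (rv t)) = 0 /\
  (leb n).-integrable setT (fun t => (\sum_(i <- s) partial i (Z i) (rv t))%:E).
{ elim: s => [|i s [IH1 IH2]].
  split.
   by rewrite (@eq_Rintegral _ _ _ _ _ (fun=> 0)) ?Rintegral_cst ?mul0r// => t _; rewrite big_nil.
  by apply: eq_integrable (integrable0 _ _) => // t _; rewrite big_nil.
 have E t : \sum_(i <- i :: s) partial i (Z i) (rv t) = partial i (Z i) (rv t) + \sum_(i <- s) partial i (Z i) (rv t).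
 { by rewrite big_cons. }
 split.
  rewrite (@eq_Rintegral _ _ _ _ _ (fun t => partial i (Z i) (rv t) + \sum_(i <- s) partial i (Z i) (rv t))).
   apply: (etrans (RintegralD measurableT (intZ i) IH2)).
   by rewrite -[RHS]addr0; congr (_ + _).
  by move=> t _; rewrite E.
 have := integrableD measurableT (intZ i) IH2; apply: eq_integrable => // t _.
 by rewrite E EFinD. }
have [S0 _] := sumI (index_enum 'I_n).
rewrite Rintegral_mkcond -[RHS]S0; apply: eq_Rintegral => t _.
rewrite patchE; case: ifPn => [/set_mem Ut|/negP nUt].
 have E i : partial i (Z i) (rv t) = partial i psi (rv t) * flux i a (rv t) + psi (rv t) * partial i (flux i a : _ -> R^o) (rv t).
 { have -> : partial i (Z i) (rv t) = partial i (psi \* flux i a : _ -> R^o) (rv t).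
  { apply: (@partial_eq_open R n R^o (cimg c) _ _ i _ oU _ Ut) => y Uy.
   by rewrite /Z patchE mem_set. }
  rewrite /partial deriveM; last 2 first.
  - exact: (Ck_derivable Cpsi Ut).
  - exact: (Ck_derivable (Ck_flux 1 i a) Ut).
  by rewrite addrC; congr (_ + _); exact: mulrC. }
 rewrite [RHS](eq_bigr _ (fun i _ => E i)) big_split /= -mulr_sumr.
 rewrite (div_flux_eq0 a Ut (H0 _ Ut)) mulr0 addr0; exact: eq_bigr.
rewrite big1// => i _; apply: (partial_support i clK (ZK i)) => /KU Ut; apply: nUt.
by rewrite inE.
Qed.

End ChartGeometry.

(** * Smooth functions on the manifold, bumps and localization *)

Section SmoothFunctions.
Context {R : realType} {n : nat} {M : ptopologicalType}.
Variable S : smooth_manifold R n M.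
Implicit Types (c d : chart R n M) (phi psi : M -> R).

Lemma closed_compact_manifold (K : set M) : compact K -> closed K.
Proof. by apply: compact_closed => //; exact: (manifold_hausdorff S). Qed.

Lemma smooth_cst (a : R) : smooth_fun S (fun=> a).
Proof. by move=> c Ac k; exact: (Ck_cst k (a : R^o) (@open_cimg _ _ _ c)). Qed.

Lemma smooth_funD phi psi : smooth_fun S phi -> smooth_fun S psi -> smooth_fun S (fun p => phi p + psi p).
Proof. by move=> sp sq c Ac k; exact: (CkD (@open_cimg _ _ _ c) (sp c Ac k) (sq c Ac k)). Qed.

Lemma smooth_funM phi psi : smooth_fun S phi -> smooth_fun S psi -> smooth_fun S (fun p => phi p * psi p).
Proof. by move=> sp sq c Ac k; exact: (CkM (@open_cimg _ _ _ c) (sp c Ac k) (sq c Ac k)). Qed.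

Lemma smooth_funB phi psi : smooth_fun S phi -> smooth_fun S psi -> smooth_fun S (fun p => phi p - psi p).
Proof.
by move=> sp sq c Ac k; exact: (CkD (@open_cimg _ _ _ c) (sp c Ac k) (CkN (@open_cimg _ _ _ c) (sq c Ac k))).
Qed.

Lemma smooth_fun_step phi : smooth_fun S phi -> smooth_fun S (fun p => step (phi p)).
Proof. by move=> sp c Ac k; exact: (Ck_step (@open_cimg _ _ _ c) (sp c Ac k)). Qed.

Lemma smooth_funV phi : (forall p, phi p != 0) -> smooth_fun S phi -> smooth_fun S (fun p => (phi p)^-1).
Proof.
move=> p0 sp c Ac k; exact: (CkV (@open_cimg _ _ _ c) (fun x _ => p0 (cinv c x)) (sp c Ac k)).
Qed.

Lemma smooth_funX phi m : smooth_fun S phi -> smooth_fun S (fun p => phi p ^+ m).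
Proof.
move=> sp; elim: m => [|m IH]; first exact: smooth_cst.
rewrite (_ : (fun p => _) = (fun p => phi p * phi p ^+ m)); first exact: smooth_funM.
by apply/funext => p; rewrite exprS.
Qed.

Lemma smooth_fun_sum (I : Type) (s : seq I) (f : I -> M -> R) : (forall i, smooth_fun S (f i)) ->
 smooth_fun S (fun p => \sum_(i <- s) f i p).
Proof.
move=> sf; elim: s => [|i s IH].
 rewrite (_ : (fun p => _) = fun=> 0); first exact: smooth_cst.
 by apply/funext => p; rewrite big_nil.
rewrite (_ : (fun p => _) = (fun p => f i p + \sum_(j <- s) f j p)); first exact: smooth_funD.
by apply/funext => p; rewrite big_cons.
Qed.

Lemma smooth_continuous phi : smooth_fun S phi -> continuous phi.
Proof.
move=> sp p; have [c Ac cp] := atlas_cover S p.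
have H : {for p, continuous ((phi \o cinv c) \o cmap c)}.
{ apply: continuous_comp; first exact: cmap_continuous.
 by apply: (Ck_continuous (sp c Ac 0%N)); exact: cmap_img. }
have E : {near p, (phi \o cinv c) \o cmap c =1 phi}.
{ have : nbhs p (cdom c) by apply: open_nbhs_nbhs; split => //; exact: open_cdom.
 by apply: filterS => q cq; rewrite /= cmapK. }
have H' : ((phi \o cinv c) \o cmap c) @ p --> phi p.
{ by have <- : ((phi \o cinv c) \o cmap c) p = phi p; [rewrite /= cmapK|exact: H]. }
by apply: cvg_trans H'; apply: near_eq_cvg.
Qed.

Definition push c (b : 'rV[R]_n -> R) : M -> R := fun p => if `[< cdom c p >] then b (cmap c p) else 0.

Lemma pushE c b p : cdom c p -> push c b p = b (cmap c p).
Proof. by move=> cp; rewrite /push asboolT. Qed.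

Lemma compact_cinv c (K : set 'rV[R]_n) : compact K -> K `<=` cimg c -> compact (cinv c @` K).
Proof.
move=> cK KU; apply: continuous_compact => //.
by apply: continuous_in_subspaceT => x /set_mem /KU; exact: cinv_continuous.
Qed.

Lemma compact_cmap c (K : set M) : compact K -> K `<=` cdom c -> compact (cmap c @` K).
Proof.
move=> cK Kc; apply: continuous_compact => //.
by apply: continuous_in_subspaceT => p /set_mem /Kc; exact: cmap_continuous.
Qed.

Lemma push_support c b (K : set 'rV[R]_n) : (forall x, ~ K x -> b x = 0) ->
 forall p, ~ (cinv c @` K) p -> push c b p = 0.
Proof.
move=> b0 p np; rewrite /push; case: asboolP => // cp.
by apply: b0 => Kx; apply: np; exists (cmap c p) => //; exact: cmapK.
Qed.

Lemma open_preimage_cinv c (O : set M) : open O -> open [set x | cimg c x /\ O (cinv c x)].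
Proof.
move=> oO; rewrite openE => x [Ux Ox]; apply: filterI.
 by apply: open_nbhs_nbhs; split => //; exact: open_cimg.
by apply: (cinv_continuous Ux); exact: open_nbhs_nbhs.
Qed.

Lemma open_cinv_image c (U : set 'rV[R]_n) : open U -> open [set p | cdom c p /\ U (cmap c p)].
Proof.
move=> oO; rewrite openE => x [Ux Ox]; apply: filterI.
 by apply: open_nbhs_nbhs; split => //; exact: open_cdom.
by apply: (cmap_continuous Ux); exact: open_nbhs_nbhs.
Qed.

(** In another chart the domain is covered by two open sets: the overlap with [c], where the
    transition map is composed, and the complement of the image of K, where the function is zero.
    That image is closed because the manifold is Hausdorff. *)
Lemma push_smooth c (b : 'rV[R]_n -> R^o) (K : set 'rV[R]_n) : atlas S c -> smooth_on setT b ->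
 compact K -> K `<=` cimg c -> (forall x, ~ K x -> b x = 0) -> smooth_fun S (push c b).
Proof.
move=> Ac sb cK KU b0 d Ad k.
have clK : closed (cinv c @` K).
{ by apply: compact_closed; [exact: manifold_hausdorff S|exact: compact_cinv]. }
pose V1 := [set x | cimg d x /\ cdom c (cinv d x)].
pose V2 := [set x | cimg d x /\ (~` (cinv c @` K)) (cinv d x)].
have oV1 : open V1 by apply: open_preimage_cinv; exact: open_cdom.
have oV2 : open V2 by apply: open_preimage_cinv; exact: closed_openC.
apply: (@Ck_sub _ _ _ k (V1 `|` V2)).
 move=> x Ux; have [cx|ncx] := pselect (cdom c (cinv d x)); first by left.
 right; split => // -[y Ky yx]; apply: ncx; rewrite -yx.
 by apply: cinv_dom; exact: KU.
apply: CkU.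
 have tau := atlas_smooth Ad Ac.
 have Ct j : Ck k V1 (fun y => (cmap c \o cinv d) y 0 j : R^o) by exact: Ck_row oV1 (tau k).
 have := @Ck_comp R n n k setT V1 b (cmap c \o cinv d) openT oV1 (fun _ _ => I) (sb k) Ct.
 by apply: Ck_eq => // x [Ux cx] /=; rewrite pushE.
apply: Ck_eq (Ck_cst k (0 : R^o) oV2) => // x [Ux nx] /=.
by rewrite (push_support b0).
Qed.

Lemma bump_exists c p (O : set M) : atlas S c -> cdom c p -> open O -> O p ->
 exists beta : M -> R, [/\ smooth_fun S beta, forall q, 0 <= beta q <= 1,
  (exists2 K, compact K & K `<=` cdom c `&` O /\ forall q, ~ K q -> beta q = 0) &
  exists W, [/\ open W, W p & forall q, W q -> beta q = 1]].
Proof.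
move=> Ac cp oO Op.
have oU := @open_preimage_cinv c O oO.
have Ux : [set x | cimg c x /\ O (cinv c x)] (cmap c p) by split; [exact: cmap_img|rewrite cmapK].
have /nbhs_ballP[e /= e0 eU] : nbhs (cmap c p) [set x | cimg c x /\ O (cinv c x)] by exact: open_nbhs_nbhs.
(* The bump of radius r is supported in radius 2r = 2e/3, inside the ball of radius e. *)
pose r := e / 3; have r0 : 0 < r by rewrite divr_gt0.
pose K := [set x : 'rV[R]_n | `|x - cmap c p| <= 2 * r].
have KB : K `<=` [set x | cimg c x /\ O (cinv c x)].
{ move=> x Kx; apply: eU; rewrite mx_norm_ball /ball_ /= distrC; apply: le_lt_trans Kx _.
 by rewrite /r; lra. }
have cK : compact K.
{ have := @compact_closed_ball R n (2 * r) (mulr_gt0 (ltr0Sn _ 1) r0).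
 move=> /(@continuous_compact _ _ (fun x : 'rV[R]_n => x + cmap c p) _ (ltac:(
   by apply: continuous_subspaceT; exact: continuous_addr))).
 congr compact; apply/seteqP; split => x /=.
  by move=> [y yr <-]; rewrite /K /= addrK.
 by move=> Kx; exists (x - cmap c p) => //; rewrite subrK. }
have KU : K `<=` cimg c by move=> x /KB[].
have b0 x : ~ K x -> bump (cmap c p) r x = 0.
{ by move=> /negP; rewrite -ltNge => /ltW; exact: bump0. }
exists (push c (bump (cmap c p) r)); split.
- by apply: (@push_smooth c _ K) => // k; exact: Ck_bump.
- by move=> q; rewrite /push; case: asboolP => _; rewrite ?bump_ge0 ?bump_le1// lexx ler01.
- exists (cinv c @` K); first exact: compact_cinv.
 split; last exact: push_support.
 by move=> _ [x /KB[Ux' Ox] <-]; split => //; exact: cinv_dom.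
- exists [set q | cdom c q /\ ball (cmap c p) r (cmap c q)]; split.
 + by apply: open_cinv_image; exact: ball_open.
 + by split => //; exact: ballxx.
 + move=> q [cq]; rewrite mx_norm_ball /ball_ /= => /ltW qr.
  by rewrite pushE// bump1// distrC.
Qed.

(* Partition of unity as an induction principle: peel off [beta * phi], supported in one chart. *)
Lemma chart_induction (P : (M -> R) -> Prop) :
 P (fun=> 0) -> (forall phi psi, P phi -> P psi -> P (fun p => phi p + psi p)) ->
 (forall c phi, atlas S c -> smooth_fun S phi -> compactly_supported (cdom c) phi -> P phi) ->
 forall phi, smooth_fun S phi -> compactly_supported setT phi -> P phi.
Proof.
move=> P0 PD Pc phi sphi [K [cK _] phi0].
have /choice[bW bWP] : forall p, exists bW : (M -> R) * set M, [/\ smooth_fun S bW.1,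
  exists2 c, atlas S c & compactly_supported (cdom c) bW.1, open bW.2, bW.2 p & forall q, bW.2 q -> bW.1 q = 1].
{ move=> p; have [c Ac cp] := atlas_cover S p.
 have [b [sb _ [K' cK' [K'c b0]] [W [oW Wp W1]]]] := @bump_exists c p setT Ac cp openT I.
 exists (b, W); split => //; exists c => //; exists K' => //; split => // q /K'c[] //. }
have [i _|p Kp|s [_ sP]] := @compact_seq_cover _ _ setT K (fun p => (bW p).2) cK.
- by have [] := bWP i.
- by exists p => //; have [] := bWP p.
have {sP} : forall p, phi p != 0 -> exists2 q, q \in s & (bW q).2 p.
{ move=> p pp; apply: sP; apply: contrapT => /phi0 p0; by rewrite p0 eqxx in pp. }
have : compactly_supported setT phi by exists K.
elim: s phi sphi {K cK phi0} => [|q s IH] phi sphi cphi sP.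
 rewrite (_ : phi = fun=> 0)//; apply/funext => p; apply/eqP; apply: contrapT => /negP /sP[//].
have [sb [c Ac cb] oW Wq W1] := bWP q.
rewrite (_ : phi = (fun p => (bW q).1 p * phi p + (1 - (bW q).1 p) * phi p)); last first.
{ by apply/funext => p; rewrite -mulrDl addrCA subrr addr0 mul1r. }
apply: PD.
 apply: (Pc c) => //; first exact: smooth_funM.
 by case: cb => K [cK Kc] b0; exists K => // p /b0 ->; rewrite mul0r.
apply: IH.
- by apply: smooth_funM => //; apply: smooth_funB => //; exact: smooth_cst.
- by case: cphi => K [cK Kc] b0; exists K => // p /b0 ->; rewrite mulr0.
- move=> p; rewrite mulf_eq0 negb_or => /andP[p1 /sP[r]].
 rewrite inE => /predU1P[->|rs rp]; last by exists r.
 by move=> /W1 E; move: p1; rewrite E subrr eqxx.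
Qed.

End SmoothFunctions.

Lemma max0_mulr {R : realDomainType} (a b : R) : 0 <= b -> Num.max a 0 * b = Num.max (a * b) 0.
Proof.
move=> b0; case: (leP 0 a) => a0; first by rewrite (max_idPl _)// mulr_ge0.
by rewrite mul0r (max_idPr _)// mulr_le0_ge0// ltW.
Qed.

(** * From a formula for measures of sets to one for integrals *)

Section IntegralTransfer.
Local Open Scope ereal_scope.
Context {d1 d2} {X : measurableType d1} {Y : measurableType d2} {R : realType}.
Variables (lam : {measure set X -> \bar R}) (nu : {measure set Y -> \bar R}).
Variables (phi : X -> Y) (g : X -> R) (D : set X) (E : set Y).
Hypotheses (mD : measurable D) (mE : measurable E) (mphi : measurable_fun D phi).
Hypotheses (mg : measurable_fun D g) (g0 : forall x, D x -> (0 <= g x)%R).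
Hypothesis nuE : forall B, measurable B ->
 nu (B `&` E) = \int[lam]_(x in D) (\1_B (phi x) * g x)%:E.

Import HBNNSimple.

(** The identity is known for indicators by [nuE], extends linearly to simple functions, and passes
    to the limit by monotone convergence on both sides. *)
Lemma ge0_integral_transfer (f : Y -> \bar R) :
 measurable_fun setT f -> (forall y, 0 <= f y) ->
 \int[nu]_(y in E) f y = \int[lam]_(x in D) (f (phi x) * (g x)%:E).
Proof.
move=> mf f0.
pose f_ := nnsfun_approx measurableT mf.
have mfphi n : measurable_fun D (fun x => f_ n (phi x)).
{ apply: (measurable_comp measurableT) => //; exact: measurable_funP. }
transitivity (limn (fun n => \int[nu]_(x in E) (f_ n x)%:E)).
{ rewrite -monotone_convergence//.
 - apply: eq_integral => y _; apply/esym/cvg_lim => //.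
  by apply: cvg_nnsfun_approx.
 - by move=> n; apply/measurable_EFinP; apply: measurable_funTS; exact: measurable_funP.
 - by move=> n y _; rewrite lee_fin.
 - by move=> y _ m n mn; rewrite lee_fin; exact/lefP/nd_nnsfun_approx. }
rewrite [X in limn X](_ : _ =
  (fun n => \int[lam]_(x in D) (f_ n (phi x) * g x)%:E)).
{ rewrite -monotone_convergence//.
 - apply: eq_integral => x /[!inE] Dx; apply/cvg_lim => //.
  under eq_fun do rewrite EFinM.
  by apply: cvgeZr => //; apply: cvg_nnsfun_approx.
 - move=> n; apply/measurable_EFinP; exact: measurable_funM.
 - by move=> n x Dx; rewrite lee_fin mulr_ge0// g0.
 - move=> x Dx m n mn; rewrite lee_fin; apply: ler_wpM2r; first exact: g0.
  exact/lefP/nd_nnsfun_approx. }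
apply/funext => n.
transitivity (\sum_(k \in range (f_ n))
  \int[lam]_(x in D) (k%:E * (\1_(f_ n @^-1` [set k]) (phi x) * g x)%:E)).
{ under eq_integral do rewrite fimfunE -fsumEFin//.
 rewrite ge0_integral_fsum//; last 2 first.
 - by move=> y; exact/measurable_EFinP/measurable_funM.
 - by move=> y x _; rewrite nnfun_muleindic_ge0.
 apply: eq_fsbigr => r /[!inE] -[y _ fyr].
 have r0 : (0 <= r)%R by rewrite -fyr.
 have mr : measurable (f_ n @^-1` [set r]) by exact: measurable_sfunP.
 rewrite integralZl_indic_nnsfun// integral_indic//= nuE// ge0_integralZl_EFin//.
 - by move=> x Dx; rewrite lee_fin mulr_ge0// g0.
 - apply/measurable_EFinP; apply: measurable_funM => //.
  apply: (measurable_comp measurableT) => //; exact: measurable_indic. }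
rewrite -ge0_integral_fsum//.
- apply: eq_integral => x Dx; rewrite [in RHS]fimfunE mulr_fsuml -fsumEFin//.
 by apply: eq_fsbigr => r _; rewrite -EFinM mulrA.
- move=> r; apply: measurable_funeM; apply/measurable_EFinP; apply: measurable_funM => //.
 apply: (measurable_comp measurableT) => //; exact: measurable_indic.
- move=> r x Dx; have [fr|fr] := eqVneq (f_ n (phi x)) r.
  by rewrite mule_ge0// lee_fin; [rewrite -fr|rewrite mulr_ge0// g0].
 by rewrite indicE memNset ?mul0r ?mule0// => /= /eqP; apply/negP.
Qed.

Lemma Rintegral_transfer (f : Y -> R) : measurable_fun setT f ->
 (\int[nu]_(y in E) f y = \int[lam]_(x in D) (f (phi x) * g x))%R.
Proof.
move=> mf; have mf' : measurable_fun setT (EFin \o f) by exact/measurable_EFinP.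
congr fine; rewrite [LHS]integralE [RHS]integralE.
rewrite (ge0_integral_transfer (measurable_funepos mf'))//.
rewrite (ge0_integral_transfer (measurable_funeneg mf'))//.
congr (_ - _); apply: eq_integral => x /[!inE] Dx.
 by rewrite !funeposE -!EFin_max -EFinM max0_mulr// g0.
by rewrite !funenegE -!EFin_max -EFinM max0_mulr ?g0// mulNr.
Qed.

End IntegralTransfer.

(** * The Riemannian measure read in charts *)

Section ChartMeasure.
Context {R : realType} {n : nat} {M : ptopologicalType}.
Local Notation Rm := (measurableTypeR R).
Variables (S : smooth_manifold R n M) (iota : M -> 'rV[R]_n.+1).
Variable mu : {measure set (borelType M) -> \bar R}.
Hypothesis imm : is_immersion S iota.
Hypothesis Hmu : is_riemannian_volume S iota mu.

Definition cdomain (c : chart R n M) : set (n.-tuple Rm) := rv @^-1` cimg c.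
Definition cpoint (c : chart R n M) (t : n.-tuple Rm) : borelType M := cinv c (rv t).

Lemma measurable_cdomain c : measurable (cdomain c).
Proof. by apply: measurable_rv_open; exact: open_cimg. Qed.

Lemma measurable_open (O : set M) : open O -> measurable (O : set (borelType M)).
Proof. by exact: sub_gen_smallest. Qed.

Lemma measurable_cpoint c : measurable_fun (cdomain c) (cpoint c).
Proof.
apply: (measurability _ (erefl : @measurable _ (borelType M) = <<s (@open M) >>)).
move=> _ [V oV <-].
rewrite (_ : _ `&` _ = rv @^-1` [set x | cimg c x /\ V (cinv c x)])//.
by apply: measurable_rv_open; exact: open_preimage_cinv.
Qed.

Lemma measurable_continuous (f : M -> R) : continuous f -> measurable_fun setT (f : borelType M -> R).
Proof.
move=> /continuousP cf; apply: (measurability _ (RGenOpens.measurableE R)).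
move=> _ [_ [a [b ->]] <-]; rewrite setTI.
by apply: measurable_open; apply: cf.
Qed.

Lemma mu_chart c (B : set (borelType M)) : atlas S c -> measurable B ->
 mu (B `&` (cdom c : set (borelType M))) =
 (\int[leb n]_(t in cdomain c) (\1_B (cpoint c t) * vol iota c (rv t))%:E)%E.
Proof.
move=> Ac mB; have mc : measurable (cdom c : set (borelType M)) by apply: measurable_open; exact: open_cdom.
rewrite (Hmu Ac (measurableI _ _ mB mc)); last by [].
rewrite (_ : rv @^-1` _ = cdomain c `&` (cpoint c @^-1` B)).
 rewrite integral_mkcondr; apply: eq_integral => t /[!inE] Dt.
 rewrite patchE; case: ifPn => [/set_mem Bt|/negP nBt].
  by rewrite indicE mem_set// mul1r.
 by rewrite indicE memNset ?mul0r// => Bt; apply: nBt; rewrite inE.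
apply/seteqP; split => t.
 by move=> [p [Bp cp] pt]; split; rewrite /cdomain /cpoint /= -pt ?cmapK//; exact: cmap_img.
move=> [Dt Bt]; exists (cinv c (rv t)); last exact: cinvK.
by split => //; exact: cinv_dom.
Qed.

Lemma measurable_vol c : atlas S c -> measurable_fun (cdomain c) (fun t => vol iota c (rv t)).
Proof.
move=> Ac; have [sF fT] := imm Ac.
apply: (@measurable_rv_continuous R n (cimg c) (vol iota c)); first exact: open_cimg.
move=> x Ux; exact: (Ck_continuous (Ck_vol sF fT 0)).
Qed.

Lemma ge0_integral_chart c (f : M -> \bar R) : atlas S c ->
 measurable_fun setT (f : borelType M -> _) -> (forall p, 0 <= f p)%E ->
 (\int[mu]_(p in (cdom c : set (borelType M))) f p =
  \int[leb n]_(t in cdomain c) (f (cpoint c t) * (vol iota c (rv t))%:E))%E.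
Proof.
move=> Ac mf f0.
apply: (@ge0_integral_transfer _ _ _ _ R (leb n) mu (cpoint c) (fun t => vol iota c (rv t)) (cdomain c)) => //.
- exact: measurable_cdomain.
- by apply: measurable_open; exact: open_cdom.
- exact: measurable_cpoint.
- exact: measurable_vol.
- by move=> t _; exact: sqrtr_ge0.
- by move=> B mB; exact: mu_chart.
Qed.

Lemma Rintegral_chart c (f : M -> R) : atlas S c ->
 measurable_fun setT (f : borelType M -> _) ->
 \int[mu]_(p in (cdom c : set (borelType M))) f p =
 \int[leb n]_(t in cdomain c) (f (cpoint c t) * vol iota c (rv t)).
Proof.
move=> Ac mf.
apply: (@Rintegral_transfer _ _ _ _ R (leb n) mu (cpoint c) (fun t => vol iota c (rv t)) (cdomain c)) => //.
- exact: measurable_cdomain.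
- by apply: measurable_open; exact: open_cdom.
- exact: measurable_cpoint.
- exact: measurable_vol.
- by move=> t _; exact: sqrtr_ge0.
- by move=> B mB; exact: mu_chart.
Qed.

(** Every point has a neighbourhood of finite measure, the preimage of a coordinate ball on which
    the volume density is at most its central value plus 1; finitely many cover K. *)
Lemma mu_compact_lty (K : set M) : compact K ->
 measurable (K : set (borelType M)) /\ (mu (K : set (borelType M)) < +oo)%E.
Proof.
move=> cK.
have clK := closed_compact_manifold S cK.
have mK : measurable (K : set (borelType M)).
{ by rewrite -[X in measurable X]setCK; apply: measurableC; apply: measurable_open; exact: closed_openC. }
split => //.
have /choice[W WP] : forall p : M, exists W : set M, [/\ open W, W p & (mu (W : set (borelType M)) < +oo)%E].
{ move=> p; have [c Ac cp] := atlas_cover S p; have [sF fT] := imm Ac.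
 have Ux := cmap_img cp.
 have cv : {for cmap c p, continuous (vol iota c)} by exact: (Ck_continuous (Ck_vol sF fT 0) Ux).
 have /nbhs_ballP[e /= e0 eU] : nbhs (cmap c p) [set x | cimg c x /\ vol iota c x < vol iota c (cmap c p) + 1].
 { apply: filterI; first by apply: open_nbhs_nbhs; split => //; exact: open_cimg.
  have /cvgrPdist_lt/(_ 1 ltr01) := cv; apply: (@filterS _ _ (nbhs_filter _)) => y /=.
  by rewrite ltr_distlC => /andP[]. }
 pose B := ball (cmap c p) e.
 exists [set q | cdom c q /\ B (cmap c q)]; split.
 - by apply: open_cinv_image; exact: ball_open.
 - by split => //; exact: ballxx.
 have mW : measurable ([set q | cdom c q /\ B (cmap c q)] : set (borelType M)).
 { by apply: measurable_open; apply: open_cinv_image; exact: ball_open. }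
 have mB : measurable (rv @^-1` B : set (n.-tuple Rm)) by apply: measurable_rv_open; exact: ball_open.
 rewrite (Hmu Ac mW); last by move=> q [].
 rewrite (_ : rv @^-1` _ = rv @^-1` B); last first.
 { apply/seteqP; split => t; first by move=> [q [cq Bq] E]; rewrite /preimage /= -E.
  move=> Bt; have [Ut _] := eU _ Bt; exists (cinv c (rv t)); last exact: cinvK.
  by split; [exact: cinv_dom|rewrite cinvK]. }
 apply: (@le_lt_trans _ _ (\int[leb n]_(t in rv @^-1` B) (vol iota c (cmap c p) + 1)%:E)%E).
  apply: ge0_le_integral => //.
  - apply/measurable_EFinP; apply: measurable_funS (measurable_vol Ac); first exact: measurable_cdomain.
   by move=> t /eU[].
  - by move=> t /eU[_ /ltW]; rewrite lee_fin.
 rewrite integral_cst// lte_mul_pinfty ?lee_fin ?addr_ge0 ?sqrtr_ge0//.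
 apply: (@leb_bounded R n _ (`|cmap c p| + e)) => // t.
 rewrite /B mx_norm_ball /ball_ /= => H; have := ler_distD (cmap c p) (rv t) 0; rewrite !subr0 distrC; lra. }
have [i _|p Kp|s [_ sP]] := @compact_seq_cover _ _ setT K W cK.
- by have [] := WP i.
- by exists p => //; have [] := WP p.
apply: (@le_lt_trans _ _ (mu (\big[setU/set0]_(q <- s) (W q : set (borelType M))))).
 apply: le_measure; rewrite ?inE//.
  by apply: bigsetU_measurable => q _; apply: measurable_open; have [] := WP q.
 by move=> p /sP[q qs Wp]; rewrite -bigcup_seq; exists q.
elim: s {sP} => [|q s IH]; first by rewrite big_nil measure0.
have [oW _ Woo] := WP q.
rewrite big_cons; apply: le_lt_trans (measureU2 _ _ _) _.
- exact: measurable_open.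
- by apply: bigsetU_measurable => r _; apply: measurable_open; have [] := WP r.
- exact: lte_add_pinfty.
Qed.

Lemma measurable_indic_compact (K : set M) : compact K -> measurable_fun setT (\1_K : borelType M -> R).
Proof. by move=> /mu_compact_lty[mK _]. Qed.

End ChartMeasure.

(** * Matrix expressions invariant under congruence *)

Section Congruence.
Context {R : realFieldType} {n m : nat}.
Variables (J : 'M[R]_n).
Hypothesis uJ : J \in unitmx.

Lemma congr_invmx (g : 'M[R]_n) : g \in unitmx ->
 invmx (J *m g *m J^T) = invmx J^T *m invmx g *m invmx J.
Proof.
move=> ug; have uJt : J^T \in unitmx by rewrite unitmx_tr.
have ugc : J *m g *m J^T \in unitmx by rewrite !unitmx_mul uJ ug.
apply: (can_inj (mulmxK ugc)); rewrite mulVmx// !mulmxA.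
rewrite -[_ *m invmx J *m J]mulmxA mulVmx// mulmx1.
by rewrite -[_ *m invmx g *m g]mulmxA mulVmx// mulmx1 mulVmx.
Qed.

Lemma congr_mul_invmx (k : nat) (r r' : 'M[R]_(k, n)) (h h' : 'M[R]_n) (T T' : 'M[R]_(n, m)) :
 r' = r *m J^T -> h' = invmx J^T *m h *m invmx J -> T' = J *m T ->
 r' *m h' *m T' = r *m h *m T.
Proof.
move=> -> -> ->.
have uJt : J^T \in unitmx by rewrite unitmx_tr.
rewrite !mulmxA -[_ *m invmx J *m J]mulmxA mulVmx// mulmx1.
by rewrite -[_ *m J^T *m _]mulmxA mulmxV// mulmx1.
Qed.

Lemma congr_trace (h A h' A' : 'M[R]_n) : h' = invmx J^T *m h *m invmx J -> A' = J *m A *m J^T ->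
 \tr (h'^T *m (A' *m h' *m A'^T)) = \tr (h^T *m (A *m h *m A^T)).
Proof.
move=> h'E A'E.
have uJt : J^T \in unitmx by rewrite unitmx_tr.
have E : A' *m h' *m A'^T = J *m (A *m h *m A^T) *m J^T.
{ rewrite A'E h'E !trmx_mul trmxK !mulmxA -[_ *m J^T *m invmx J^T]mulmxA mulmxV// mulmx1.
 by rewrite -[_ *m invmx J *m J]mulmxA mulVmx// mulmx1. }
rewrite E h'E !trmx_mul !trmx_inv trmxK !mulmxA.
rewrite -[_ *m invmx J *m J]mulmxA mulVmx// mulmx1.
by rewrite mxtrace_mulC !mulmxA mulmxV// mul1mx.
Qed.

(** Turns the fourfold contraction that defines |A|^2 into traces, one for each ambient coordinate,
    to which invariance under a change of chart can be applied by matrix algebra. *)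
Lemma contraction_trace (s : 'I_n -> 'I_n -> 'rV[R]_m) (h : 'M[R]_n)
  (A := fun e => \matrix_(i, j) s i j 0 e : 'M[R]_n) :
 \sum_i \sum_j \sum_k \sum_l h i k * h j l * (\sum_e s i j 0 e * s k l 0 e) =
 \sum_e \tr (h^T *m (A e *m h *m (A e)^T)).
Proof.
have E e : \tr (h^T *m (A e *m h *m (A e)^T)) =
 \sum_i \sum_k \sum_j \sum_l (h k i * (s k l 0 e * h l j * s i j 0 e)).
{ apply: eq_bigr => i _; rewrite mxE; apply: eq_bigr => k _.
 rewrite mxE [X in _ * X]mxE mulr_sumr; apply: eq_bigr => j _.
 rewrite mxE [(A e)^T _ _]mxE mulr_suml mulr_sumr; apply: eq_bigr => l _.
 by rewrite [X in _ * (X * _ * _)]mxE [X in _ * (_ * X)]mxE. }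
rewrite (eq_bigr _ (fun e _ => E e)).
have F e : \sum_i \sum_k \sum_j \sum_l (h k i * (s k l 0 e * h l j * s i j 0 e)) =
 \sum_i \sum_j \sum_k \sum_l h i k * h j l * (s i j 0 e * s k l 0 e).
{ rewrite exchange_big; apply: eq_bigr => k _.
 rewrite [RHS]exchange_big; apply: eq_bigr => i _.
 rewrite exchange_big; apply: eq_bigr => l _; apply: eq_bigr => j _; ring. }
rewrite (eq_bigr _ (fun e _ => F e)).
rewrite [RHS]exchange_big; apply: eq_bigr => i _.
rewrite [RHS]exchange_big; apply: eq_bigr => j _.
rewrite [RHS]exchange_big; apply: eq_bigr => k _.
rewrite [RHS]exchange_big; apply: eq_bigr => l _.
by rewrite mulr_sumr.
Qed.

End Congruence.

(** * Independence of the chart *)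

Section ChartChange.
Context {R : realType} {n : nat} {M : ptopologicalType}.
Variables (S : smooth_manifold R n M) (iota : M -> 'rV[R]_n.+1).
Hypothesis imm : is_immersion S iota.
Implicit Types (c d : chart R n M).

Definition overlap c d : set 'rV[R]_n := [set x | cimg c x /\ cdom d (cinv c x)].

Lemma open_overlap c d : open (overlap c d).
Proof. by apply: open_preimage_cinv; exact: open_cdom. Qed.

Definition jac c d (x : 'rV[R]_n) : 'M[R]_n :=
 \matrix_(i, b) partial i (fun y => (cmap d \o cinv c) y 0 b : R^o) x.

Lemma Ck_transition k c d b : atlas S c -> atlas S d ->
 Ck k (overlap c d) (fun y => (cmap d \o cinv c) y 0 b : R^o).
Proof. by move=> Ac Ad; apply: Ck_row; [exact: open_overlap|exact: (atlas_smooth Ac Ad)]. Qed.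

Lemma partial_change c d (f : M -> R) i x : atlas S c -> atlas S d ->
 Ck 1 (cimg d) (f \o cinv d : _ -> R^o) -> overlap c d x ->
 partial i (f \o cinv c : _ -> R^o) x =
 \sum_b jac c d x i b * partial b (f \o cinv d : _ -> R^o) (cmap d (cinv c x)).
Proof.
move=> Ac Ad Cf Ox; have oO := @open_overlap c d.
rewrite (@partial_eq_open _ _ _ (overlap c d) _ ((f \o cinv d) \o (cmap d \o cinv c))) //; last first.
{ by move=> y [Uy dy] /=; rewrite cmapK. }
have [|_ E] := @chain_rule_line R n _ (cimg d) (f \o cinv d) (cmap d \o cinv c) x 'e_i
 (@open_cimg _ _ _ d) Cf _ (fun b => Ck_derivable (Ck_transition 1 b Ac Ad) Ox).
 by apply: cmap_img; case: Ox.
rewrite [LHS]E; apply: eq_bigr => b _; by rewrite mulrC mxE.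
Qed.

Lemma Ck_iota k c j : atlas S c -> Ck k (cimg c) ((fun p => iota p 0 j) \o cinv c : _ -> R^o).
Proof. by move=> Ac; have [sF _] := imm Ac; exact: (@Ck_row R n n.+1 k (cimg c) (iota \o cinv c) j (@open_cimg _ _ _ c) (sF k)). Qed.

Lemma tangent_change c d x : atlas S c -> atlas S d -> overlap c d x ->
 tangent_mx iota c x = jac c d x *m tangent_mx iota d (cmap d (cinv c x)).
Proof.
move=> Ac Ad Ox; have [sF _] := imm Ac; have [sF' _] := imm Ad.
have Ux' : cimg d (cmap d (cinv c x)) by apply: cmap_img; case: Ox.
apply/matrixP => i j; rewrite (tangentE sF) ?mxE; last by case: Ox.
rewrite -[partial _ _ _]/(partial i ((fun p => iota p 0 j) \o cinv c : _ -> R^o) x).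
rewrite (partial_change i Ac Ad (Ck_iota 1 j Ad) Ox); apply: eq_bigr => b _.
by rewrite (tangentE sF').
Qed.

(** The immersion has full rank in chart [c], and its tangent matrix there factors through the
    Jacobian; so the Jacobian has full rank. *)
Lemma jac_unit c d x : atlas S c -> atlas S d -> overlap c d x -> jac c d x \in unitmx.
Proof.
move=> Ac Ad Ox; have [_ fT] := imm Ac.
have := fT x (proj1 Ox); rewrite (tangent_change Ac Ad Ox) -row_free_unit.
by rewrite /row_free eqn_leq => /andP[_ H]; rewrite eqn_leq rank_leq_row (leq_trans H)// mxrankM_maxl.
Qed.

Lemma metric_change c d x : atlas S c -> atlas S d -> overlap c d x ->
 metric_mx iota c x = jac c d x *m metric_mx iota d (cmap d (cinv c x)) *m (jac c d x)^T.
Proof. by move=> Ac Ad Ox; rewrite /metric_mx (tangent_change Ac Ad Ox) trmx_mul !mulmxA. Qed.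

Lemma invmetric_change c d x : atlas S c -> atlas S d -> overlap c d x ->
 invmx (metric_mx iota c x) =
 invmx (jac c d x)^T *m invmx (metric_mx iota d (cmap d (cinv c x))) *m invmx (jac c d x).
Proof.
move=> Ac Ad Ox; have uJ := jac_unit Ac Ad Ox; have [sF fT] := imm Ad.
have ug : metric_mx iota d (cmap d (cinv c x)) \in unitmx.
{ by apply: (metric_unit fT); apply: cmap_img; case: Ox. }
rewrite -(congr_invmx uJ ug); congr invmx; exact: metric_change.
Qed.

(* The tangential projection, acting on row vectors from the right. *)
Definition tproj c x : 'M[R]_n.+1 :=
 (tangent_mx iota c x)^T *m invmx (metric_mx iota c x) *m tangent_mx iota c x.

Lemma tproj_change c d x : atlas S c -> atlas S d -> overlap c d x ->
 tproj c x = tproj d (cmap d (cinv c x)).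
Proof.
move=> Ac Ad Ox; have uJ := jac_unit Ac Ad Ox.
have E1 := invmetric_change Ac Ad Ox; have E2 := tangent_change Ac Ad Ox.
have E3 : (tangent_mx iota c x)^T = (tangent_mx iota d (cmap d (cinv c x)))^T *m (jac c d x)^T.
{ by rewrite E2 trmx_mul. }
exact: (congr_mul_invmx uJ E3 E1 E2).
Qed.

Definition gradc c (phi : M -> R) x : 'rV[R]_n.+1 :=
 (\row_i partial i (phi \o cinv c : _ -> R^o) x) *m invmx (metric_mx iota c x) *m tangent_mx iota c x.

Lemma gradc_change c d phi x : atlas S c -> atlas S d -> overlap c d x ->
 Ck 1 (cimg d) (phi \o cinv d : _ -> R^o) ->
 gradc c phi x = gradc d phi (cmap d (cinv c x)).
Proof.
move=> Ac Ad Ox Cp; have uJ := jac_unit Ac Ad Ox.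
have E1 := invmetric_change Ac Ad Ox; have E2 := tangent_change Ac Ad Ox.
have E3 : (\row_i partial i (phi \o cinv c : _ -> R^o) x) =
  (\row_i partial i (phi \o cinv d : _ -> R^o) (cmap d (cinv c x))) *m (jac c d x)^T.
{ apply/rowP => i; rewrite [LHS]mxE (partial_change i Ac Ad Cp Ox) [RHS]mxE; apply: eq_bigr => b _.
 by rewrite mulrC [X in _ = X * _]mxE [X in _ = _ * X]mxE. }
exact: (congr_mul_invmx uJ E3 E1 E2).
Qed.

Lemma chart_atP p : atlas S (chart_at S p) /\ cdom (chart_at S p) p.
Proof. by rewrite /chart_at; case: cid2. Qed.

Lemma grad_chart c phi p : atlas S c -> cdom c p -> smooth_fun S phi ->
 grad S iota phi p = gradc c phi (cmap c p).
Proof.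
move=> Ac cp sp; have [Ad dp] := chart_atP p.
rewrite -[LHS]/(gradc (chart_at S p) phi (cmap (chart_at S p) p)).
rewrite (@gradc_change _ c phi _ Ad Ac); last exact: (sp c Ac 1%N).
 by rewrite cmapK.
by split; [exact: cmap_img|rewrite cmapK].
Qed.

Lemma tangent_mul_proj c x : cimg c x -> atlas S c -> tangent_mx iota c x *m tproj c x = tangent_mx iota c x.
Proof.
move=> Ux Ac; have [sF fT] := imm Ac.
by rewrite !mulmxA mulmxV ?mul1mx// (metric_unit fT).
Qed.

(** Second derivatives do not transform tensorially, but the extra term, with second derivatives of
    the transition map, is a combination of tangent vectors and is removed by the normal
    projection. *)
Lemma hess_change c d x i j : atlas S c -> atlas S d -> overlap c d x ->
 sff iota c x i j = \sum_a \sum_b (jac c d x i a * jac c d x j b) *: sff iota d (cmap d (cinv c x)) a b.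
Proof.
move=> Ac Ad Ox; have [sF' fT'] := imm Ad.
have oO := @open_overlap c d; have Ux := proj1 Ox.
have Ux' : cimg d (cmap d (cinv c x)) by apply: cmap_img; case: Ox.
set x' := cmap d (cinv c x).
have HE e (Ae : atlas S e) (y : 'rV[R]_n) (Uy : cimg e y) k l b :
 partial k (partial l (iota \o cinv e)) y 0 b = partial k (fun z => tangent_mx iota e z l b : R^o) y.
{ have [sFe _] := imm Ae; rewrite partial_row; last exact: (Ck_derivable (CkS l (sFe 2%N)) Uy).
 have H z (Uz : cimg e z) : partial l (iota \o cinv e) z 0 b = tangent_mx iota e z l b by rewrite mxE.
 exact: (@partial_eq_open R n R^o (cimg e) _ _ k y (@open_cimg _ _ _ e) H Uy). }
(* The first sum is the tangential, non-tensorial term; the second is the tensorial one. *)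
have key b : partial i (partial j (iota \o cinv c)) x 0 b =
 \sum_l (partial i (fun y => jac c d y j l : R^o) x) * tangent_mx iota d x' l b +
 \sum_l \sum_a (jac c d x i a * jac c d x j l) * partial a (partial l (iota \o cinv d)) x' 0 b.
{ apply: (eq_trans (HE c Ac x Ux i j b)).
 have Tl l : Ck 1 (cimg d) (fun z => tangent_mx iota d z l b : R^o) by exact: Ck_tangent.
 have Dl l : is_derive x 'e_i (fun y => tangent_mx iota d (cmap d (cinv c y)) l b : R^o)
  (\sum_a jac c d x i a * partial a (fun z => tangent_mx iota d z l b : R^o) x').
 { have D := @chain_rule_line R n _ (cimg d) (fun z => tangent_mx iota d z l b) (cmap d \o cinv c) x 'e_i
   (@open_cimg _ _ _ d) (Tl l) Ux' (fun b => Ck_derivable (Ck_transition 1 b Ac Ad) Ox).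
  apply: is_derive_eq D _; apply: eq_bigr => a _; by rewrite mulrC [X in _ = X * _]mxE. }
 have Dj l : is_derive x 'e_i (fun y => jac c d y j l : R^o) (partial i (fun y => jac c d y j l : R^o) x).
 { apply: derivableP.
  have Cj : Ck 1 (overlap c d) (fun y => jac c d y j l : R^o).
  { apply: Ck_eq (CkS j (Ck_transition 2 l Ac Ad)) => // y _; by rewrite mxE. }
  exact: (Ck_derivable Cj Ox). }
 rewrite (@partial_eq_open _ _ _ (overlap c d) _ (fun y => \sum_l jac c d y j l * tangent_mx iota d (cmap d (cinv c y)) l b : R^o))//; last first.
 { by move=> y Oy; rewrite (tangent_change Ac Ad Oy) mxE. }
 have [_ E] := @is_derive_bigsum R _ _ (index_enum 'I_n) _ _ x 'e_i (fun l => is_deriveM (Dj l) (Dl l)).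
 rewrite [LHS]E big_split /= addrC; congr (_ + _); apply: eq_bigr => l _.
  exact: mulrC.
 rewrite /GRing.scale /= mulr_sumr; apply: eq_bigr => a _; rewrite mulrCA mulrA.
 by rewrite (HE d Ad x' Ux'). }
have P1 (e : chart R n M) y v : normal_part iota e y v = v - v *m tproj e y.
{ by rewrite !mulmxA. }
rewrite /sff P1 (tproj_change Ac Ad Ox).
have -> : partial i (partial j (iota \o cinv c)) x =
 (\row_l partial i (fun y => jac c d y j l : R^o) x) *m tangent_mx iota d x' +
 \sum_l \sum_a (jac c d x i a * jac c d x j l) *: partial a (partial l (iota \o cinv d)) x'.
{ apply/rowP => b; rewrite key [RHS]mxE; congr (_ + _).
  by rewrite mxE; apply: eq_bigr => l _; rewrite [X in _ = X * _]mxE.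
 rewrite summxE; apply: eq_bigr => l _; rewrite summxE; apply: eq_bigr => a _; by rewrite [RHS]mxE. }
rewrite mulmxDl -mulmxA (tangent_mul_proj Ux' Ad) opprD addrACA subrr add0r.
rewrite exchange_big mulmx_suml -sumrB; apply: eq_bigr => a _.
rewrite mulmx_suml -sumrB; apply: eq_bigr => b _.
by rewrite P1 scalerBr -scalemxAl.
Qed.

Definition sffe c x (e : 'I_n.+1) : 'M[R]_n := \matrix_(i, j) sff iota c x i j 0 e.

Lemma sff_sqnormE c x : sff_sqnorm iota c x =
 \sum_e \tr ((invmx (metric_mx iota c x))^T *m (sffe c x e *m invmx (metric_mx iota c x) *m (sffe c x e)^T)).
Proof.
exact: (contraction_trace (sff iota c x) (invmx (metric_mx iota c x))).
Qed.

Lemma sff_sqnorm_change c d x : atlas S c -> atlas S d -> overlap c d x ->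
 sff_sqnorm iota c x = sff_sqnorm iota d (cmap d (cinv c x)).
Proof.
move=> Ac Ad Ox; have uJ := jac_unit Ac Ad Ox.
rewrite !sff_sqnormE; apply: eq_bigr => e _.
have E1 : sffe c x e = jac c d x *m sffe d (cmap d (cinv c x)) e *m (jac c d x)^T.
{ apply/matrixP => i j; rewrite [LHS]mxE (hess_change i j Ac Ad Ox).
 transitivity (\sum_a \sum_b jac c d x i a * jac c d x j b * sff iota d (cmap d (cinv c x)) a b 0 e).
  by rewrite summxE; apply: eq_bigr => a _; rewrite summxE; apply: eq_bigr => b _; rewrite mxE.
 rewrite exchange_big [RHS]mxE; apply: eq_bigr => b _.
 rewrite [X in _ = X * _]mxE mulr_suml; apply: eq_bigr => a _.
 by rewrite [sffe _ _ _ _ _]mxE [(jac c d x)^T _ _]mxE mulrAC. }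
have E2 := invmetric_change Ac Ad Ox.
exact: (congr_trace uJ E2 E1).
Qed.

Lemma A2_chart c p : atlas S c -> cdom c p -> A2 S iota p = sff_sqnorm iota c (cmap c p).
Proof.
move=> Ac cp; have [Ad dp] := chart_atP p.
rewrite /A2 (@sff_sqnorm_change _ c _ Ad Ac); first by rewrite cmapK.
by split; [exact: cmap_img|rewrite cmapK].
Qed.

End ChartChange.

Lemma sqr_sum_le {R : realFieldType} (m : nat) (a : 'I_m -> R) :
 (\sum_i a i) ^+ 2 <= m%:R * \sum_i a i ^+ 2.
Proof.
have -> : (\sum_i a i) ^+ 2 = \sum_i \sum_j a i * a j by rewrite expr2 mulr_suml; apply: eq_bigr => i _; rewrite mulr_sumr.
via (\sum_i \sum_j (2^-1 * a i ^+ 2 + 2^-1 * a j ^+ 2)).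
 apply: ler_sum => i _; apply: ler_sum => j _; have := sqr_ge0 (a i - a j); lra.
under eq_bigr do rewrite big_split sumr_const.
rewrite big_split /= sumr_const card_ord sumrMnl -mulr_sumr.
lra.
Qed.

(** * Euclidean inner product inequalities *)

Section DotProduct.
Context {R : realType} {m : nat}.
Implicit Types (u v w : 'rV[R]_m).

Lemma dotvC u v : dotv u v = dotv v u.
Proof. by apply: eq_bigr => j _; rewrite mulrC. Qed.

Lemma dotvDl u v w : dotv (u + v) w = dotv u w + dotv v w.
Proof. by rewrite -big_split; apply: eq_bigr => j _; rewrite mxE mulrDl. Qed.

Lemma dotvZl (a : R) u v : dotv (a *: u) v = a * dotv u v.
Proof. by rewrite mulr_sumr; apply: eq_bigr => j _; rewrite mxE mulrA. Qed.

Lemma dotvDr u v w : dotv w (u + v) = dotv w u + dotv w v.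
Proof. by rewrite dotvC dotvDl !(dotvC w). Qed.

Lemma dotvZr (a : R) u v : dotv u (a *: v) = a * dotv u v.
Proof. by rewrite dotvC dotvZl dotvC. Qed.

Lemma dotv0l v : dotv 0 v = 0.
Proof. by rewrite /dotv big1// => j _; rewrite mxE mul0r. Qed.

Lemma enorm_ge0 v : 0 <= enorm v.
Proof. exact: sqrtr_ge0. Qed.

Lemma enorm_sqr v : enorm v ^+ 2 = dotv v v.
Proof. by rewrite sqr_sqrtr// dotv_ge0. Qed.

Lemma enormZ (a : R) v : enorm (a *: v) = `|a| * enorm v.
Proof. by rewrite /enorm dotvZl dotvZr mulrA sqrtrM ?sqr_ge0// sqrtr_sqr. Qed.

Lemma enorm0 : enorm (0 : 'rV[R]_m) = 0.
Proof. by rewrite /enorm dotv0l sqrtr0. Qed.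

Lemma dotv_le_sum u v (e : R) : 0 < e -> 2 * dotv u v <= e * dotv u u + e^-1 * dotv v v.
Proof.
move=> e0; have := dotv_ge0 (e *: u - v); rewrite -scaleN1r !dotvDl !dotvDr !dotvZl !dotvZr (dotvC v u).
rewrite !(mulN1r, mulrN1, opprK, mulrN) => H.
have e1 : 0 < e^-1 by rewrite invr_gt0.
have : 0 <= e^-1 * (e * (e * dotv u u) + - (e * dotv u v) + (- (e * dotv u v) + dotv v v)).
 by rewrite mulr_ge0// ltW.
rewrite !mulrDr !mulrN !mulrA mulVf; lra.
Qed.

Lemma dotv_le_enorm u v : `|dotv u v| <= enorm u * enorm v.
Proof.
rewrite -(ler_pXn2r (_ : (0 < 2)%N))// ?nnegrE ?mulr_ge0 ?enorm_ge0//.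
rewrite exprMn !enorm_sqr real_normK ?num_real//.
have [u0|/eqP u0] := eqVneq (dotv u u) 0.
 by move/eqP: u0; rewrite dotv_eq0 => /eqP ->; rewrite !dotv0l expr0n mul0r.
have up : 0 < dotv u u by rewrite lt_def dotv_ge0 andbT; apply/eqP.
have := dotv_ge0 (dotv u u *: v - dotv u v *: u); rewrite -scaleN1r !dotvDl !dotvDr !dotvZl !dotvZr (dotvC v u).
move=> H; rewrite -subr_ge0 -(pmulr_rge0 _ up); apply: le_trans H _; apply: le_of_eq; ring.
Qed.

Lemma enormD u v : enorm (u + v) <= enorm u + enorm v.
Proof.
rewrite -(ler_pXn2r (_ : (0 < 2)%N))// ?nnegrE ?addr_ge0 ?enorm_ge0//.
rewrite enorm_sqr dotvDl !dotvDr sqrrD !enorm_sqr (dotvC v u).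
have := dotv_le_enorm u v; have := ler_norm (dotv u v); lra.
Qed.

Lemma enormN v : enorm (- v) = enorm v.
Proof. by rewrite -scaleN1r enormZ normrN1 mul1r. Qed.

Lemma coord_le_enorm v j : `|v 0 j| <= enorm v.
Proof.
rewrite -(ler_pXn2r (_ : (0 < 2)%N))// ?nnegrE ?enorm_ge0// enorm_sqr real_normK ?num_real//.
by rewrite /dotv (bigD1 j)//= lerDl sumr_ge0// => k _; rewrite sqr_ge0.
Qed.

Lemma enorm_le_coord v (e : R) : 0 <= e -> (forall j, `|v 0 j| <= e) -> enorm v <= m%:R * e.
Proof.
move=> e0 H; rewrite -(ler_pXn2r (_ : (0 < 2)%N))// ?nnegrE ?enorm_ge0 ?mulr_ge0//.
rewrite enorm_sqr exprMn; via (\sum_(j < m) e ^+ 2).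
 by apply: ler_sum => j _; rewrite -expr2 -real_normK ?num_real// lerXn2r.
rewrite sumr_const card_ord -[X in X <= _]mulr_natl; apply: ler_wpM2r; rewrite ?sqr_ge0// -natrX ler_nat.
by case: (m) => // k; rewrite -[X in (X <= _)%N]expn1 leq_pexp2l.
Qed.

Lemma dotv_proj_le (P : 'M[R]_m) v : P^T = P -> P *m P = P -> dotv (v *m P) (v *m P) <= dotv v v.
Proof.
move=> Ps Pi.
have E : dotv v (v *m P) = dotv (v *m P) (v *m P).
{ by rewrite !dotvE !trmx_mul Ps -[in RHS]mulmxA [P *m (P *m _)]mulmxA Pi. }
have := dotv_ge0 (v - v *m P); rewrite -scaleN1r !dotvDl !dotvDr !dotvZl !dotvZr (dotvC _ v); lra.
Qed.

End DotProduct.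

(** * Rules for the gradient and continuity of the curvature *)

Section Gradient.
Context {R : realType} {n : nat} {M : ptopologicalType}.
Variables (S : smooth_manifold R n M) (iota : M -> 'rV[R]_n.+1).
Hypothesis imm : is_immersion S iota.
Implicit Types (c d : chart R n M) (phi psi : M -> R).
Local Notation grad := (grad S iota).

Definition tproj_at p : 'M[R]_n.+1 := tproj iota (chart_at S p) (cmap (chart_at S p) p).

Lemma is_derive_chart c phi x i : atlas S c -> smooth_fun S phi -> cimg c x ->
 is_derive x 'e_i (phi \o cinv c : _ -> R^o) (partial i (phi \o cinv c : _ -> R^o) x).
Proof. by move=> Ac sp Ux; apply: derivableP; exact: (Ck_derivable (sp c Ac 1%N) Ux). Qed.

(** At a point the gradient is a fixed linear function of the partial derivatives in the chosen
    chart, so the sum, product, chain and vanishing rules all reduce to identities between partial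
    derivatives. *)
Lemma grad_linear p phi psi theta a b : (forall i, let c := chart_at S p in
  partial i (theta \o cinv c : _ -> R^o) (cmap c p) =
  a * partial i (phi \o cinv c : _ -> R^o) (cmap c p) + b * partial i (psi \o cinv c : _ -> R^o) (cmap c p)) ->
 grad theta p = a *: grad phi p + b *: grad psi p.
Proof.
move=> H; rewrite !scalemxAl -!mulmxDl; congr (_ *m _ *m _).
by apply/rowP => i; rewrite !mxE.
Qed.

Lemma gradM phi psi p : smooth_fun S phi -> smooth_fun S psi ->
 grad (fun q => phi q * psi q) p = phi p *: grad psi p + psi p *: grad phi p.
Proof.
move=> sp sq; apply: grad_linear => i c; have [Ac cp] := chart_atP S p.
have Ux : cimg c (cmap c p) by exact: cmap_img.
have [_ E] := is_deriveM (is_derive_chart i Ac sp Ux) (is_derive_chart i Ac sq Ux).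
rewrite [LHS]E /= cmapK//.
Qed.

Lemma gradD phi psi p : smooth_fun S phi -> smooth_fun S psi ->
 grad (fun q => phi q + psi q) p = grad phi p + grad psi p.
Proof.
move=> sp sq; rewrite -[grad phi p]scale1r -[grad psi p]scale1r; apply: grad_linear => i c; have [Ac cp] := chart_atP S p.
have Ux : cimg c (cmap c p) by exact: cmap_img.
have [_ E] := is_deriveD (is_derive_chart i Ac sp Ux) (is_derive_chart i Ac sq Ux).
by rewrite !mul1r.
Qed.

Lemma grad_comp (f : R -> R) (L : R) phi p : smooth_fun S phi ->
 is_derive (phi p) (1 : R) f L -> grad (fun q => f (phi q)) p = L *: grad phi p.
Proof.
move=> sp Df; rewrite -[RHS]addr0 -(scale0r (grad phi p)); apply: grad_linear => i c; have [Ac cp] := chart_atP S p.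
rewrite mul0r addr0.
have Ux : cimg c (cmap c p) by exact: cmap_img.
rewrite -[LHS]derive_line -[X in _ = L * X]derive_line.
have D : is_derive (0 : R) (1 : R) (fun t : R => (phi \o cinv c) (cmap c p + t *: 'e_i)) (partial i (phi \o cinv c : _ -> R^o) (cmap c p)).
{ have := @is_derive_line _ _ _ (phi \o cinv c : _ -> R^o) (cmap c p) 'e_i 0.
 by rewrite scale0r addr0; apply; exact: (Ck_derivable (sp c Ac 1%N) Ux). }
have Df' : is_derive ((fun t : R => (phi \o cinv c) (cmap c p + t *: 'e_i)) 0) (1 : R) f L.
{ by rewrite /= scale0r addr0 cmapK. }
have [_ E] := is_derive1_comp (f := f) (g := fun t : R => (phi \o cinv c) (cmap c p + t *: 'e_i)) Df' D.
have [_ E'] := D.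
by rewrite [X in _ = L * X]E'.
Qed.

Lemma grad_support phi K p : closed K -> (forall q, ~ K q -> phi q = 0) -> ~ K p -> grad phi p = 0.
Proof.
move=> cK H nK; have [Ac cp] := chart_atP S p.
have E : grad phi p = 0 *: grad phi p + 0 *: grad phi p; last by rewrite E !scale0r addr0.
apply: grad_linear => i c; rewrite !mul0r addr0.
rewrite (@partial_eq_open _ _ _ [set x | cimg c x /\ (~` K) (cinv c x)] _ (cst 0 : _ -> R^o))//.
- by rewrite /partial derive_cst.
- by apply: open_preimage_cinv; exact: closed_openC.
- by move=> x [_ /H].
- by split; [exact: cmap_img|rewrite cmapK].
Qed.

Lemma smooth_fun_iota a : smooth_fun S (fun p => iota p 0 a).
Proof. by move=> c Ac k; exact: (Ck_iota imm). Qed.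

(** The partial derivatives of a coordinate of [iota] form a column of the tangent matrix, so its
    gradient is a row of T^t g^(-1) T. *)
Lemma grad_iota a p : grad (fun q => iota q 0 a) p = row a (tproj_at p).
Proof.
have [Ac cp] := chart_atP S p; have [sF fT] := imm Ac.
rewrite !row_mul; congr (_ *m _ *m _).
apply/rowP => i; rewrite [LHS]mxE [RHS]mxE [RHS]mxE (tangentE sF)//; exact: cmap_img.
Qed.

Lemma tproj_sym c x : (tproj iota c x)^T = tproj iota c x.
Proof.
have E : (invmx (metric_mx iota c x))^T = invmx (metric_mx iota c x).
{ by apply/matrixP => i j; rewrite mxE; exact: invmetric_sym. }
by rewrite !trmx_mul trmxK E mulmxA.
Qed.

Lemma tproj_at_sym p : (tproj_at p)^T = tproj_at p.
Proof. exact: tproj_sym. Qed.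

Lemma tproj_at_idem p : tproj_at p *m tproj_at p = tproj_at p.
Proof.
have [Ac cp] := chart_atP S p; have Ux := cmap_img cp.
have := tangent_mul_proj imm Ux Ac; rewrite /tproj_at.
move=> E; rewrite -mulmxA; rewrite E //.
Qed.

Lemma tproj_at_trace p : \tr (tproj_at p) = n%:R.
Proof.
have [Ac cp] := chart_atP S p; have Ux := cmap_img cp; have [sF fT] := imm Ac.
rewrite mxtrace_mulC mulmxA.
rewrite -[_ *m (tangent_mx _ _ _)^T]/(metric_mx iota (chart_at S p) (cmap (chart_at S p) p)).
by rewrite mulmxV ?(metric_unit fT)// mxtrace1.
Qed.

Lemma Ck_gradc c phi k a : atlas S c -> smooth_fun S phi ->
 Ck k (cimg c) (fun x => gradc iota c phi x 0 a : R^o).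
Proof.
move=> Ac sp; have [sF fT] := imm Ac; have oU := @open_cimg _ _ _ c.
apply: (@Ck_eq _ _ _ _ _ (fun x => \sum_j (\sum_i partial i (phi \o cinv c : _ -> R^o) x * invmx (metric_mx iota c x) i j) * tangent_mx iota c x j a)) => //.
{ move=> x Ux; rewrite [RHS]mxE; apply: eq_bigr => j _; congr (_ * _).
 by rewrite [RHS]mxE; apply: eq_bigr => i _; rewrite [X in _ = X * _]mxE. }
apply: Ck_sum => // j _; apply: CkM => //; last exact: Ck_tangent.
apply: Ck_sum => // i _; apply: CkM => //; last exact: Ck_invmetric.
exact: (CkS i (sp c Ac k.+1)).
Qed.

Lemma chart_continuous (f : M -> R) : (forall c, atlas S c -> exists g : 'rV[R]_n -> R^o,
  Ck 0 (cimg c) g /\ forall p, cdom c p -> f p = g (cmap c p)) -> continuous f.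
Proof.
move=> H p; have [c Ac cp] := atlas_cover S p; have [g [Cg gE]] := H c Ac.
have C : {for p, continuous (g \o cmap c)}.
{ apply: continuous_comp; first exact: cmap_continuous.
 by apply: (Ck_continuous Cg); exact: cmap_img. }
have N : nbhs p (cdom c) by apply: open_nbhs_nbhs; split => //; exact: open_cdom.
have E : {near p, g \o cmap c =1 f} by apply: filterS N => q cq; rewrite gE.
have Ep : f p = (g \o cmap c) p by rewrite gE.
rewrite /continuous_at Ep; apply: cvg_trans C; exact: (near_eq_cvg E).
Qed.

Lemma grad_continuous phi a : smooth_fun S phi -> continuous (fun p => grad phi p 0 a).
Proof.
move=> sp; apply: chart_continuous => c Ac.
exists (fun x => gradc iota c phi x 0 a); split; first exact: Ck_gradc.
by move=> p cp; rewrite (grad_chart imm Ac cp sp).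
Qed.

Lemma Ck_sff c i j e : atlas S c -> Ck 0 (cimg c) (fun x => sff iota c x i j 0 e : R^o).
Proof.
move=> Ac; have [sF fT] := imm Ac; have oU := @open_cimg _ _ _ c.
have Cv b : Ck 0 (cimg c) (fun x => partial i (partial j (iota \o cinv c)) x 0 b : R^o).
{ apply: (@Ck_row _ _ _ 0 (cimg c) (partial i (partial j (iota \o cinv c)))) => //.
 exact: (CkS i (CkS j (sF 2%N))). }
apply: (@Ck_eq _ _ _ _ _ (fun x => partial i (partial j (iota \o cinv c)) x 0 e -
 \sum_d (\sum_k (\sum_b partial i (partial j (iota \o cinv c)) x 0 b * tangent_mx iota c x k b) * invmx (metric_mx iota c x) k d) * tangent_mx iota c x d e)) => //.
{ move=> x Ux; rewrite [RHS]mxE; congr (_ + _).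
 rewrite [RHS]mxE; congr (- _); rewrite [RHS]mxE; apply: eq_bigr => d _; congr (_ * _).
 rewrite [RHS]mxE; apply: eq_bigr => k _; congr (_ * _).
 by rewrite [RHS]mxE; apply: eq_bigr => b _; rewrite [X in _ = _ * X]mxE. }
refine (CkD oU (Cv e) (CkN oU _)).
apply: Ck_sum => // d _; apply: CkM => //; last exact: Ck_tangent.
apply: Ck_sum => // k _; apply: CkM => //; last exact: Ck_invmetric.
apply: Ck_sum => // b _; exact: (CkM oU (Cv b) (Ck_tangent sF 0 k b)).
Qed.

Lemma A2_continuous : continuous (A2 S iota).
Proof.
apply: chart_continuous => c Ac; have [sF fT] := imm Ac; have oU := @open_cimg _ _ _ c.
exists (sff_sqnorm iota c); split; last by move=> p cp; exact: A2_chart.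
apply: Ck_sum => // i _; apply: Ck_sum => // j _; apply: Ck_sum => // k _; apply: Ck_sum => // l _.
apply: CkM => //; first by apply: CkM => //; exact: Ck_invmetric.
apply: Ck_sum => // e _; apply: CkM => //; exact: Ck_sff.
Qed.

End Gradient.

(** * The divergence formula on the manifold *)

Section FirstVariation.
Context {R : realType} {n : nat} {M : ptopologicalType}.
Variables (S : smooth_manifold R n M) (iota : M -> 'rV[R]_n.+1).
Variable mu : {measure set (borelType M) -> \bar R}.
Hypothesis imm : is_immersion S iota.
Hypothesis Hmu : is_riemannian_volume S iota mu.
Implicit Types (f phi : M -> R).

Lemma bounded_compact_integrable f K B : measurable_fun setT (f : borelType M -> R) -> compact K ->
 (forall p, ~ K p -> f p = 0) -> (forall p, `|f p| <= B) -> L1 mu f.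
Proof.
move=> mf cK f0 fB; have [mK Koo] := mu_compact_lty imm Hmu cK.
by apply: (@bounded_integrable _ _ _ mu f setT K B) => // p _; (exact: f0 || exact: fB).
Qed.

Lemma continuous_compact_integrable f K : continuous f -> compact K ->
 (forall p, ~ K p -> f p = 0) -> L1 mu f.
Proof.
move=> cf cK f0; have [B B0 fB] := @compact_ubound R M K f cK (fun p _ => cf p).
apply: (@bounded_compact_integrable f K B) => //; first exact: measurable_continuous.
move=> p; have [Kp|nK] := pselect (K p); first exact: fB.
by rewrite f0// normr0 ltW.
Qed.

Lemma Rintegral_supported f (D : set M) : measurable (D : set (borelType M)) ->
 measurable_fun setT (f : borelType M -> R) -> (forall p, ~ D p -> f p = 0) ->
 \int[mu]_p f p = \int[mu]_(p in (D : set (borelType M))) f p.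
Proof.
move=> mD mf f0; rewrite [RHS]Rintegral_mkcond; apply: eq_Rintegral => p _.
rewrite patchE; case: ifPn => // /negP nD; apply: f0 => Dp; apply: nD; by rewrite inE.
Qed.

Hypothesis minimal : is_minimal S iota.

(** Inside one chart this is [chart_first_variation] after a change of variables; the general case
    follows by chart induction. *)
Lemma first_variation phi a : smooth_fun S phi -> compactly_supported setT phi ->
 \int[mu]_p (grad S iota phi p 0 a) = 0.
Proof.
move=> sp cp.
(* Smoothness and compact support are carried in the predicate, so that in the additive step both
   gradients are known to be integrable. *)
suff [] : smooth_fun S phi /\ compactly_supported setT phi /\ \int[mu]_p (grad S iota phi p 0 a) = 0 by move=> _ [].
move: phi sp cp; apply: (@chart_induction R n M S (fun phi => smooth_fun S phi /\ compactly_supported setT phi /\ \int[mu]_p (grad S iota phi p 0 a) = 0)).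
- split; first exact: smooth_cst.
 split; first by exists set0 => //; split => //; exact: compact0.
 rewrite (_ : (fun p => _) = cst 0) ?Rintegral_cst ?mul0r//.
 by apply/funext => p; rewrite (@grad_support _ _ _ S iota (fun=> 0) set0)// ?mxE//; exact: closed0.
- move=> phi psi [sp [[K [cK _] p0] Ip]] [sq [[L [cL _] q0] Iq]].
 have hM := manifold_hausdorff S.
 have clK : closed K by exact: compact_closed.
 have clL : closed L by exact: compact_closed.
 split; first exact: smooth_funD.
 split.
  exists (K `|` L); first by split => //; exact: compactU.
  by move=> p nKL; rewrite p0 ?q0 ?addr0// => H; apply: nKL; [right|left].
 transitivity (\int[mu]_p (grad S iota phi p 0 a + grad S iota psi p 0 a)).
  by apply: eq_Rintegral => p _; rewrite gradD// mxE.
 rewrite RintegralD// ?Ip ?Iq ?addr0//.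
  apply: (@continuous_compact_integrable _ K) => //; first exact: (grad_continuous imm).
  by move=> p nK; rewrite (grad_support S iota clK p0 nK) mxE.
 apply: (@continuous_compact_integrable _ L) => //; first exact: (grad_continuous imm).
 by move=> p nK; rewrite (grad_support S iota clL q0 nK) mxE.
- move=> c phi Ac sp [K [cK KU] p0]; split => //; split; first by exists K.
 have [sF fT] := imm Ac.
 have clK := closed_compact_manifold S cK.
 have cg := @grad_continuous R n M S iota imm phi a sp.
 have mg := @measurable_continuous R M _ cg.
 rewrite (@Rintegral_supported _ (cdom c))//; last first.
 { by move=> p nc; rewrite (grad_support S iota clK p0) ?mxE// => /KU. }
 { by apply: measurable_open; exact: open_cdom. }
 rewrite (Rintegral_chart imm Hmu Ac mg).
 rewrite -[RHS](@chart_first_variation R n M iota c sF fT (phi \o cinv c) (cmap c @` K) a) //.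
 + apply: eq_Rintegral => t; rewrite inE => Ut.
  have Dt : cdom c (cpoint c t) by exact: cinv_dom.
  rewrite (grad_chart imm Ac Dt sp) /cpoint cinvK// /gradc.
  rewrite mxE mulr_suml.
  transitivity (\sum_j \sum_i partial i (phi \o cinv c : _ -> R^o) (rv t) * (vol iota c (rv t) * (invmx (metric_mx iota c (rv t)) i j * tangent_mx iota c (rv t) j a))).
  { apply: eq_bigr => j _; rewrite mxE !mulr_suml; apply: eq_bigr => i _.
   rewrite [X in X * _ * _ * _ = _]mxE; ring. }
  rewrite exchange_big /=; apply: eq_bigr => i _.
  by rewrite /flux !mulr_sumr.
 + by move=> x Ux; exact: minimal.
 + exact: (sp c Ac 1%N).
 + by apply: continuous_compact => //; apply: continuous_in_subspaceT => p /set_mem /KU; exact: cmap_continuous.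
 + by move=> x [p /KU cp <-]; exact: cmap_img.
 + move=> x Ux nK; apply: p0 => Kx; apply: nK; exists (cinv c x) => //; exact: cinvK.
Qed.

End FirstVariation.

(** * Density and monotonicity *)

Lemma measurable_indic_comp {d d'} {X : measurableType d} {Y : measurableType d'} {R : realType}
 (E : set X) (f : X -> Y) (A : set Y) : measurable A -> measurable_fun E f ->
 measurable_fun E (fun x => \1_A (f x) : R).
Proof. by move=> mA mf; apply: (measurable_comp measurableT) => //. Qed.

(** * A lower bound for the volume of an ellipsoid *)

Section Ellipsoid.
Context {R : realType}.
Local Notation Rm := (measurableTypeR R).

Definition quadf {n : nat} (g : 'M[R]_n) (v : 'rV[R]_n) : R := (v *m g *m v^T) 0 0.

Lemma quadfE {n : nat} (g : 'M[R]_n) v : quadf g v = \sum_j (\sum_i v 0 i * g i j) * v 0 j.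
Proof. by rewrite /quadf mxE; apply: eq_bigr => j _; rewrite mxE [v^T _ _]mxE. Qed.

Lemma quadf_continuous {n : nat} (g : 'M[R]_n) : continuous (quadf g).
Proof.
have C : Ck 0 setT (fun v => \sum_j (\sum_i v 0 i * g i j) * v 0 j : R^o).
{ apply: Ck_sum => [|j _]; first exact: openT.
 apply: CkM; [exact: openT| |exact: Ck_coord openT].
 apply: Ck_sum => [|i _]; first exact: openT.
 by apply: CkM; [exact: openT|exact: Ck_coord openT|exact: (Ck_cst 0 (g i j) openT)]. }
move=> v; rewrite (_ : quadf g = (fun v => \sum_j (\sum_i v 0 i * g i j) * v 0 j)); first exact: (Ck_continuous C).
by apply/funext => w; exact: quadfE.
Qed.

Lemma measurable_quadf {n : nat} (g : 'M[R]_n) (m : R) (x : 'rV[R]_n) :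
 measurable ([set t | quadf g (rv t - x) <= m] : set (n.-tuple Rm)).
Proof.
have mf := measurable_shift_fun x (@quadf_continuous n g).
rewrite (_ : [set t | _] = (fun t => quadf g (rv t - x)) @^-1` `]-oo, m]%classic); last first.
 by [].
by rewrite -[X in measurable X]setTI; exact: mf.
Qed.

(** Completing the square in the first coordinate; the remaining form is the Schur complement. *)
Lemma schur_quadf {n : nat} (a : R) (b : 'rV[R]_n) (c : 'M[R]_n) (x : R) (w : 'rV[R]_n) : a != 0 ->
 quadf (block_mx a%:M b b^T c) (row_mx x%:M w : 'rV_(1 + n)) =
 a * (x + a^-1 * dotv b w) ^+ 2 + quadf (c - a^-1 *: (b^T *m b)) w.
Proof.
move=> a0; have bw : w *m b^T = (dotv b w)%:M.
{ by rewrite [LHS]mx11_scalar -dotvE dotvC. }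
have wb : b *m w^T = (dotv b w)%:M.
{ by rewrite [LHS]mx11_scalar -dotvE. }
rewrite /quadf mul_row_block tr_row_mx mul_row_col !mulmxDl tr_scalar_mx.
rewrite mulmxBr mulmxBl -scalemxAr -scalemxAl mulmxA -[w *m b^T *m b *m w^T]mulmxA bw.
rewrite -[x%:M *m b *m _]mulmxA wb -!scalar_mxM.
by rewrite !mxE !mulr1n; field.
Qed.

Lemma schur_det {n : nat} (a : R) (b : 'rV[R]_n) (c : 'M[R]_n) : a != 0 ->
 \det (block_mx a%:M b b^T c) = a * \det (c - a^-1 *: (b^T *m b)).
Proof.
move=> a0.
have -> : block_mx a%:M b b^T c =
 block_mx (1%:M : 'M[R]_1) 0 (a^-1 *: b^T) 1%:M *m block_mx a%:M b 0 (c - a^-1 *: (b^T *m b)).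
{ rewrite mulmx_block !mul1mx !mul0mx !addr0.
 congr block_mx; first by rewrite mul_mx_scalar scalerA mulfV// scale1r.
 by rewrite -scalemxAl addrC subrK. }
by rewrite det_mulmx det_lblock det_ublock !det1 mul1r mul1r det_scalar.
Qed.

(** Induction by Schur complements. The bound n r^2 allots r^2 to each completed square, so above a
    point of the smaller ellipsoid lies a full interval of length 2r / sqrt a, and the factors
    multiply to (2r)^n / sqrt(det g). Positivity of the determinant comes along, one pivot at a
    time. *)
Lemma ellipsoid_volume {n : nat} (g : 'M[R]_n) (r : R) : 0 < r -> g^T = g ->
 (forall v, v != 0 -> 0 < quadf g v) ->
 0 < \det g /\
 (((2 * r) ^+ n / Num.sqrt (\det g))%:E <= leb n [set t | quadf g (rv t) <= n%:R * r ^+ 2]%R)%E.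
Proof.
move=> r0; elim: n g => [|n IH] g gs gpos.
 rewrite det_mx00 sqrtr1 divr1 expr0 /=; split => //.
 rewrite diracE mem_set//= mul0r quadfE big_ord0//.
pose a := g 0 0; pose b : 'rV[R]_n := ursubmx (g : 'M[R]_(1 + n)); pose c : 'M[R]_n := drsubmx (g : 'M[R]_(1 + n)).
have gE : g = block_mx a%:M b b^T c.
{ have E1 : ulsubmx (g : 'M[R]_(1 + n)) = a%:M.
  by rewrite [LHS]mx11_scalar; congr (_%:M); rewrite !mxE; congr (g _ _); apply: val_inj.
 have gs1 : (g : 'M[R]_(1 + n))^T = g := gs.
 have E2 : dlsubmx (g : 'M[R]_(1 + n)) = b^T by rewrite /b trmx_ursub gs1.
 by rewrite -E1 -E2 submxK. }
have quadE x w : quadf g (row_mx x%:M w : 'rV_(1 + n)) = quadf (block_mx a%:M b b^T c) (row_mx x%:M w : 'rV_(1 + n)) by rewrite -gE.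
have rne (w : 'rV[R]_n) (x : R) : (x != 0) || (w != 0) -> (row_mx x%:M w : 'rV[R]_(1 + n)) != 0.
{ move=> H; apply/eqP => E; move: H; have := E; rewrite -(@row_mx0 _ 1 1 n) => /eq_row_mx[/matrixP/(_ 0 0) + ->].
 by rewrite !mxE eqxx mulr1n => ->; rewrite !eqxx. }
have a0 : 0 < a.
{ have := gpos (row_mx 1%:M (0 : 'rV[R]_n)) (rne _ _ _); rewrite oner_neq0 => /(_ isT).
 rewrite quadE /quadf mul_row_block !mul0mx !addr0 tr_row_mx mul_row_col trmx0 mulmx0 addr0.
 by rewrite tr_scalar_mx mul1mx mulmx1 mxE eqxx mulr1n. }
have an : a != 0 by rewrite gt_eqF.
pose g' := c - a^-1 *: (b^T *m b).
have gs' : g'^T = g'.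
{ rewrite /g' linearB /= linearZ /= trmx_mul trmxK; congr (_ - _).
 by rewrite /c trmx_drsub gs. }
have gpos' w : w != 0 -> 0 < quadf g' w.
{ move=> w0; have := gpos (row_mx (- (a^-1 * dotv b w))%:M w) (rne _ _ _); rewrite w0 orbT => /(_ isT).
 by rewrite quadE schur_quadf// addNr expr0n mulr0 add0r. }
have [d0 IH'] := IH g' gs' gpos'.
have dE : \det g = a * \det g' by rewrite gE schur_det.
rewrite dE; split; first exact: mulr_gt0.
rewrite sqrtrM ?(ltW a0)//.
pose A := [set t : n.+1.-tuple Rm | quadf g (rv t) <= n.+1%:R * r ^+ 2].
pose B := [set t : n.-tuple Rm | quadf g' (rv t) <= n%:R * r ^+ 2].
have mA : measurable A.
{ have := measurable_quadf g (n.+1%:R * r ^+ 2) 0; rewrite (_ : [set t | _] = A)//.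
 by apply/seteqP; split => t /=; rewrite subr0. }
have mB : measurable B.
{ have := measurable_quadf g' (n%:R * r ^+ 2) 0; rewrite (_ : [set t | _] = B)//.
 by apply/seteqP; split => t /=; rewrite subr0. }
suff : (((2 * r) ^+ n.+1 / (Num.sqrt a * Num.sqrt (\det g')))%:E <= \int[leb n.+1]_t (\1_A t)%:E)%E.
 by rewrite integral_indic// setIT.
rewrite ge0_integral_leb_cons//; last first.
 by apply/measurable_EFinP; exact: measurable_indic.
have sa0 : 0 < Num.sqrt a by rewrite sqrtr_gt0.
via (\int[leb n]_t ((2 * r / Num.sqrt a)%:E * (\1_B t)%:E))%E.
{ rewrite ge0_integralZl_EFin//; last 2 first.
 - by apply/measurable_EFinP; exact: measurable_indic.
 - by rewrite divr_ge0 ?mulr_ge0 ?sqrtr_ge0// ltW.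
 rewrite integral_indic// setIT.
 via ((2 * r / Num.sqrt a)%:E * ((2 * r) ^+ n / Num.sqrt (\det g'))%:E)%E.
  rewrite -EFinM lee_fin exprS le_eqVlt; apply/orP; left; apply/eqP.
  by rewrite invfM; ring.
 by apply: lee_wpmul2l => //; rewrite lee_fin divr_ge0 ?mulr_ge0 ?sqrtr_ge0// ltW. }
have mAE : measurable_fun setT (EFin \o \1_A : n.+1.-tuple Rm -> \bar R).
{ by apply/measurable_EFinP; exact: measurable_indic. }
apply: ge0_le_integral => //.
- by move=> t _; rewrite mule_ge0// lee_fin divr_ge0 ?mulr_ge0 ?sqrtr_ge0// ltW.
- by apply: measurable_funeM; apply/measurable_EFinP; exact: measurable_indic.
- by apply: (@measurable_fun_leb_inner R n (EFin \o \1_A)) => // t; rewrite lee_fin.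
move=> t _; rewrite [\1_B t]indicE; case: (boolP (t \in B)) => [/set_mem Bt|_]; last first.
 by rewrite mule0; apply: integral_ge0.
(* The slice over t contains the interval of half-length r / sqrt a centred at -l, where the
   completed square vanishes. *)
pose l := a^-1 * dotv b (rv t); pose I := `[- l - r / Num.sqrt a, - l + r / Num.sqrt a]%classic : set Rm.
have rs0 : 0 < r / Num.sqrt a by rewrite divr_gt0.
have mI : measurable I by exact: measurable_itv.
rewrite mule1; via (\int[@lebesgue_measure R]_x (\1_I x)%:E)%E.
{ have LI : @lebesgue_measure R I = (2 * r / Num.sqrt a)%:E.
 { apply: (eq_trans (@lebesgue_measure_itv R (`[(- l - r / Num.sqrt a)%R, (- l + r / Num.sqrt a)%R]))).
  rewrite /= lte_fin ifT; last by lra.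
  by rewrite -EFinD; congr EFin; ring. }
 by rewrite integral_indic// setIT [X in (_ <= X)%E]LI. }
apply: ge0_le_integral => //.
- by apply/measurable_EFinP; exact: (measurable_indic mI).
- apply/measurable_EFinP; apply: (measurable_indic_comp mA).
 exact: (measurableT_comp (@measurable_consp R n) (measurable_pair2 t)).
move=> x _; rewrite lee_fin !indicE; case: (boolP (x \in I)) => // /set_mem; rewrite /I /= in_itv /= => /andP[x1 x2].
rewrite mem_set// /A /=.
have rvE : rv (consp (x, t)) = (row_mx x%:M (rv t) : 'rV_(1 + n)).
{ apply/rowP => j; rewrite mxE.
 case: (unliftP ord0 j) => [k|] ->.
  rewrite consp_tnthS; transitivity ((row_mx x%:M (rv t) : 'rV[R]_(1 + n)) 0 (rshift 1 k)).
   by rewrite row_mxEr mxE.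
  by congr (fun_of_matrix _ _ _); apply: val_inj.
 transitivity ((row_mx x%:M (rv t) : 'rV[R]_(1 + n)) 0 (lshift n ord0)).
  by rewrite row_mxEl mxE.
 by congr (fun_of_matrix _ _ _); apply: val_inj. }
rewrite rvE quadE schur_quadf//.
rewrite -natr1 mulrDl mul1r addrC; apply: lerD; first exact: Bt.
have : (x + l) ^+ 2 <= (r / Num.sqrt a) ^+ 2.
{ by rewrite -real_normK ?num_real// lerXn2r ?nnegrE ?(ltW rs0)// ler_norml; lra. }
rewrite expr_div_n sqr_sqrtr ?(ltW a0)// => H.
by rewrite mulrC -ler_pdivlMr.
Qed.

Lemma ellipsoid_volume_at {n : nat} (g : 'M[R]_n) (r : R) (x : 'rV[R]_n) : 0 < r -> g^T = g ->
 (forall v, v != 0 -> 0 < quadf g v) ->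
 (((2 * r) ^+ n / Num.sqrt (\det g))%:E <= leb n [set t | quadf g (rv t - x) <= n%:R * r ^+ 2]%R)%E.
Proof.
move=> r0 gs gp; apply: le_trans (proj2 (ellipsoid_volume r0 gs gp)) _.
pose B := [set t : n.-tuple Rm | quadf g (rv t - x) <= n%:R * r ^+ 2].
have mB : measurable B by exact: measurable_quadf.
have := @ge0_integral_leb_shift R n (EFin \o \1_B) x; rewrite -/B.
rewrite [X in _ -> _ -> _ = X]integral_indic// setIT => <-; last 2 first.
- by apply/measurable_EFinP; exact: measurable_indic.
- by move=> t; rewrite lee_fin.
pose A := [set t : n.-tuple Rm | quadf g (rv t) <= n%:R * r ^+ 2].
have mA : measurable A.
{ have := measurable_quadf g (n%:R * r ^+ 2) 0; rewrite (_ : [set t | _] = A)//.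
 by apply/seteqP; split => t /=; rewrite subr0. }
suff : (\int[leb n]_t (\1_A t)%:E <= \int[leb n]_t (EFin \o \1_B) (shiftt x t))%E.
 by rewrite [X in (X <= _)%E -> _]integral_indic// setIT.
apply: le_of_eq; apply: eq_integral => t _; congr (_%:E).
congr ((_ : bool)%:R); apply/idP/idP => /set_mem H; apply/mem_set; move: H; by rewrite /B /= rv_shiftt addrK.
Qed.

End Ellipsoid.

Lemma continuous_enorm_dist {R : realType} {m : nat} {X : topologicalType} (f : X -> 'rV[R]_m) (a : 'rV[R]_m) :
 continuous f -> continuous (fun q => enorm (f q - a)).
Proof.
move=> cf q.
have C : Ck 0 setT (fun v : 'rV[R]_m => \sum_j (v 0 j - a 0 j) * (v 0 j - a 0 j) : R^o).
{ apply: Ck_sum => [|j _]; first exact: openT.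
 have H := CkD openT (Ck_coord 0 j openT) (Ck_cst 0 (- a 0 j : R^o) openT).
 exact: (CkM openT H H). }
have -> : (fun q => enorm (f q - a)) = @Num.sqrt R \o ((fun v : 'rV[R]_m => \sum_j (v 0 j - a 0 j) * (v 0 j - a 0 j)) \o f).
{ by apply/funext => r; congr (Num.sqrt _); apply: eq_bigr => j _; rewrite !mxE. }
apply: continuous_comp; last exact: sqrt_continuous.
apply: continuous_comp; [exact: cf|exact: (Ck_continuous C)].
Qed.

Lemma half_lt_of_dist {R : realType} (a b : R) : `|a - b| < a / 2 -> a / 2 < b.
Proof. by rewrite ltr_distlC => /andP[+ _]; lra. Qed.

Lemma density_radius {R : realFieldType} (s N : R) : 1 <= N -> N * (s / (4 * N)) ^+ 2 <= (s / 4) ^+ 2.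
Proof.
move=> N1; have N0 : N != 0 by lra.
rewrite (_ : N * _ = (s / 4) ^+ 2 * N^-1); last by field.
by apply: ler_piMr; [exact: sqr_ge0|rewrite invf_le1; lra].
Qed.

Lemma row_sub3 {R : realType} {m : nat} (u v w : 'rV[R]_m) a : (u - v - w) 0 a = u 0 a - v 0 a - w 0 a.
Proof. by rewrite !mxE. Qed.

Lemma quarters_lt {R : realFieldType} (a b s : R) : 0 < s -> a <= s / 4 -> b <= s / 4 -> a + b < s.
Proof. lra. Qed.

Lemma indic_ge0 {R : realType} {T : Type} (A : set T) (x : T) : 0 <= \1_A x :> R.
Proof. by []. Qed.

(** * Lower density of the measure at a point *)

Section Density.
Context {R : realType} {n : nat} {M : ptopologicalType}.
Local Notation Rm := (measurableTypeR R).
Variables (S : smooth_manifold R n M) (iota : M -> 'rV[R]_n.+1).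
Variable mu : {measure set (borelType M) -> \bar R}.
Hypothesis imm : is_immersion S iota.
Hypothesis Hmu : is_riemannian_volume S iota mu.

Lemma row_mulmx_le {k m} (v : 'rV[R]_k) (B : 'M[R]_(k, m)) :
 exists2 C : R, 0 < C & forall v : 'rV[R]_k, `|v *m B| <= C * enorm v.
Proof.
exists (1 + \sum_i \sum_j `|B j i|); first by rewrite ltr_pwDl// sumr_ge0// => i _; rewrite sumr_ge0.
move=> w; apply: norm_coord_le => [|i]; first by rewrite mulr_ge0 ?enorm_ge0// addr_ge0// sumr_ge0// => j _; rewrite sumr_ge0.
rewrite mxE; apply: le_trans (ler_norm_sum _ _ _) _.
via (\sum_j enorm w * `|B j i|).
 by apply: ler_sum => j _; rewrite normrM ler_wpM2r// coord_le_enorm.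
rewrite -mulr_sumr mulrC ler_wpM2r ?enorm_ge0// (bigD1 i)//= [1 + _]addrC -addrA lerDl addr_ge0// sumr_ge0// => j _.
by rewrite sumr_ge0.
Qed.

(** With r = s/(4n) the factor (2r)^n of the ellipsoid volume is ((2n)^(-1) s)^n; the factor 1/2 is
    the guaranteed ratio of the volume density to its value at the centre. *)
Definition density_const : R := 2^-1 * (2 * n%:R)^-1 ^+ n.

(** Near p the map [iota] is close to its linear part T. Coordinate points y with |(y - x0) T| <=
    s/4 form an ellipsoid for the metric at p, and the linearization error is at most s/4 as well,
    so they are mapped into the ball of radius s. *)
Lemma density_lower p (N : set M) : (0 < n)%N -> open N -> N p ->
 exists2 s0 : R, 0 < s0 & forall s, 0 < s < s0 ->
  ((density_const * s ^+ n)%:E <= mu ([set q | N q /\ enorm (iota q - iota p)%R < s]%R : set (borelType M)))%E.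
Proof.
move=> n0 oN Np; have [c Ac cp] := atlas_cover S p; have [sF fT] := imm Ac.
have oU := @open_cimg _ _ _ c; have Ux := cmap_img cp.
set x0 := cmap c p; pose T := tangent_mx iota c x0; pose g := metric_mx iota c x0.
have v0 : 0 < vol iota c x0 by exact: (vol_gt0 fT Ux).
(* T^t g^(-1) is a right inverse of T, so C bounds |v| by |v T|. *)
have [C C0 HC] := @row_mulmx_le n.+1 n 0 (T^T *m invmx g).
have inv (v : 'rV[R]_n) : `|v| <= C * enorm (v *m T).
{ have := HC (v *m T); rewrite mulmxA -[v *m T *m T^T]mulmxA -[v *m (T *m T^T) *m _]mulmxA.
 by rewrite -[T *m T^T]/g mulmxV ?mulmx1// (metric_unit fT). }
have n1 : 0 < n.+1%:R :> R by rewrite ltr0n.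
(* The coordinatewise error eta * C * s/4, summed over n + 1 ambient coordinates, is exactly s/4. *)
pose eta := (n.+1%:R * C)^-1.
have eta0 : 0 < eta by rewrite invr_gt0 mulr_gt0.
have est : \forall h \near (0 : 'rV[R]_n), forall a, `|(iota \o cinv c) (h + x0) 0 a - (iota \o cinv c) x0 0 a - (h *m T) 0 a| <= eta * `|h|.
{ apply: (@filter_forall _ _ _ (nbhs (0 : 'rV[R]_n)) (nbhs_filter _)) => a.
 have := @Ck1_estimate R n (cimg c) (fun x => (iota \o cinv c) x 0 a) x0 eta oU (Ck_F sF 1 a) Ux eta0.
 apply: (@filterS _ _ (nbhs_filter _)) => h H; apply: le_trans H; rewrite [(h *m T) 0 a]mxE.
 apply: le_of_eq; congr (`| _ - _ |).
 by apply: eq_bigr => i _; rewrite /T (tangentE sF). }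
have cv : {for x0, continuous (vol iota c)} by exact: (Ck_continuous (Ck_vol sF fT 0) Ux).
have NU : nbhs x0 [set x | (cimg c x /\ N (cinv c x)) /\ vol iota c x0 / 2 < vol iota c x].
{ apply: filterI.
  apply: open_nbhs_nbhs; split; first exact: open_preimage_cinv.
  by rewrite /= /x0 cmapK.
 have h2 : 0 < vol iota c x0 / 2 by lra.
 have /cvgrPdist_lt/(_ _ h2) := cv; apply: (@filterS _ _ (nbhs_filter _)) => y /=.
 exact: half_lt_of_dist. }
move: est => /nbhs_norm0P[d1 /= d10 H1]; move: NU => /nbhs_ballP[d2 /= d20 H2].
exists (Num.min d1 d2 / C); first by rewrite divr_gt0// lt_min d10.
move=> s /andP[s0 ss].
have Cs : C * s < Num.min d1 d2 by rewrite mulrC -ltr_pdivlMr.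
pose A := [set q | N q /\ enorm (iota q - iota p) < s].
have ci : continuous iota.
{ move=> q; apply: continuous_rowP => b; exact: (smooth_continuous (smooth_fun_iota imm b)). }
have ce : continuous (fun q => enorm (iota q - iota p)) by exact: continuous_enorm_dist.
have oA : open A.
{ apply: openI => //; have /continuousP H := ce; have := H `]-oo, s[%classic (@interval_open R -oo%O (BLeft s) isT isT).
 by rewrite (_ : _ @^-1` _ = [set q | enorm (iota q - iota p) < s])//; apply/seteqP; split => q; rewrite /= in_itv. }
have mA : measurable (A : set (borelType M)) by exact: measurable_open.
via (mu ((A : set (borelType M)) `&` (cdom c : set (borelType M)))); last first.
{ apply: le_measure; [rewrite inE|rewrite inE; exact: mA|exact: subIsetl].
 by apply: measurableI => //; apply: measurable_open; exact: open_cdom. }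
rewrite (mu_chart Hmu Ac mA).
pose r := s / (4 * n%:R).
have nR : 0 < n%:R :> R by rewrite ltr0n.
have r0 : 0 < r by rewrite divr_gt0// mulr_gt0.
pose E := [set t : n.-tuple Rm | quadf g (rv t - x0) <= n%:R * r ^+ 2].
have mE : measurable E by exact: measurable_quadf.
have gE v : quadf g v = enorm (v *m T) ^+ 2 by rewrite enorm_sqr /quadf /g metric_quad.
have Ey (y : 'rV[R]_n) : quadf g (y - x0) <= n%:R * r ^+ 2 ->
 [/\ cimg c y, A (cinv c y) & vol iota c x0 / 2 < vol iota c y].
{ rewrite gE => H.
 have h : enorm ((y - x0) *m T) <= s / 4.
 { rewrite -(ler_pXn2r (_ : (0 < 2)%N))// ?nnegrE ?enorm_ge0 ?divr_ge0 ?(ltW s0)//.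
  by apply: le_trans H _; apply: density_radius; rewrite ler1n. }
 have hn : `|y - x0| <= C * (s / 4) by apply: le_trans (inv _) _; rewrite ler_pM2l.
 have hn' : `|y - x0| < Num.min d1 d2 by apply: le_lt_trans hn _; apply: lt_trans Cs; rewrite ltr_pM2l//; lra.
 move: hn'; rewrite lt_min => /andP[hd1 hd2].
 have [|[Ut Nt] vt] := H2 y; first by rewrite mx_norm_ball /ball_ /= distrC.
 split => //; split => //.
 have Hd := H1 (y - x0) hd1.
 have -> : iota (cinv c y) - iota p = (y - x0) *m T + ((iota \o cinv c) (y - x0 + x0) - (iota \o cinv c) x0 - (y - x0) *m T).
 { by rewrite [y - x0 + x0]subrK /= /x0 cmapK// [RHS]addrC subrK. }
 apply: le_lt_trans (enormD _ _) _.
 have : enorm ((iota \o cinv c) (y - x0 + x0) - (iota \o cinv c) x0 - (y - x0) *m T) <= n.+1%:R * (eta * (C * (s / 4))).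
 { apply: enorm_le_coord => [|a]; first by rewrite !mulr_ge0// ?ltW// divr_gt0.
  rewrite row_sub3; apply: le_trans (Hd a) _; apply: ler_wpM2l => //; exact: ltW. }
 rewrite (_ : n.+1%:R * _ = s / 4); last first.
  by rewrite mulrA mulrA /eta invfM; field; rewrite !gt_eqF.
 exact: quarters_lt. }
have EP (t : n.-tuple Rm) : E t -> [/\ cdomain c t, A (cpoint c t) & vol iota c x0 / 2 < vol iota c (rv t)].
{ by move=> /Ey. }
via (\int[leb n]_(t in E) (vol iota c x0 / 2)%:E)%E; last first.
{ via (\int[leb n]_(t in E) (\1_(A : set (borelType M)) (cpoint c t) * vol iota c (rv t))%:E)%E.
  apply: ge0_le_integral => //.
  - by move=> t _; rewrite lee_fin divr_ge0// ltW.
  - apply/measurable_EFinP; apply: measurable_funM.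
    apply: (@measurable_indic_comp _ _ _ (borelType M) R _ _ A mA).
    have sE : E `<=` cdomain c by move=> t /EP[].
    exact: (measurable_funS (measurable_cdomain c) sE (@measurable_cpoint R n M c)).
   by apply: measurable_funS (measurable_vol imm Ac); [exact: measurable_cdomain|move=> t /EP[]].
  - by move=> t /EP[_ At vt]; rewrite lee_fin indicE mem_set// mul1r ltW.
 apply: ge0_subset_integral => //.
 - exact: measurable_cdomain.
 - apply/measurable_EFinP; apply: measurable_funM; last exact: (measurable_vol imm Ac).
  apply: (@measurable_indic_comp _ _ _ (borelType M) R _ _ A mA); exact: measurable_cpoint.
 - by move=> t _; rewrite lee_fin; apply: mulr_ge0; [exact: indic_ge0|exact: sqrtr_ge0].
 - by move=> t /EP[]. }
rewrite integral_cst//.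
have gpos v : v != 0 -> 0 < quadf g v.
{ move=> vn; rewrite gE exprn_gt0// lt_def enorm_ge0 andbT; apply: contraNN vn => /eqP e0.
 by have := inv v; rewrite e0 mulr0 normr_le0. }
have V := @ellipsoid_volume_at R n g r x0 r0 (metric_sym iota c x0) gpos.
apply: le_trans (lee_wpmul2l _ V); last by rewrite lee_fin divr_ge0// ltW.
rewrite lee_fin /density_const -[Num.sqrt _]/(vol iota c x0).
apply: le_of_eq.
rewrite (_ : 2 * r = (2 * n%:R)^-1 * s); last by rewrite /r; field; rewrite gt_eqF.
by rewrite exprMn; field; rewrite gt_eqF.
Qed.

End Density.

(** * Bounded measurable functions that vanish off a compact set *)

Section BoundedSupported.
Context {R : realType} {n : nat} {M : ptopologicalType}.
Variables (S : smooth_manifold R n M) (iota : M -> 'rV[R]_n.+1).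
Variable mu : {measure set (borelType M) -> \bar R}.
Hypothesis imm : is_immersion S iota.
Hypothesis Hmu : is_riemannian_volume S iota mu.
Variable K : set M.
Hypothesis cK : compact K.
Implicit Types f g : M -> R.

(** A class stable under sums, scaling and restriction to measurable sets, all of whose members are
    integrable, so integrability need not be rechecked in each estimate. *)
Definition nice f := [/\ measurable_fun setT (f : borelType M -> R), exists B, forall p, `|f p| <= B &
 forall p, ~ K p -> f p = 0].

Lemma nice_integrable f : nice f -> L1 mu f.
Proof. by move=> [mf [B fB] f0]; exact: (bounded_compact_integrable imm Hmu mf cK f0 fB). Qed.

Lemma nice_continuous f : continuous f -> (forall p, ~ K p -> f p = 0) -> nice f.
Proof.
move=> cf f0; split => //; first exact: measurable_continuous.
have [B B0 fB] := @compact_ubound R M K f cK (fun p _ => cf p).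
exists B => p; have [Kp|nK] := pselect (K p); first exact: fB.
by rewrite f0// normr0 ltW.
Qed.

Lemma nice0 : nice (fun=> 0).
Proof. by split => //; exists 0 => p; rewrite normr0. Qed.

Lemma niceD f g : nice f -> nice g -> nice (fun p => f p + g p).
Proof.
move=> [mf [B fB] f0] [mg [C gC] g0]; split.
- exact: (measurable_funD mf mg).
- by exists (B + C) => p; apply: le_trans (ler_normD _ _) _; exact: lerD.
- by move=> p nK; rewrite f0// g0// addr0.
Qed.

Lemma niceZ (c : R) f : nice f -> nice (fun p => c * f p).
Proof.
move=> [mf [B fB] f0]; split.
- by apply: measurable_funM => //; exact: measurable_cst.
- by exists (`|c| * B) => p; rewrite normrM ler_wpM2l.
- by move=> p nK; rewrite f0// mulr0.
Qed.

Lemma nice_sum (I : Type) (s : seq I) (f : I -> M -> R) : (forall i, nice (f i)) ->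
 nice (fun p => \sum_(i <- s) f i p).
Proof.
move=> nf; elim: s => [|i s IH].
 by rewrite (_ : (fun p => _) = fun=> 0); [exact: nice0|apply/funext => p; rewrite big_nil].
rewrite (_ : (fun p => _) = fun p => f i p + \sum_(j <- s) f j p); first exact: niceD.
by apply/funext => p; rewrite big_cons.
Qed.

Lemma nice_indic (A : set M) f : measurable (A : set (borelType M)) -> nice f -> nice (fun p => \1_A p * f p).
Proof.
move=> mA [mf [B fB] f0]; split.
- by apply: measurable_funM => //; exact: (@measurable_indic _ (borelType M) R setT A mA).
- exists B => p; rewrite normrM; apply: le_trans (fB p).
 rewrite -[X in _ <= X]mul1r; apply: ler_wpM2r => //; rewrite indicE; case: (_ \in _); rewrite ?normr1 ?normr0//.
- by move=> p nK; rewrite f0// mulr0.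
Qed.

Lemma nice_RintegralD f g : nice f -> nice g ->
 \int[mu]_p (f p + g p) = \int[mu]_p f p + \int[mu]_p g p.
Proof. by move=> nf ng; rewrite RintegralD//; exact: nice_integrable. Qed.

Lemma nice_RintegralZ (c : R) f : nice f -> \int[mu]_p (c * f p) = c * \int[mu]_p f p.
Proof. by move=> nf; rewrite RintegralZl//; exact: nice_integrable. Qed.

Lemma nice_Rintegral_sum (I : Type) (s : seq I) (f : I -> M -> R) : (forall i, nice (f i)) ->
 \int[mu]_p (\sum_(i <- s) f i p) = \sum_(i <- s) \int[mu]_p f i p.
Proof.
by move=> nf; apply: Rintegral_sum => i; exact: nice_integrable.
Qed.

Lemma nice_Rintegral_le f g : nice f -> nice g -> (forall p, f p <= g p) ->
 \int[mu]_p f p <= \int[mu]_p g p.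
Proof. by move=> nf ng fg; apply: le_Rintegral => //; exact: nice_integrable. Qed.

End BoundedSupported.

Lemma dotv_projE {R : realType} {m : nat} (P : 'M[R]_m) (v : 'rV[R]_m) : P^T = P -> P *m P = P ->
 dotv v (v *m P) = dotv (v *m P) (v *m P).
Proof. by move=> Ps Pi; rewrite !dotvE !trmx_mul Ps -[in RHS]mulmxA [P *m (P *m _)]mulmxA Pi. Qed.

(** * The weighted monotonicity inequality *)

Section Monotonicity.
Context {R : realType} {n : nat} {M : ptopologicalType}.
Variables (S : smooth_manifold R n M) (iota : M -> 'rV[R]_n.+1).
Variable mu : {measure set (borelType M) -> \bar R}.
Hypothesis imm : is_immersion S iota.
Hypothesis Hmu : is_riemannian_volume S iota mu.
Hypothesis minimal : is_minimal S iota.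
Hypothesis n0 : (0 < n)%N.
Local Notation grad := (grad S iota).

Lemma iota_continuous : continuous iota.
Proof.
by move=> q; apply: continuous_rowP => b; exact: (smooth_continuous (smooth_fun_iota imm b)).
Qed.

Lemma smooth_fun_sqrt (phi : M -> R) : (forall p, 0 < phi p) -> smooth_fun S phi ->
 smooth_fun S (fun p => Num.sqrt (phi p)).
Proof. by move=> p0 sp c Ac k; apply: Ck_sqrt => [x _|]; [exact: p0|exact: sp]. Qed.

Lemma enorm_grad_continuous phi : smooth_fun S phi -> continuous (fun p => enorm (grad phi p)).
Proof.
move=> sp; rewrite (_ : (fun p => _) = (fun p => enorm (grad phi p - 0))); last by apply/funext => p; rewrite subr0.
by apply: continuous_enorm_dist => q; apply: continuous_rowP => b; exact: (grad_continuous imm).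
Qed.

Section Weight.
Variables (xi : 'rV[R]_n.+1) (s : R).
Hypothesis s0 : 0 < s.
Implicit Types u phi : M -> R.

Definition sqdist p : R := \sum_a (iota p 0 a - xi 0 a) ^+ 2.

(** A smooth substitute for the reciprocal of the larger of s and the distance to [xi]; being
    smooth, its powers may enter the divergence formula directly. *)
Definition weight p : R := (Num.sqrt (s ^+ 2 + sqdist p))^-1.

Lemma sqdist_ge0 p : 0 <= sqdist p.
Proof. by rewrite sumr_ge0// => a _; exact: sqr_ge0. Qed.

Lemma sqdistE p : sqdist p = enorm (iota p - xi) ^+ 2.
Proof. by rewrite enorm_sqr; apply: eq_bigr => a _; rewrite !mxE. Qed.

Lemma shifted_sqdist_gt0 p : 0 < s ^+ 2 + sqdist p.
Proof. by rewrite ltr_pwDl ?sqdist_ge0// exprn_gt0. Qed.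

Lemma weight_gt0 p : 0 < weight p.
Proof. by rewrite invr_gt0 sqrtr_gt0 shifted_sqdist_gt0. Qed.

Lemma weight_sqr p : weight p ^+ 2 * (s ^+ 2 + sqdist p) = 1.
Proof.
by rewrite exprVn sqr_sqrtr ?(ltW (shifted_sqdist_gt0 p))// mulVf// gt_eqF// shifted_sqdist_gt0.
Qed.

Lemma smooth_fun_dist a : smooth_fun S (fun p => iota p 0 a - xi 0 a).
Proof. by apply: smooth_funB; [exact: (smooth_fun_iota imm)|exact: smooth_cst]. Qed.

Lemma smooth_fun_shifted_sqdist : smooth_fun S (fun p => s ^+ 2 + sqdist p).
Proof.
apply: smooth_funD; first exact: smooth_cst.
by apply: smooth_fun_sum => a; apply: smooth_funX; exact: smooth_fun_dist.
Qed.

Lemma smooth_fun_weight : smooth_fun S weight.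
Proof.
apply: smooth_funV => [p|]; first by rewrite gt_eqF// sqrtr_gt0 shifted_sqdist_gt0.
by apply: smooth_fun_sqrt; [exact: shifted_sqdist_gt0|exact: smooth_fun_shifted_sqdist].
Qed.

Lemma grad_cst (c : R) p : grad (fun=> c) p = 0.
Proof.
have E : grad (fun=> c) p = 0 *: grad (fun=> c) p + 0 *: grad (fun=> c) p; last by rewrite E !scale0r addr0.
apply: grad_linear => i d; rewrite !mul0r addr0.
by rewrite /partial derive_cst.
Qed.

Lemma grad_dist a p : grad (fun q => iota q 0 a - xi 0 a) p = row a (tproj_at S iota p).
Proof.
rewrite gradD ?grad_cst ?addr0 ?(grad_iota imm)//; [exact: (smooth_fun_iota imm)|exact: smooth_cst].
Qed.

Lemma grad_sum (I : Type) (r : seq I) (f : I -> M -> R) p : (forall i, smooth_fun S (f i)) ->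
 grad (fun q => \sum_(i <- r) f i q) p = \sum_(i <- r) grad (f i) p.
Proof.
move=> sf; elim: r => [|i r IH].
 rewrite big_nil -[RHS](grad_cst 0 p); congr (grad _ p).
 by apply/funext => q; rewrite big_nil.
rewrite big_cons -IH -gradD//; last exact: smooth_fun_sum.
by congr (grad _ p); apply/funext => q; rewrite big_cons.
Qed.

Lemma grad_sqdist p : grad (fun q => s ^+ 2 + sqdist q) p = 2 *: ((iota p - xi) *m tproj_at S iota p).
Proof.
rewrite gradD; [|exact: smooth_cst|by apply: smooth_fun_sum => a; apply: smooth_funX; exact: smooth_fun_dist].
rewrite grad_cst add0r grad_sum; last by move=> a; apply: smooth_funX; exact: smooth_fun_dist.
rewrite mulmx_sum_row scaler_sumr; apply: eq_bigr => a _.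
transitivity (grad (fun q => (iota q 0 a - xi 0 a) * (iota q 0 a - xi 0 a)) p).
 by [].
rewrite gradM; [|exact: smooth_fun_dist|exact: smooth_fun_dist].
by rewrite grad_dist -scalerDl scalerA !mxE mulr_natl.
Qed.

Lemma is_derive_inv_sqrtX (t : R) : 0 < t ->
 is_derive t (1 : R) (fun x => (Num.sqrt x)^-1 ^+ n) (- (n%:R / 2) * (Num.sqrt t)^-1 ^+ n.+2).
Proof.
move=> t0; have q0 : Num.sqrt t != 0 by rewrite gt_eqF// sqrtr_gt0.
have D := @is_deriveX _ _ _ n t 1 _ (@is_deriveV R _ _ _ _ q0 (is_derive1_sqrt t0)).
rewrite (_ : (fun x => _) = (fun y : R => (Num.sqrt y)^-1) ^+ n); last by rewrite exprfctE.
apply: (@is_derive_eq _ _ _ _ _ _ _ _ D).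
rewrite /GRing.scale /=; case: (n) n0 => // k _; rewrite !exprS.
by field.
Qed.

Lemma grad_weightX p :
 grad (fun q => weight q ^+ n) p = (- n%:R * weight p ^+ n.+2) *: ((iota p - xi) *m tproj_at S iota p).
Proof.
have := @grad_comp R n M S iota (fun x => (Num.sqrt x)^-1 ^+ n) _ (fun q => s ^+ 2 + sqdist q) p
 smooth_fun_shifted_sqdist (is_derive_inv_sqrtX (shifted_sqdist_gt0 p)).
rewrite -[LHS]/(grad (fun q => weight q ^+ n) p) => ->.
rewrite grad_sqdist scalerA; congr (_ *: _); by field.
Qed.

(** With y = iota - xi, the sum is the tangential divergence of u w^n y. It equals n u w^n + w^n <y,
    grad u> - n u w^(n+2) |y^T|^2, where n is the trace of the projection. Since |y^T| <= |y| and
    w^2 (s^2 + |y|^2) = 1, the terms without grad u leave at least n u s^2 w^(n+2); the gradient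
    term is bounded through |y| w <= 1. *)
Lemma weighted_div_ge u p : smooth_fun S u -> 0 <= u p ->
 n%:R * (u p * s ^+ 2 * weight p ^+ n.+2) - enorm (grad u p) * weight p ^+ n.-1 <=
 \sum_a grad (fun q => u q * weight q ^+ n * (iota q 0 a - xi 0 a)) p 0 a.
Proof.
move=> su u0; set y := iota p - xi; set P := tproj_at S iota p; set w := weight p.
have sw : smooth_fun S (fun q => weight q ^+ n) by apply: smooth_funX; exact: smooth_fun_weight.
have E a : grad (fun q => u q * weight q ^+ n * (iota q 0 a - xi 0 a)) p 0 a =
 u p * w ^+ n * P a a + w ^+ n * (y 0 a * grad u p 0 a) - n%:R * (u p * w ^+ n.+2) * (y 0 a * (y *m P) 0 a).
{ rewrite gradM; [|exact: smooth_funM|exact: smooth_fun_dist].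
 rewrite grad_dist gradM// grad_weightX.
 rewrite !mxE; ring. }
under eq_bigr do rewrite E.
rewrite sumrB big_split /= -!mulr_sumr -[\sum_i P i i]/(\tr P).
rewrite -[\sum_i y 0 i * (y *m P) 0 i]/(dotv y (y *m P)) (tproj_at_trace imm).
have H1 : dotv y (y *m tproj_at S iota p) <= sqdist p.
{ have Pi := tproj_at_idem imm p; have Ps := tproj_at_sym S iota p.
 have -> : dotv y (y *m tproj_at S iota p) = dotv (y *m tproj_at S iota p) (y *m tproj_at S iota p).
 { exact: dotv_projE. }
 by apply: le_trans (dotv_proj_le y Ps Pi) _; rewrite sqdistE enorm_sqr. }
have w0 : 0 < w := weight_gt0 p.
have W := weight_sqr p.
have yw : enorm y * w <= 1.
{ rewrite -(ler_pXn2r (_ : (0 < 2)%N))// ?nnegrE ?mulr_ge0 ?enorm_ge0 ?(ltW w0)//.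
 rewrite exprMn -sqdistE expr1n -W mulrC ler_wpM2l ?sqr_ge0// lerDr sqr_ge0//. }
have H2 : - (enorm (grad u p) * w ^+ n.-1) <= w ^+ n * dotv y (grad u p).
{ via (w ^+ n * - (enorm y * enorm (grad u p))).
  have H : enorm y * w ^+ n <= w ^+ n.-1.
  { have wn : w ^+ n = w * w ^+ n.-1 by rewrite -exprS prednK.
   rewrite wn mulrA; apply: ler_piMl; last exact: yw.
   by rewrite exprn_ge0// ltW. }
  rewrite mulrN lerN2 (_ : w ^+ n * _ = enorm (grad u p) * (enorm y * w ^+ n)); last by ring.
  by apply: ler_wpM2l; first exact: enorm_ge0.
 apply: ler_wpM2l; first by rewrite exprn_ge0// ltW.
 by have := dotv_le_enorm y (grad u p); rewrite ler_norml => /andP[]. }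
have H3 : n%:R * (u p * w ^+ n.+2) * dotv y (y *m tproj_at S iota p) <= n%:R * (u p * w ^+ n.+2) * sqdist p.
{ apply: ler_wpM2l => //; apply: mulr_ge0; first exact: ler0n.
 by apply: mulr_ge0 => //; apply: exprn_ge0; exact: ltW. }
have E4 : u p * w ^+ n = u p * w ^+ n.+2 * (s ^+ 2 + sqdist p).
{ by rewrite -addn2 exprD -[RHS]mulrA -[_ * w ^+ 2 * _]mulrA W mulr1. }
rewrite E4; move: H2 H3; set B := w ^+ n * dotv _ _; set Q := sqdist p.
move=> H2 H3.
lra.
Qed.

(** The pointwise bound is integrated; each component of the divergence integrates to zero by the
    first variation formula. *)
Lemma monotonicity_ineq u K : smooth_fun S u -> compact K -> (forall p, ~ K p -> u p = 0) -> (forall p, 0 <= u p) ->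
 n%:R * (\int[mu]_p (u p * s ^+ 2 * weight p ^+ n.+2)) <= \int[mu]_p (enorm (grad u p) * weight p ^+ n.-1).
Proof.
move=> su cK u0 up.
have clK := closed_compact_manifold S cK.
have cu := smooth_continuous su.
have cw := smooth_continuous smooth_fun_weight.
have cX m : continuous (fun p => weight p ^+ m).
{ exact: (smooth_continuous (smooth_funX m smooth_fun_weight)). }
have n1 : nice K (fun p => u p * s ^+ 2 * weight p ^+ n.+2).
{ apply: nice_continuous => //; last by move=> p nK; rewrite u0// !mul0r.
 by move=> p; apply: cvgM; [apply: cvgM; [exact: cu|exact: cvg_cst]|exact: cX]. }
have n2 : nice K (fun p => enorm (grad u p) * weight p ^+ n.-1).
{ apply: nice_continuous => //; last by move=> p nK; rewrite (grad_support S iota clK u0 nK) enorm0 mul0r.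
 by move=> p; apply: cvgM; [exact: enorm_grad_continuous|exact: cX]. }
have sX a : smooth_fun S (fun q => u q * weight q ^+ n * (iota q 0 a - xi 0 a)).
{ by apply: smooth_funM; [apply: smooth_funM => //; apply: smooth_funX; exact: smooth_fun_weight|exact: smooth_fun_dist]. }
have X0 a p : ~ K p -> u p * weight p ^+ n * (iota p 0 a - xi 0 a) = 0 by move=> nK; rewrite u0// !mul0r.
have n3 a : nice K (fun p => grad (fun q => u q * weight q ^+ n * (iota q 0 a - xi 0 a)) p 0 a).
{ apply: nice_continuous => //; first exact: (grad_continuous imm).
 by move=> p nK; rewrite (grad_support S iota clK (X0 a) nK) mxE. }
have I0 : \int[mu]_p (\sum_a grad (fun q => u q * weight q ^+ n * (iota q 0 a - xi 0 a)) p 0 a) = 0.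
{ rewrite (nice_Rintegral_sum imm Hmu cK _ n3) big1// => a _.
 by apply: (first_variation imm Hmu minimal); [exact: sX|exists K => //; exact: X0]. }
rewrite -subr_le0 -I0 -(nice_RintegralZ imm Hmu cK _ n1) -RintegralB//; last 2 first.
- exact: (nice_integrable imm Hmu cK (niceZ n%:R n1)).
- exact: (nice_integrable imm Hmu cK n2).
apply: (nice_Rintegral_le imm Hmu cK).
- have := niceD (niceZ n%:R n1) (niceZ (-1) n2); congr nice.
 by apply/funext => p; rewrite mulN1r.
- exact: nice_sum.
- by move=> p; exact: weighted_div_ge.
Qed.

End Weight.
End Monotonicity.

(** * Weighted Sobolev inequality *)

Section Vitali.
Context {R : realType} {m : nat} {I : eqType}.
Variables (ctr : I -> 'rV[R]_m) (rad : I -> R).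

(* The balls i and j are disjoint, in a form that is convenient to negate. *)
Definition far i j := rad i + rad j <= enorm (ctr i - ctr j).

Lemma far_disjoint i j y : far i j -> enorm (y - ctr i) < rad i -> enorm (y - ctr j) < rad j -> False.
Proof.
rewrite /far => H yi yj; have := enormD (ctr i - y) (y - ctr j).
rewrite addrA subrK -[X in _ <= X + _]enormN opprB => H2.
by lra.
Qed.

(** Greedy selection by decreasing radius: the list is sorted increasingly and treated from its
    tail. A rejected ball meets a selected one whose radius is at least as large, so it lies in the
    triple of that ball. *)
Lemma vitali (s : seq I) : exists2 s' : seq I, {subset s' <= s} /\ pairwise (fun i j => far i j) s' &
 forall i y, i \in s -> enorm (y - ctr i) < rad i ->
  exists2 j, j \in s' & enorm (y - ctr j) < 3 * rad j.
Proof.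
pose le := fun i j => rad i <= rad j.
suff H : forall r, sorted le r -> exists2 s' : seq I, {subset s' <= r} /\ pairwise (fun i j => far i j) s' &
 forall i y, i \in r -> enorm (y - ctr i) < rad i ->
  exists2 j, j \in s' & enorm (y - ctr j) < 3 * rad j.
{ have [|s' [ss pw] Hs] := H (sort le s).
  by apply: sort_sorted => i j; exact: le_total.
 exists s'; first by split => // i /ss; rewrite mem_sort.
 by move=> i y si; apply: Hs; rewrite mem_sort. }
elim=> [_|i r IH]; first by exists [::].
rewrite /= path_sortedE; last by move=> a b c; exact: le_trans.
move=> /andP[/allP ir sr]; have [s' [ss pw] Hs] := IH sr.
have [/allP Hfar|/allPn[j js nf]] := boolP (all (fun j => far i j) s').
 exists (i :: s'); first split.
 - by move=> a; rewrite !inE => /orP[->//|/ss ->]; rewrite orbT.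
 - by rewrite /= pw andbT; apply/allP.
 move=> a y; rewrite inE => /orP[/eqP ->|ar] ya.
  by exists i; rewrite ?mem_head//; have := enorm_ge0 (y - ctr i); lra.
 by have [b bs yb] := Hs a y ar ya; exists b => //; rewrite inE bs orbT.
exists s'; first by split => // a /ss; rewrite inE => ->; rewrite orbT.
move=> a y; rewrite inE => /orP[/eqP ->|ar] ya; last exact: Hs ar ya.
exists j => //; have rj := ir j (ss j js); rewrite /le in rj.
move: nf; rewrite -ltNge => nf.
have := enormD (y - ctr i) (ctr i - ctr j); rewrite addrA subrK; lra.
Qed.

End Vitali.

(** * Geometric sums with ratio three *)

Section DyadicSums.
Context {R : realType}.

Lemma geometric_third (c : R) m k : 0 <= c -> \sum_(i < k) c * 3 ^- (m + i) <= c * 3 ^- m * (3 / 2).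
Proof.
move=> c0; suff -> : \sum_(i < k) c * 3 ^- (m + i) = c * 3 ^- m * (3 / 2) * (1 - 3 ^- k).
 by apply: ler_piMr; rewrite ?exprn_ge0//; apply: mulr_ge0 => //; apply: mulr_ge0.
elim: k => [|k IH]; first by rewrite big_ord0 invr1 subrr mulr0.
rewrite big_ord_recr /= IH exprD exprS.
have h1 : 3 ^+ k != 0 :> R by [].
have h2 : 3 ^+ m != 0 :> R by [].
by field; rewrite h1.
Qed.

Lemma pow3_unbounded (x : R) : exists m : nat, x < 3 ^+ m.
Proof.
exists (Num.bound `|x|); apply: le_lt_trans (ler_norm x) _.
apply: lt_trans (archi_boundP (normr_ge0 x)) _.
by rewrite -natrX ltr_nat ltn_expl.
Qed.

Lemma sum_pow3_le (c : R) L : 0 <= c -> \sum_(l < L) c * 3 ^+ l <= c * 3 ^+ L.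
Proof.
move=> c0; elim: L => [|L IH]; first by rewrite big_ord0 mulr1.
rewrite big_ord_recr /= exprS.
have : 0 <= c * 3 ^+ L by rewrite mulr_ge0//.
by lra.
Qed.

End DyadicSums.

Section WeightBounds.
Context {R : realType} {n : nat} {M : ptopologicalType}.
Variables (iota : M -> 'rV[R]_n.+1) (xi : 'rV[R]_n.+1) (s : R).
Hypothesis s0 : 0 < s.
Local Notation w := (weight iota xi s).

Lemma weight_lower q : enorm (iota q - xi) < s -> 1 <= 2 * s * w q.
Proof.
move=> H; have w0 := weight_gt0 iota xi s0 q; have E := weight_sqr iota xi s0 q.
rewrite -(ler_pXn2r (_ : (0 < 2)%N))// ?nnegrE ?mulr_ge0 ?(ltW s0) ?(ltW w0)//.
have H2 : sqdist iota xi q <= s ^+ 2 by rewrite sqdistE lerXn2r ?nnegrE ?enorm_ge0 ?(ltW s0)// ltW.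
rewrite (_ : (2 * s * w q) ^+ 2 = w q ^+ 2 * (4 * s ^+ 2)); last by ring.
rewrite expr1n -[X in X <= _]E; apply: ler_wpM2l; first exact: sqr_ge0.
have : 0 <= s ^+ 2 by exact: sqr_ge0.
by lra.
Qed.

Lemma weight_le_inv q (t : R) : 0 < t -> t <= s \/ t <= enorm (iota q - xi) -> w q <= t^-1.
Proof.
move=> t0 H; have w0 := weight_gt0 iota xi s0 q; have E := weight_sqr iota xi s0 q.
rewrite -[t^-1]mul1r ler_pdivlMr//.
rewrite -(ler_pXn2r (_ : (0 < 2)%N))// ?nnegrE ?mulr_ge0 ?(ltW t0) ?(ltW w0)//.
rewrite expr1n -[X in _ <= X]E exprMn; apply: ler_wpM2l; first exact: sqr_ge0.
have h1 := sqdist_ge0 iota xi q; have h2 : 0 <= s ^+ 2 by exact: sqr_ge0.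
case: H => H.
 have : t ^+ 2 <= s ^+ 2 by rewrite lerXn2r ?nnegrE ?(ltW t0) ?(ltW s0).
 by lra.
have : t ^+ 2 <= sqdist iota xi q by rewrite sqdistE lerXn2r ?nnegrE ?(ltW t0) ?enorm_ge0.
by lra.
Qed.

End WeightBounds.

Lemma pow_ratio_shift {R : realFieldType} (A J : R) (x : R) m : x != 0 ->
 (3 / x) ^+ m * (A * (3 * x) ^+ m.+1 * J) = 3 ^+ m * 3 ^+ m.+1 * A * J * x.
Proof.
move=> x0; have xm : x ^+ m != 0 by rewrite expf_neq0.
by rewrite !exprS !exprMn exprVn; field.
Qed.

Lemma pow_ratio_cancel {R : realFieldType} (a t : R) m : a != 0 -> t != 0 ->
 (3 / (a * t)) ^+ m * a ^+ m.+1 = 3 ^+ m * a * (t^-1) ^+ m.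
Proof.
move=> a0 t0; have am : a ^+ m != 0 by rewrite expf_neq0.
have tm : t ^+ m != 0 by rewrite expf_neq0.
by rewrite !exprS invfM !exprMn !exprVn; field; rewrite tm.
Qed.

(** * Good radii and the estimate for the set where u equals 1 *)

Section GoodScale.
Context {R : realType} {n : nat} {M : ptopologicalType}.
Variables (S : smooth_manifold R n M) (iota : M -> 'rV[R]_n.+1).
Variable mu : {measure set (borelType M) -> \bar R}.
Hypothesis imm : is_immersion S iota.
Hypothesis Hmu : is_riemannian_volume S iota mu.
Hypothesis minimal : is_minimal S iota.
Hypothesis n1 : (1 < n)%N.
Local Notation grad := (grad S iota).
Local Notation dc := (@density_const R n).

Definition pullball p (t : R) : set M := [set q | enorm (iota q - iota p) < t].

Lemma open_pullball p t : open (pullball p t).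
Proof.
have /continuousP H := @continuous_enorm_dist R n.+1 M iota (iota p) (iota_continuous imm).
have := H `]-oo, t[%classic (@interval_open R -oo%O (BLeft t) isT isT).
by [].
Qed.

Lemma measurable_pullball p t : measurable (pullball p t : set (borelType M)).
Proof. by apply: measurable_open; exact: open_pullball. Qed.

(** A lower bound for the weighted mass at small scales: 1/2 from u > 1/2 near the point, [dc] from
    the density, and 2^(-n-2) from the weight being at least 1/(2s) on the ball of radius s. *)
Let c2 : R := 2^-1 * dc * 2 ^- n.+2.
(** The powers of 3 come from comparing radii that differ by a factor 3, the power of 2 from
    [U_le_J]. *)
Let Cn : R := 3 ^+ (2 * n) * 2 ^+ n.+2.
Definition MS_const : R := Cn * 4 / c2.

Lemma density_const_gt0 : 0 < dc.
Proof. by rewrite mulr_gt0// exprn_gt0// invr_gt0 mulr_gt0// ltr0n ltnW. Qed.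

Lemma c2_gt0 : 0 < c2.
Proof. by apply: mulr_gt0; [apply: mulr_gt0; [rewrite invr_gt0|exact: density_const_gt0]|rewrite invr_gt0]. Qed.

Lemma Cn_gt0 : 0 < Cn.
Proof. by rewrite mulr_gt0//. Qed.

Lemma MS_const_gt0 : 0 < MS_const.
Proof. by rewrite divr_gt0 ?c2_gt0// mulr_gt0// Cn_gt0. Qed.

(** The choice of [MS_const] turns the right-hand side into (c2/4)(Sm + 3/2), which is at most 5/8
    Sm because c2 <= 1 and c2 <= Sm, whereas n >= 2. *)
Lemma scale_contradiction (Sm a : R) : 0 < a -> c2 <= Sm -> c2 <= 1 ->
 ~ (n%:R * Sm <= (MS_const * a)^-1 * (Cn * a * Sm + Cn * a * (3 / 2))).
Proof.
move=> a0 cS c1; have C0 := Cn_gt0; have cp := c2_gt0.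
rewrite (_ : _^-1 * _ = c2 / 4 * (Sm + 3 / 2)); last first.
 by rewrite /MS_const; field; rewrite !gt_eqF.
have N2 : 2 <= n%:R :> R by rewrite ler_nat.
have S0 : 0 < Sm by lra.
have h1 : 2 * Sm <= n%:R * Sm by rewrite ler_wpM2r// ltW.
have h2 : c2 * Sm <= Sm by rewrite ler_piMl// ltW.
lra.
Qed.

Lemma c2_le1 : c2 <= 1.
Proof.
have h : (2 * n%:R)^-1 ^+ n <= 1 :> R.
 have N1 : 1 <= n%:R :> R by rewrite ler1n ltnW.
 apply: exprn_ile1; first by [].
 by rewrite invf_le1; lra.
have h2 : 2 ^- n.+2 <= 1 :> R by rewrite invf_le1 ?exprn_gt0// exprn_ege1// ler1n.
have h3 : 0 <= 2 ^- n.+2 :> R by [].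
have hA : 2^-1 * (2^-1 * (2 * n%:R)^-1 ^+ n) <= 1 :> R by lra.
by apply: le_trans (ler_wpM2r h3 hA) _; rewrite mul1r.
Qed.

Variables (u : M -> R) (K : set M).
Hypothesis su : smooth_fun S u.
Hypothesis cK : compact K.
Hypothesis u0 : forall p, ~ K p -> u p = 0.
Hypothesis u01 : forall p, 0 <= u p <= 1.
Variable a : R.
Hypothesis a0 : 0 < a.
Hypothesis mua : (mu ([set p | 0 < u p]%R : set (borelType M)) <= (a ^+ n)%:E)%E.

Let ug p : 0 <= u p. Proof. by have /andP[] := u01 p. Qed.

Let clK := closed_compact_manifold S cK.

Lemma nice_u : nice K u.
Proof. by apply: nice_continuous => //; exact: smooth_continuous su. Qed.

Lemma nice_gradu : nice K (fun q => enorm (grad u q)).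
Proof.
apply: nice_continuous => //; first exact: (enorm_grad_continuous imm).
by move=> q nK; rewrite (grad_support S iota clK u0 nK) enorm0.
Qed.

Lemma superlevel_open (c : R) : open [set q | c < u q].
Proof.
have /continuousP H := smooth_continuous su.
have := H `]c, +oo[%classic (@interval_open R (BRight c) +oo%O isT isT).
by rewrite (_ : _ @^-1` _ = [set q | c < u q])//; apply/seteqP; split => q; rewrite /= in_itv andbT.
Qed.

Lemma Rintegral_indic_mu (A : set M) : measurable (A : set (borelType M)) -> A `<=` K ->
 nice K (\1_A : M -> R) /\ (mu (A : set (borelType M)) = (\int[mu]_q (\1_A q : R))%:E)%E.
Proof.
move=> mA AK; have nA : nice K (\1_A : M -> R).
{ split; first exact: (@measurable_indic _ (borelType M) R setT A mA).
  by exists 1 => p; rewrite indicE; case: (_ \in _); rewrite ?normr1 ?normr0.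
 by move=> p nK; rewrite indicE memNset// => /AK. }
rewrite fineK; last first.
 by apply: integrable_fin_num => //; exact: (nice_integrable imm Hmu cK nA).
by rewrite (@integral_indic _ (borelType M) R mu setT measurableT A mA) setIT.
Qed.

Section AtPoint.
Variable p : M.
Hypothesis up : u p = 1.

Let U t := \int[mu]_q (\1_(pullball p t) q * u q).
Let Gam t := \int[mu]_q (\1_(pullball p t) q * enorm (grad u q)).
(** The scale-invariant weighted mass: monotonicity bounds n [J] by the weighted gradient mass [G],
    and up to a constant [J] dominates the mass [U] of the ball divided by s^n. *)
Let J s := \int[mu]_q (u q * s ^+ 2 * weight iota (iota p) s q ^+ n.+2).
Let G s := \int[mu]_q (enorm (grad u q) * weight iota (iota p) s q ^+ n.-1).

Let nU t : nice K (fun q => \1_(pullball p t) q * u q).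
Proof. by apply: nice_indic; [exact: measurable_pullball|exact: nice_u]. Qed.

Let nG t : nice K (fun q => \1_(pullball p t) q * enorm (grad u q)).
Proof. by apply: nice_indic; [exact: measurable_pullball|exact: nice_gradu]. Qed.

Let cw s k : 0 < s -> continuous (fun q => weight iota (iota p) s q ^+ k).
Proof. by move=> s0; exact: (smooth_continuous (smooth_funX k (smooth_fun_weight imm (iota p) s0))). Qed.

Let nJ s : 0 < s -> nice K (fun q => u q * s ^+ 2 * weight iota (iota p) s q ^+ n.+2).
Proof.
move=> s0; apply: nice_continuous => //; last by move=> q nK; rewrite u0// !mul0r.
move=> q; apply: cvgM; last exact: cw.
by apply: cvgM; [exact: smooth_continuous su q|exact: cvg_cst].
Qed.

Let nGs s : 0 < s -> nice K (fun q => enorm (grad u q) * weight iota (iota p) s q ^+ n.-1).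
Proof.
move=> s0; apply: nice_continuous => //; last by move=> q nK; rewrite (grad_support S iota clK u0 nK) enorm0 mul0r.
by move=> q; apply: cvgM; [exact: (enorm_grad_continuous imm su)|exact: cw].
Qed.

Lemma JG s : 0 < s -> n%:R * J s <= G s.
Proof. by move=> s0; exact: (monotonicity_ineq imm Hmu minimal (ltnW n1) (iota p) s0 su cK u0 ug). Qed.

Lemma U_le_J s : 0 < s -> U s <= 2 ^+ n.+2 * s ^+ n * J s.
Proof.
move=> s0; rewrite -(nice_RintegralZ imm Hmu cK); last exact: nJ.
apply: (nice_Rintegral_le imm Hmu cK) => //; first by apply: niceZ; exact: nJ.
move=> q; have w0 := weight_gt0 iota (iota p) s0 q.
rewrite (_ : 2 ^+ n.+2 * s ^+ n * _ = (2 * s * weight iota (iota p) s q) ^+ n.+2 * u q); last first.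
 by rewrite !exprMn !exprS; ring.
rewrite indicE; case: (boolP (q \in _)) => [/set_mem|_]; last first.
 by rewrite mul0r mulr_ge0// exprn_ge0// !mulr_ge0// ltW.
move=> /(weight_lower s0) H; rewrite mul1r; apply: ler_peMl => //.
by rewrite exprn_ege1.
Qed.

Lemma U_le_measure t : U t <= a ^+ n.
Proof.
have mA : measurable ([set q | 0 < u q] : set (borelType M)) by apply: measurable_open; exact: superlevel_open.
have sK : [set q | 0 < u q] `<=` K by move=> q /= uq; apply: contrapT => /u0 E; rewrite E ltxx in uq.
have [nA EA] := Rintegral_indic_mu mA sK.
via (\int[mu]_q (\1_[set q | 0 < u q] q : R)).
 apply: (nice_Rintegral_le imm Hmu cK) => // q.
 have [uq|] := ltP 0 (u q); last first.
  move=> H; have u00 : u q = 0 by apply/eqP; rewrite eq_le H ug.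
  by rewrite u00 mulr0.
 rewrite [X in _ <= X]indicE mem_set// indicE; case: (_ \in _); rewrite ?mul1r ?mul0r//.
 by have /andP[] := u01 q.
by move: mua; rewrite EA.
Qed.

(** Near p the function u exceeds 1/2, and the measure has positive lower density there; on the
    small ball the weight is comparable to 1/s. *)
Lemma J_lower : exists2 d : R, 0 < d & forall s, 0 < s < d -> c2 <= J s.
Proof.
have N : [set q | 2^-1 < u q] p by rewrite /= up; lra.
have [d d0 Hd] := density_lower imm Hmu (ltnW n1) (superlevel_open 2^-1) N.
exists d => // s /andP[s0 sd].
pose A := [set q | [set q | 2^-1 < u q] q /\ enorm (iota q - iota p) < s].
have oA : open A by apply: openI; [exact: superlevel_open|exact: (open_pullball p s)].
have AK : A `<=` K by move=> q [/= uq _]; apply: contrapT => /u0 E; lra.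
have [nA EA] := Rintegral_indic_mu (measurable_open oA) AK.
have := Hd s; rewrite s0 sd => /(_ isT); rewrite EA => HA.
via (2^-1 * 2 ^- n.+2 * s ^- n * \int[mu]_q (\1_A q : R)).
 have sn : 0 < s ^+ n by rewrite exprn_gt0.
 via (2^-1 * 2 ^- n.+2 * s ^- n * (dc * s ^+ n)).
  rewrite /c2 le_eqVlt; apply/orP; left; apply/eqP.
  have tn : 2 ^+ n.+2 != 0 :> R by [].
  by field; rewrite gt_eqF.
 apply: ler_wpM2l => //; rewrite !mulr_ge0// ?invr_ge0 ltW//.
rewrite -(nice_RintegralZ imm Hmu cK _ nA).
apply: (nice_Rintegral_le imm Hmu cK); [exact: niceZ|exact: nJ|] => q.
have w0 := weight_gt0 iota (iota p) s0 q.
rewrite indicE; case: (boolP (q \in _)) => [/set_mem[/= uq qs]|_]; last first.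
 by rewrite mulr0; apply: mulr_ge0; [apply: mulr_ge0 => //; exact: sqr_ge0|apply: exprn_ge0; exact: ltW].
rewrite mulr1.
have H : 1 <= (2 * s * weight iota (iota p) s q) ^+ n.+2 by rewrite exprn_ege1// weight_lower.
have H2 : 0 < 2 ^- n.+2 * s ^- n by rewrite mulr_gt0// invr_gt0 exprn_gt0.
via (2^-1 * (2 ^- n.+2 * s ^- n * (2 * s * weight iota (iota p) s q) ^+ n.+2)).
 by rewrite -mulrA ler_pM2l// -[X in X <= _]mulr1 ler_pM2l.
have -> : 2 ^- n.+2 * s ^- n * (2 * s * weight iota (iota p) s q) ^+ n.+2 = s ^+ 2 * weight iota (iota p) s q ^+ n.+2.
{ have tn : 2 ^+ n != 0 :> R by [].
 have sn : s ^+ n != 0 by rewrite expf_neq0// gt_eqF.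
 by rewrite !exprMn !exprS; field; rewrite sn. }
rewrite -mulrA; apply: ler_wpM2r; last exact: ltW.
by rewrite mulr_ge0 ?sqr_ge0// exprn_ge0// ltW.
Qed.

(** K is divided according to the first radius sg 3^l, l >= i, that reaches the point; there the
    weight at scale sg 3^i is at most 3/(sg 3^l). The other terms of the sum are nonnegative. *)
Lemma G_le_sum (sg : R) k i : 0 < sg -> (i < k)%N -> (forall q, K q -> enorm (iota q - iota p) < sg * 3 ^+ k.-1) ->
 G (sg * 3 ^+ i) <= \sum_(l < k) (3 / (sg * 3 ^+ l)) ^+ n.-1 * Gam (sg * 3 ^+ l).
Proof.
move=> s0 ik Kb.
have sp l : 0 < sg * 3 ^+ l by rewrite mulr_gt0//.
have nZ l : nice K (fun q => (3 / (sg * 3 ^+ l)) ^+ n.-1 * (\1_(pullball p (sg * 3 ^+ l)) q * enorm (grad u q))).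
{ by apply: niceZ. }
under eq_bigr => l _ do rewrite -(nice_RintegralZ imm Hmu cK)//.
rewrite -(nice_Rintegral_sum imm Hmu cK)//.
apply: (nice_Rintegral_le imm Hmu cK); [exact: nGs|by apply: nice_sum => l; exact: nZ|] => q.
have [Kq|nK] := pselect (K q); last first.
 rewrite (grad_support S iota clK u0 nK) enorm0 mul0r sumr_ge0// => l _; by lra.
have exP : exists l, (i <= l)%N && (enorm (iota q - iota p) < sg * 3 ^+ l).
{ exists k.-1; rewrite Kb// andbT; move: ik; by case: (k). }
(* Minimality of l means that either l = i, where the scale itself bounds the weight, or the point
   lies outside the preceding ball, where the distance bounds it. *)
have [l /andP[il ql] lmin] := ex_minnP exP.
have lk : (l < k)%N.
{ apply: (@leq_ltn_trans k.-1); last by move: ik; case: (k).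
 by apply: lmin; rewrite Kb// andbT; move: ik; case: (k). }
rewrite (bigD1 (Ordinal lk))//= -[X in X <= _]addr0; apply: lerD; last first.
 apply: sumr_ge0 => j _; rewrite ?mulr_ge0 ?enorm_ge0 ?indic_ge0// exprn_ge0// divr_ge0// ltW//.
rewrite [\1_ _ q]indicE mem_set// mul1r mulrC; apply: ler_wpM2r; first exact: enorm_ge0.
have w0 := weight_gt0 iota (iota p) (sp i) q.
apply: lerXn2r; rewrite ?nnegrE ?(ltW w0) ?divr_ge0 ?(ltW (sp l))//.
rewrite -[3 / _]invf_div; apply: (weight_le_inv (sp i)); first by rewrite divr_gt0.
have [li|il'] := leqP l i.
 have -> : l = i by apply/eqP; rewrite eqn_leq li.
 by have := sp i; lra.
right; case: l il ql lmin lk il' => // l _ _ lmin _ il'.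
have : ~~ (enorm (iota q - iota p) < sg * 3 ^+ l).
{ apply/negP => H; have := lmin l; rewrite H andbT => /(_ il'); by rewrite ltnn. }
by rewrite -leNgt exprS mulrCA [3 * _]mulrC mulfK.
Qed.

(** If no radius were good, the gradient mass at every scale would be less than the mass of the
    tripled ball over [MS_const] a. This is inserted in the monotonicity inequality at the scale,
    among those from below d up to a, where J is largest. Scales below a contribute at most Cn a J
    by maximality, scales from a on at most Cn a 3/2 because the mass never exceeds a^n; this is
    impossible by [scale_contradiction]. *)
Lemma good_scale : exists2 t : R, 0 < t &
 \int[mu]_q (\1_(pullball p (3 * t)) q * u q) <= MS_const * a * \int[mu]_q (\1_(pullball p t) q * enorm (grad u q)).
Proof.
apply: contrapT => /forall2NP Hno.
have Hlt t : 0 < t -> MS_const * a * Gam t < U (3 * t).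
{ by move=> t0; rewrite ltNge; apply/negP => H; case: (Hno t). }
have [d d0 HJ] := J_lower.
(* L brings the smallest scale a 3^(-L) below d, where the lower bound for J is valid. *)
have [L HL] := pow3_unbounded (a / d).
have [B B0 KB] := @compact_ubound R M K (fun q => enorm (iota q - iota p)) cK
 (fun q _ => @continuous_enorm_dist R n.+1 M iota (iota p) (iota_continuous imm) q).
(* m makes the ball of radius a 3^m contain all of K, as [G_le_sum] requires. *)
have [m Hm] := pow3_unbounded (B / a).
pose sg := a * 3 ^- L; pose k := (L + m.+1)%N; pose s i := sg * 3 ^+ i.
have p3 i : 0 < 3 ^+ i :> R by rewrite exprn_gt0.
have sg0 : 0 < sg by rewrite mulr_gt0// invr_gt0.
have sp i : 0 < s i by rewrite mulr_gt0.
have sgd : sg < d.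
{ by rewrite /sg ltr_pdivrMr// mulrC -ltr_pdivrMr. }
have sL i : s (L + i)%N = a * 3 ^+ i by rewrite /s /sg exprD mulrA mulfVK// gt_eqF.
have Kb q : K q -> enorm (iota q - iota p) < sg * 3 ^+ k.-1.
{ move=> /KB; rewrite ger0_norm ?enorm_ge0// => H; apply: le_lt_trans H _.
 rewrite /k addnS /= -/(s (L + m)%N) sL mulrC -ltr_pdivrMr//. }
pose j := [arg max_(i > (ord0 : 'I_L.+1)) J (s i)]%O.
have jmax (i : 'I_L.+1) : J (s i) <= J (s j).
{ rewrite /j; case: arg_maxP => // b _ Hb; exact: Hb. }
have jk : (j < k)%N by rewrite /k addnS ltnS (leq_trans (leq_ord j))// leq_addr.
have Sc : c2 <= J (s j).
{ apply: le_trans (jmax ord0); apply: HJ; rewrite sp /= /s expr0 mulr1//. }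
have Sp : 0 < J (s j) := lt_le_trans c2_gt0 Sc.
apply: (scale_contradiction a0 Sc c2_le1).
apply: le_trans (JG (sp j)) _; apply: le_trans (G_le_sum sg0 jk Kb) _.
have La : 0 < MS_const * a by rewrite mulr_gt0// MS_const_gt0.
have G1 l : Gam (s l) <= (MS_const * a)^-1 * U (s l.+1).
{ rewrite mulrC ler_pdivlMr// mulrC; have := Hlt _ (sp l); rewrite (_ : 3 * s l = s l.+1); first exact: ltW.
 by rewrite /s exprS mulrCA. }
have c0 l : 0 <= (3 / s l) ^+ n.-1 by rewrite exprn_ge0// divr_ge0// ltW.
via (\sum_(l < k) (MS_const * a)^-1 * ((3 / s l) ^+ n.-1 * U (s l.+1))).
 by apply: ler_sum => l _; rewrite mulrCA; apply: ler_wpM2l; [exact: c0|exact: G1].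
rewrite -mulr_sumr; apply: ler_wpM2l; first by rewrite invr_ge0 ltW.
rewrite /k big_split_ord /=; apply: lerD.
- via (\sum_(l < L) (Cn * J (s j) * sg) * 3 ^+ l).
  apply: ler_sum => l _.
  have Hl : U (s l.+1) <= 2 ^+ n.+2 * s l.+1 ^+ n * J (s j).
  { apply: le_trans (U_le_J (sp _)) _; apply: ler_wpM2l; last first.
    have lL : (l.+1 < L.+1)%N by rewrite ltnS.
    exact: (jmax (Ordinal lL)).
   by rewrite mulr_ge0// exprn_ge0// ltW. }
  apply: le_trans (ler_wpM2l (c0 _) Hl) _.
  have sl0 : s l != 0 by rewrite gt_eqF.
  have -> : s l.+1 = 3 * s l by rewrite /s exprS mulrCA.
  have nE : n = n.-1.+1 by rewrite prednK// ltnW.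
  have -> : (3 / s l) ^+ n.-1 * (2 ^+ n.+2 * (3 * s l) ^+ n * J (s j)) =
       3 ^+ n.-1 * 3 ^+ n * 2 ^+ n.+2 * J (s j) * s l.
  { by have := pow_ratio_shift (2 ^+ n.+2) (J (s j)) n.-1 sl0; rewrite prednK// ltnW. }
  rewrite -[_ * J (s j) * sg * _]mulrA -/(s l); apply: ler_wpM2r; first exact: ltW.
  apply: ler_wpM2r; first exact: ltW.
  rewrite /Cn; apply: ler_wpM2r; first by rewrite exprn_ge0.
  by rewrite -exprD; apply: ler_weXn2l; [rewrite ler1n|rewrite mul2n -addnn leq_add2r leq_pred].
 apply: le_trans (sum_pow3_le _ _) _.
  by apply: mulr_ge0; [apply: mulr_ge0; [exact: (ltW Cn_gt0)|exact: ltW]|exact: ltW].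
 by rewrite -[_ * sg * _]mulrA (_ : sg * 3 ^+ L = a) ?[Cn * _ * a]mulrAC// /sg mulfVK// gt_eqF.
- via (\sum_(i < m.+1) (3 ^+ n.-1 * a) * 3 ^- (0 + i)).
  apply: ler_sum => i _; rewrite sL.
  apply: le_trans (ler_wpM2l _ (U_le_measure _)) _; first by rewrite exprn_ge0// divr_ge0// mulr_ge0// ?(ltW a0).
  have -> : (3 / (a * 3 ^+ i)) ^+ n.-1 * a ^+ n = 3 ^+ n.-1 * a * (3 ^- i) ^+ n.-1.
  { have := @pow_ratio_cancel R a (3 ^+ i) n.-1; rewrite prednK ?(ltnW n1)//; apply; first by rewrite gt_eqF.
   by []. }
  apply: ler_wpM2l; first by rewrite mulr_ge0 ?exprn_ge0// ltW.
  have h1 : 3 ^- (nat_of_ord i) <= 1 :> R by rewrite invf_le1 ?exprn_gt0// exprn_ege1// ler1n.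
  apply: ler_iXnr => //; move: n1; by case: (n) => // -[].
 apply: le_trans (geometric_third _ _ _) _; first by rewrite mulr_ge0 ?exprn_ge0// ltW.
 rewrite invr1 mulr1; apply: ler_wpM2r; first by lra.
 apply: ler_wpM2r; first exact: ltW.
 rewrite -[X in X <= _]mulr1; apply: ler_pM; [by rewrite exprn_ge0|exact: ler01| |].
  by apply: ler_weXn2l; [rewrite ler1n|rewrite mul2n -addnn (leq_trans (leq_pred n))// leq_addr].
 by rewrite exprn_ege1// ler1n.
Qed.

End AtPoint.

Lemma sum_far_indic (t : M -> R) (s : seq M) q :
 pairwise (fun i j => far iota t i j) s -> \sum_(i <- s) \1_(pullball i (t i)) q <= 1 :> R.
Proof.
elim: s => [|i s IH]; first by rewrite big_nil.
rewrite /= => /andP[/allP fi ps]; rewrite big_cons indicE; case: (boolP (q \in _)) => [/set_mem qi|_]; last first.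
 by rewrite add0r; exact: IH.
rewrite big_seq big1 ?addr0// => j js; rewrite indicE memNset// => qj.
exact: (far_disjoint (fi j js) qi qj).
Qed.

(** The compact set where u = 1 is covered by finitely many good balls. Vitali selects disjoint ones
    whose triples still cover it; the mass of u on each triple is bounded by the gradient mass on
    the ball, and disjointness lets these be summed. *)
Lemma weak_sobolev : (mu ([set q | u q = 1]%R : set (borelType M)) <=
 (MS_const * a * \int[mu]_q enorm (grad u q))%:E)%E.
Proof.
pose A := [set q | u q = 1].
have cu := smooth_continuous su.
have clA : closed A.
{ have /continuous_closedP H := cu; have := H [set x | 1 <= x] (@closed_ge R 1).
 rewrite (_ : _ @^-1` _ = A)//; apply/seteqP; split => q /=; last by move=> ->.
 by have /andP[_ h1] := u01 q; move=> h2; apply/eqP; rewrite eq_le h1. }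
have AK : A `<=` K by move=> q; rewrite /A /= => uq; apply: contrapT => /u0; rewrite uq => /eqP; rewrite oner_eq0.
have cA : compact A by exact: (subclosed_compact clA cK AK).
have /choice[t tP] : forall p, exists t : R, u p = 1 -> 0 < t /\
  \int[mu]_q (\1_(pullball p (3 * t)) q * u q) <= MS_const * a * \int[mu]_q (\1_(pullball p t) q * enorm (grad u q)).
{ move=> p; have [up|nu] := pselect (u p = 1); last by exists 0.
 by have [t t0 Ht] := good_scale up; exists t. }
have [|p Ap|s [sA sc]] := @compact_seq_cover M M A A (fun p => pullball p (t p)) cA.
- by move=> p _; exact: open_pullball.
- by exists p => //; rewrite /pullball /= subrr enorm0; have [] := tP p Ap.
have [s' [ss pw] Hs] := vitali iota t s.
have mA : measurable (A : set (borelType M)).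
{ by rewrite -[X in measurable X]setCK; apply: measurableC; apply: measurable_open; exact: closed_openC. }
have [nA EA] := Rintegral_indic_mu mA AK.
rewrite EA.
have nU i : nice K (fun q => \1_(pullball i (3 * t i)) q * u q).
{ by apply: nice_indic; [exact: measurable_pullball|exact: nice_u]. }
have nG i : nice K (fun q => \1_(pullball i (t i)) q * enorm (grad u q)).
{ by apply: nice_indic; [exact: measurable_pullball|exact: nice_gradu]. }
via (\int[mu]_q (\sum_(i <- s') \1_(pullball i (3 * t i)) q * u q)).
{ apply: (nice_Rintegral_le imm Hmu cK) => //; first by apply: nice_sum.
 move=> q; rewrite indicE; case: (boolP (q \in _)) => [/set_mem Aq|_]; last first.
  by apply: sumr_ge0 => i _; rewrite mulr_ge0//.
 have [i si qi] := sc q Aq; have [j js qj] := Hs i (iota q) si qi.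
 have Aq1 : u q = 1 := Aq.
 rewrite (big_rem j js) indicE mem_set// Aq1 mul1r lerDl.
 by apply: sumr_ge0 => k _. }
rewrite (nice_Rintegral_sum imm Hmu cK)//.
via (\sum_(i <- s') MS_const * a * \int[mu]_q (\1_(pullball i (t i)) q * enorm (grad u q))).
{ rewrite [X in X <= _]big_seq [X in _ <= X]big_seq; apply: ler_sum => i is'.
 by have [] := tP i (sA i (ss i is')). }
rewrite -mulr_sumr -(nice_Rintegral_sum imm Hmu cK)//; apply: ler_wpM2l.
 by rewrite mulr_ge0 ?(ltW MS_const_gt0)// ltW.
apply: (nice_Rintegral_le imm Hmu cK); [exact: nice_sum|exact: nice_gradu|] => q.
rewrite -mulr_suml; apply: ler_piMl; first exact: enorm_ge0.
exact: sum_far_indic.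
Qed.

End GoodScale.

(** * Mollification and weak gradients in charts *)

Lemma exists_inv_lt {R : realType} (x : R) : 0 < x -> exists k : nat, k.+1%:R^-1 < x.
Proof.
exists (Num.bound x^-1); rewrite invf_plt ?posrE ?ltr0n//.
apply: lt_trans (archi_boundP _) _; first by rewrite invr_ge0 ltW.
by lra.
Qed.

(** Serves as the Cauchy-Schwarz and Jensen inequalities for integrals: the quadratic in t is the
    integral of a nonnegative function. *)
Lemma discriminant_le {R : realType} (A B C : R) : 0 <= A -> (forall t, 0 <= t ^+ 2 * A - 2 * t * B + C) -> B ^+ 2 <= A * C.
Proof.
move=> A0 H; have [A00|An] := eqVneq A 0.
 rewrite A00; have [->|Bn] := eqVneq B 0; first by lra.
 have := H ((C + 1) / (2 * B)); rewrite A00 (_ : 2 * _ * B = C + 1); last by field.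
 by lra.
have Ap : 0 < A by lra.
have := H (B / A); rewrite (_ : _ + C = (A * C - B ^+ 2) / A); last by field.
by rewrite pmulr_lge0 ?invr_gt0// subr_ge0.
Qed.

(** * Comparison of integrals with real bounds *)

Section IntegralBounds.
Context {d} {T : measurableType d} {R : realType}.
Variables (mu : {measure set T -> \bar R}) (D : set T).
Hypothesis mD : measurable D.
Implicit Types u v w : T -> R.

Lemma integral_le_of_le u v (a : R) : measurable_fun D u -> measurable_fun D v ->
 (forall t, D t -> 0 <= u t <= v t) -> (\int[mu]_(t in D) (v t)%:E <= a%:E)%E ->
 (\int[mu]_(t in D) (u t)%:E <= a%:E)%E.
Proof.
move=> mu' mv uv; apply: le_trans; apply: ge0_le_integral => //.
- by move=> t Dt; rewrite lee_fin; have /andP[] := uv t Dt.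
- exact/measurable_EFinP.
- exact/measurable_EFinP.
- by move=> t Dt; rewrite lee_fin; have /andP[] := uv t Dt.
Qed.

Lemma integral_le_add u v w (a b : R) : measurable_fun D u -> measurable_fun D v -> measurable_fun D w ->
 (forall t, D t -> 0 <= u t <= v t + w t) -> (forall t, D t -> 0 <= v t) -> (forall t, D t -> 0 <= w t) ->
 (\int[mu]_(t in D) (v t)%:E <= a%:E)%E -> (\int[mu]_(t in D) (w t)%:E <= b%:E)%E ->
 (\int[mu]_(t in D) (u t)%:E <= (a + b)%:E)%E.
Proof.
move=> mu' mv mw uvw v0 w0 va wb.
apply: (integral_le_of_le mu' (measurable_funD mv mw)) => //.
have -> : (\int[mu]_(t in D) (v t + w t)%:E = \int[mu]_(t in D) (v t)%:E + \int[mu]_(t in D) (w t)%:E)%E.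
{ under eq_integral do rewrite EFinD.
 rewrite ge0_integralD//; [exact/measurable_EFinP|exact/measurable_EFinP]. }
by rewrite EFinD; exact: leeD.
Qed.

Lemma integral_le_scale (k : R) v (a : R) : 0 <= k -> measurable_fun D v -> (forall t, D t -> 0 <= v t) ->
 (\int[mu]_(t in D) (v t)%:E <= a%:E)%E -> (\int[mu]_(t in D) (k * v t)%:E <= (k * a)%:E)%E.
Proof.
move=> k0 mv v0 va; under eq_integral do rewrite EFinM.
rewrite ge0_integralZl_EFin//; last exact/measurable_EFinP.
by rewrite EFinM; apply: lee_wpmul2l.
Qed.

Lemma sqrD_le (x y : R) : (x + y) ^+ 2 <= 2 * x ^+ 2 + 2 * y ^+ 2.
Proof. by have := sqr_ge0 (x - y); lra. Qed.

Lemma integral_sqrD_le u v (a b : R) : measurable_fun D u -> measurable_fun D v ->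
 (\int[mu]_(t in D) (u t ^+ 2)%:E <= a%:E)%E -> (\int[mu]_(t in D) (v t ^+ 2)%:E <= b%:E)%E ->
 (\int[mu]_(t in D) ((u t + v t) ^+ 2)%:E <= (2 * a + 2 * b)%:E)%E.
Proof.
move=> mu' mv ua vb.
have m2 (f : T -> R) : measurable_fun D f -> measurable_fun D (fun t => 2 * f t ^+ 2).
{ by move=> mf; apply: measurable_funM => //; exact: measurable_funX. }
apply: (@integral_le_add _ (fun t => 2 * u t ^+ 2) (fun t => 2 * v t ^+ 2)).
- by apply: measurable_funX; exact: measurable_funD.
- exact: m2.
- exact: m2.
- by move=> t _; rewrite sqr_ge0 sqrD_le.
- by move=> t _; rewrite mulr_ge0// sqr_ge0.
- by move=> t _; rewrite mulr_ge0// sqr_ge0.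
- by apply: (@integral_le_scale 2 (fun t => u t ^+ 2)) => // [|t _]; [exact: measurable_funX|exact: sqr_ge0].
- by apply: (@integral_le_scale 2 (fun t => v t ^+ 2)) => // [|t _]; [exact: measurable_funX|exact: sqr_ge0].
Qed.

Lemma decreasing_measure_small (E : nat -> set T) (e : R) : (forall k, measurable (E k)) ->
 (mu (E 0%N) < +oo)%E -> (forall k, E k.+1 `<=` E k) -> (forall t, ~ (forall k, E k t)) -> 0 < e ->
 exists k, (mu (E k) <= e%:E)%E.
Proof.
move=> mE E0 dE cE e0.
have I0 : \bigcap_k E k = set0 by apply/seteqP; split => // t H; apply: (cE t) => k; exact: H.
have ndE : nonincreasing_seq E.
{ apply/nonincreasing_seqP => k; apply/subsetPset; exact: dE. }
have mI : measurable (\bigcap_k E k) by rewrite I0.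
have := nonincreasing_cvg_mu E0 mE mI ndE; rewrite I0 measure0 => /fine_cvgP[fE cv].
have /cvgrPdist_le/(_ e e0) H := cv.
have [k _ Hk] : \forall k \near \oo, mu (E k) \is a fin_num /\ `|0 - fine (mu (E k))| <= e by exact: filterI.
exists k; have [f1 f2] := Hk k (leqnn k); rewrite -(fineK f1).
by move: f2; rewrite sub0r normrN; apply: le_trans; exact: ler_norm.
Qed.

End IntegralBounds.

(** * Continuous functions are dense in L^2 of a set of finite measure *)

Section DensityContinuous.
Context {R : realType} {n : nat}.
Local Notation Rm := (measurableTypeR R).
Variable D : set (n.-tuple Rm).
Hypothesis mD : measurable D.
Hypothesis Doo : (leb n D < +oo)%E.
Implicit Types (A : set (n.-tuple Rm)) (g : 'rV[R]_n -> R).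

Lemma measurable_rv g : Ck 0 setT (g : _ -> R^o) -> measurable_fun D (fun t : n.-tuple Rm => g (rv t)).
Proof.
move=> cg; apply: measurable_funTS.
exact: (@measurable_rv_continuous R n setT g openT (fun x Ux => Ck_continuous cg Ux)).
Qed.

(** These sets are shown to form a sigma-algebra. The range [0, 1] is kept because it passes to
    products, hence to intersections, and because it turns L^1 closeness into L^2 closeness. *)
Definition set_approx A := measurable A /\ forall e : R, 0 < e -> exists g,
 [/\ Ck 0 setT (g : _ -> R^o), forall x, 0 <= g x <= 1 & (\int[leb n]_(t in D) (`|\1_A t - g (rv t)|)%:E <= e%:E)%E].

Let mdiff A g : measurable A -> Ck 0 setT (g : _ -> R^o) -> measurable_fun D (fun t : n.-tuple Rm => `|\1_A t - g (rv t)| : R).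
Proof.
move=> mA cg; apply: measurableT_comp => //; apply: measurable_funB; last exact: measurable_rv.
exact: measurable_indic.
Qed.

Lemma set_approx0 : set_approx set0.
Proof.
split => // e e0; exists (fun=> 0); split.
- exact: (Ck_cst 0 (0 : R^o) openT).
- by move=> x; rewrite lexx ler01.
- under eq_integral do rewrite indic0 subrr normr0.
 by rewrite integral0 ltW.
Qed.

Lemma set_approxC A : set_approx A -> set_approx (~` A).
Proof.
move=> [mA H]; split; first exact: measurableC.
move=> e e0; have [g [cg g01 gA]] := H e e0; exists (fun x => 1 - g x); split.
- exact: (CkD openT (Ck_cst 0 (1 : R^o) openT) (CkN openT cg)).
- by move=> x; have := g01 x; lra.
- apply: le_trans gA; apply: le_of_eq; apply: eq_integral => t _.
 congr (_%:E); rewrite -normrN !indicE in_setC; congr (`| _ |).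
 by case: (t \in A) => /=; ring.
Qed.

Lemma set_approxI A B : set_approx A -> set_approx B -> set_approx (A `&` B).
Proof.
move=> [mA HA] [mB HB]; have mAB := measurableI _ _ mA mB; split => // e e0.
have e2 : 0 < e / 2 by lra.
have [g [cg g01 gA]] := HA _ e2; have [h [ch h01 hB]] := HB _ e2.
have cgh : Ck 0 setT (fun x => g x * h x : R^o) by exact: (CkM openT cg ch).
exists (fun x => g x * h x); split => //.
- by move=> x; have /andP[g0 g1] := g01 x; have /andP[h0 h1] := h01 x; rewrite mulr_ge0// mulr_ile1.
- have M3 := @mdiff (A `&` B) (fun x => g x * h x) mAB cgh.
 rewrite (splitr e); apply: (integral_le_add mD M3 (mdiff mA cg) (mdiff mB ch) _ _ _ gA hB);
  [|by move=> t _; exact: normr_ge0|by move=> t _; exact: normr_ge0].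
 move=> t _; rewrite normr_ge0; have /andP[g0 g1] := g01 (rv t).
 rewrite !indicE in_setI; set a : R := (t \in A)%:R; set b : R := (t \in B)%:R.
 have -> : ((t \in A) && (t \in B))%:R = a * b by rewrite /a /b; case: (t \in A); case: (t \in B); rewrite ?mulr0 ?mulr1.
 have -> : a * b - g (rv t) * h (rv t) = (a - g (rv t)) * b + g (rv t) * (b - h (rv t)) by ring.
 apply: le_trans (ler_normD _ _) _; rewrite !normrM; apply: lerD.
  by rewrite ler_piMr// /b; case: (t \in B); rewrite ?normr1 ?normr0.
 by rewrite ler_piMl// ger0_norm.
Qed.

Lemma set_approxU A B : set_approx A -> set_approx B -> set_approx (A `|` B).
Proof.
by move=> HA HB; rewrite -[_ `|` _]setCK setCU; apply: set_approxC; apply: set_approxI; exact: set_approxC.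
Qed.

(** D has finite measure, so a finite union misses only a small part of the countable one. *)
Lemma set_approx_bigcup (F : nat -> set (n.-tuple Rm)) : (forall k, set_approx (F k)) -> set_approx (\bigcup_k F k).
Proof.
move=> HF; have mF k : measurable (F k) by have [] := HF k.
have mU : measurable (\bigcup_k F k) by exact: bigcupT_measurable.
split => // e e0; have e2 : 0 < e / 2 by lra.
pose U N := \big[setU/set0]_(k < N) F k.
have HU N : set_approx (U N).
{ rewrite /U; elim: N => [|N IH]; first by rewrite big_ord0; exact: set_approx0.
 by rewrite big_ord_recr /=; exact: set_approxU. }
pose E N := D `&` (\bigcup_k F k `\` U N).
have [mUN _] : (forall N, measurable (U N)) /\ True by split => // N; have [] := HU N.
have [N HN] : exists N, (leb n (E N) <= (e / 2)%:E)%E.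
{ apply: decreasing_measure_small => //.
 - by move=> N; apply: measurableI => //; exact: measurableD.
 - apply: le_lt_trans Doo; apply: le_measure; rewrite ?inE//; last exact: subIsetl.
  by apply: measurableI => //; exact: measurableD.
 - move=> N t [Dt [Ft nU]]; split => //; split => // Ut; apply: nU; rewrite /U big_ord_recr /=; by left.
 - move=> t H; have [_ [[k _ Fk] _]] := H 0%N; have [_ [_]] := H k.+1; apply.
  by rewrite /U big_ord_recr /=; right. }
have [_ /(_ _ e2)[g [cg g01 gU]]] := HU N.
exists g; split => //; rewrite (splitr e).
have mX : measurable (\bigcup_k F k `\` U N) by exact: measurableD.
apply: (@integral_le_add _ _ _ _ D mD _ (\1_(\bigcup_k F k `\` U N)) (fun t => `|\1_(U N) t - g (rv t)|)).
- exact: mdiff.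
- exact: measurable_indic.
- exact: mdiff.
- move=> t _; rewrite normr_ge0 /=.
 have -> : \1_(\bigcup_k F k) t - g (rv t) = \1_(\bigcup_k F k `\` U N) t + (\1_(U N) t - g (rv t)) :> R.
 { rewrite addrA; congr (_ - _); rewrite !indicE in_setD.
  case: (boolP (t \in U N)) => [/set_mem tU|_]; last by rewrite andbT addr0.
  rewrite andbF add0r mem_set//; move: tU; rewrite /U -bigcup_mkord => -[k _ Fk]; by exists k. }
 apply: le_trans (ler_normD _ _) _; rewrite lerD2r ger0_norm// indicE ler0n//.
- by move=> t _; rewrite indicE ler0n.
- by move=> t _; exact: normr_ge0.
- by rewrite integral_indic// setIC.
- exact: gU.
Qed.

(** The functions step((k+1) psi) differ from the indicator only where 0 < psi < 1/(k+1), and these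
    sets decrease to the empty set. *)
Lemma set_approx_pos (psi : 'rV[R]_n -> R^o) : Ck 0 setT psi -> set_approx [set t | 0 < psi (rv t)].
Proof.
move=> Cpsi; have cpsi : continuous psi by move=> x; exact: (Ck_continuous Cpsi).
have mpsi := measurable_comp_rv cpsi.
have mS (I : set R) : measurable I -> measurable ([set t : n.-tuple Rm | I (psi (rv t))]).
{ by move=> mI; rewrite -[X in measurable X]setTI; exact: (mpsi measurableT _ mI). }
have mP : measurable [set t : n.-tuple Rm | 0 < psi (rv t)].
{ have := mS `]0, +oo[%classic (measurable_itv _); congr (measurable _).
 by apply/seteqP; split => t; rewrite /= in_itv /= andbT. }
split => // e e0.
pose E k := D `&` [set t | 0 < psi (rv t) < k.+1%:R^-1].
have mE0 k : measurable [set t : n.-tuple Rm | 0 < psi (rv t) < k.+1%:R^-1].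
{ exact: (mS `]0, k.+1%:R^-1[%classic (measurable_itv _)). }
have mE k : measurable (E k) by exact: measurableI.
have [k Hk] : exists k, (leb n (E k) <= e%:E)%E.
{ apply: decreasing_measure_small => //.
 - by apply: le_lt_trans Doo; apply: le_measure; rewrite ?inE//; exact: subIsetl.
 - move=> k t [Dt /= /andP[p0 p1]]; split => //=; rewrite p0 /=; apply: lt_le_trans p1 _.
  by rewrite lef_pV2 ?posrE ?ltr0n// ler_nat.
 - move=> t H; have [_ /= /andP[p0 _]] := H 0%N.
  have [k Hk] := exists_inv_lt p0.
  by have [_ /= /andP[_ p1]] := H k; have := lt_trans p1 Hk; rewrite ltxx. }
have Cg : Ck 0 setT (fun x => step (k.+1%:R * psi x) : R^o).
{ apply: Ck_step; first exact: openT.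
 by apply: (@CkM R n 0 setT (cst (k.+1%:R : R^o))) => //; [exact: openT|exact: Ck_cst openT]. }
exists (fun x => step (k.+1%:R * psi x)); split => //.
- by move=> x; rewrite step_ge0 step_le1.
- apply: (@integral_le_of_le _ _ _ _ _ mD _ (\1_([set t | 0 < psi (rv t) < k.+1%:R^-1]))).
 + exact: (mdiff mP Cg).
 + exact: measurable_indic.
 + move=> t _; rewrite normr_ge0 /=; rewrite [X in X - _]indicE.
  have k0 : 0 < k.+1%:R :> R by rewrite ltr0n.
  case: (boolP (t \in [set t | 0 < psi (rv t)])) => [/set_mem /= p0|/negP np]; last first.
   rewrite step0 ?subr0 ?normr0 ?indicE ?ler0n//.
   rewrite pmulr_rle0// leNgt; apply/negP => H; apply: np; by rewrite inE.
  have [p1|p1] := ltP (psi (rv t)) (k.+1%:R^-1).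
   rewrite indicE mem_set/=; last by rewrite p0.
   have := step_ge0 (k.+1%:R * psi (rv t)); have := step_le1 (k.+1%:R * psi (rv t)).
   by move=> h1 h0; rewrite ger0_norm; lra.
  rewrite step1 ?subrr ?normr0 ?indicE ?ler0n//.
  by rewrite mulrC -ler_pdivrMr// mul1r.
 + by rewrite integral_indic// setIC.
Qed.

(** The product sigma-algebra is generated by coordinate preimages of open intervals, and the
    preimage of ]a, b[ is the positivity set of (x_i - a)(b - x_i). *)
Lemma measurable_set_approx A : measurable A -> set_approx A.
Proof.
apply: smallest_sub.
 split; [exact: set_approx0| |exact: set_approx_bigcup].
 by move=> B HB; rewrite setTD; exact: set_approxC.
move=> B; rewrite -bigcup_seq => -[i _ [C mC <-]]; rewrite setTI.
have : measurable C := mC; rewrite RGenOpens.measurableE.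
apply: (@smallest_sub _ _ _ [set E | set_approx ((fun t : n.-tuple Rm => tnth t i) @^-1` E)]).
 split.
 - by rewrite /= preimage_set0; exact: set_approx0.
 - by move=> E HE; rewrite /= setTD preimage_setC; exact: set_approxC.
 - by move=> F HF; rewrite /= preimage_bigcup; exact: set_approx_bigcup.
move=> _ [a [b ->]]; have [ab|ba] := ltP a b; last first.
 rewrite set_itv_ge; first exact: set_approx0.
 by rewrite -leNgt.
have CX : Ck 0 setT (fun x : 'rV[R]_n => x 0 i : R^o) by apply: Ck_coord; exact: openT.
have C1 : Ck 0 setT (fun x : 'rV[R]_n => (x 0 i - a) * (b - x 0 i) : R^o).
{ apply: (@CkM R n 0 setT (fun x => x 0 i - a : R^o) (fun x => b - x 0 i : R^o)); first exact: openT.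
  exact: (CkD openT CX (Ck_cst 0 (- a : R^o) openT)).
 exact: (CkD openT (Ck_cst 0 (b : R^o) openT) (CkN openT CX)). }
have := set_approx_pos C1; congr set_approx; apply/seteqP; split => t /=; rewrite in_itv /= !mxE.
 move=> H; have [h1|h1] := ltP a (tnth t i).
  by move: H; rewrite pmulr_rgt0 ?subr_gt0// => ->.
 have h2 : (tnth t i - a) * (b - tnth t i) <= 0 by rewrite mulr_le0_ge0 ?subr_le0// subr_ge0; exact: ltW (le_lt_trans h1 ab).
 by lra.
by move=> /andP[h1 h2]; rewrite mulr_gt0// subr_gt0.
Qed.

Definition L2_approx (w : n.-tuple Rm -> R) := measurable_fun D w /\ forall e : R, 0 < e -> exists2 g : 'rV[R]_n -> R,
 Ck 0 setT (g : _ -> R^o) & (\int[leb n]_(t in D) ((w t - g (rv t)) ^+ 2)%:E <= e%:E)%E.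

Let mdiff2 (w : n.-tuple Rm -> R) g : measurable_fun D w -> Ck 0 setT (g : _ -> R^o) -> measurable_fun D (fun t : n.-tuple Rm => w t - g (rv t) : R).
Proof. by move=> mw cg; apply: measurable_funB => //; exact: measurable_rv. Qed.

Lemma L2_approx_indic A : measurable A -> L2_approx \1_A.
Proof.
move=> mA; have [_ HA] := measurable_set_approx mA; split; first exact: measurable_indic.
move=> e e0; have [g [cg g01 gA]] := HA e e0; exists g => //.
apply: (integral_le_of_le mD _ _ _ gA); [|exact: mdiff|].
 by apply: measurable_funX; apply: mdiff2 => //.
move=> t _; rewrite sqr_ge0 -real_normK ?num_real//.
apply: ler_piMr => //; have /andP[g0 g1] := g01 (rv t).
by rewrite indicE; case: (t \in A) => /=; rewrite ler_norml; lra.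
Qed.

Lemma L2_approxD (v w : n.-tuple Rm -> R) : L2_approx v -> L2_approx w -> L2_approx (fun t => v t + w t).
Proof.
move=> [mv Hv] [mw Hw]; split; first exact: measurable_funD.
move=> e e0; have e4 : 0 < e / 4 by lra.
have [g cg gv] := Hv _ e4; have [h ch hw] := Hw _ e4.
exists (fun x => g x + h x); first exact: (CkD openT cg ch).
have := integral_sqrD_le mD (mdiff2 mv cg) (mdiff2 mw ch) gv hw.
rewrite (_ : 2 * _ + _ = e); last by field.
congr (_ <= _)%E; apply: eq_integral => t _; congr (_%:E); ring.
Qed.

Lemma L2_approxZ (k : R) (w : n.-tuple Rm -> R) : L2_approx w -> L2_approx (fun t => k * w t).
Proof.
move=> [mw Hw]; split; first exact: measurable_funM.
move=> e e0; have k1 : 0 < k ^+ 2 + 1 by rewrite ltr_wpDl ?sqr_ge0.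
have [g cg gw] := Hw (e / (k ^+ 2 + 1)) (divr_gt0 e0 k1).
have ckg := CkM openT (Ck_cst 0 (k : R^o) openT) cg.
exists (fun x => k * g x); first exact: ckg.
have m2 := measurable_funX 2 (mdiff2 mw cg).
apply: (@integral_le_of_le _ _ _ _ _ mD _ (fun t => (k ^+ 2 + 1) * (w t - g (rv t)) ^+ 2)).
- apply: measurable_funX; apply: measurable_funB; first exact: measurable_funM.
 by apply: measurable_funM => //; exact: measurable_rv.
- exact: measurable_funM.
- by move=> t _; rewrite sqr_ge0 /= -mulrBr exprMn ler_wpM2r ?sqr_ge0// lerDl.
- rewrite [X in (_ <= X%:E)%E](_ : e = (k ^+ 2 + 1) * (e / (k ^+ 2 + 1))); last by field; rewrite gt_eqF.
 by apply: integral_le_scale => //; [exact: ltW|move=> t _; exact: sqr_ge0].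
Qed.

Lemma L2_approx_lim (w : n.-tuple Rm -> R) : measurable_fun D w -> (forall e : R, 0 < e -> exists2 v, L2_approx v &
 (\int[leb n]_(t in D) ((w t - v t) ^+ 2)%:E <= e%:E)%E) -> L2_approx w.
Proof.
move=> mw H; split => // e e0; have e4 : 0 < e / 4 by lra.
have [v [mv Hv] wv] := H _ e4; have [g cg gv] := Hv _ e4; exists g => //.
have := integral_sqrD_le mD (measurable_funB mw mv) (mdiff2 mv cg) wv gv.
rewrite (_ : 2 * _ + _ = e); last by field.
congr (_ <= _)%E; apply: eq_integral => t _; congr (_%:E); rewrite /=; ring.
Qed.

Import HBNNSimple.

Lemma L2_approx_nnsfun (f : {nnsfun n.-tuple Rm >-> R}) : L2_approx f.
Proof.
have -> : (f : _ -> R) = fun t => \sum_(r <- finmap.enum_fset (fset_set (range f))) r * \1_(f @^-1` [set r]) t.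
{ by apply/funext => t; rewrite fimfunE fsbig_finite. }
elim: (finmap.enum_fset _) => [|r s IH].
 rewrite (_ : (fun t => _) = (fun t : n.-tuple Rm => 0 * \1_set0 t)).
  by apply: L2_approxZ; apply: L2_approx_indic.
 by apply/funext => t; rewrite big_nil mul0r.
rewrite (_ : (fun t => _) = fun t => r * \1_(f @^-1` [set r]) t + \sum_(r <- s) r * \1_(f @^-1` [set r]) t).
 by apply: L2_approxD => //; apply: L2_approxZ; apply: L2_approx_indic.
by apply/funext => t; rewrite big_cons.
Qed.

(** Simple functions increase to w, and (w - f_k)^2 <= w^2 permits dominated convergence. *)
Lemma L2_approx_ge0 (w : n.-tuple Rm -> R) : measurable_fun setT w -> (forall t, 0 <= w t) ->
 (\int[leb n]_(t in D) (w t ^+ 2)%:E < +oo)%E -> L2_approx w.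
Proof.
move=> mw w0 woo; have mwD : measurable_fun D w by exact: measurable_funTS.
have mwE : measurable_fun setT (EFin \o w) by exact/measurable_EFinP.
apply: L2_approx_lim => // e e0.
pose f := nnsfun_approx measurableT mwE.
have f_cvg t : f k t @[k --> \oo] --> w t.
{ have /= := @cvg_nnsfun_approx _ _ _ _ measurableT _ mwE (fun t _ => w0 t) t I.
 by move=> /fine_cvgP[_]. }
have fw k t : 0 <= f k t <= w t.
{ rewrite fun_ge0; have := f_cvg t => /cvg_lim <- //; apply: nondecreasing_cvgn_le; last by apply/cvg_ex; exists (w t).
 by move=> a b ab; exact/lefP/nd_nnsfun_approx. }
have ig : (leb n).-integrable D (EFin \o (fun t => w t ^+ 2)).
{ apply/integrableP; split; first by apply/measurable_EFinP; exact: measurable_funX.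
 by under eq_integral do rewrite /= ger0_norm ?sqr_ge0//. }
have mfk k : measurable_fun D (f k : _ -> R) by apply: measurable_funTS.
have h1 k : measurable_fun D (fun t => ((w t - f k t) ^+ 2)%:E).
{ by apply/measurable_EFinP; apply: measurable_funX; exact: measurable_funB. }
have h3 : {ae leb n, forall t, D t -> (fun k => ((w t - f k t) ^+ 2)%:E) @ \oo --> (cst 0%E : n.-tuple Rm -> \bar R) t}.
{ apply: aeW => t Dt; apply: cvg_EFin; first by near=> k.
 rewrite (_ : 0 = (w t - w t) * (w t - w t)); last by lra.
 by apply: cvgM; apply: cvgB => //; exact: cvg_cst. }
have h5 : {ae leb n, forall (t : n.-tuple Rm) (k : nat), D t -> (`|((w t - f k t) ^+ 2)%R%:E| <= (EFin \o (fun t : n.-tuple Rm => w t ^+ 2)%R) t)%E}.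
{ apply: aeW => t k Dt; rewrite lee_fin ger0_norm ?sqr_ge0//.
 by have /andP[f0 f1] := fw k t; rewrite lerXn2r ?nnegrE ?subr_ge0//; lra. }
have [_ _] := dominated_convergence mD h1 (measurable_cst _) h3 ig h5.
rewrite integral_cst// mul0e => /fine_cvgP[fin cv].
have /cvgrPdist_le/(_ e e0) C := cv.
have [k _ Hk] : \forall k \near \oo, (\int[leb n]_(t in D) ((w t - f k t) ^+ 2)%:E)%E \is a fin_num /\
  `|0 - fine (\int[leb n]_(t in D) ((w t - f k t) ^+ 2)%:E)%E| <= e by exact: filterI.
have [g1 g2] := Hk k (leqnn k); exists (f k : _ -> R); first exact: L2_approx_nnsfun.
rewrite -(fineK g1); move: g2; rewrite sub0r normrN; apply: le_trans; exact: ler_norm.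
Unshelve. all: end_near.
Qed.

Lemma continuous_dense_L2 (w : n.-tuple Rm -> R) : measurable_fun setT w ->
 (\int[leb n]_(t in D) (w t ^+ 2)%:E < +oo)%E -> L2_approx w.
Proof.
move=> mw woo.
have mle (v : n.-tuple Rm -> R) : measurable_fun setT v -> (forall t, v t ^+ 2 <= w t ^+ 2) ->
 (\int[leb n]_(t in D) (v t ^+ 2)%:E < +oo)%E.
{ move=> mv vw; apply: le_lt_trans woo; apply: ge0_le_integral => //.
 - by move=> t _; rewrite lee_fin sqr_ge0.
 - by apply/measurable_EFinP; apply: measurable_funX; exact: measurable_funTS.
 - by apply/measurable_EFinP; apply: measurable_funX; exact: measurable_funTS.
 - by move=> t _; rewrite lee_fin. }
have m1 : measurable_fun setT (fun t => (`|w t| + w t) / 2).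
{ by apply: measurable_funM => //; apply: measurable_funD => //; exact: measurableT_comp. }
have m2 : measurable_fun setT (fun t => (`|w t| - w t) / 2).
{ by apply: measurable_funM => //; apply: measurable_funB => //; exact: measurableT_comp. }
have H1 : L2_approx (fun t => (`|w t| + w t) / 2).
{ apply: L2_approx_ge0 => //; first by move=> t; have := ler_norm (- w t); rewrite normrN; lra.
 apply: mle => // t; rewrite -[w t ^+ 2]real_normK ?num_real//; apply: lerXn2r; rewrite ?nnegrE//.
  by have := ler_norm (- w t); rewrite normrN; lra.
 by have := ler_norm (w t); lra. }
have H2 : L2_approx (fun t => (`|w t| - w t) / 2).
{ apply: L2_approx_ge0 => //; first by move=> t; have := ler_norm (w t); lra.
 apply: mle => // t; rewrite -[w t ^+ 2]real_normK ?num_real//; apply: lerXn2r; rewrite ?nnegrE//.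
  by have := ler_norm (w t); lra.
 by have := ler_norm (- w t); rewrite normrN; lra. }
have := L2_approxD H1 (L2_approxZ (-1) H2); congr L2_approx; apply/funext => t; by field.
Qed.

End DensityContinuous.

(** * Numerical inequalities for the level-set recursion *)

Section RealLemmas.
Context {R : realType}.

Lemma nth_root n (x : R) : (0 < n)%N -> 0 <= x -> exists2 b : R, 0 <= b & b ^+ n = x.
Proof.
exists (x `^ (n%:R^-1)); first exact: powR_ge0.
rewrite -powR_mulrn ?powR_ge0// -powRrM mulVf ?powRr1// pnatr_eq0 -lt0n//.
Qed.

(** Pointwise form of Hölder's inequality: for q <= c the first term suffices, otherwise the second.
    Integrated over a set and optimized in c it gives the Hölder bound up to a factor 2. *)
Lemma young_sq n (q c : R) : (2 < n)%N -> 0 <= q -> 0 < c -> q ^+ 2 <= c ^+ 2 + q ^+ n * c ^- (n - 2).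
Proof.
move=> n2 q0 c0; have [qc|cq] := leP q c.
 via (c ^+ 2); first by rewrite lerXn2r ?nnegrE// ltW.
 by rewrite lerDl mulr_ge0 ?invr_ge0 ?exprn_ge0// ltW.
via (q ^+ n * c ^- (n - 2)); last by rewrite lerDr exprn_ge0// ltW.
rewrite ler_pdivlMr ?exprn_gt0// -{2}(subnKC (ltnW n2)) exprD; apply: ler_wpM2l; first exact: sqr_ge0.
by rewrite lerXn2r ?nnegrE// ltW.
Qed.

(* The recursion satisfied by the level-set energies: either the level sets
  shrink by a fixed factor, or the energy of the shell controls them. *)
Lemma level_recursion n (b b' h C e : R) : (2 < n)%N -> 0 <= b' -> b' <= b -> 0 < h -> 0 <= e -> 0 <= C ->
 b' ^+ (2 * n) * h ^+ 2 <= C * b ^+ 2 * b ^+ n * e ->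
 (2 * h) ^+ 2 * b' ^+ (n - 2) <= 2^-1 * (h ^+ 2 * b ^+ (n - 2)) + 4 * 8 ^+ (2 * n) * C * e.
Proof.
move=> n2 b'0 b'b h0 e0 C0 H; have b0 := le_trans b'0 b'b.
have Ce : 0 <= 4 * 8 ^+ (2 * n) * C * e by rewrite !mulr_ge0//.
have Sp : (n - 2 = (n - 2).-1.+1)%N by rewrite prednK// subn_gt0.
have [bz|bn] := eqVneq b 0.
 have -> : b' = 0 by lra.
 by rewrite bz expr0n subn_eq0 leqNgt n2 !mulr0 add0r.
have bp : 0 < b by lra.
have [x [x0 x1 b'E]] : exists x : R, [/\ 0 <= x, x <= 1 & b' = x * b].
{ by exists (b' / b); rewrite divr_ge0// ler_pdivrMr// mul1r mulfVK. }
have h2 : 0 < h ^+ 2 by rewrite exprn_gt0.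
have bn2 : 0 < b ^+ (n - 2) by rewrite exprn_gt0.
have key : x ^+ (2 * n) * (h ^+ 2 * b ^+ (n - 2)) <= C * e.
{ have bb : 0 < b ^+ 2 * b ^+ n by rewrite mulr_gt0// exprn_gt0.
 rewrite -(ler_pM2r bb); apply: le_trans (_ : _ <= C * b ^+ 2 * b ^+ n * e) _; last first.
  by lra.
 apply: le_trans H; rewrite b'E [(x * b) ^+ _]exprMn le_eqVlt; apply/orP; left; apply/eqP.
 have -> : b ^+ (2 * n) = b ^+ (n - 2) * b ^+ 2 * b ^+ n by rewrite -!exprD subnK ?(ltnW n2)// mul2n addnn.
 by ring. }
have [xs|xl] := leP (x ^+ (n - 2)) (8^-1).
 have : (2 * h) ^+ 2 * b' ^+ (n - 2) <= 2^-1 * (h ^+ 2 * b ^+ (n - 2)).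
 { rewrite b'E (_ : (2 * h) ^+ 2 * _ = x ^+ (n - 2) * (4 * (h ^+ 2 * b ^+ (n - 2)))); last by rewrite [(x * b) ^+ _]exprMn; ring.
  apply: le_trans (ler_wpM2r _ xs) _; first by rewrite !mulr_ge0// ltW.
  by lra. }
 by lra.
have x8 : 8^-1 <= x.
{ by apply: le_trans (ltW xl) _; rewrite Sp exprS ler_piMr// exprn_ile1. }
have xn : 8 ^- (2 * n) <= x ^+ (2 * n) by rewrite -exprVn lerXn2r ?nnegrE.
have k2 : h ^+ 2 * b ^+ (n - 2) <= 8 ^+ (2 * n) * (C * e).
{
 rewrite -ler_pdivrMl//; apply: le_trans key; apply: ler_wpM2r => //.
 by rewrite mulr_ge0// ltW. }
have : (2 * h) ^+ 2 * b' ^+ (n - 2) <= 4 * (h ^+ 2 * b ^+ (n - 2)).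
{ rewrite (_ : (2 * h) ^+ 2 = 4 * h ^+ 2); last by ring.
 rewrite -mulrA ler_pM2l// ler_pM2l// lerXn2r ?nnegrE//. }
have : 0 <= h ^+ 2 * b ^+ (n - 2) by rewrite mulr_ge0// ltW.
move=> P0 P1.
by lra.
Qed.

Lemma halving_sum (a e : nat -> R) (C : R) N : (forall k, 0 <= a k) ->
 (forall k, a k.+1 <= 2^-1 * a k + C * e k) ->
 \sum_(k < N.+1) a k <= 2 * a 0%N + 2 * C * \sum_(k < N) e k.
Proof.
(* The additional [a N] closes the induction: doubling the recursion gives 2 a(N+1) <= a N + 2 C e
   N. *)
move=> a0 H; suff : \sum_(k < N.+1) a k + a N <= 2 * a 0%N + 2 * C * \sum_(k < N) e k.
 by apply: le_trans; rewrite lerDl.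
elim: N => [|N IH]; first by rewrite big_ord_recl !big_ord0; lra.
rewrite big_ord_recr [in X in _ <= X]big_ord_recr /=.
have := H N; lra.
Qed.

End RealLemmas.

Lemma eq_leRL {d} {T : porderType d} (x y : T) : x = y -> (x <= y)%O.
Proof. by move=> ->. Qed.

Lemma young_balance {R : realFieldType} (k b : R) m : k != 0 -> b != 0 ->
 (k / b) ^+ 2 * b ^+ m.+2 + (k / b) ^- m * k ^+ m.+2 = 2 * k ^+ 2 * b ^+ m.
Proof.
move=> k0 b0; have km : k ^+ m != 0 by rewrite expf_neq0.
have bm : b ^+ m != 0 by rewrite expf_neq0.
by rewrite [in X in _ + X]expr_div_n !exprS; field; rewrite km bm.
Qed.

Section ShellSums.
Context {R : realType} {M : Type}.
Variables (phi : M -> R) (l : R).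
Hypothesis l0 : 0 < l.

(** The shells are disjoint: 3 h^2 lies strictly below 2 (2h)^2, the lower end of the next one. *)
Lemma sum_shell_le1 N p :
 \sum_(k < N) \1_([set p | 2 * (l * 2 ^+ k) ^+ 2 <= phi p ^+ 2 <= 3 * (l * 2 ^+ k) ^+ 2]) p <= 1 :> R.
Proof.
elim: N => [|N IH]; first by rewrite big_ord0.
rewrite big_ord_recr /=; case: (boolP (p \in [set p | 2 * (l * 2 ^+ N) ^+ 2 <= phi p ^+ 2 <= 3 * (l * 2 ^+ N) ^+ 2])); last first.
 by move=> /negbTE np; rewrite [X in _ + X]indicE np addr0.
move=> /[dup] pN /set_mem /= /andP[pl _]; rewrite [X in _ + X]indicE pN big1 ?add0r// => k _.
rewrite indicE memNset//= => /andP[_ pu].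
have hk : 2 * (l * 2 ^+ k) <= l * 2 ^+ N.
{ by rewrite mulrCA ler_pM2l// -exprS; apply: ler_weXn2l; rewrite ?ler1n. }
have lk : 0 < l * 2 ^+ k by rewrite mulr_gt0//.
have : (2 * (l * 2 ^+ k)) ^+ 2 <= (l * 2 ^+ N) ^+ 2.
{ by rewrite lerXn2r ?nnegrE// ?mulr_ge0 ?exprn_ge0// ltW. }
have : 0 < (l * 2 ^+ k) ^+ 2 by rewrite exprn_gt0.
by lra.
Qed.

(** A dyadic layer-cake bound: if phi^2 lies between (l 2^N)^2 and 4 (l 2^N)^2, the last term alone
    dominates it. *)
Lemma level_decomposition N p : phi p ^+ 2 <= (l * 2 ^+ N) ^+ 2 ->
 phi p ^+ 2 <= l ^+ 2 + \sum_(k < N) 4 * (l * 2 ^+ k) ^+ 2 * \1_([set p | (l * 2 ^+ k) ^+ 2 < phi p ^+ 2]) p.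
Proof.
elim: N => [|N IH]; first by rewrite big_ord0 mulr1 addr0.
rewrite big_ord_recr => H.
have [/IH H1|H1] := leP (phi p ^+ 2) ((l * 2 ^+ N) ^+ 2).
 by rewrite addrA; apply: le_trans H1 _; rewrite lerDl; apply: mulr_ge0; [apply: mulr_ge0 => //; exact: sqr_ge0|exact: indic_ge0].
have -> : \1_[set p | (l * 2 ^+ N) ^+ 2 < phi p ^+ 2] p = 1 :> R by rewrite indicE mem_set.
rewrite mulr1 addrA.
via (4 * (l * 2 ^+ N) ^+ 2).
 by apply: le_trans H _; rewrite [2 ^+ N.+1]exprS le_eqVlt; apply/orP; left; apply/eqP; ring.
rewrite lerDr; apply: addr_ge0; first exact: sqr_ge0.
by apply: sumr_ge0 => k _; apply: mulr_ge0; [apply: mulr_ge0 => //; exact: sqr_ge0|exact: indic_ge0].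
Qed.

End ShellSums.

(** * Level-set estimates and the weighted Sobolev inequality *)

Section WeightedSobolev.
Context {R : realType} {n : nat} {M : ptopologicalType}.
Variables (S : smooth_manifold R n M) (iota : M -> 'rV[R]_n.+1).
Variable mu : {measure set (borelType M) -> \bar R}.
Hypothesis imm : is_immersion S iota.
Hypothesis Hmu : is_riemannian_volume S iota mu.
Hypothesis minimal : is_minimal S iota.
Hypothesis n2 : (2 < n)%N.
Local Notation grad := (grad S iota).

Let n1 : (1 < n)%N. Proof. exact: ltnW. Qed.
Let n0 : (0 < n)%N. Proof. exact: ltnW. Qed.

Section Levels.
Variables (phi : M -> R) (K : set M).
Hypothesis sphi : smooth_fun S phi.
Hypothesis cK : compact K.
Hypothesis phi0 : forall p, ~ K p -> phi p = 0.

Let clK := closed_compact_manifold S cK.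

Definition level (h : R) : set M := [set p | h ^+ 2 < phi p ^+ 2].
(** Steps of phi^2 instead of |phi| stay smooth. The thresholds 2 h^2 and 3 h^2 lie strictly between
    h^2 and (2h)^2, so the function vanishes off [level h] and equals 1 on [level (2 * h)]. *)
Definition trunc (h : R) p : R := step (h ^- 2 * phi p ^+ 2 - 2).
Definition shell (h : R) : set M := [set p | 2 * h ^+ 2 <= phi p ^+ 2 <= 3 * h ^+ 2].

Lemma sq_continuous : continuous (fun p => phi p ^+ 2).
Proof. exact: (smooth_continuous (smooth_funX 2 sphi)). Qed.

Lemma level_open h : open (level h).
Proof.
have /continuousP H := sq_continuous.
have := H `]h ^+ 2, +oo[%classic (@interval_open R (BRight (h ^+ 2)) +oo%O isT isT).
by rewrite (_ : _ @^-1` _ = level h)//; apply/seteqP; split => q; rewrite /= in_itv andbT.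
Qed.

Lemma measurable_level h : measurable (level h : set (borelType M)).
Proof. by apply: measurable_open; exact: level_open. Qed.

Lemma level_sub h : level h `<=` K.
Proof.
move=> p; rewrite /level /= => H; apply: contrapT => /phi0 E; move: H; rewrite E expr0n.
by rewrite ltNge sqr_ge0.
Qed.

Lemma shell_closed h : closed (shell h).
Proof.
have /continuous_closedP H := sq_continuous.
rewrite (_ : shell h = (fun p => phi p ^+ 2) @^-1` `[2 * h ^+ 2, 3 * h ^+ 2]%classic).
 by apply: H; exact: interval_closed.
by [].
Qed.

Lemma measurable_shell h : measurable (shell h : set (borelType M)).
Proof.
rewrite -[X in measurable X]setCK; apply: measurableC; apply: measurable_open.
by apply: closed_openC; exact: shell_closed.
Qed.

Lemma shell_level h : 0 < h -> shell h `<=` level h.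
Proof.
move=> h0 p; rewrite /level /= => /andP[H _].
by have : 0 < h ^+ 2 by [rewrite exprn_gt0]; lra.
Qed.

Lemma smooth_trunc h : smooth_fun S (trunc h).
Proof.
apply: smooth_fun_step; apply: smooth_funB; last exact: smooth_cst.
by apply: smooth_funM; [exact: smooth_cst|exact: smooth_funX].
Qed.

Lemma trunc_eq0 h p : 0 < h -> phi p ^+ 2 <= 2 * h ^+ 2 -> trunc h p = 0.
Proof.
move=> h0 H; apply: step0; rewrite subr_le0 mulrC ler_pdivrMr// exprn_gt0//.
Qed.

Lemma trunc_eq1 h p : 0 < h -> 3 * h ^+ 2 <= phi p ^+ 2 -> trunc h p = 1.
Proof.
move=> h0 H; apply: step1; by rewrite lerBrDr mulrC ler_pdivlMr ?exprn_gt0.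
Qed.

Lemma trunc_supp h p : 0 < h -> ~ K p -> trunc h p = 0.
Proof. by move=> h0 nK; apply: trunc_eq0 => //; rewrite phi0// expr0n mulr_ge0// sqr_ge0. Qed.

Let closed_ge_sq (x : R) : closed [set p | x <= phi p ^+ 2].
Proof. by have /continuous_closedP H := sq_continuous; exact: (H [set y | x <= y] (@closed_ge R x)). Qed.
Let closed_le_sq (x : R) : closed [set p | phi p ^+ 2 <= x].
Proof. by have /continuous_closedP H := sq_continuous; exact: (H [set y | y <= x] (@closed_le R x)). Qed.

Lemma grad_trunc_off h p : 0 < h -> ~ shell h p -> grad (trunc h) p = 0.
Proof.
move=> h0 ns; have [lo|hi] := ltP (phi p ^+ 2) (2 * h ^+ 2).
 apply: (grad_support S iota (K := [set q | 2 * h ^+ 2 <= phi q ^+ 2])); first exact: closed_ge_sq.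
  by move=> q /= /negP; rewrite -ltNge => /ltW; exact: trunc_eq0.
 by move=> /=; rewrite leNgt lo.
have sB : smooth_fun S (fun q => 1 - trunc h q) by apply: smooth_funB; [exact: smooth_cst|exact: smooth_trunc].
have G1 : grad (fun q => 1 - trunc h q) p = 0.
{ apply: (grad_support S iota (K := [set q | phi q ^+ 2 <= 3 * h ^+ 2])); first exact: closed_le_sq.
  by move=> q /= /negP; rewrite -ltNge => /ltW H; rewrite trunc_eq1// subrr.
 by move=> /= H; apply: ns; rewrite /shell /= hi. }
have := @gradD _ _ _ S iota _ _ p (smooth_trunc h) sB; rewrite G1 addr0 => <-.
rewrite (_ : (fun q => _) = fun=> 1); first exact: grad_cst.
by apply/funext => q; rewrite addrC subrK.
Qed.

(** By the chain rule the factor is at most Cs times 2|phi|/h^2, and |phi| <= 2h on the shell. *)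
Lemma grad_trunc_le (Cs : R) (g : R -> R) h p : (forall x, is_derive x (1 : R) step (g x)) ->
 (forall x, `|g x| <= Cs) -> 0 < h ->
 enorm (grad (trunc h) p) <= 4 * Cs / h * (\1_(shell h) p * enorm (grad phi p)).
Proof.
move=> Dg gC h0.
rewrite indicE; case: (boolP (p \in _)) => [/set_mem ps|/negP ns]; last first.
 by rewrite grad_trunc_off ?enorm0 ?mul0r ?mulr0// => H; apply: ns; rewrite inE.
rewrite mul1r.
have D : is_derive (phi p) (1 : R) (fun x : R => step (h ^- 2 * x ^+ 2 - 2)) (g (h ^- 2 * phi p ^+ 2 - 2) * (h ^- 2 * (2 * phi p))).
{ have D1 : is_derive (phi p) (1 : R) (fun x : R => h ^- 2 * (x * x) - 2) (h ^- 2 * (2 * phi p)).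
 { apply: is_derive_eq; rewrite /GRing.scale /=; ring. }
 have D1' : is_derive (phi p) (1 : R) (fun x : R => h ^- 2 * x ^+ 2 - 2) (h ^- 2 * (2 * phi p)) by [].
 have Dg' : is_derive ((fun x : R => h ^- 2 * x ^+ 2 - 2) (phi p)) (1 : R) step (g (h ^- 2 * phi p ^+ 2 - 2)) := Dg _.
 have [dd E] := is_derive1_comp (f := step) (g := fun x : R => h ^- 2 * x ^+ 2 - 2) Dg' D1'.
 by split => //. }
rewrite [grad (trunc h) p](@grad_comp R n M S iota (fun x : R => step (h ^- 2 * x ^+ 2 - 2)) _ phi p sphi D).
rewrite enormZ; apply: ler_wpM2r; first exact: enorm_ge0.
rewrite normrM.
have ph : `|phi p| <= 2 * h.
{ rewrite -(ler_pXn2r (_ : (0 < 2)%N))// ?nnegrE ?mulr_ge0 ?(ltW h0)// real_normK ?num_real//.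
 move: ps; rewrite /= => /andP[_ H].
 by have : 0 < h ^+ 2 by [rewrite exprn_gt0]; lra. }
have hh : 0 < h ^- 2 by rewrite invr_gt0 exprn_gt0.
via (Cs * (h ^- 2 * (2 * (2 * h)))).
 apply: ler_pM => //; rewrite normrM (ger0_norm (ltW hh)) ler_pM2l// normrM ger0_norm// ler_pM2l//.
by apply: le_of_eq; field; rewrite gt_eqF.
Qed.

Let niceg := nice_gradu imm sphi cK phi0.

Lemma nice_grad_sq : nice K (fun p => enorm (grad phi p) ^+ 2).
Proof.
have ce := enorm_grad_continuous imm sphi.
apply: nice_continuous => //.
 by rewrite (_ : (fun p => _) = fun p => enorm (grad phi p) * enorm (grad phi p)) => [p|];
   [apply: cvgM; exact: ce|apply/funext => p; rewrite expr2].
by move=> q nK; rewrite (grad_support S iota clK phi0 nK) enorm0 expr0n.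
Qed.

Definition shell_energy h : R := \int[mu]_p (\1_(shell h) p * enorm (grad phi p) ^+ 2).

Let nice_shell h : nice K (fun p => \1_(shell h) p * enorm (grad phi p) ^+ 2).
Proof. by apply: nice_indic; [exact: measurable_shell|exact: nice_grad_sq]. Qed.

Lemma shell_energy_ge0 h : 0 <= shell_energy h.
Proof. by apply: Rintegral_ge0 => p _; rewrite mulr_ge0 ?sqr_ge0. Qed.

Lemma shell_cauchy_schwarz h m : 0 < h -> (mu (level h : set (borelType M)) <= m%:E)%E ->
 (\int[mu]_p (\1_(shell h) p * enorm (grad phi p))) ^+ 2 <= m * shell_energy h.
Proof.
move=> h0 Hm; have [nA EA] := Rintegral_indic_mu imm Hmu cK (measurable_shell h)
 (subset_trans (shell_level h0) (@level_sub h)).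
have mA : \int[mu]_p (\1_(shell h) p : R) <= m.
{ rewrite -lee_fin -EA; apply: le_trans Hm; apply: le_measure; rewrite ?inE.
 - exact: measurable_shell.
 - exact: measurable_level.
 - exact: shell_level. }
via (\int[mu]_p (\1_(shell h) p : R) * shell_energy h); last first.
 by apply: ler_wpM2r; [exact: shell_energy_ge0|exact: mA].
have nI : nice K (fun p => \1_(shell h) p * enorm (grad phi p)) by apply: nice_indic; [exact: measurable_shell|].
apply: discriminant_le; first by apply: Rintegral_ge0 => p _.
move=> t.
have -> : t ^+ 2 * \int[mu]_p (\1_(shell h) p : R) - 2 * t * \int[mu]_p (\1_(shell h) p * enorm (grad phi p)) + shell_energy h =
 \int[mu]_p ((t ^+ 2 * \1_(shell h) p + (- (2 * t)) * (\1_(shell h) p * enorm (grad phi p))) + \1_(shell h) p * enorm (grad phi p) ^+ 2).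
{ rewrite (nice_RintegralD imm Hmu cK); [|by apply: niceD; exact: niceZ|exact: nice_shell].
 rewrite (nice_RintegralD imm Hmu cK); [|exact: niceZ|exact: niceZ].
 by rewrite !(nice_RintegralZ imm Hmu cK)// mulNr. }
apply: Rintegral_ge0 => p _.
have -> : t ^+ 2 * \1_(shell h) p + - (2 * t) * (\1_(shell h) p * enorm (grad phi p)) + \1_(shell h) p * enorm (grad phi p) ^+ 2
 = \1_(shell h) p * (t - enorm (grad phi p)) ^+ 2 by ring.
by rewrite mulr_ge0 ?sqr_ge0.
Qed.

Lemma level_root h : exists2 b : R, 0 <= b & mu (level h : set (borelType M)) = (b ^+ n)%:E.
Proof.
have [nA EA] := Rintegral_indic_mu imm Hmu cK (measurable_level h) (@level_sub h).
have [|b b0 bE] := @nth_root R n (\int[mu]_p (\1_(level h) p : R)) n0.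
 by apply: Rintegral_ge0 => p _.
by exists b => //; rewrite bE.
Qed.

Definition root_level h : R := s2val (cid2 (level_root h)).
Lemma root_level_ge0 h : 0 <= root_level h. Proof. by rewrite /root_level; case: cid2. Qed.
Lemma root_levelE h : mu (level h : set (borelType M)) = (root_level h ^+ n)%:E.
Proof. by rewrite /root_level; case: cid2. Qed.

(** Write b(h) for the n-th root of the measure of [level h]. [weak_sobolev] for the truncation
    gives b(2h)^n <= C b(h)/h times the integral of |grad phi| over the shell. Squaring and applying
    Cauchy-Schwarz gives b(2h)^(2n) h^2 <= C^2 b(h)^(2+n) times the shell energy, the hypothesis of
    [level_recursion]. *)
Lemma level_step (Cs : R) (g : R -> R) h : (forall x, is_derive x (1 : R) step (g x)) ->
 (forall x, `|g x| <= Cs) -> 0 < h ->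
 (2 * h) ^+ 2 * root_level (2 * h) ^+ (n - 2) <= 2^-1 * (h ^+ 2 * root_level h ^+ (n - 2)) +
  4 * 8 ^+ (2 * n) * (@MS_const R n * (4 * Cs)) ^+ 2 * shell_energy h.
Proof.
move=> Dg gC h0; have C0 : 0 <= Cs := le_trans (normr_ge0 _) (gC 0).
have h4 : (2 * h) ^+ 2 = 4 * h ^+ 2 by ring.
have hp : 0 < h ^+ 2 by rewrite exprn_gt0.
have sub1 : level (2 * h) `<=` level h.
{ by move=> p; rewrite /level /= h4; apply: le_lt_trans; lra. }
have bb : root_level (2 * h) <= root_level h.
{ rewrite -(ler_pXn2r n0) ?nnegrE ?root_level_ge0// -lee_fin -!root_levelE.
 by apply: le_measure; rewrite ?inE; [exact: measurable_level|exact: measurable_level|]. }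
apply: level_recursion => //; [exact: root_level_ge0|exact: shell_energy_ge0|exact: sqr_ge0|].
(* A null level set is treated apart because [weak_sobolev] requires a positive root. *)
have [bz|bn] := eqVneq (root_level h) 0.
 have -> : root_level (2 * h) = 0 by apply/eqP; rewrite eq_le root_level_ge0 andbT -bz.
 have -> : (0 : R) ^+ (2 * n) = 0 by rewrite expr0n muln_eq0 /= eqn0Ngt n0.
 rewrite mul0r; apply: mulr_ge0; last exact: shell_energy_ge0.
 apply: mulr_ge0; last by apply: exprn_ge0; exact: root_level_ge0.
 by apply: mulr_ge0; exact: sqr_ge0.
have bp : 0 < root_level h by rewrite lt_def bn root_level_ge0.
have v01 p : 0 <= trunc h p <= 1 by rewrite step_ge0 step_le1.
have mv : (mu ([set p | 0 < trunc h p]%R : set (borelType M)) <= (root_level h ^+ n)%:E)%E.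
{ rewrite -root_levelE; apply: le_measure; rewrite ?inE.
 - by apply: measurable_open; exact: (superlevel_open (smooth_trunc h)).
 - exact: measurable_level.
 - move=> p; rewrite /level /= => H; rewrite ltNge; apply/negP => H2; move: H.
  by rewrite trunc_eq0 ?ltxx//; lra. }
have W := weak_sobolev imm Hmu minimal n1 (smooth_trunc h) cK (fun p => @trunc_supp h p h0) v01 bp mv.
have W2 : root_level (2 * h) ^+ n <= @MS_const R n * root_level h * \int[mu]_p enorm (grad (trunc h) p).
{ rewrite -lee_fin -root_levelE; apply: le_trans W; apply: le_measure; rewrite ?inE.
 - exact: measurable_level.
 - have /continuous_closedP H := smooth_continuous (smooth_trunc h).
  rewrite -[X in measurable X]setCK; apply: measurableC; apply: measurable_open; apply: closed_openC.
  exact: (H [set x | x = 1] (@closed_eq R 1)).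
 - by move=> p; rewrite /level /= h4 => H; apply: trunc_eq1 => //; lra. }
have nt : nice K (fun p => enorm (grad (trunc h) p)).
{ apply: nice_continuous => //; first exact: (enorm_grad_continuous imm (smooth_trunc h)).
 by move=> q nK; rewrite (grad_support S iota clK (fun p => @trunc_supp h p h0) nK) enorm0. }
have nI : nice K (fun p => \1_(shell h) p * enorm (grad phi p)) by apply: nice_indic; [exact: measurable_shell|].
have W3 : \int[mu]_p enorm (grad (trunc h) p) <= 4 * Cs / h * \int[mu]_p (\1_(shell h) p * enorm (grad phi p)).
{ rewrite -(nice_RintegralZ imm Hmu cK)//; apply: (nice_Rintegral_le imm Hmu cK) => //; first exact: niceZ.
 by move=> p; exact: (grad_trunc_le p Dg gC h0). }
have CS := @shell_cauchy_schwarz h (root_level h ^+ n) h0; rewrite root_levelE lexx in CS.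
have {}CS := CS isT.
set I := \int[mu]_p (\1_(shell h) p * enorm (grad phi p)) in W3 CS.
have I0 : 0 <= I by apply: Rintegral_ge0 => p _; rewrite mulr_ge0 ?indic_ge0 ?enorm_ge0.
have L0 := MS_const_gt0 (R := R) n1.
have W4 : root_level (2 * h) ^+ n * h <= @MS_const R n * (4 * Cs) * root_level h * I.
{ rewrite -ler_pdivlMr//; apply: le_trans W2 _.
 apply: le_trans (ler_wpM2l _ W3) _; first by rewrite mulr_ge0// ltW.
 by apply: le_of_eq; field; rewrite gt_eqF. }
have -> : root_level (2 * h) ^+ (2 * n) * h ^+ 2 = (root_level (2 * h) ^+ n * h) ^+ 2 by rewrite exprMn -exprM mulnC.
via ((@MS_const R n * (4 * Cs) * root_level h * I) ^+ 2).
 apply: lerXn2r => //; rewrite nnegrE; apply: mulr_ge0 => //.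
 - by apply: exprn_ge0; exact: root_level_ge0.
 - exact: ltW.
 - by apply: mulr_ge0; [apply: mulr_ge0; [exact: ltW|exact: mulr_ge0]|exact: root_level_ge0].
rewrite (_ : (_ * I) ^+ 2 = (@MS_const R n * (4 * Cs)) ^+ 2 * root_level h ^+ 2 * I ^+ 2); last by ring.
rewrite -[X in _ <= X]mulrA; apply: ler_wpM2l => //.
by apply: mulr_ge0; exact: sqr_ge0.
Qed.

End Levels.

(** Hölder's inequality for q^2 on A, with constant 2, obtained from [young_sq]. *)
Lemma weighted_measure_bound (q : M -> R) (A : set M) (kappa b : R) :
 measurable_fun setT (q : borelType M -> R) -> (forall p, 0 <= q p) -> 0 < kappa -> 0 <= b ->
 (\int[mu]_p (q p ^+ n)%:E <= (kappa ^+ n)%:E)%E -> measurable (A : set (borelType M)) ->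
 (mu (A : set (borelType M)) <= (b ^+ n)%:E)%E ->
 (\int[mu]_(p in (A : set (borelType M))) (q p ^+ 2)%:E <= (2 * kappa ^+ 2 * b ^+ (n - 2))%:E)%E.
Proof.
move=> mq q0 k0 b0 Hq mA HA.
have mX m : measurable_fun setT (fun p : borelType M => (q p ^+ m)%:E).
{ by apply/measurable_EFinP; exact: measurable_funX. }
have [bz|bn] := eqVneq b 0.
 have mu0 : mu (A : set (borelType M)) = 0%E.
 { by apply/eqP; rewrite eq_le measure_ge0 andbT; apply: le_trans HA _; rewrite bz expr0n eqn0Ngt n0. }
 have I0 : (\int[mu]_(p in (A : set (borelType M))) (q p ^+ 2)%:E = 0)%E.
 { exact: (null_set_integral mA (measurable_funTS (mX 2%N)) mu0). }
 rewrite I0 lee_fin; apply: mulr_ge0; last exact: exprn_ge0.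
 by apply: mulr_ge0 => //; exact: sqr_ge0.
have bp : 0 < b by rewrite lt_def bn.
(* With this threshold both terms of Young's inequality integrate to at most kappa^2 b^(n-2). *)
pose c := kappa / b.
have c0 : 0 < c by rewrite divr_gt0.
have cn : 0 < c ^- (n - 2) by rewrite invr_gt0 exprn_gt0.
via (\int[mu]_(p in (A : set (borelType M))) ((c ^+ 2)%:E + (c ^- (n - 2))%:E * (q p ^+ n)%:E))%E.
 apply: ge0_le_integral => //.
 - by move=> p _; rewrite lee_fin sqr_ge0.
 - exact: (measurable_funTS (mX 2%N)).
 - apply: emeasurable_funD; first exact: measurable_cst.
  by apply: measurable_funeM; exact: (measurable_funTS (mX n)).
 - by move=> p _; rewrite -EFinM -EFinD lee_fin [_ * (q p ^+ n)]mulrC; exact: young_sq.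
rewrite ge0_integralD//; last 3 first.
- by move=> p _; rewrite lee_fin sqr_ge0.
- by move=> p _; rewrite -EFinM lee_fin mulr_ge0 ?exprn_ge0 ?q0// ltW.
- by apply: measurable_funeM; exact: (measurable_funTS (mX n)).
rewrite integral_cst// ge0_integralZl_EFin//; last 3 first.
- by move=> p _; rewrite lee_fin exprn_ge0.
- exact: (measurable_funTS (mX n)).
- exact: ltW.
via ((c ^+ 2)%:E * (b ^+ n)%:E + (c ^- (n - 2))%:E * (kappa ^+ n)%:E)%E.
 apply: leeD.
  by apply: lee_wpmul2l => //; rewrite lee_fin sqr_ge0.
 apply: lee_wpmul2l; first by rewrite ltW.
 apply: le_trans Hq; apply: ge0_subset_integral => //.
 by move=> p _; rewrite lee_fin exprn_ge0.
rewrite lee_fin le_eqVlt; apply/orP; left; apply/eqP.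
have [m nE] : exists m, n = m.+2 by exists (n - 2)%N; rewrite -addn2 subnK//.
rewrite nE (_ : (m.+2 - 2)%N = m); last by rewrite subn2.
by apply: young_balance; rewrite ?gt_eqF.
Qed.

Definition sobolev_bound (C : R) := forall (q phi : M -> R) (K : set M) (kappa : R),
 measurable_fun setT (q : borelType M -> R) -> (forall p, 0 <= q p) -> 0 < kappa ->
 (\int[mu]_p (q p ^+ n)%:E <= (kappa ^+ n)%:E)%E ->
 smooth_fun S phi -> compact K -> (forall p, ~ K p -> phi p = 0) ->
 (\int[mu]_p (q p ^+ 2 * phi p ^+ 2)%:E <= (C * kappa ^+ 2 * \int[mu]_p (enorm (grad phi p) ^+ 2))%:E)%E.

(** phi^2 is bounded by a layer-cake sum over doubled levels starting from l; on each level set the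
    weight contributes 2 kappa^2 b^(n-2). The numbers h^2 b^(n-2) satisfy the halving recursion
    driven by the shell energies, whose sum is at most the total energy. *)
Lemma weighted_sobolev : exists2 C : R, 0 < C & sobolev_bound C.
Proof.
have [g Dg [Cs Cs0 gC]] := @step_derive R.
pose C1 := 4 * 8 ^+ (2 * n) * (@MS_const R n * (4 * Cs)) ^+ 2.
have C10 : 0 < C1.
{ have L0 := MS_const_gt0 (R := R) n1.
 rewrite /C1; apply: mulr_gt0; first by apply: mulr_gt0 => //; exact: exprn_gt0.
 by apply: exprn_gt0; apply: mulr_gt0 => //; exact: mulr_gt0. }
exists (16 * C1); first by rewrite mulr_gt0.
move=> q phi K kappa mq q0 k0 Hq sphi cK phi0.
have clK := closed_compact_manifold S cK.
have [mK Koo] := mu_compact_lty imm Hmu cK.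
have [B B0 HB] : exists2 B : R, 0 <= B & mu (K : set (borelType M)) = (B ^+ n)%:E.
{ have [|b b0 bE] := @nth_root R n (fine (mu (K : set (borelType M)))) n0; first by rewrite fine_ge0.
 by exists b => //; rewrite bE fineK// ge0_fin_numE. }
have k20 : 0 <= kappa ^+ 2 by exact: sqr_ge0.
have cph := smooth_continuous sphi.
have [Ph Ph0 phB] := @compact_ubound R M K phi cK (fun p _ => cph p).
set E := \int[mu]_p (enorm (grad phi p) ^+ 2).
have E0 : 0 <= E by apply: Rintegral_ge0 => p _; exact: sqr_ge0.
(* The values below the lowest level l contribute a multiple of l^2 B^(n-2), which disappears as l
   tends to 0. *)
suff H l : 0 < l -> (\int[mu]_p (q p ^+ 2 * phi p ^+ 2)%:E <= (2 * kappa ^+ 2 * (9 * (l ^+ 2 * B ^+ (n - 2)) + 8 * C1 * E))%:E)%E.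
{ have D0 : 0 <= 2 * kappa ^+ 2 * (9 * B ^+ (n - 2)) by apply: mulr_ge0; [exact: mulr_ge0|apply: mulr_ge0 => //; exact: exprn_ge0].
 apply/lee_addgt0Pr => e e0.
 have [l l0 ll] : exists2 l : R, 0 < l & l ^+ 2 * (2 * kappa ^+ 2 * (9 * B ^+ (n - 2))) <= e.
 { exists (Num.sqrt (e / (1 + 2 * kappa ^+ 2 * (9 * B ^+ (n - 2))))).
   by rewrite sqrtr_gt0 divr_gt0// ltr_pwDl.
  rewrite sqr_sqrtr; last by rewrite divr_ge0 ?(ltW e0)// addr_ge0.
  rewrite mulrAC ler_pdivrMr ?ltr_pwDl//; apply: ler_wpM2l; first exact: ltW.
  by rewrite lerDr. }
 apply: le_trans (H l l0) _; rewrite -EFinD lee_fin.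
 via (16 * C1 * kappa ^+ 2 * E + l ^+ 2 * (2 * kappa ^+ 2 * (9 * B ^+ (n - 2)))).
  by apply: le_of_eq; ring.
 by rewrite lerD2l. }
move=> l0.
have [m Hm] := pow3_unbounded (Ph / l).
(* Levels double while the available bound is a power of 3; 3 <= 2^2 explains the factor 2. *)
pose N := (2 * m)%N.
have HN : Ph < l * 2 ^+ N.
{ move: Hm; rewrite ltr_pdivrMr// mulrC => Hm; apply: lt_le_trans Hm _; rewrite ler_pM2l// /N exprM.
 by apply: lerXn2r; rewrite ?nnegrE//; rewrite -natrX ler_nat. }
pose h k : R := l * 2 ^+ k.
have h0 k : 0 < h k by rewrite mulr_gt0// exprn_gt0.
have hS k : h k.+1 = 2 * h k by rewrite /h exprS mulrCA.
pose b k := root_level sphi cK phi0 (h k).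
pose a k := h k ^+ 2 * b k ^+ (n - 2).
have b0 k : 0 <= b k by exact: root_level_ge0.
have a0 k : 0 <= a k by rewrite mulr_ge0 ?sqr_ge0 ?exprn_ge0.
have arec k : a k.+1 <= 2^-1 * a k + C1 * shell_energy phi (h k).
{ by rewrite /a /b hS; exact: (level_step sphi cK phi0 Dg gC (h0 k)). }
have aN := halving_sum N a0 arec.
have a00 : a 0%N <= l ^+ 2 * B ^+ (n - 2).
{ rewrite /a /h expr0 mulr1; apply: ler_wpM2l; first exact: sqr_ge0.
 rewrite lerXn2r ?nnegrE// -(ler_pXn2r n0) ?nnegrE// -lee_fin -HB -(root_levelE sphi cK phi0).
 apply: le_measure; rewrite ?inE//; [exact: measurable_level|exact: level_sub]. }
have eN : \sum_(k < N) shell_energy phi (h k) <= E.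
{ have ng := nice_grad_sq sphi cK phi0.
 have nS k : nice K (fun p => \1_(shell phi (h k)) p * enorm (grad phi p) ^+ 2).
 { by apply: nice_indic => //; exact: measurable_shell. }
 via (\int[mu]_p (\sum_(k < N) \1_(shell phi (h k)) p * enorm (grad phi p) ^+ 2)).
  by rewrite (nice_Rintegral_sum imm Hmu cK (index_enum _) (fun k : 'I_N => nS k)).
 apply: (nice_Rintegral_le imm Hmu cK); [exact: (nice_sum _ (fun k : 'I_N => nS k))|exact: ng|] => p.
 rewrite -mulr_suml; apply: ler_piMl; first exact: sqr_ge0.
 exact: sum_shell_le1. }
have Sa : \sum_(k < N) a k <= 2 * (l ^+ 2 * B ^+ (n - 2)) + 2 * C1 * E.
{ via (\sum_(k < N.+1) a k); first by rewrite big_ord_recr /= lerDl.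
 apply: le_trans aN _; apply: lerD; first by rewrite ler_pM2l.
 by rewrite ler_pM2l// mulr_gt0. }
have mq2 : measurable_fun setT (fun p : borelType M => (q p ^+ 2)%:E).
{ by apply/measurable_EFinP; exact: measurable_funX. }
have piece c A r : 0 <= c -> measurable (A : set (borelType M)) -> 0 <= r -> (mu (A : set (borelType M)) <= (r ^+ n)%:E)%E ->
 [/\ measurable_fun setT (fun p : borelType M => (c * (\1_A p * q p ^+ 2))%:E),
   (forall p, 0 <= (c * (\1_A p * q p ^+ 2))%:E)%E &
 (\int[mu]_p (c * (\1_A p * q p ^+ 2))%:E <= (c * (2 * kappa ^+ 2 * r ^+ (n - 2)))%:E)%E].
{ move=> c0 mA r0 Ar.
 have m1 : measurable_fun setT (fun p : borelType M => (\1_A p * q p ^+ 2)%:E).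
 { apply/measurable_EFinP; apply: measurable_funM; last exact: measurable_funX.
  exact: (@measurable_indic _ (borelType M) R setT A mA). }
 have p1 p : (0 <= (\1_A p * q p ^+ 2)%:E)%E by rewrite lee_fin mulr_ge0 ?indic_ge0 ?sqr_ge0.
 split.
 - by under eq_fun do rewrite EFinM; exact: measurable_funeM.
 - by move=> p; rewrite EFinM mule_ge0.
 under eq_integral do rewrite EFinM.
 rewrite ge0_integralZl_EFin// EFinM; apply: lee_wpmul2l; first by rewrite lee_fin.
 have W := weighted_measure_bound mq q0 k0 r0 Hq mA Ar.
 apply: le_trans W; rewrite [leRHS]integral_mkcond; apply: ge0_le_integral => //.
 - by apply/(measurable_restrictT _ mA); exact: measurable_funTS.
 - move=> p _; rewrite patchE indicE; case: ifP => _; rewrite ?mul1r ?mul0r//. }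
pose c k := 4 * h k ^+ 2.
have sumb m' : [/\ measurable_fun setT (fun p : borelType M => (l ^+ 2 * (\1_K p * q p ^+ 2) + \sum_(k < m') c k * (\1_(level phi (h k)) p * q p ^+ 2))%:E),
  (forall p, 0 <= (l ^+ 2 * (\1_K p * q p ^+ 2) + \sum_(k < m') c k * (\1_(level phi (h k)) p * q p ^+ 2))%:E)%E &
  (\int[mu]_p (l ^+ 2 * (\1_K p * q p ^+ 2) + \sum_(k < m') c k * (\1_(level phi (h k)) p * q p ^+ 2))%:E <=
   (l ^+ 2 * (2 * kappa ^+ 2 * B ^+ (n - 2)) + \sum_(k < m') c k * (2 * kappa ^+ 2 * b k ^+ (n - 2)))%:E)%E].
{ elim: m' => [|m' [IHm IHp IHi]].
  have [pm pp pi] := @piece (l ^+ 2) K B (sqr_ge0 _) mK B0 (eq_leRL HB).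
  split.
  - by under eq_fun do rewrite big_ord0 addr0.
  - by move=> p; rewrite big_ord0 addr0.
  - by under eq_integral do rewrite big_ord0 addr0; rewrite big_ord0 addr0.
 have cp : 0 <= c m' by rewrite mulr_ge0// sqr_ge0.
 have [pm pp pi] := @piece (c m') (level phi (h m')) (b m') cp (measurable_level sphi (h m')) (b0 m') (eq_leRL (root_levelE sphi cK phi0 (h m'))).
 split.
 - by under eq_fun do rewrite big_ord_recr /= addrA EFinD; exact: emeasurable_funD.
 - by move=> p; rewrite big_ord_recr /= addrA EFinD adde_ge0.
 under eq_integral do rewrite big_ord_recr /= addrA EFinD.
 have -> := ge0_integralD mu measurableT (fun p _ => IHp p) IHm (fun p _ => pp p) pm.
 by apply: le_trans (leeD IHi pi) _; rewrite -EFinD lee_fin big_ord_recr /= addrA. }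
have [sm sp si] := sumb N.
have mqp : measurable_fun setT (fun p : borelType M => (q p ^+ 2 * phi p ^+ 2)%:E).
{ apply/measurable_EFinP; apply: measurable_funM; first exact: measurable_funX.
 exact: (measurable_continuous (sq_continuous sphi)). }
via (\int[mu]_p (l ^+ 2 * (\1_K p * q p ^+ 2) + \sum_(k < N) c k * (\1_(level phi (h k)) p * q p ^+ 2))%:E)%E.
{ apply: ge0_le_integral => //.
 - by move=> p _; rewrite lee_fin mulr_ge0 ?sqr_ge0.
 move=> p _.
 rewrite (_ : _ + _ = q p ^+ 2 * (l ^+ 2 * \1_K p + \sum_(k < N) c k * \1_(level phi (h k)) p)); last first.
  rewrite mulrDr mulr_sumr; congr (_ + _); first by ring.
  by apply: eq_bigr => k _; ring.
 apply: ler_wpM2l; first exact: sqr_ge0.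
 have [Kp|nK] := pselect (K p); last first.
  rewrite phi0// expr0n; apply: addr_ge0; first by rewrite mulr_ge0 ?sqr_ge0.
  by apply: sumr_ge0 => k _; apply: mulr_ge0; [apply: mulr_ge0 => //; exact: sqr_ge0|exact: indic_ge0].
 rewrite [\1_K p]indicE mem_set// mulr1; apply: level_decomposition => //.
 rewrite -[phi p ^+ 2]real_normK ?num_real//; apply: lerXn2r; rewrite ?nnegrE ?(ltW (h0 N))//.
 exact: le_trans (phB p Kp) (ltW HN). }
apply: le_trans si _.
rewrite (_ : \sum_(k < N) _ = 2 * kappa ^+ 2 * (4 * \sum_(k < N) a k)); last first.
 by rewrite !mulr_sumr; apply: eq_bigr => k _; rewrite /c /a; ring.
rewrite mulrCA -mulrDr; apply: ler_wpM2l; first by rewrite mulr_ge0.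
lra.
Qed.

End WeightedSobolev.

(** * Mollification in L^2 *)

Section Mollification.
Context {R : realType} {n : nat}.
Local Notation Rm := (measurableTypeR R).
Implicit Types (w : n.-tuple Rm -> R) (eta : 'rV[R]_n -> R^o).

Lemma mollifier_shift_integral e eta x : mollifier e eta ->
 L1 (leb n) (fun t => eta (rv t - x)) /\
 \int[leb n]_t eta (rv t - x) = 1.
Proof.
move=> [k0 e0 es ev e1]; have ce := kernel_continuous k0; split; last first.
 rewrite -[RHS]e1; apply: (@Rintegral_leb_shift R n eta (- x)).
 exact: (measurable_comp_rv ce).
have [_ [K cK K0]] := k0; have [B B0 HB] := kernel_bounded k0.
have [r r0 Kr] := compact_bounded_rV cK.
have mf := measurable_shift_fun x ce.
pose A := [set t : n.-tuple Rm | `|rv t - x| < r].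
have mA : measurable A.
{ apply: (@measurable_rv_open R n [set y | `|y - x| < r]); rewrite openE => y /= yr.
 apply/nbhs_ballP; exists (r - `|y - x|) => /=; first by rewrite subr_gt0.
 move=> z; rewrite mx_norm_ball /ball_ /= => H; have := ler_distD y z x; rewrite (distrC z y); lra. }
apply: (@bounded_integrable _ _ _ (leb n) _ setT A B) => //.
- apply: (@leb_bounded R n A (r + `|x|)) => // t At.
 have := ler_normD (rv t - x) x; rewrite subrK => H; apply: le_lt_trans H _; by rewrite ltrD2r.
- move=> t _ nA; apply: K0 => Kt; apply: nA; exact: Kr.
Qed.

Lemma conv_sq_le e eta w x : mollifier e eta ->
 L1 (leb n) w -> L1 (leb n) (fun t => w t ^+ 2) ->
 (conv w eta x) ^+ 2 <= conv (fun t => w t ^+ 2) eta x.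
Proof.
move=> me iw iw2; have [k0 e0 _ _ _] := me; have [ie e1] := mollifier_shift_integral x me.
have i1 := kernel_integrable x iw k0; have i2 := kernel_integrable x iw2 k0.
rewrite -[X in _ <= X]mul1r; apply: discriminant_le => // t.
have -> : t ^+ 2 * 1 - 2 * t * conv w eta x + conv (fun t => w t ^+ 2) eta x =
 \int[leb n]_y ((t ^+ 2 * eta (rv y - x) + (- (2 * t)) * (w y * eta (rv y - x))) + w y ^+ 2 * eta (rv y - x)).
{ have j1 : L1 (leb n) (fun y => t ^+ 2 * eta (rv y - x)).
  exact: L1Z.
 have j2 : L1 (leb n) (fun y => (- (2 * t)) * (w y * eta (rv y - x))).
  exact: L1Z.
 have j3 : L1 (leb n) (fun y => t ^+ 2 * eta (rv y - x) + (- (2 * t)) * (w y * eta (rv y - x))).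
  exact: L1D.
 rewrite RintegralD// RintegralD// RintegralZl// RintegralZl// e1 /conv; ring. }
apply: Rintegral_ge0 => y _.
have -> : t ^+ 2 * eta (rv y - x) + - (2 * t) * (w y * eta (rv y - x)) + w y ^+ 2 * eta (rv y - x) = (t - w y) ^+ 2 * eta (rv y - x) by ring.
by rewrite mulr_ge0 ?sqr_ge0.
Qed.

Lemma conv_measurable w eta : L1 (leb n) w -> kernel_fun eta ->
 measurable_fun setT (fun x : n.-tuple Rm => conv w eta (rv x)).
Proof.
move=> iw k0; have cc := conv_continuous iw k0.
exact: (measurable_comp_rv cc).
Qed.

(** Jensen's inequality in the form [conv_sq_le], then Tonelli; evenness of the kernel makes the
    inner integral in x equal to 1. *)
Lemma conv_contraction e eta w : mollifier e eta -> measurable_fun setT w ->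
 L1 (leb n) w -> L1 (leb n) (fun t => w t ^+ 2) ->
 (\int[leb n]_x (conv w eta (rv x) ^+ 2)%:E <= \int[leb n]_t (w t ^+ 2)%:E)%E.
Proof.
move=> me mw iw iw2; have [k0 e0 _ ev _] := me.
via (\int[leb n]_x (conv (fun t => w t ^+ 2) eta (rv x))%:E)%E.
 apply: ge0_le_integral => //.
 - by move=> x _; rewrite lee_fin sqr_ge0.
 - by apply/measurable_EFinP; apply: measurable_funX; exact: conv_measurable.
 - by apply/measurable_EFinP; exact: conv_measurable.
 - by move=> x _; rewrite lee_fin; exact: (conv_sq_le (rv x) me).
have E x : (conv (fun t => w t ^+ 2) eta x)%:E = (\int[leb n]_t (w t ^+ 2 * eta (rv t - x))%:E)%E.
{ rewrite /conv /Rintegral fineK//; apply: integrable_fin_num => //.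
 exact: kernel_integrable. }
under eq_integral do rewrite E.
pose f (z : n.-tuple Rm * n.-tuple Rm) := (w z.2 ^+ 2 * eta (rv z.2 - rv z.1))%:E.
have ce := kernel_continuous k0.
have mf : measurable_fun setT f.
{ apply/measurable_EFinP; apply: measurable_funM.
  by apply: measurable_funX; apply: measurableT_comp => //.
 rewrite (_ : (fun z => _) = (fun t : n.-tuple Rm => eta (rv t)) \o
   (fun z : n.-tuple Rm * n.-tuple Rm => [tuple (tnth z.2 i - tnth z.1 i : Rm) | i < n])); last first.
  apply/funext => z /=; congr (eta _); apply/rowP => i; by rewrite !mxE tnth_mktuple.
 apply: measurableT_comp; first exact: (measurable_comp_rv ce).
 apply/measurable_fun_tnthP => i.
 rewrite (_ : _ \o _ = (fun z : n.-tuple Rm * n.-tuple Rm => tnth z.2 i - tnth z.1 i : Rm)); last first.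
  by apply/funext => z /=; rewrite tnth_mktuple.
 apply: measurable_funB.
  exact: (measurableT_comp (measurable_tnth i) measurable_snd).
 exact: (measurableT_comp (measurable_tnth i) measurable_fst). }
have f0 z : (0 <= f z)%E by rewrite lee_fin mulr_ge0 ?sqr_ge0.
rewrite -[X in (X <= _)%E]/(\int[leb n]_x \int[leb n]_t f (x, t))%E (@fubini_tonelli _ _ _ _ R (leb n) (leb n) f mf f0).
apply: le_of_eq; apply: eq_integral => t _.
rewrite /f /=; under eq_integral do rewrite EFinM.
have [ie e1] := mollifier_shift_integral (rv t) me.
rewrite ge0_integralZl_EFin//; last 3 first.
- by move=> x _; rewrite lee_fin.
- apply/measurable_EFinP; have := measurable_shift_fun (rv t) ce; congr measurable_fun; apply/funext => x.
 by rewrite -ev opprB.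
- exact: sqr_ge0.
under eq_integral do rewrite -ev opprB.
by rewrite -[X in (_ * X)%E]fineK ?[fine _]e1 ?mule1//; exact: integrable_fin_num.
Qed.

Lemma L2_supported_L1 w (K : set 'rV[R]_n) : measurable_fun setT w -> compact K ->
 (forall t, ~ K (rv t) -> w t = 0) -> (\int[leb n]_t (w t ^+ 2)%:E < +oo)%E ->
 L1 (leb n) w /\ L1 (leb n) (fun t => w t ^+ 2).
Proof.
move=> mw cK w0 woo; have i2 : L1 (leb n) (fun t => w t ^+ 2).
{ apply/integrableP; split; first by apply/measurable_EFinP; exact: measurable_funX.
 by under eq_integral do rewrite /= ger0_norm ?sqr_ge0//. }
split => //.
have iK := indic_compact_integrable cK.
apply: (@le_integrable _ _ _ (leb n) _ measurableT _ (EFin \o (fun t => \1_(rv @^-1` K) t + w t ^+ 2))).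
- exact/measurable_EFinP.
- move=> t _; rewrite /= lee_fin [X in _ <= X]ger0_norm ?addr_ge0 ?sqr_ge0 ?indicE ?ler0n//.
 have [Kt|nK] := pselect (K (rv t)); last by rewrite w0// normr0 addr_ge0 ?sqr_ge0 ?ler0n.
 rewrite mem_set//=; have := sqr_ge0 (`|w t| - 2^-1); have := sqr_ge0 (w t).
 rewrite sqrrB -[w t ^+ 2]real_normK ?num_real//; lra.
- exact: L1D.
Qed.

Lemma conv_support e eta w (rho : R) x : mollifier e eta -> e <= 1 -> (forall t, rho < `|rv t| -> w t = 0) ->
 rho + 1 < `|x| -> conv w eta x = 0.
Proof.
move=> [_ _ es _ _] e1 w0 xr; rewrite /conv (_ : (fun t => _) = cst 0) ?Rintegral_cst ?mul0r//.
apply/funext => t /=; have [tr|/w0 ->] := leP `|rv t| rho; last by lra.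
rewrite es; have := ler_normD (rv t) (x - rv t); rewrite addrC subrK (distrC x); lra.
Qed.

Lemma conv_uniform (g : 'rV[R]_n -> R^o) (K : set 'rV[R]_n) (e : R) : Ck 0 setT g -> compact K ->
 (forall x, ~ K x -> g x = 0) -> 0 < e -> exists2 d : R, 0 < d & forall r eta x, r < d -> mollifier r eta ->
  `|conv (fun t => g (rv t)) eta x - g x| <= e.
Proof.
move=> Cg cK g0 e0; have cg : continuous g by move=> x; exact: (Ck_continuous Cg).
have [d d0 Hd] := compact_supp_unif_cont cg cK g0 e0.
have ig := compact_supp_integrable cg cK g0.
exists d => // r eta x rd me; have [k0 e0' es _ _] := me; have [ie e1] := mollifier_shift_integral x me.
have i1 := kernel_integrable x ig k0.
have -> : conv (fun t => g (rv t)) eta x - g x = \int[leb n]_t (g (rv t) * eta (rv t - x) + - g x * eta (rv t - x)).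
{ rewrite RintegralD//; last first.
  exact: L1Z.
 by rewrite RintegralZl// e1 mulr1. }
apply: le_trans (@Rintegral_norm_le _ _ _ (leb n) (fun t => eta (rv t - x)) _ e ie _ _) _.
- apply: measurable_funD.
  by apply: measurable_funM; [exact: (measurable_comp_rv cg)|exact: (measurable_shift_fun x (kernel_continuous k0))].
 by apply: measurable_funM => //; exact: (measurable_shift_fun x (kernel_continuous k0)).
- move=> t; rewrite -mulrDl normrM; have [h|h] := ltP `|rv t - x| r.
  by apply: ler_wpM2r => //; apply: Hd; exact: lt_trans rd.
 by rewrite es// normr0 !mulr0.
- rewrite (_ : (fun t => _) = (fun t => eta (rv t - x))) ?e1 ?mulr1//.
 by apply/funext => t; rewrite ger0_norm.
Qed.

Lemma measurable_norm_le (r : R) : measurable [set t : n.-tuple Rm | `|rv t| <= r].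
Proof.
have c : continuous (fun x : 'rV[R]_n => `|x|) by exact: norm_continuous.
have m := measurable_comp_rv c.
have := m measurableT `]-oo, r]%classic (measurable_itv _); rewrite setTI; congr measurable.
Qed.

(** w is replaced by a continuous compactly supported h: mollifications of h converge uniformly on a
    bounded set, and the mollified difference w - h stays small by contraction. *)
Lemma mollify_L2 w (rho e : R) : measurable_fun setT w -> 0 < rho -> (forall t, rho < `|rv t| -> w t = 0) ->
 (\int[leb n]_t (w t ^+ 2)%:E < +oo)%E -> 0 < e ->
 exists2 d : R, 0 < d & forall r eta, r < d -> mollifier r eta ->
  (\int[leb n]_x ((conv w eta (rv x) - w x) ^+ 2)%:E <= e%:E)%E.
Proof.
move=> mw rho0 w0 woo e0.
pose D := [set t : n.-tuple Rm | `|rv t| <= 2 * rho].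
have mD : measurable D by exact: measurable_norm_le.
have Doo : (leb n D < +oo)%E.
{ by apply: (@leb_bounded R n D (2 * rho + 1)) => // t; rewrite /D /= => H; apply: le_lt_trans H _; rewrite ltrDl. }
have wD : (\int[leb n]_(t in D) (w t ^+ 2)%:E < +oo)%E.
{ apply: le_lt_trans woo; apply: ge0_subset_integral => //.
  by apply/measurable_EFinP; exact: measurable_funX.
 by move=> t _; rewrite lee_fin sqr_ge0. }
(* The final count is 2(e/12) + 2(2(e/8) + 2(e/12)) = e. *)
have e12 : 0 < e / 12 by rewrite divr_gt0.
have [_ /(_ _ e12)[g Cg gw]] := continuous_dense_L2 mD Doo mw wD.
pose h x : R := bump 0 rho x * g x.
have Ch : Ck 0 setT (h : _ -> R^o) by apply: CkM => //; [exact: openT|exact: Ck_bump].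
have ch : continuous h by move=> x; exact: (Ck_continuous Ch).
pose K := [set x : 'rV[R]_n | `|x| <= 2 * rho].
have cK : compact K by apply: compact_closed_ball; rewrite mulr_gt0.
have h0 x : ~ K x -> h x = 0.
{ by move=> /negP; rewrite -ltNge => H; rewrite /h bump0 ?mul0r// subr0 ltW. }
have mh : measurable_fun setT (fun t : n.-tuple Rm => h (rv t)) by exact: (measurable_comp_rv ch).
have mwh : measurable_fun setT (fun t => w t - h (rv t)) by exact: measurable_funB.
have Hwh : (\int[leb n]_t ((w t - h (rv t)) ^+ 2)%:E <= (e / 12)%:E)%E.
{ have -> : (\int[leb n]_t ((w t - h (rv t)) ^+ 2)%:E = \int[leb n]_(t in D) ((w t - h (rv t)) ^+ 2)%:E)%E.
 { rewrite [RHS]integral_mkcond; apply: eq_integral => t _; rewrite patchE; case: ifPn => // /negP nD.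
  have nK : 2 * rho < `|rv t| by rewrite ltNge; apply/negP => H; apply: nD; rewrite inE.
  rewrite h0; last by rewrite /K /=; apply/negP; rewrite -ltNge.
  by rewrite w0 ?subrr ?expr0n//; apply: lt_trans nK; rewrite ltr_pMl// ltr1n. }
 apply: (integral_le_of_le mD _ _ _ gw).
 - by apply: measurable_funX; exact: measurable_funTS.
 - apply: measurable_funX; apply: measurable_funB; first exact: measurable_funTS.
  exact: measurable_rv.
 - move=> t Dt; rewrite sqr_ge0 /=.
  have -> : w t - h (rv t) = bump 0 rho (rv t) * (w t - g (rv t)).
  { rewrite mulrBr; congr (_ - _); have [tr|/w0 ->] := leP `|rv t| rho; last by rewrite mulr0.
   by rewrite bump1 ?mul1r// subr0. }
  rewrite exprMn; apply: ler_piMl; first exact: sqr_ge0.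
  by rewrite exprn_ile1 ?bump_ge0 ?bump_le1. }
have whoo : (\int[leb n]_t ((w t - h (rv t)) ^+ 2)%:E < +oo)%E by apply: le_lt_trans Hwh _; exact: ltry.
have wh0 t : ~ K (rv t) -> w t - h (rv t) = 0.
{ move=> nK; rewrite h0// subr0; apply: w0; move/negP: nK; rewrite -ltNge; apply: lt_trans; lra. }
have wK t : ~ K (rv t) -> w t = 0 by move=> nK; have := wh0 t nK; rewrite h0// subr0.
have [i1 i2] := L2_supported_L1 mwh cK wh0 whoo.
have [j1 j2] := L2_supported_L1 mw cK wK woo.
have ih := compact_supp_integrable ch cK h0.
pose V := fine (leb n [set t : n.-tuple Rm | `|rv t| <= 2 * rho + 1]).
have mV : measurable [set t : n.-tuple Rm | `|rv t| <= 2 * rho + 1] by exact: measurable_norm_le.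
have VE : leb n [set t : n.-tuple Rm | `|rv t| <= 2 * rho + 1] = V%:E.
{ rewrite fineK// ge0_fin_numE//; apply: (@leb_bounded R n _ (2 * rho + 2)) => // t /= H; apply: le_lt_trans H _; lra. }
have V0 : 0 <= V by rewrite fine_ge0.
pose e1 := Num.min 1 (e / (8 * (V + 1))).
have V1 : 0 < 8 * (V + 1) by lra.
have e10 : 0 < e1 by rewrite lt_min ltr01 divr_gt0.
have e1V : e1 ^+ 2 * V <= e / 8.
{ have h1 : e1 <= 1 by rewrite ge_min lexx.
 have h2 : e1 * (8 * (V + 1)) <= e by rewrite -ler_pdivlMr// ge_min lexx orbT.
 via (e1 * (V + 1)); last by lra.
 rewrite expr2 -mulrA ler_pM2l//; apply: le_trans (_ : V <= _); last by rewrite lerDl.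
 by apply: ler_piMl. }
have [d d0 Hd] := conv_uniform Ch cK h0 e10.
exists (Num.min 1 d); first by rewrite lt_min ltr01.
move=> r eta; rewrite lt_min => /andP[r1 rd] me; have [k0 _ _ _ _] := me.
have Hc : (\int[leb n]_x ((conv (fun t => h (rv t)) eta (rv x) - h (rv x)) ^+ 2)%:E <= (e / 8)%:E)%E.
{ pose V' := [set t : n.-tuple Rm | `|rv t| <= 2 * rho + 1].
 apply: (@integral_le_of_le _ _ _ (leb n) setT measurableT _ (fun x => e1 ^+ 2 * \1_V' x)).
 - apply: measurable_funX; apply: measurable_funB => //; exact: conv_measurable.
 - by apply: measurable_funM => //; exact: measurable_indic.
 - move=> x _; rewrite sqr_ge0 /= indicE; case: (boolP (x \in V')) => [_|/negP nx].
   rewrite mulr1; apply: sqr_le_sqr.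
   exact: (Hd r eta (rv x) rd me).
  have xr : 2 * rho + 1 < `|rv x| by rewrite ltNge; apply/negP => H; apply: nx; rewrite inE.
  rewrite h0; last by rewrite /K /=; apply/negP; rewrite -ltNge; lra.
  rewrite (conv_support me (ltW r1) _ xr) ?subrr ?expr0n ?mulr0//.
  by move=> t tr; apply: h0; rewrite /K /=; apply/negP; rewrite -ltNge.
 - under eq_integral do rewrite EFinM.
  rewrite ge0_integralZl_EFin ?sqr_ge0//; last by apply/measurable_EFinP.
  by rewrite integral_indic// setIT [X in (_ * X)%E]VE. }
have Hcw := conv_contraction me mwh i1 i2.
have Hcw' : (\int[leb n]_x (conv (fun t => w t - h (rv t)) eta (rv x) ^+ 2)%:E <= (e / 12)%:E)%E by exact: le_trans Hcw Hwh.
have Hhw : (\int[leb n]_x ((- (w x - h (rv x))) ^+ 2)%:E <= (e / 12)%:E)%E.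
{ by under eq_integral do rewrite sqrrN. }
have mc1 := conv_measurable i1 k0.
have mc2 : measurable_fun setT (fun x : n.-tuple Rm => conv (fun t => h (rv t)) eta (rv x) - h (rv x)).
{ by apply: measurable_funB => //; exact: conv_measurable. }
have mc3 : measurable_fun setT (fun x : n.-tuple Rm => - (w x - h (rv x))) by exact: measurableT_comp.
have S1 := integral_sqrD_le measurableT mc2 mc3 Hc Hhw.
have S2 := integral_sqrD_le measurableT mc1 (measurable_funD mc2 mc3) Hcw' S1.
via (2 * (e / 12) + 2 * (2 * (e / 8) + 2 * (e / 12)))%:E; last by rewrite lee_fin; lra.
apply: le_trans S2; apply: le_of_eq; apply: eq_integral => x _; congr ((_ ^+ 2)%:E).
have -> : conv (fun t => w t - h (rv t)) eta (rv x) = conv w eta (rv x) - conv (fun t => h (rv t)) eta (rv x).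
{ rewrite -RintegralB//; [|exact: kernel_integrable|exact: kernel_integrable].
 by apply: eq_Rintegral => t _; rewrite mulrBl. }
rewrite /=; ring.
Qed.

End Mollification.

Section SquareIntegrable.
Context {d} {T : measurableType d} {R : realType}.
Variable mu : {measure set T -> \bar R}.
Implicit Types u v : T -> R.

Definition L2 u := measurable_fun setT u /\ (\int[mu]_t (u t ^+ 2)%:E < +oo)%E.

Lemma L2_int u : L2 u -> L1 mu (fun t => u t ^+ 2).
Proof.
move=> [mu' uoo]; apply/integrableP; split; first by apply/measurable_EFinP; exact: measurable_funX.
by under eq_integral do rewrite /= ger0_norm ?sqr_ge0//.
Qed.

Lemma L2_prod u v : L2 u -> L2 v ->
 L1 mu (fun t => u t * v t).
Proof.
move=> su sv; have [m1 _] := su; have [m2 _] := sv.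
apply: (@le_integrable _ _ _ mu _ measurableT _ (EFin \o (fun t => u t ^+ 2 + v t ^+ 2))).
- by apply/measurable_EFinP; exact: measurable_funM.
- move=> t _; rewrite /= lee_fin [X in _ <= X]ger0_norm ?addr_ge0 ?sqr_ge0// normrM.
 have := sqr_ge0 (`|u t| - `|v t|); have := sqr_ge0 (`|u t| + `|v t|).
 rewrite sqrrB sqrrD !real_normK ?num_real//; lra.
- exact: L1D (L2_int su) (L2_int sv).
Qed.

Lemma L2D u v : L2 u -> L2 v -> L2 (fun t => u t + v t).
Proof.
move=> su sv; have [m1 i1] := su; have [m2 i2] := sv; split; first exact: measurable_funD.
have E w : L2 w -> exists a : R, (\int[mu]_t (w t ^+ 2)%:E <= a%:E)%E.
{ move=> [mw iw]; exists (fine (\int[mu]_t (w t ^+ 2)%:E)); rewrite fineK// ge0_fin_numE//.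
 by apply: integral_ge0 => t _; rewrite lee_fin sqr_ge0. }
have [a ua] := E u su; have [b vb] := E v sv.
exact: le_lt_trans (integral_sqrD_le measurableT m1 m2 ua vb) (ltry _).
Qed.

Lemma L2_bounded u v (B : R) : L2 u -> measurable_fun setT v ->
 (forall t, `|v t| <= B * `|u t|) -> L2 v.
Proof.
move=> su mv vB; have [m1 i1] := su; split => //.
apply: (@le_lt_trans _ _ (\int[mu]_t (B ^+ 2 * u t ^+ 2)%:E)%E).
 apply: ge0_le_integral => //.
 - by move=> t _; rewrite lee_fin sqr_ge0.
 - by apply/measurable_EFinP; exact: measurable_funX.
 - by apply/measurable_EFinP; apply: measurable_funM => //; exact: measurable_funX.
 - move=> t _; rewrite lee_fin -[u t ^+ 2]real_normK ?num_real// -exprMn.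
  exact: sqr_le_sqr.
under eq_integral do rewrite EFinM.
rewrite ge0_integralZl_EFin ?sqr_ge0//; last by apply/measurable_EFinP; exact: measurable_funX.
 by rewrite lte_mul_pinfty ?lee_fin ?sqr_ge0.
by move=> t _; rewrite lee_fin sqr_ge0.
Qed.

Lemma L2_0 : L2 (fun=> 0).
Proof.
split => //; under eq_integral do rewrite expr0n.
by rewrite integral0.
Qed.

Lemma L2_mul u v (B : R) : L2 u -> measurable_fun setT v ->
 (forall t, `|v t| <= B) -> L2 (fun t => v t * u t).
Proof.
move=> su mv vB; apply: (L2_bounded (B := B) su); first by apply: measurable_funM => //; case: su.
by move=> t; rewrite normrM ler_wpM2r.
Qed.

Lemma L2_sum (I : Type) (s : seq I) (u : I -> T -> R) : (forall i, L2 (u i)) ->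
 L2 (fun t => \sum_(i <- s) u i t).
Proof.
move=> su; elim: s => [|i s IH].
 by rewrite (_ : (fun t => _) = (fun=> 0)); [exact: L2_0|apply/funext => t; rewrite big_nil].
rewrite (_ : (fun t => _) = (fun t => u i t + \sum_(j <- s) u j t)); first exact: L2D.
by apply/funext => t; rewrite big_cons.
Qed.

End SquareIntegrable.

(** Balls whose doubles lie in U cover K; the smallest of finitely many radii works, and L is the
    sum of K and a closed ball. *)
Lemma compact_thickening {R : realType} {n : nat} (K U : set 'rV[R]_n) : compact K -> open U -> K `<=` U ->
 exists2 d : R, 0 < d & exists2 L, compact L & L `<=` U /\ forall x y, K x -> `|y - x| <= d -> L y.
Proof.
move=> cK oU KU.
pose D := [set p : 'rV[R]_n * R | 0 < p.2 /\ ball p.1 (p.2 *+ 2) `<=` U].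
pose b (p : 'rV[R]_n * R) := (ball p.1 p.2)^°.
have [|x Kx|s [sD sK]] := @compact_seq_cover _ _ D K b cK.
- by move=> p _; exact: open_interior.
- have : nbhs x U by apply: open_nbhs_nbhs; split => //; exact: KU.
 move=> /nbhs_ballP[e /= e0 eU]; exists (x, e / 2).
  split; first by rewrite divr_gt0.
  rewrite (_ : e / 2 *+ 2 = e)//.
  by lra.
 apply: nbhsx_ballx; by rewrite divr_gt0.
have [d d0 dP] : exists2 d : R, 0 < d & forall p, p \in s -> d <= p.2.
{ have sp p : p \in s -> 0 < p.2 by move=> /sD[].
 elim: s sp {sD sK} => [|p s IH] sp; first by exists 1.
 have [q qs|d d0 dP] := IH; first by apply: sp; rewrite inE qs orbT.
 exists (Num.min d p.2); first by rewrite lt_min d0 sp ?inE ?eqxx.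
 by move=> q; rewrite inE => /orP[/eqP ->|/dP]; rewrite ge_min ?lexx ?orbT// => ->. }
have dU x y : K x -> `|y - x| <= d -> U y.
{ move=> /sK[p ps /interior_subset xp] yx; have [p0 pU] := sD p ps; apply: pU.
 move: xp; rewrite !mx_norm_ball /= => xp.
 have := dP p ps.
 have := ler_distD x p.1 y; rewrite (distrC x y); lra. }
exists d => //; exists ((fun p : 'rV[R]_n * 'rV[R]_n => p.1 + p.2) @` (K `*` [set v | `|v| <= d])).
 apply: continuous_compact; last by apply: compact_setX => //; exact: compact_closed_ball.
 by apply: continuous_subspaceT => p; exact: add_continuous.
split; first by move=> _ [[x v] [/= Kx vd] <-]; apply: (dU x) => //; rewrite addrC addKr.
by move=> x y Kx yx; exists (x, y - x) => //=; rewrite addrC subrK.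
Qed.

Lemma common_radius {R : realType} (I : finType) (P : I -> R -> Prop) :
 (forall i, exists2 d : R, 0 < d & forall r, r < d -> P i r) ->
 exists2 d : R, 0 < d & forall i r, r < d -> P i r.
Proof.
move=> H; have /choice[d dP] : forall i, exists d : R, 0 < d /\ forall r, r < d -> P i r.
{ by move=> i; have [d d0 dP] := H i; exists d. }
exists (\big[Num.min/1]_i d i); first by apply: lt_bigmin => // i _; have [] := dP i.
move=> i r ri; have [_] := dP i; apply; apply: lt_le_trans ri _; exact: bigmin_le_cond.
Qed.

(** * Comparison of integrals on the manifold and in a chart *)

Section ChartTransfer.
Context {R : realType} {n : nat} {M : ptopologicalType}.
Local Notation Rm := (measurableTypeR R).
Variables (S : smooth_manifold R n M) (iota : M -> 'rV[R]_n.+1).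
Variable mu : {measure set (borelType M) -> \bar R}.
Hypothesis imm : is_immersion S iota.
Hypothesis Hmu : is_riemannian_volume S iota mu.
Implicit Types (c : chart R n M).

Lemma measurable_chart_fun c (F : M -> R) : measurable_fun setT (F : borelType M -> R) ->
 measurable_fun (cdomain c) (fun t => F (cpoint c t)).
Proof.
move=> mF; exact: (measurable_comp measurableT (@subsetT _ _) mF (@measurable_cpoint R n M c)).
Qed.

(** On a compact part of the chart both the volume density and its reciprocal are bounded. *)
Lemma chart_comparison c (K : set 'rV[R]_n) : atlas S c -> compact K -> K `<=` cimg c ->
 exists2 C : R, 0 < C & forall F : M -> R, measurable_fun setT (F : borelType M -> R) ->
  (forall p, 0 <= F p) -> (forall p, ~ (cinv c @` K) p -> F p = 0) ->
  (\int[leb n]_(t in cdomain c) (F (cpoint c t))%:E <= C%:E * \int[mu]_p (F p)%:E)%E /\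
  (\int[mu]_p (F p)%:E <= C%:E * \int[leb n]_(t in cdomain c) (F (cpoint c t))%:E)%E.
Proof.
move=> Ac cK Kc; have [sF fT] := imm Ac.
have v0 x : cimg c x -> 0 < vol iota c x by exact: vol_gt0.
have [C1 C10 HC1] := @compact_ubound _ _ _ (vol iota c) cK
 (fun x Kx => Ck_continuous (Ck_vol sF fT 0) (Kc x Kx)).
have [C2 C20 HC2] := @compact_ubound _ _ _ (fun x => (vol iota c x)^-1) cK
 (fun x Kx => Ck_continuous (CkV (@open_cimg _ _ _ c) (fun y yc => lt0r_neq0 (v0 y yc)) (Ck_vol sF fT 0)) (Kc x Kx)).
exists (C1 + C2); first exact: addr_gt0.
move=> F mF F0 FK.
have mEF : measurable_fun setT (EFin \o F : borelType M -> \bar R) by exact/measurable_EFinP.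
have mD := @measurable_cdomain R n M c.
have mv := measurable_vol imm Ac; have mFc := measurable_chart_fun (c := c) mF.
have mcd : measurable (cdom c : set (borelType M)) by apply: measurable_open; exact: open_cdom.
have E : (\int[mu]_p (F p)%:E = \int[leb n]_(t in cdomain c) (F (cpoint c t) * vol iota c (rv t))%:E)%E.
{ transitivity (\int[mu]_(p in (cdom c : set (borelType M))) (F p)%:E)%E.
  rewrite [RHS]integral_mkcond; apply: eq_integral => p _; rewrite patchE; case: ifPn => // /negP np.
  rewrite FK// => -[x Kx xp]; apply: np; rewrite inE -xp; exact: (cinv_dom (Kc x Kx)).
 rewrite (ge0_integral_chart imm Hmu Ac mEF); last by move=> p; rewrite lee_fin.
 by apply: eq_integral => t _; rewrite EFinM. }
have FK' t : cdomain c t -> ~ K (rv t) -> F (cpoint c t) = 0.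
{ move=> ct nK; apply: FK => -[x Kx xt]; apply: nK.
 by rewrite -(cinvK ct) -[cinv c (rv t)]/(cpoint c t) -xt cinvK//; exact: Kc. }
rewrite E; split.
- rewrite -ge0_integralZl_EFin//; last 3 first.
 + by move=> t ct; rewrite lee_fin mulr_ge0// ltW// v0.
 + by apply/measurable_EFinP; exact: measurable_funM.
 + by rewrite ltW// addr_gt0.
 apply: ge0_le_integral => //.
 + by move=> t _; rewrite lee_fin.
 + exact/measurable_EFinP.
 + by apply/measurable_EFinP; apply: measurable_funM => //; exact: measurable_funM.
 + move=> t ct; rewrite lee_fin; have [Kt|nK] := pselect (K (rv t)); last by rewrite FK' ?mul0r ?mulr0.
  have vt := v0 _ ct; have := HC2 _ Kt; rewrite gtr0_norm ?invr_gt0// => H.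
  have h1 : 1 <= C2 * vol iota c (rv t) by rewrite -ler_pdivrMr// div1r.
  rewrite mulrCA; apply: ler_peMr => //; apply: le_trans h1 _; rewrite ler_pM2r// lerDr ltW//.
- rewrite -ge0_integralZl_EFin//; last 3 first.
 + by move=> t ct; rewrite lee_fin.
 + exact/measurable_EFinP.
 + by rewrite ltW// addr_gt0.
 apply: ge0_le_integral => //.
 + by move=> t ct; rewrite lee_fin mulr_ge0// ltW// v0.
 + by apply/measurable_EFinP; exact: measurable_funM.
 + by apply/measurable_EFinP; exact: measurable_funM.
 + move=> t ct; rewrite lee_fin; have [Kt|nK] := pselect (K (rv t)); last by rewrite FK' ?mul0r ?mulr0.
  have vt := v0 _ ct; have := HC1 _ Kt; rewrite gtr0_norm// => H.
  rewrite mulrC ler_wpM2r//; lra.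
Qed.

Lemma chart_L2 c (K : set 'rV[R]_n) (F : M -> R) (k : 'rV[R]_n -> R^o) :
 atlas S c -> compact K -> K `<=` cimg c -> L2 mu F -> Ck 0 (cimg c) k ->
 (forall x, cimg c x -> ~ K x -> F (cinv c x) * k x = 0) ->
 L2 (leb n) ((fun t => F (cpoint c t) * k (rv t)) \_ (cdomain c)).
Proof.
move=> Ac cK Kc [mF Foo] Ck0 Fk0.
have mD := @measurable_cdomain R n M c; have mFc := measurable_chart_fun (c := c) mF.
have [B B0 HB] := @compact_ubound _ _ _ k cK (fun x Kx => Ck_continuous Ck0 (Kc x Kx)).
have mk : measurable_fun (cdomain c) (fun t : n.-tuple Rm => k (rv t)).
{ exact: (@measurable_rv_continuous R n (cimg c) k (@open_cimg _ _ _ c) (fun y yc => Ck_continuous Ck0 yc)). }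
have mw : measurable_fun (cdomain c) (fun t => F (cpoint c t) * k (rv t) : R) := measurable_funM mFc mk.
split; first by apply/(measurable_restrictT _ mD).
have [C C0 HC] := chart_comparison Ac cK Kc.
pose F2 p := \1_(cinv c @` K) p * F p ^+ 2.
have mi : measurable_fun setT (\1_(cinv c @` K) : borelType M -> R) by exact: (measurable_indic_compact imm Hmu (compact_cinv cK Kc)).
have mF2 : measurable_fun setT (F2 : borelType M -> R).
{ by apply: measurable_funM => //; exact: measurable_funX. }
have F20 p : 0 <= F2 p by rewrite mulr_ge0 ?sqr_ge0// indicE ler0n.
have [H _] := HC F2 mF2 F20 (fun p np => ltac:(by rewrite /F2 indicE memNset// mul0r)).
apply: (@le_lt_trans _ _ (\int[leb n]_(t in cdomain c) ((B ^+ 2) * F2 (cpoint c t))%:E)%E).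
 rewrite [leRHS]integral_mkcond; apply: ge0_le_integral => //.
 - by move=> t _; rewrite lee_fin sqr_ge0.
 - apply/measurable_EFinP; apply: measurable_funX; by apply/(measurable_restrictT _ mD).
 - apply/(measurable_restrictT _ mD); apply/measurable_EFinP; apply: measurable_funM => //.
  exact: measurable_chart_fun.
 - move=> t _; rewrite !patchE; case: ifPn => [|_]; last by rewrite expr0n.
  rewrite inE => ct; rewrite lee_fin; have [Kt|nK] := pselect (K (rv t)); last first.
   by rewrite Fk0// expr0n mulr_ge0 ?sqr_ge0// F20.
  rewrite /F2 indicE mem_set ?mul1r; last by exists (rv t).
  rewrite exprMn mulrC ler_wpM2r ?sqr_ge0//; apply: sqr_le_sqr.
  exact: HB.
under eq_integral do rewrite EFinM.
rewrite ge0_integralZl_EFin ?sqr_ge0//; last 2 first.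
- by move=> t _; rewrite lee_fin.
- by apply/measurable_EFinP; exact: measurable_chart_fun.
rewrite lte_mul_pinfty ?lee_fin ?sqr_ge0//; apply: le_lt_trans H _.
rewrite lte_mul_pinfty ?lee_fin ?(ltW C0)//; apply: le_lt_trans Foo.
apply: ge0_le_integral => //.
- by move=> p _; rewrite lee_fin.
- exact/measurable_EFinP.
- by apply/measurable_EFinP; exact: measurable_funX.
- move=> p _; rewrite lee_fin /F2; apply: ler_piMl; first exact: sqr_ge0.
 by [].
Qed.

End ChartTransfer.

Lemma partial_shift {R : realType} {n : nat} (psi : 'rV[R]_n -> R^o) x y i :
 partial i (fun z => psi (z - x) : R^o) y = partial i psi (y - x).
Proof.
have E : (fun h : R => h^-1 *: (((fun z => psi (z - x)) \o shift y) (h *: 'e_i) - psi (y - x))) =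
 (fun h : R => h^-1 *: ((psi \o shift (y - x)) (h *: 'e_i) - psi (y - x))).
 by apply/funext => h /=; rewrite addrA.
by rewrite /partial /derive E.
Qed.

Lemma smooth_on_shift {R : realType} {n : nat} (psi : 'rV[R]_n -> R^o) x :
 smooth_on setT psi -> smooth_on setT (fun z => psi (z - x) : R^o).
Proof.
move=> sp k; apply: (@Ck_comp R n n k setT setT psi (fun z => z - x) openT openT _ (sp k)) => // b.
rewrite (_ : (fun y => _) = (fun y : 'rV[R]_n => y 0 b : R^o) \+ cst (- x 0 b : R^o)); last first.
 by apply/funext => y; rewrite !mxE.
by apply: CkD; [exact: openT|exact: Ck_coord openT|exact: Ck_cst openT].
Qed.

Lemma conv_eq0 {R : realType} {n : nat} (e : R) (eta : 'rV[R]_n -> R^o) (w : n.-tuple (measurableTypeR R) -> R) x :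
 mollifier e eta -> (forall t, `|rv t - x| < e -> w t = 0) -> conv w eta x = 0.
Proof.
move=> [_ _ es _ _] w0; rewrite /conv (_ : (fun t => _) = cst 0) ?Rintegral_cst ?mul0r//.
apply/funext => t /=; have [|/w0 ->] := leP e `|rv t - x|; last by lra.
by move=> /es ->; rewrite mulr0.
Qed.

(** The translated kernel is used as the test function in the weak derivative; the minus sign from
    differentiating the convolution cancels the one from integration by parts. *)
Lemma partial_conv_weak {R : realType} {n : nat} (w dw : n.-tuple (measurableTypeR R) -> R) (eta : 'rV[R]_n -> R^o) x i :
 L1 (leb n) w -> kernel_fun eta ->
 (forall psi : 'rV[R]_n -> R^o, smooth_on setT psi ->
  \int[leb n]_t (w t * partial i psi (rv t)) = - \int[leb n]_t (dw t * psi (rv t))) ->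
 partial i (conv w eta) x = conv dw eta x.
Proof.
move=> iw ke H; have [se _] := ke; have dw' := conv_is_derive x i iw ke.
rewrite /partial derive_val convN//; last exact: kernel_partial.
have := H _ (smooth_on_shift x se); rewrite /conv.
have -> : (fun t => w t * partial i (fun z => eta (z - x) : R^o) (rv t)) =
  (fun t => w t * partial i eta (rv t - x)) by apply/funext => t; rewrite partial_shift.
by lra.
Qed.

Lemma integral_le_sum {d} {T : measurableType d} {R : realType} (mu : {measure set T -> \bar R})
  (I : Type) (s : seq I) (u : I -> T -> R) (a : I -> R) :
 (forall i, measurable_fun setT (u i)) -> (forall i t, 0 <= u i t) ->
 (forall i, (\int[mu]_t (u i t)%:E <= (a i)%:E)%E) ->
 (\int[mu]_t (\sum_(i <- s) u i t)%:E <= (\sum_(i <- s) a i)%:E)%E.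
Proof.
move=> mu' u0 ua; elim: s => [|i s IH].
 by under eq_integral do rewrite big_nil; rewrite integral0 big_nil.
have us t : 0 <= \sum_(j <- s) u j t by apply: sumr_ge0 => j _; exact: u0.
have ms : measurable_fun setT (fun t => \sum_(j <- s) u j t) by apply: measurable_sum.
rewrite big_cons; apply: (@integral_le_add _ _ _ mu setT measurableT _ (u i) (fun t => \sum_(j <- s) u j t)) => //.
- by under eq_fun do rewrite big_cons; exact: measurable_funD.
- by move=> t _; rewrite big_cons lexx andbT addr_ge0.
Qed.

(** * Weak gradients and smooth approximation of cut-off functions *)

Section WeakGradient.
Context {R : realType} {n : nat} {M : ptopologicalType}.
Local Notation Rm := (measurableTypeR R).
Variables (S : smooth_manifold R n M) (iota : M -> 'rV[R]_n.+1).
Variable mu : {measure set (borelType M) -> \bar R}.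
Hypothesis imm : is_immersion S iota.
Hypothesis Hmu : is_riemannian_volume S iota mu.
Implicit Types (c : chart R n M) (phi chi : M -> R).
Local Notation grad := (grad S iota).

Lemma tangent_dotE c x (V : 'rV[R]_n.+1) i : dotv V (row i (tangent_mx iota c x)) = (V *m (tangent_mx iota c x)^T) 0 i.
Proof. by rewrite mxE; apply: eq_bigr => j _; rewrite !mxE. Qed.

Lemma gradc_dot c phi x i : atlas S c -> cimg c x ->
 dotv (gradc iota c phi x) (row i (tangent_mx iota c x)) = partial i (phi \o cinv c : _ -> R^o) x.
Proof.
move=> Ac cx; rewrite tangent_dotE -!mulmxA mulVmx ?mulmx1 ?mxE//.
exact: metric_unit (imm Ac).2 _ cx.
Qed.

Lemma tangent_expansion c x (V : 'rV[R]_n.+1) : atlas S c -> cimg c x -> (V <= tangent_mx iota c x)%MS ->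
 V = (\row_i dotv V (row i (tangent_mx iota c x))) *m invmx (metric_mx iota c x) *m tangent_mx iota c x.
Proof.
move=> Ac cx /submxP[v Vv].
have -> : \row_i dotv V (row i (tangent_mx iota c x)) = V *m (tangent_mx iota c x)^T.
 by apply/rowP => i; rewrite mxE tangent_dotE.
rewrite Vv -[v *m _ *m _]mulmxA mulmxK//.
exact: metric_unit (imm Ac).2 _ cx.
Qed.

Lemma dotv_expansion c x (E : 'rV[R]_n) : atlas S c -> cimg c x ->
 let V := E *m invmx (metric_mx iota c x) *m tangent_mx iota c x in
 dotv V V = \sum_i \sum_j E 0 i * invmx (metric_mx iota c x) i j * E 0 j.
Proof.
move=> Ac cx V.
have -> : dotv V V = (E *m invmx (metric_mx iota c x) *m E^T) 0 0.
{ have gT := metric_sym iota c x; have hT : (invmx (metric_mx iota c x))^T = invmx (metric_mx iota c x) by rewrite trmx_inv gT.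
 rewrite dotvE !trmx_mul hT !mulmxA; congr ((_ *m _) 0 0).
 rewrite -[E *m _ *m _ *m _]mulmxA -mulmxA mulmxV ?mulmx1//.
 exact: metric_unit (imm Ac).2 _ cx. }
rewrite mxE exchange_big; apply: eq_bigr => j _; rewrite !mxE mulr_suml; exact: eq_bigr.
Qed.

(** All approximants share one compact support, so that continuous coefficients are uniformly
    bounded along the approximation. *)
Definition W0_approx (u : M -> R) (V : M -> 'rV[R]_n.+1) := exists2 K, compact K &
 (forall p, ~ K p -> u p = 0 /\ V p = 0) /\
 forall e : R, 0 < e -> exists phi, [/\ smooth_fun S phi, forall p, ~ K p -> phi p = 0 &
  (\int[mu]_p ((phi p - u p) ^+ 2 + dotv (grad phi p - V p) (grad phi p - V p))%:E <= e%:E)%E].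

Lemma chart_integrable c (K : set 'rV[R]_n) (F : M -> R) (k : 'rV[R]_n -> R^o) :
 atlas S c -> compact K -> K `<=` cimg c -> L2 mu (F : borelType M -> R) -> Ck 0 (cimg c) k ->
 (forall x, ~ K x -> k x = 0) ->
 (leb n).-integrable (cdomain c) (EFin \o (fun t : n.-tuple Rm => F (cpoint c t) * k (rv t))).
Proof.
move=> Ac cK Kc sF Ck0 k0; have [|mw woo] := chart_L2 imm Hmu Ac cK Kc sF Ck0.
 by move=> x _ nK; rewrite k0// mulr0.
have [|iw _] := L2_supported_L1 mw cK _ woo; first by move=> t nK; rewrite patchE k0// mulr0; case: ifP.
apply/(integrable_mkcond _ (measurable_cdomain c)); apply: eq_integrable iw => // t _.
by rewrite /= !patchE; case: ifP.
Qed.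

Lemma chart_dotv_integrable c (K : set 'rV[R]_n) (V : M -> 'rV[R]_n.+1) (k : 'rV[R]_n -> R^o) i :
 atlas S c -> compact K -> K `<=` cimg c -> (forall j, L2 mu (fun p : borelType M => V p 0 j)) -> Ck 0 (cimg c) k ->
 (forall x, ~ K x -> k x = 0) -> (leb n).-integrable (cdomain c)
  (EFin \o (fun t : n.-tuple Rm => dotv (V (cpoint c t)) (row i (tangent_mx iota c (rv t))) * k (rv t))).
Proof.
move=> Ac cK Kc sV Ck0 k0; have mD := measurable_cdomain c.
have I j := @chart_integrable c K (fun p => V p 0 j) (fun x => tangent_mx iota c x i j * k x) Ac cK Kc (sV j)
 (CkM (@open_cimg _ _ _ c) (Ck_tangent (imm Ac).1 0 i j) Ck0) (ltac:(by move=> x nK; rewrite /= k0 ?mulr0)).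
apply: eq_integrable (integrable_sum mD (index_enum _) (fun j (_ : xpredT j) => I j)) => // t _.
rewrite /= sumEFin mulr_suml; congr EFin; apply: eq_bigr => j _; by rewrite [row _ _ _ _]mxE mulrA.
Qed.

Variables (f : M -> R) (G : M -> 'rV[R]_n.+1).
Hypothesis W : W12_grad S iota mu f G.

(** The weak gradient of chi f according to the product rule. *)
Definition cutgrad chi p : 'rV[R]_n.+1 := chi p *: G p + f p *: grad chi p.

Lemma compact_support_bounded phi : continuous phi -> compactly_supported setT phi ->
 exists2 B : R, 0 < B & forall p, `|phi p| <= B.
Proof.
move=> cp [K [cK _] K0]; have [B B0 HB] := @compact_ubound R M K phi cK (fun p _ => cp p).
by exists B => // p; have [Kp|/K0 ->] := pselect (K p); [exact: HB|rewrite normr0 ltW].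
Qed.

Lemma grad_compactly_supported phi a : compactly_supported setT phi ->
 compactly_supported setT (fun p => grad phi p 0 a).
Proof.
move=> [K [cK KT] K0]; exists K => // p nK.
by rewrite (grad_support S iota (K := K)) ?mxE//; exact: (closed_compact_manifold S).
Qed.

Lemma cut_L2 chi : smooth_fun S chi -> compactly_supported setT chi ->
 L2 mu (fun p : borelType M => chi p * f p).
Proof.
move=> sc cs; have cc := smooth_continuous sc; have [B _ HB] := compact_support_bounded cc cs.
have [fL _ _] := W; exact: (L2_mul fL (measurable_continuous cc) HB).
Qed.

Lemma cutgrad_L2 chi a : smooth_fun S chi -> compactly_supported setT chi ->
 L2 mu (fun p : borelType M => cutgrad chi p 0 a).
Proof.
move=> sc cs; have cc := smooth_continuous sc; have [B _ HB] := compact_support_bounded cc cs.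
have cg := grad_continuous imm (a := a) sc.
have [B' _ HB'] := compact_support_bounded cg (grad_compactly_supported a cs).
have [fL GL _] := W.
rewrite (_ : (fun p => _) = (fun p : borelType M => chi p * G p 0 a + grad chi p 0 a * f p)); last first.
 by apply/funext => p; rewrite !mxE [f p * _]mulrC.
apply: L2D.
 exact: (L2_mul (GL a) (measurable_continuous cc) HB).
exact: (L2_mul fL (measurable_continuous cg) HB').
Qed.

Lemma approx_error_measurable chi phi : smooth_fun S chi -> compactly_supported setT chi -> smooth_fun S phi ->
 measurable_fun setT (fun p : borelType M => (phi p - chi p * f p) ^+ 2 +
  dotv (grad phi p - cutgrad chi p) (grad phi p - cutgrad chi p)).
Proof.
move=> sc cc sp; apply: measurable_funD.
 apply: measurable_funX; apply: measurable_funB.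
  exact: measurable_continuous (smooth_continuous sp).
 by have [] := cut_L2 sc cc.
apply: measurable_sum => j.
rewrite (_ : (fun p => _) = (fun p : borelType M => (grad phi p 0 j - cutgrad chi p 0 j) ^+ 2)); last first.
 by apply/funext => p; rewrite !mxE.
apply: measurable_funX; apply: measurable_funB; first exact: measurable_continuous (grad_continuous imm sp).
by have [] := cutgrad_L2 j sc cc.
Qed.

Lemma compactly_supportedD chi psi : compactly_supported setT chi -> compactly_supported setT psi ->
 compactly_supported setT (fun p : M => chi p + psi p).
Proof.
move=> [A [cA _] A0] [B [cB _] B0]; exists (A `|` B); first by split => //; exact: compactU.
by move=> p /not_orP[/A0 -> /B0 ->]; rewrite addr0.
Qed.

Section InChart.
Variables (c : chart R n M) (chi : M -> R) (K0 : set M).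
Hypothesis Ac : atlas S c.
Hypothesis sc : smooth_fun S chi.
Hypothesis cK0 : compact K0.
Hypothesis K0c : K0 `<=` cdom c.
Hypothesis chi0 : forall p, ~ K0 p -> chi p = 0.
Let K1 := cmap c @` K0.

Let cK1 : compact K1.
Proof. exact: compact_cmap. Qed.

Let K1c : K1 `<=` cimg c.
Proof. by move=> _ [p Kp <-]; exact: cmap_img (K0c Kp). Qed.

Let K1E x : cimg c x -> ~ K1 x -> ~ K0 (cinv c x).
Proof. by move=> cx nK Kx; apply: nK; exists (cinv c x) => //; rewrite cinvK. Qed.

Let csT : compactly_supported setT chi.
Proof. by exists K0 => //. Qed.

Let gc0 p : ~ K0 p -> grad chi p = 0.
Proof. by apply: (grad_support S iota (K := K0)) => //; exact: (closed_compact_manifold S). Qed.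

Definition cut_chart := (fun t => chi (cpoint c t) * f (cpoint c t)) \_ (cdomain c).
Definition cutgrad_chart i := (fun t : n.-tuple Rm =>
 dotv (cutgrad chi (cpoint c t)) (row i (tangent_mx iota c (rv t)))) \_ (cdomain c).

Lemma cut_chart_L2 : L2 (leb n) cut_chart.
Proof.
have := @chart_L2 R n M S iota mu imm Hmu c K1 (fun p => chi p * f p) (fun=> 1) Ac cK1 K1c
 (cut_L2 sc csT) (Ck_cst 0 (1 : R^o) (@open_cimg _ _ _ c)).
have H x : cimg c x -> ~ K1 x -> chi (cinv c x) * f (cinv c x) * 1 = 0.
 by move=> cx nK; rewrite chi0 ?mul0r//; exact: K1E.
move=> /(_ H); congr (L2 _ (_ \_ _)); by apply/funext => t; rewrite mulr1.
Qed.

Lemma cutgrad_chart_L2 i : L2 (leb n) (cutgrad_chart i).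
Proof.
rewrite (_ : cutgrad_chart i = (fun t => \sum_j ((fun t : n.-tuple Rm =>
 cutgrad chi (cpoint c t) 0 j * tangent_mx iota c (rv t) i j) \_ (cdomain c)) t)).
 apply: L2_sum => j.
 apply: (@chart_L2 R n M S iota mu imm Hmu c K1 (fun p => cutgrad chi p 0 j)
  (fun x => tangent_mx iota c x i j)) => //.
 - exact: cutgrad_L2.
 - exact: Ck_tangent (imm Ac).1 _ _ _.
 - move=> x cx nK; have nK0 := K1E cx nK; by rewrite /cutgrad chi0// gc0// scale0r scaler0 addr0 mxE mul0r.
apply/funext => t; rewrite /cutgrad_chart !patchE; case: ifPn => ct.
 by apply: eq_bigr => j _; rewrite patchE ct [row _ _ _ _]mxE.
by rewrite big1// => j _; rewrite patchE (negbTE ct).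
Qed.

Lemma cut_chart_support t : ~ K1 (rv t) -> cut_chart t = 0 /\ forall i, cutgrad_chart i t = 0.
Proof.
move=> nK; rewrite /cut_chart /cutgrad_chart !patchE; case: ifPn => [|nct].
 rewrite inE => ct; have nK0 := K1E ct nK; split; first by rewrite chi0 ?mul0r.
 by move=> i; rewrite patchE mem_set// /cutgrad chi0// gc0// scale0r scaler0 addr0 dotv0l.
by split => // i; rewrite patchE (negbTE nct).
Qed.

Lemma integrable_of_chart (u : n.-tuple Rm -> R) : L2 (leb n) u ->
 (forall t, ~ K1 (rv t) -> u t = 0) -> L1 (leb n) u.
Proof. by move=> [mu' uoo] u0; have [] := L2_supported_L1 mu' cK1 u0 uoo. Qed.

Let b : 'rV[R]_n -> R^o := (chi \o cinv c : _ -> R^o) \_ (cimg c).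

Let b0 x : ~ K1 x -> b x = 0.
Proof.
move=> nK; rewrite /b patchE; case: ifPn => //; rewrite inE => cx /=; apply: chi0; exact: K1E.
Qed.

Let bE x : cimg c x -> b x = chi (cinv c x).
Proof. by move=> cx; rewrite /b patchE mem_set. Qed.

Let smooth_b : smooth_on setT b.
Proof. by move=> k; apply: (Ck_zero_ext cK1 K1c) => [x cx nK|]; [apply: chi0; exact: K1E|exact: sc]. Qed.

Let oc := @open_cimg _ _ _ c.

(** The weak derivative of f is tested with chi psi, in which chi, extended by zero, supplies the
    compact support. The term f psi d_i chi is moved to the other side, where it belongs to the
    gradient of chi f. *)
Lemma weak_cut (psi : 'rV[R]_n -> R^o) i : smooth_on setT psi ->
 \int[leb n]_t (cut_chart t * partial i psi (rv t)) = - \int[leb n]_t (cutgrad_chart i t * psi (rv t)).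
Proof.
move=> sp; have [fL GL [_ Wc]] := W.
have pb x : cimg c x -> partial i b x = partial i (chi \o cinv c : _ -> R^o) x.
 by apply: partial_eq_open oc _.
have sbp : smooth_on setT (b \* psi : _ -> R^o) by move=> k; apply: CkM => //; exact: openT.
have csp : compactly_supported (cimg c) (b \* psi).
 by exists K1 => // x nK; rewrite /= b0// mul0r.
have pM x : partial i (b \* psi : _ -> R^o) x = b x * partial i psi x + psi x * partial i b x.
{ rewrite /partial deriveM//; first exact: (Ck_derivable (smooth_b 1)).
 exact: (Ck_derivable (sp 1)). }
have db0 x : ~ K1 x -> partial i b x = 0.
{ apply: (partial_support (K := K1)) => //.
 by apply: compact_closed => //. }
have sT k (g : 'rV[R]_n -> R^o) : Ck k setT g -> Ck k (cimg c) g by apply: Ck_sub.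
have i1 := chart_integrable Ac cK1 K1c fL (CkM oc (sT 0%N _ (smooth_b 0)) (sT _ _ (CkS i (sp 1%N))))
 (ltac:(by move=> x nK; rewrite /= b0 ?mul0r)).
have i2 := chart_integrable Ac cK1 K1c fL (CkM oc (sT 0%N _ (sp 0%N)) (sT _ _ (CkS i (smooth_b 1))))
 (ltac:(by move=> x nK; rewrite /= db0 ?mulr0)).
have i3 := @chart_dotv_integrable c K1 G _ i Ac cK1 K1c GL (sT _ _ (sbp 0%N)) (ltac:(by move=> x nK; rewrite /= b0 ?mul0r)).
have mD := measurable_cdomain c.
have -> : \int[leb n]_t (cut_chart t * partial i psi (rv t)) =
 \int[leb n]_(t in cdomain c) (f (cpoint c t) * (b (rv t) * partial i psi (rv t))).
{ rewrite [RHS]Rintegral_mkcond; apply: eq_Rintegral => t _; rewrite /cut_chart !patchE.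
 case: ifPn => [/set_mem ct|_]; last by rewrite mul0r.
 by rewrite bE// mulrA [chi _ * _]mulrC. }
have -> : \int[leb n]_t (cutgrad_chart i t * psi (rv t)) = \int[leb n]_(t in cdomain c)
 (dotv (G (cpoint c t)) (row i (tangent_mx iota c (rv t))) * (b (rv t) * psi (rv t)) + f (cpoint c t) * (psi (rv t) * partial i b (rv t))).
{ rewrite [RHS]Rintegral_mkcond; apply: eq_Rintegral => t _; rewrite /cutgrad_chart !patchE; case: ifPn => [/set_mem ct|_]; last by rewrite mul0r.
 rewrite dotvDl !dotvZl (grad_chart imm Ac (cinv_dom ct) sc) cinvK// gradc_dot// pb// bE//; ring. }
have := Wc c i _ Ac sbp csp; under eq_Rintegral do rewrite pM mulrDr.
by rewrite !RintegralD// opprD => /(canRL (addrK _)).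
Qed.

(** The coordinate expression of chi f is mollified and carried back to the manifold. Partial
    derivatives of the mollification are mollified weak derivatives, so function and gradient errors
    both tend to zero in coordinates; bounds for the inverse metric and the volume density transfer
    this to the manifold. *)
Lemma W0_approx_chart : W0_approx (fun p => chi p * f p) (cutgrad chi).
Proof.
have [d d0 [L cL [Lc KL]]] := compact_thickening cK1 oc K1c.
have cLM := compact_cinv cL Lc.
have K1L x : K1 x -> L x by move=> Kx; apply: (KL x x Kx); rewrite subrr normr0 ltW.
have K0L p : K0 p -> (cinv c @` L) p.
 by move=> Kp; exists (cmap c p); [apply: K1L; exists p|exact: cmapK (K0c Kp)].
exists (cinv c @` L) => //; split.
 move=> p nL; have nK : ~ K0 p by move=> /K0L.
 by rewrite /cutgrad chi0// gc0// scale0r scaler0 addr0 mul0r.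
move=> e e0; have [C C0 HC] := chart_comparison imm Hmu Ac cL Lc.
(* A bound B for the sum of squares of the entries bounds every entry by B + 1, since 2|x| <= x^2 +
   1. *)
pose hsq x : R^o := \sum_i \sum_j invmx (metric_mx iota c x) i j * invmx (metric_mx iota c x) i j.
have Chsq : Ck 0 (cimg c) hsq.
{ apply: Ck_sum => // i _; apply: Ck_sum => // j _.
 have Ch := Ck_invmetric (imm Ac).1 (imm Ac).2 0 i j; exact: CkM. }
have [B B0 HB] := @compact_ubound _ _ _ hsq cL (fun x Lx => Ck_continuous Chsq (Lc x Lx)).
have hB x i j : L x -> `|invmx (metric_mx iota c x) i j| <= B + 1.
{ move=> Lx; have := HB x Lx; rewrite ger0_norm => [H|]; last first.
  by apply: sumr_ge0 => k _; apply: sumr_ge0 => l _; rewrite -expr2 sqr_ge0.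
 have : invmx (metric_mx iota c x) i j ^+ 2 <= hsq x.
 { rewrite /hsq (bigD1 i)//= (bigD1 j)//= -expr2 -!addrA lerDl addr_ge0//.
   by apply: sumr_ge0 => k _; rewrite -expr2 sqr_ge0.
  by apply: sumr_ge0 => k _; apply: sumr_ge0 => l _; rewrite -expr2 sqr_ge0. }
 have := sqr_ge0 (`|invmx (metric_mx iota c x) i j| - 1).
 rewrite sqrrB real_normK ?num_real// !mulr1 expr1n; have := normr_ge0 (invmx (metric_mx iota c x) i j); lra. }
(* The function error contributes 1; the gradient error contributes (B + 1) n for the quadratic
   form, and another n for the number of components. *)
pose k := 1 + (B + 1) * n%:R * n%:R.
have k1 : 1 <= k by rewrite lerDl !mulr_ge0 ?ler0n//; lra.
pose e' := e / (C * k).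
have e'0 : 0 < e' by rewrite divr_gt0// mulr_gt0//; lra.
have [rho rho0 Krho] := compact_bounded_rV cK1.
have far t : rho < `|rv t| -> ~ K1 (rv t) by move=> h /Krho; lra.
have [mw woo] := cut_chart_L2.
have [dw dw0 Hw] := mollify_L2 mw rho0 (fun t h => (cut_chart_support (far t h)).1) woo e'0.
have [dD dD0 HD] : exists2 dD : R, 0 < dD & forall i r, r < dD -> forall eta, mollifier r eta ->
 (\int[leb n]_x ((conv (cutgrad_chart i) eta (rv x) - cutgrad_chart i x) ^+ 2)%:E <= e'%:E)%E.
{ apply: common_radius => i; have [mDi Dioo] := cutgrad_chart_L2 i.
 have [dD dD0 HD] := mollify_L2 mDi rho0 (fun t h => (cut_chart_support (far t h)).2 i) Dioo e'0.
 by exists dD => // r rd eta me; exact: HD me. }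
pose r := Num.min d (Num.min dw dD) / 2.
have r0 : 0 < r by rewrite divr_gt0// !lt_min d0 dw0 dD0.
have rm : r < Num.min d (Num.min dw dD) by rewrite /r ltr_pdivrMr// ltr_pMr ?ltr1n// !lt_min d0 dw0 dD0.
move: rm; rewrite !lt_min => /and3P[rd rw rD].
have [eta me] := @mollifier_exists R n r r0; have [ke eta0 _ _ _] := me.
have iw := integrable_of_chart cut_chart_L2 (fun t nK => (cut_chart_support nK).1).
have iD i := integrable_of_chart (cutgrad_chart_L2 i) (fun t nK => (cut_chart_support nK).2 i).
have sv : smooth_on setT (conv cut_chart eta) by exact: conv_smooth.
have v0 x : ~ L x -> conv cut_chart eta x = 0.
{ move=> nL; apply: (conv_eq0 me) => t tx; apply: (cut_chart_support _).1 => Kt; apply: nL.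
 by apply: (KL _ _ Kt); rewrite distrC ltW// (lt_trans tx). }
pose phi := push c (conv cut_chart eta).
have sphi : smooth_fun S phi by exact: (push_smooth Ac sv cL Lc v0).
have phi0 p : ~ (cinv c @` L) p -> phi p = 0 by exact: (push_support v0).
exists phi; split => //.
pose F p := (phi p - chi p * f p) ^+ 2 + dotv (grad phi p - cutgrad chi p) (grad phi p - cutgrad chi p).
have F0 p : 0 <= F p by rewrite addr_ge0 ?sqr_ge0 ?dotv_ge0.
have FL p : ~ (cinv c @` L) p -> F p = 0.
{ move=> nL; have nK : ~ K0 p by move=> /K0L.
 rewrite /F phi0// (grad_support S iota (K := cinv c @` L))//; last exact: (closed_compact_manifold S).
 by rewrite /cutgrad chi0// gc0// scale0r scaler0 addr0 mul0r !subrr dotv0l expr0n addr0. }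
have mF : measurable_fun setT (F : borelType M -> R) by exact: approx_error_measurable.
have [_ HF] := HC F mF F0 FL; apply: le_trans HF _.
have -> : e = C * (k * e') by rewrite /e' mulrA mulrC divfK// gt_eqF// mulr_gt0//; lra.
rewrite EFinM lee_pmul2l ?lte_fin//.
pose Ei i t := conv (cutgrad_chart i) eta (rv t) - cutgrad_chart i t.
have mE i : measurable_fun setT (Ei i).
{ apply: measurable_funB; first by apply: conv_measurable => //; exact: iD.
 by have [] := cutgrad_chart_L2 i. }
have mV : measurable_fun setT (fun t : n.-tuple Rm => conv cut_chart eta (rv t) - cut_chart t).
{ by apply: measurable_funB => //; exact: conv_measurable. }
pose Q (t : n.-tuple Rm) := (conv cut_chart eta (rv t) - cut_chart t) ^+ 2 + (B + 1) * n%:R * \sum_i Ei i t ^+ 2.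
have QF t : cdomain c t -> F (cpoint c t) <= Q t.
{ move=> ct; have Bn : 0 <= (B + 1) * n%:R by rewrite mulr_ge0 ?ler0n//; lra.
 have SE : 0 <= \sum_i Ei i t ^+ 2 by apply: sumr_ge0 => i _; exact: sqr_ge0.
 have [Lt|nL] := pselect (L (rv t)); last first.
  rewrite FL; first by rewrite addr_ge0 ?sqr_ge0// mulr_ge0.
  by move=> [x Lx xt]; apply: nL; rewrite -(cinvK ct) -[cinv c (rv t)]/(cpoint c t) -xt cinvK//; exact: Lc.
 have cd := cinv_dom ct.
 have phE x : cimg c x -> (phi \o cinv c) x = conv cut_chart eta x.
  by move=> cx; rewrite /= /phi pushE ?cinvK//; exact: cinv_dom.
 rewrite /F /Q; apply: lerD.
  by rewrite -[phi (cpoint c t)]/((phi \o cinv c) (rv t)) phE// [cut_chart t]patchE mem_set.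
 have -> : grad phi (cpoint c t) - cutgrad chi (cpoint c t) =
   (\row_i Ei i t) *m invmx (metric_mx iota c (rv t)) *m tangent_mx iota c (rv t).
 { have [_ _ [GT _]] := W.
  have cT : (cutgrad chi (cpoint c t) <= tangent_mx iota c (rv t))%MS.
  { rewrite addmx_sub// scalemx_sub//; first by have := GT c _ Ac cd; rewrite cinvK.
   rewrite (grad_chart imm Ac cd sc) cinvK// /gradc; exact: submxMl. }
  rewrite (grad_chart imm Ac cd sphi) cinvK// /gradc [X in _ - X](tangent_expansion Ac ct cT).
  rewrite -!mulmxBl; congr (_ *m _ *m _); apply/rowP => i; rewrite !mxE /Ei.
  rewrite (partial_eq_open (g := conv cut_chart eta) i oc phE ct) (partial_conv_weak _ iw ke (fun psi sp => weak_cut i sp)).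
  by rewrite [cutgrad_chart i t]patchE mem_set. }
 rewrite dotv_expansion//.
 via ((B + 1) * (\sum_i `|Ei i t|) ^+ 2).
  rewrite expr2 mulr_suml mulr_sumr; apply: ler_sum => i _; rewrite !mulr_sumr; apply: ler_sum => j _; rewrite !mxE.
  by apply: le_trans (ler_norm _) _; rewrite !normrM -mulrA mulrCA ler_wpM2r ?mulr_ge0// hB.
 rewrite -mulrA ler_wpM2l//; first by lra.
 by apply: le_trans (sqr_sum_le _) _; under eq_bigr do rewrite real_normK ?num_real//. }
via (\int[leb n]_t (Q t)%:E)%E.
 via (\int[leb n]_(t in cdomain c) (Q t)%:E)%E; last first.
  apply: ge0_subset_integral => //; first exact: measurable_cdomain.
  - apply/measurable_EFinP; apply: measurable_funD; first exact: measurable_funX.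
   by apply: measurable_funM => //; apply: measurable_sum => i; exact: measurable_funX.
  - move=> t _; rewrite lee_fin addr_ge0 ?sqr_ge0// mulr_ge0 ?sumr_ge0// => [|i _]; rewrite ?sqr_ge0//.
   by rewrite mulr_ge0 ?ler0n//; lra.
 apply: ge0_le_integral => //.
 - exact: measurable_cdomain.
 - by move=> t _; rewrite lee_fin.
 - by apply/measurable_EFinP; exact: measurable_chart_fun.
 - apply/measurable_EFinP; apply: measurable_funTS; apply: measurable_funD; first exact: measurable_funX.
  by apply: measurable_funM => //; apply: measurable_sum => i; exact: measurable_funX.
have -> : k * e' = e' + (B + 1) * n%:R * \sum_(i < n) e' by rewrite sumr_const card_ord -[e' *+ n]mulr_natl /k; ring.
have Bn : 0 <= (B + 1) * n%:R by rewrite mulr_ge0 ?ler0n//; lra.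
have mEs : measurable_fun setT (fun t => \sum_i Ei i t ^+ 2) by apply: measurable_sum => i; exact: measurable_funX.
have Es t : 0 <= \sum_i Ei i t ^+ 2 by apply: sumr_ge0 => i _; exact: sqr_ge0.
apply: (@integral_le_add _ _ _ (leb n) setT measurableT _ (fun t => (conv cut_chart eta (rv t) - cut_chart t) ^+ 2)
 (fun t => (B + 1) * n%:R * \sum_i Ei i t ^+ 2)) => //.
- by apply: measurable_funD; [exact: measurable_funX|exact: measurable_funM].
- exact: measurable_funX.
- exact: measurable_funM.
- by move=> t _; rewrite lexx andbT addr_ge0 ?sqr_ge0// mulr_ge0.
- by move=> t _; exact: sqr_ge0.
- by move=> t _; rewrite mulr_ge0.
- exact: Hw me.
- apply: integral_le_scale => //; apply: integral_le_sum => [i|i t|i]; first exact: measurable_funX.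
  exact: sqr_ge0.
 exact: (HD i r rD eta me).
Qed.

End InChart.

Lemma W0_approxD chi psi : smooth_fun S chi -> smooth_fun S psi ->
 compactly_supported setT chi -> compactly_supported setT psi ->
 W0_approx (fun p => chi p * f p) (cutgrad chi) -> W0_approx (fun p => psi p * f p) (cutgrad psi) ->
 W0_approx (fun p => (chi p + psi p) * f p) (cutgrad (fun p => chi p + psi p)).
Proof.
have ler0n2 : (0 : R) <= 2 by [].
have add4 (A a1 a2 D d1 d2 : R) : A <= 2 * a1 + 2 * a2 -> D <= 2 * d1 + 2 * d2 ->
 A + D <= 2 * (a1 + d1) + 2 * (a2 + d2) by lra.
have dD (x y : 'rV[R]_n.+1) : dotv (x + y) (x + y) <= 2 * dotv x x + 2 * dotv y y.
{ have := dotv_ge0 (x - y); rewrite -scaleN1r !dotvDl !dotvDr !dotvZl !dotvZr (dotvC y x); lra. }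
have vE (x y z t : 'rV[R]_n.+1) : x - y + (z - t) = x + z - (y + t) by rewrite opprD addrACA.
have rE (x y a b g : R) : x - a * g + (y - b * g) = x + y - (a + b) * g by ring.
move=> sc sp cc cp [K cK [K0 HK]] [L cL [L0 HL]].
have cgE p : cutgrad (fun p => chi p + psi p) p = cutgrad chi p + cutgrad psi p.
{ rewrite /cutgrad gradD// scalerDl scalerDr !addrA; congr (_ + _).
 by rewrite -!addrA; congr (_ + _); rewrite addrC. }
exists (K `|` L); first exact: compactU.
split.
 move=> p /not_orP[nK nL]; have [h1 h2] := K0 p nK; have [h3 h4] := L0 p nL.
 by rewrite cgE h2 h4 mulrDl h1 h3 !addr0.
move=> e e0; have e4 : 0 < e / 4 by rewrite divr_gt0.
have [phi [s1 z1 b1]] := HK _ e4; have [tau [s2 z2 b2]] := HL _ e4.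
exists (fun p => phi p + tau p); split; first exact: smooth_funD.
 by move=> p /not_orP[nK nL]; rewrite z1// z2// addr0.
pose E u h (p : M) := (h p - u p * f p) ^+ 2 + dotv (grad h p - cutgrad u p) (grad h p - cutgrad u p).
have mE u h := @approx_error_measurable u h.
have E0 u h p : 0 <= E u h p by rewrite addr_ge0 ?sqr_ge0 ?dotv_ge0.
have -> : e = 2 * (e / 4) + 2 * (e / 4) by lra.
have ccp := compactly_supportedD cc cp.
apply: (@integral_le_add _ _ _ mu setT measurableT (E (fun p => chi p + psi p) (fun p => phi p + tau p)) (fun p => 2 * E chi phi p) (fun p => 2 * E psi tau p)).
- by apply: mE => //; exact: smooth_funD.
- by apply: measurable_funM => //; exact: mE.
- by apply: measurable_funM => //; exact: mE.
- move=> p _; rewrite E0 /= /E cgE gradD//.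
 rewrite -rE -vE; apply: add4; [exact: sqrD_le|exact: dD].
- by move=> p _; rewrite mulr_ge0.
- by move=> p _; rewrite mulr_ge0.
- apply: (@integral_le_scale _ _ _ mu setT measurableT 2 (E chi phi) (e / 4) ler0n2 (mE _ _ sc cc s1)) => [p _|]; [exact: E0|exact: b1].
- apply: (@integral_le_scale _ _ _ mu setT measurableT 2 (E psi tau) (e / 4) ler0n2 (mE _ _ sp cp s2)) => [p _|]; [exact: E0|exact: b2].
Qed.

(** Chart induction reduces to [W0_approx_chart]; smoothness and support are again part of the
    predicate because [W0_approxD] needs them. *)
Lemma cutoff_approx chi : smooth_fun S chi -> compactly_supported setT chi ->
 W0_approx (fun p => chi p * f p) (cutgrad chi).
Proof.
move=> sc cc; suff [] : [/\ smooth_fun S chi, compactly_supported setT chi & W0_approx (fun p => chi p * f p) (cutgrad chi)] by [].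
move: chi sc cc; apply: (@chart_induction R n M S (fun chi => [/\ smooth_fun S chi, compactly_supported setT chi & W0_approx (fun p => chi p * f p) (cutgrad chi)])).
- have g0 p : grad (fun=> 0) p = 0 by exact: grad_cst.
 split; first exact: smooth_cst.
  by exists set0 => //; split => //; exact: compact0.
 exists set0; first exact: compact0.
 split; first by move=> p _; rewrite /cutgrad g0 scale0r scaler0 addr0 mul0r.
 move=> e e0; exists (fun=> 0); split => //; first exact: smooth_cst.
 rewrite (_ : (fun p => _) = cst 0%E) ?integral0 ?lee_fin ?ltW//.
 by apply/funext => p; rewrite /cutgrad g0 scale0r scaler0 addr0 mul0r !subrr dotv0l expr0n addr0.
- move=> phi psi [s1 c1 a1] [s2 c2 a2]; split; first exact: smooth_funD.
  exact: compactly_supportedD.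
 exact: W0_approxD.
- move=> c chi Ac sc [K [cK Kc] K0]; split => //; first by exists K => //; split.
 exact: (W0_approx_chart Ac sc cK Kc K0).
Qed.

End WeakGradient.

(** * Energy estimates for weak solutions *)

Section SquareIntegrableFields.
Context {d} {T : measurableType d} {R : realType} {m : nat}.
Variable mu : {measure set T -> \bar R}.
Implicit Types (u v a b c : T -> R) (U V : T -> 'rV[R]_m).

Definition L2_field V := forall j, L2 mu (fun t => V t 0 j).

Lemma le_Rintegral_L1 u v : L1 mu u -> L1 mu v ->
 (forall t, u t <= v t) -> \int[mu]_t u t <= \int[mu]_t v t.
Proof. by move=> iu iv uv; apply: le_Rintegral => // t _. Qed.

Lemma integrable_dotv U V : L2_field U -> L2_field V ->
 L1 mu (fun t => dotv (U t) (V t)).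
Proof.
by move=> sU sV; apply: L1_sum => j; exact: L2_prod.
Qed.

Lemma L2_fieldD U V : L2_field U -> L2_field V ->
 L2_field (fun t => U t + V t).
Proof.
move=> sU sV j; rewrite (_ : (fun t => _) = (fun t => U t 0 j + V t 0 j)); first exact: L2D.
by apply/funext => t; rewrite mxE.
Qed.

Lemma L2_fieldN V : L2_field V -> L2_field (fun t => - V t).
Proof.
move=> sV j; have [mV _] := sV j.
rewrite (_ : (fun t => _) = (fun t => - V t 0 j)); last by apply/funext => t; rewrite mxE.
apply: (L2_bounded (B := 1) (sV j)) => [|t]; first exact: measurableT_comp.
by rewrite normrN mul1r.
Qed.

Lemma young_Rintegral a b c (e : R) : L1 mu a -> L1 mu b ->
 L1 mu c -> (forall t, `|a t| <= 2^-1 * (e * b t + e^-1 * c t)) ->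
 `|\int[mu]_t a t| <= 2^-1 * (e * \int[mu]_t b t + e^-1 * \int[mu]_t c t).
Proof.
move=> ia ib ic H.
have i1 := L1Z e ib; have i2 := L1Z e^-1 ic; have i3 := L1D i1 i2.
rewrite -RintegralZl// -[X in _ <= _ * (_ + X)]RintegralZl// -RintegralD// -RintegralZl//.
apply: le_trans (le_normr_Rintegral measurableT ia) _.
apply: le_Rintegral_L1; [exact: integrable_norm|exact: L1Z|exact: H].
Qed.

Lemma dotv_young U V (e : R) : 0 < e -> L2_field U -> L2_field V ->
 `|\int[mu]_t dotv (U t) (V t)| <=
 2^-1 * (e * \int[mu]_t dotv (U t) (U t) + e^-1 * \int[mu]_t dotv (V t) (V t)).
Proof.
move=> e0 sU sV; apply: young_Rintegral; try exact: integrable_dotv.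
move=> t; have := dotv_le_sum (U t) (V t) e0; have := dotv_le_sum (- U t) (V t) e0.
rewrite -scaleN1r !dotvZl !dotvZr ler_norml => h1 h2; lra.
Qed.

Lemma mul_young u v (e : R) : 0 < e -> L2 mu u -> L2 mu v ->
 `|\int[mu]_t (u t * v t)| <= 2^-1 * (e * \int[mu]_t (u t ^+ 2) + e^-1 * \int[mu]_t (v t ^+ 2)).
Proof.
move=> e0 su sv; apply: young_Rintegral; [exact: L2_prod|exact: L2_int|exact: L2_int|].
move=> t; have key (x : R) : 2 * (x * v t) <= e * x ^+ 2 + e^-1 * v t ^+ 2.
{ have := mulr_ge0 (ltW e0) (sqr_ge0 (x - e^-1 * v t)).
 have -> : e * (x - e^-1 * v t) ^+ 2 = e * x ^+ 2 - 2 * ((e * e^-1) * (x * v t)) + (e * e^-1) * (e^-1 * v t ^+ 2) by ring.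
 rewrite mulfV; lra. }
have h1 := key (u t); have := key (- u t); rewrite mulNr => h2.
rewrite ler_norml; lra.
Qed.

End SquareIntegrableFields.

Lemma eq_of_le_scale {R : realType} (x y C : R) : (forall e, 0 < e -> `|x - y| <= e * C) -> x = y.
Proof.
move=> H; have C0 : 0 <= C by have := le_trans (normr_ge0 _) (H 1 ltr01); rewrite mul1r.
apply/eqP; rewrite -subr_eq0 -normr_le0; apply/ler_addgt0Pl => e e0; rewrite addr0.
have C1 : 0 < C + 1 by lra.
apply: le_trans (H (e / (C + 1)) _) _; first by rewrite divr_gt0.
rewrite -mulrA [_^-1 * C]mulrC mulrA ler_pdivrMr//; lra.
Qed.

Lemma energy_arith {R : realFieldType} (a b c d e GG FF DD ZZ B : R) :
 - (a + b) + (c + d) = 0 -> `|b| <= 2^-1 * (e * GG + e^-1 * DD) -> `|d| <= 2^-1 * (e * FF + e^-1 * ZZ) ->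
 e^-1 * DD <= e -> e^-1 * ZZ <= B ^+ 2 * e ->
 `|a - c| <= e * (2^-1 * (GG + 1 + (FF + B ^+ 2))).
Proof.
move: (B ^+ 2) (e^-1 * DD) (e^-1 * ZZ) => B2 x y h; rewrite !ler_norml => /andP[h1 h2] /andP[h3 h4] h5 h6.
lra.
Qed.

(** * Testing the equation with functions that are only W^{1,2} *)

Section Energy.
Context {R : realType} {n : nat} {M : ptopologicalType}.
Variables (S : smooth_manifold R n M) (iota : M -> 'rV[R]_n.+1).
Variable mu : {measure set (borelType M) -> \bar R}.
Hypothesis imm : is_immersion S iota.
Hypothesis Hmu : is_riemannian_volume S iota mu.
Implicit Types (phi chi eta : M -> R).
Local Notation grad := (grad S iota).

Lemma continuous_L2 phi K : continuous phi -> compact K -> (forall p, ~ K p -> phi p = 0) ->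
 L2 mu (phi : borelType M -> R).
Proof.
move=> cp cK p0; split; first exact: measurable_continuous.
have cp2 : continuous (fun p => phi p * phi p) by move=> x; apply: continuousM; exact: cp.
have z p : ~ K p -> phi p * phi p = 0 by move=> /p0 ->; rewrite mul0r.
have i := continuous_compact_integrable imm Hmu cp2 cK z.
rewrite EFin_Rintegral// ltry//.
Qed.

Lemma grad_L2 phi : smooth_fun S phi -> compactly_supported setT phi ->
 L2_field mu (fun p : borelType M => grad phi p).
Proof.
move=> sp cs j; have [K [cK _] K0] := grad_compactly_supported S iota j cs.
exact: continuous_L2 (grad_continuous imm sp) cK K0.
Qed.

Variables (f : M -> R) (G : M -> 'rV[R]_n.+1).
Hypothesis W : W12_grad S iota mu f G.

Let sf : L2 mu (f : borelType M -> R).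
Proof. by have [? _ _] := W. Qed.

Let sG : L2_field mu (G : borelType M -> 'rV[R]_n.+1).
Proof. by have [_ ? _] := W. Qed.

Local Notation cutgrad := (cutgrad S iota f G).

Lemma cutgrad_field chi : smooth_fun S chi -> compactly_supported setT chi ->
 L2_field mu (fun p : borelType M => cutgrad chi p).
Proof. by move=> sc cc j; exact: (cutgrad_L2 imm W). Qed.

Lemma cut_diff_L2 chi phi : smooth_fun S chi -> compactly_supported setT chi ->
 smooth_fun S phi -> compactly_supported setT phi ->
 L2 mu (fun p : borelType M => phi p - chi p * f p).
Proof.
move=> sc cc sp [K [cK _] p0].
rewrite (_ : (fun p => _) = (fun p : borelType M => phi p + - 1 * (chi p * f p))); last first.
 by apply/funext => p; rewrite mulN1r.
apply: L2D; first exact: continuous_L2 (smooth_continuous sp) cK p0.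
by apply: (L2_mul (B := 1) (cut_L2 W sc cc)) => // p; rewrite normrN normr1.
Qed.

Lemma scaled_grad_L2 eta : smooth_fun S eta -> compactly_supported setT eta ->
 L2_field mu (fun p : borelType M => f p *: grad eta p).
Proof.
move=> se ce j; have cg := grad_continuous imm (a := j) se.
have [B _ HB] := compact_support_bounded cg (grad_compactly_supported S iota j ce).
rewrite (_ : (fun p => _) = (fun p : borelType M => grad eta p 0 j * f p)); last by apply/funext => p; rewrite mxE mulrC.
exact: (L2_mul sf (measurable_continuous cg) HB).
Qed.

Lemma cutoff_approx_real chi : smooth_fun S chi -> compactly_supported setT chi ->
 exists2 K, compact K & (forall p, ~ K p -> chi p * f p = 0) /\
 forall e : R, 0 < e -> exists phi, [/\ smooth_fun S phi, forall p, ~ K p -> phi p = 0,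
  \int[mu]_p ((phi p - chi p * f p) ^+ 2) <= e &
  \int[mu]_p dotv (grad phi p - cutgrad chi p) (grad phi p - cutgrad chi p) <= e].
Proof.
move=> sc cc; have [K cK [K0 H]] := cutoff_approx imm Hmu W sc cc.
exists K => //; split; first by move=> p /K0[].
move=> e e0; have [phi [sp p0 He]] := H e e0; exists phi.
have cp : compactly_supported setT phi by exists K.
have sV := L2_fieldD (grad_L2 sp cp) (L2_fieldN (cutgrad_field sc cc)).
have iV := integrable_dotv sV sV.
have iu' := L2_int (cut_diff_L2 sc cc sp cp).
have He' : \int[mu]_p ((phi p - chi p * f p) ^+ 2) + \int[mu]_p dotv (grad phi p - cutgrad chi p) (grad phi p - cutgrad chi p) <= e.
{ rewrite -RintegralD// -lee_fin -EFin_Rintegral//; exact: L1D. }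
have h1 : 0 <= \int[mu]_p ((phi p - chi p * f p) ^+ 2) by apply: Rintegral_ge0 => p _; exact: sqr_ge0.
have h2 : 0 <= \int[mu]_p dotv (grad phi p - cutgrad chi p) (grad phi p - cutgrad chi p).
 by apply: Rintegral_ge0 => p _; exact: dotv_ge0.
split => //.
- by apply: le_trans He'; rewrite lerDl.
- by apply: le_trans He'; rewrite lerDr.
Qed.

Section Sobolev.
Hypothesis minimal : is_minimal S iota.
Hypothesis n2 : (2 < n)%N.

(** The Sobolev inequality for smooth approximants of chi f in the limit. Local boundedness of q
    controls the weighted L^2 error, and the factor 4 comes from two uses of (x + y)^2 <= 2 x^2 + 2
    y^2. *)
Lemma cut_sobolev (C : R) (q chi : M -> R) (kappa : R) :
 sobolev_bound S iota mu C ->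
 0 < C -> measurable_fun setT (q : borelType M -> R) -> (forall p, 0 <= q p) -> 0 < kappa ->
 (\int[mu]_p (q p ^+ n)%:E <= (kappa ^+ n)%:E)%E ->
 (forall K, compact K -> exists B, forall p, K p -> q p <= B) ->
 smooth_fun S chi -> compactly_supported setT chi ->
 (\int[mu]_p (q p ^+ 2 * (chi p * f p) ^+ 2)%:E <=
  (4 * C * kappa ^+ 2 * \int[mu]_p dotv (cutgrad chi p) (cutgrad chi p))%:E)%E.
Proof.
move=> Sob C0 mq q0 k0 qk qB sc cc.
have [K cK [K0 H]] := cutoff_approx_real sc cc.
have [B HB] := qB K cK.
have [B1 B10 HB1] : exists2 B1 : R, 0 < B1 & forall p, K p -> q p ^+ 2 <= B1.
{ exists (B ^+ 2 + 1); first by rewrite ltr_pwDr ?sqr_ge0.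
 move=> p Kp; via (B ^+ 2); last by rewrite lerDl.
 by apply: lerXn2r; rewrite ?nnegrE ?(le_trans _ (HB p Kp))// HB. }
have sV := cutgrad_field sc cc; have iVV := integrable_dotv sV sV.
have [mu' _] := cut_L2 W sc cc.
have k20 : 0 <= C * kappa ^+ 2 by rewrite mulr_ge0 ?sqr_ge0// ltW.
apply/lee_addgt0Pr => e e0.
(* The gradient error enters with factor 4 C kappa^2 and the weighted error with 2 B1, so together
   they cost exactly e. *)
pose e1 := e / (4 * (C * kappa ^+ 2) + 2 * B1).
have D0 : 0 < 4 * (C * kappa ^+ 2) + 2 * B1 by lra.
have e10 : 0 < e1 by rewrite divr_gt0.
have eE : e = e1 * (4 * (C * kappa ^+ 2) + 2 * B1) by rewrite divfK ?gt_eqF.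
have [phi [sp p0 H1 H2]] := H e1 e10.
have cp : compactly_supported setT phi by exists K.
have sg := grad_L2 sp cp.
have sD := L2_fieldD sg (L2_fieldN sV).
have iD := integrable_dotv sD sD; have igg := integrable_dotv sg sg.
have mp := measurable_continuous (smooth_continuous sp).
have Hphi := Sob q phi K kappa mq q0 k0 qk sp cK p0.
have Hg : \int[mu]_p (enorm (grad phi p) ^+ 2) <= 2 * (\int[mu]_p dotv (cutgrad chi p) (cutgrad chi p)) + 2 * e1.
{ via (2 * (\int[mu]_p dotv (cutgrad chi p) (cutgrad chi p)) +
  2 * \int[mu]_p dotv (grad phi p - cutgrad chi p) (grad phi p - cutgrad chi p)); last by rewrite lerD2l ler_pM2l.
 rewrite (_ : (fun p => enorm _ ^+ 2) = (fun p => dotv (grad phi p) (grad phi p))); last first.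
  by apply/funext => p; rewrite enorm_sqr.
 have j1 := L1Z 2 iVV; have j2 := L1Z 2 iD.
 rewrite -!RintegralZl// -RintegralD//; apply: le_Rintegral_L1 => //; first exact: L1D.
 move=> p; have key (x y : 'rV[R]_n.+1) : dotv x x <= 2 * dotv y y + 2 * dotv (x - y) (x - y).
 { have := dotv_ge0 (x + (- 2) *: y); rewrite -[- y]scaleN1r !dotvDl !dotvDr !dotvZl !dotvZr (dotvC y x); lra. }
 exact: key. }
have Hd : (\int[mu]_p (B1 * (phi p - chi p * f p) ^+ 2)%:E <= (B1 * e1)%:E)%E.
{ have iu := L2_int (cut_diff_L2 sc cc sp cp).
 have j := L1Z B1 iu.
 by rewrite EFin_Rintegral// lee_fin RintegralZl// ler_pM2l. }
have X := @integral_le_add _ _ _ mu setT measurableT (fun p => q p ^+ 2 * (chi p * f p) ^+ 2)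
  (fun p => 2 * (q p ^+ 2 * phi p ^+ 2)) (fun p => 2 * (B1 * (phi p - chi p * f p) ^+ 2))
  (2 * (C * kappa ^+ 2 * \int[mu]_p (enorm (grad phi p) ^+ 2))) (2 * (B1 * e1)).
have m2 : measurable_fun setT (fun p : borelType M => q p ^+ 2 * phi p ^+ 2).
 by apply: measurable_funM; exact: measurable_funX.
have m3 : measurable_fun setT (fun p : borelType M => B1 * (phi p - chi p * f p) ^+ 2).
 by apply: measurable_funM => //; apply: measurable_funX; exact: measurable_funB.
apply: le_trans (X _ _ _ _ _ _ _ _) _.
- by apply: measurable_funM; exact: measurable_funX.
- exact: measurable_funM.
- exact: measurable_funM.
- move=> p _; rewrite mulr_ge0 ?sqr_ge0//=.
 have [Kp|nK] := pselect (K p); last first.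
  by rewrite K0// p0// subrr expr0n !mulr0 addr0.
 have := sqrD_le (phi p) (- (phi p - chi p * f p)); rewrite opprB addrC subrK => h.
 via (q p ^+ 2 * (2 * phi p ^+ 2 + 2 * (chi p * f p - phi p) ^+ 2)).
  by rewrite ler_wpM2l ?sqr_ge0.
 rewrite mulrDr mulrCA lerD2l mulrCA ler_pM2l// -[chi p * f p - _]opprB sqrrN.
 by rewrite ler_wpM2r ?sqr_ge0// HB1.
- by move=> p _; rewrite mulr_ge0// mulr_ge0 ?sqr_ge0.
- by move=> p _; rewrite mulr_ge0// mulr_ge0 ?sqr_ge0// ltW.
- by apply: integral_le_scale => // p _; rewrite mulr_ge0 ?sqr_ge0.
- by apply: integral_le_scale => // p _; rewrite mulr_ge0 ?sqr_ge0// ltW.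
rewrite lee_fin eE.
set I := \int[mu]_p dotv _ _ in Hg *; set J := \int[mu]_p _ in Hg *; set k2 := C * kappa ^+ 2 in k20 *.
have : k2 * J <= k2 * (2 * I + 2 * e1) by rewrite ler_wpM2l.
rewrite -[4 * C * _]mulrA -/k2; move: I J k2 e1 {k20 D0 e10 eE H1 H2 Hg Hphi Hd X} => I J k2 e1; lra.
Qed.

End Sobolev.

Section Jacobi.
Hypothesis J : weak_jacobi S iota mu f G.

(** The equation is tested with smooth approximants of chi f instead of chi f itself; both sides are
    continuous under the approximation, as A2 is bounded on the common support. *)
Lemma energy_identity chi : smooth_fun S chi -> compactly_supported setT chi ->
 \int[mu]_p dotv (G p) (cutgrad chi p) = \int[mu]_p (A2 S iota p * f p * (chi p * f p)).
Proof.
move=> sc cc; have [K cK [K0 H]] := cutoff_approx_real sc cc.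
have cA := A2_continuous imm.
have [B B0 HB] := @compact_ubound R M K _ cK (fun p _ => cA p).
have sV := cutgrad_field sc cc.
apply: (@eq_of_le_scale _ _ _ (2^-1 * (\int[mu]_p dotv (G p) (G p) + 1 + (\int[mu]_p (f p ^+ 2) + B ^+ 2)))) => e e0.
(* With approximation of order e^2, Young's inequality with parameter e leaves an error of order
   e. *)
have e20 : 0 < e ^+ 2 by rewrite exprn_gt0.
have [phi [sp p0 H1 H2]] := H _ e20.
have cp : compactly_supported setT phi by exists K.
have sg := grad_L2 sp cp.
have sD := L2_fieldD sg (L2_fieldN sV).
have su := cut_diff_L2 sc cc sp cp.
have mA := measurable_continuous cA.
have AB h : (forall p, ~ K p -> h p = 0) -> forall p, `|A2 S iota p * h p| <= B * `|h p|.
{ move=> h0 p; have [Kp|nK] := pselect (K p); last by rewrite h0// mulr0 normr0 mulr0.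
 by rewrite normrM ler_wpM2r ?HB. }
have sz : L2 mu (fun p : borelType M => A2 S iota p * (phi p - chi p * f p)).
{ apply: (L2_bounded (B := B) su); first by apply: measurable_funM => //; case: su.
 by apply: AB => p nK; rewrite p0// K0// subrr. }
have sAu : L2 mu (fun p : borelType M => A2 S iota p * (chi p * f p)).
{ have scf := cut_L2 W sc cc.
 apply: (L2_bounded (B := B) scf); first by apply: measurable_funM => //; case: scf.
 exact: AB. }
have iGV := integrable_dotv sG sV; have iGD := integrable_dotv sG sD.
have ifu := L2_prod sf sAu; have ifz := L2_prod sf sz.
have E1 : \int[mu]_p dotv (G p) (grad phi p) = \int[mu]_p dotv (G p) (cutgrad chi p) + \int[mu]_p dotv (G p) (grad phi p - cutgrad chi p).
{ rewrite -RintegralD//; apply: eq_Rintegral => p _; by rewrite -dotvDr addrC subrK. }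
have E2 : \int[mu]_p (A2 S iota p * f p * phi p) = \int[mu]_p (f p * (A2 S iota p * (chi p * f p))) + \int[mu]_p (f p * (A2 S iota p * (phi p - chi p * f p))).
{ rewrite -RintegralD//; apply: eq_Rintegral => p _; ring. }
have E3 : \int[mu]_p (A2 S iota p * f p * (chi p * f p)) = \int[mu]_p (f p * (A2 S iota p * (chi p * f p))).
{ by apply: eq_Rintegral => p _; rewrite -mulrA mulrCA. }
have := J sp cp; rewrite E1 E2 E3.
have Y1 := dotv_young e0 sG sD; have Y2 := mul_young e0 sf sz.
have Z2 : \int[mu]_p ((A2 S iota p * (phi p - chi p * f p)) ^+ 2) <= B ^+ 2 * e ^+ 2.
{ have iu := L2_int su; have iBu := L1Z (B ^+ 2) iu.
 via (B ^+ 2 * \int[mu]_p ((phi p - chi p * f p) ^+ 2)); last by rewrite ler_wpM2l ?sqr_ge0.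
 rewrite -RintegralZl//; apply: le_Rintegral_L1 => //; first exact: L2_int.
 move=> p; rewrite -exprMn -[leRHS]real_normK ?num_real//.
 apply: sqr_le_sqr; rewrite [in leRHS]normrM [`|B|]gtr0_norm//; apply: (AB (fun p => phi p - chi p * f p)).
 by move=> p' nK; rewrite p0// K0// subrr. }
have ei : e^-1 * e ^+ 2 = e by rewrite mulrA mulVf ?mul1r// gt_eqF.
have i0 : 0 <= e^-1 by rewrite invr_ge0 ltW.
have Y1' := ler_wpM2l i0 H2; have Y2' := ler_wpM2l i0 Z2; rewrite ei in Y1'; rewrite mulrCA ei in Y2'.
by move=> J0; exact: energy_arith J0 Y1 Y2 Y1' Y2'.
Qed.

(** The test function is eta^2 f, through the pointwise identity <G, grad(eta^2 f)> = |grad(eta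
    f)|^2 - f^2 |grad eta|^2. *)
Lemma cut_energy eta : smooth_fun S eta -> compactly_supported setT eta ->
 \int[mu]_p dotv (cutgrad eta p) (cutgrad eta p) =
 \int[mu]_p (A2 S iota p * (eta p * f p) ^+ 2) + \int[mu]_p (f p ^+ 2 * dotv (grad eta p) (grad eta p)).
Proof.
move=> se ce; have [K [cK _] K0] := ce.
have s2 := smooth_funM se se.
have c2 : compactly_supported setT (fun p => eta p * eta p).
 by exists K => // p nK; rewrite K0// mul0r.
have H := energy_identity s2 c2.
have E1 : \int[mu]_p (A2 S iota p * (eta p * f p) ^+ 2) = \int[mu]_p (A2 S iota p * f p * (eta p * eta p * f p)).
{ apply: eq_Rintegral => p _; ring. }
have sfg := scaled_grad_L2 se ce.
have iG := integrable_dotv sG (cutgrad_field s2 c2); have ifg := integrable_dotv sfg sfg.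
have E2 : \int[mu]_p (f p ^+ 2 * dotv (grad eta p) (grad eta p)) = \int[mu]_p dotv (f p *: grad eta p) (f p *: grad eta p).
{ by apply: eq_Rintegral => p _; rewrite dotvZl dotvZr mulrA. }
rewrite E1 -H E2 -RintegralD//; apply: eq_Rintegral => p _.
have cE chi q : cutgrad chi q = chi q *: G q + f q *: grad chi q by [].
rewrite !cE gradM// !dotvDl !dotvDr !dotvZl !dotvZr !dotvDr !dotvZr (dotvC (grad eta p) (G p)); ring.
Qed.

End Jacobi.
End Energy.

Lemma absorb_arith {R : realFieldType} (X a b c d C : R) :
 X = a + b -> a <= 2^-1 * X + C * c -> b <= d -> X <= 2 * C * c + 2 * d.
Proof. by lra. Qed.

(** * Cutoffs at infinity and local control of solutions *)

Section Cutoffs.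
Context {R : realType} {n : nat} {M : ptopologicalType}.
Variables (S : smooth_manifold R n M) (iota : M -> 'rV[R]_n.+1).
Variable mu : {measure set (borelType M) -> \bar R}.
Hypothesis imm : is_immersion S iota.
Hypothesis Hmu : is_riemannian_volume S iota mu.
Hypothesis proper : is_proper iota.
Hypothesis n2 : (2 < n)%N.
Local Notation grad := (grad S iota).
Local Notation rho := (sqdist iota 0).

Definition extrinsic_ball (r : R) : set M := iota @^-1` [set y | `|y| <= r].

Lemma compact_extrinsic_ball r : 0 < r -> compact (extrinsic_ball r).
Proof. by move=> r0; apply: proper.2; exact: compact_closed_ball. Qed.

Lemma extrinsic_ball_sqdist r p : 0 < r -> extrinsic_ball r p -> rho p < (n.+2%:R * r) ^+ 2.
Proof.
move=> r0 pr; rewrite sqdistE subr0; apply: ltrXn2r; rewrite ?enorm_ge0 ?(ltW r0)//.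
apply: le_lt_trans (enorm_le_coord (ltW r0) (fun j => le_trans (coord_le_norm (iota p) j) pr)) _.
by lra.
Qed.

Lemma compact_sub_extrinsic_ball (K : set M) : compact K ->
 exists m : nat, forall k, (m <= k)%N -> K `<=` extrinsic_ball k.+1%:R.
Proof.
move=> cK; have ci : continuous (fun p => `|iota p|).
 by move=> p; apply: (@continuous_comp _ _ _ iota (fun y : 'rV[R]_n.+1 => `|y|)); [exact: proper.1|exact: norm_continuous].
have [B B0 HB] := @compact_ubound R M K _ cK (fun p _ => ci p).
exists (Num.trunc B) => k mk p Kp.
have := HB p Kp; rewrite normr_id => /le_trans; apply; apply/ltW.
by apply: lt_le_trans (truncnS_gt _) _; rewrite ler_nat.
Qed.

(** The cutoff is a function of |iota|^2 / r^2: properness makes its support compact, and the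
    gradient is bounded because projecting the position vector does not lengthen it. *)
Lemma cutoff_exists : exists2 C : R, 0 < C & forall r : R, 0 < r -> exists eta : M -> R,
 [/\ smooth_fun S eta, compactly_supported setT eta, forall p, 0 <= eta p <= 1,
  forall p, rho p < r ^+ 2 -> eta p = 1 /\ grad eta p = 0 &
  forall p, dotv (grad eta p) (grad eta p) <= C / r ^+ 2].
Proof.
have [g Dg [B B0 HB]] := @step_derive R.
(* The squared derivative is at most B^2/r^4, and the squared gradient of |iota|^2 at most 4
   |iota|^2 <= 8 r^2 where the cutoff varies. *)
exists (8 * B ^+ 2); first by rewrite mulr_gt0// exprn_gt0.
move=> r r0; have r20 : 0 < r ^+ 2 by rewrite exprn_gt0.
(* The argument is 2 - rho/r^2, written with 1 + rho so that the smoothness and gradient of the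
   shifted squared distance apply with s = 1. *)
pose eta p := step (2 + (r ^+ 2)^-1 - (r ^+ 2)^-1 * (1 ^+ 2 + rho p)).
have sr := smooth_fun_shifted_sqdist imm 0 1.
have se : smooth_fun S eta.
{ apply: smooth_fun_step; apply: smooth_funB; first exact: smooth_cst.
 by apply: smooth_funM => //; exact: smooth_cst. }
have etaE p : eta p = step (2 - rho p / r ^+ 2) by rewrite /eta; congr step; rewrite expr1n; ring.
have eta1 p : rho p <= r ^+ 2 -> eta p = 1.
{ move=> h; rewrite etaE step1//; have : rho p / r ^+ 2 <= 1 by rewrite ler_pdivrMr// mul1r.
 lra. }
have eta0 p : 2 * r ^+ 2 <= rho p -> eta p = 0.
{ move=> h; rewrite etaE step0//; have : 2 <= rho p / r ^+ 2 by rewrite ler_pdivlMr.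
 lra. }
have crho : continuous rho.
{ have s1 : smooth_fun S (fun=> (1 : R)) by exact: smooth_cst.
 have := smooth_continuous (smooth_funB sr s1).
 rewrite (_ : (fun q => _) = rho)//; by apply/funext => q; rewrite expr1n [1 + _]addrC addrK. }
have gout p : ~ (rho p <= 2 * r ^+ 2) -> grad eta p = 0.
{ move=> h; apply: (grad_support S iota (K := rho @^-1` [set x | x <= 2 * r ^+ 2])) => //.
  by apply: preimage_closed => //; exact: closed_le.
 by move=> q /negP; rewrite -ltNge => /ltW /eta0. }
have gin p : rho p < r ^+ 2 -> grad eta p = 0.
{ move=> h; have s1 : smooth_fun S (fun q => 1 - eta q) by apply: smooth_funB => //; exact: smooth_cst.
 have g1 : grad (fun q => 1 - eta q) p = 0.
 { apply: (grad_support S iota (K := rho @^-1` [set x | r ^+ 2 <= x])) => //.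
  - by apply: preimage_closed => //; exact: closed_ge.
  - by move=> q /negP; rewrite -ltNge => /ltW /eta1 ->; rewrite subrr.
  - by move=> /=; rewrite leNgt h. }
 have := gradD iota p se s1; rewrite g1 addr0 => <-.
 rewrite (_ : (fun q => _) = fun=> 1) ?grad_cst//; apply/funext => q; ring. }
exists eta; split => //.
- exists (extrinsic_ball (2 * r)); first by split => //; apply: compact_extrinsic_ball; rewrite mulr_gt0.
 move=> p /negP; rewrite -ltNge => h; apply: eta0; rewrite sqdistE subr0.
 have : (2 * r) ^+ 2 <= enorm (iota p) ^+ 2.
 { apply: lerXn2r; rewrite ?nnegrE ?enorm_ge0 ?mulr_ge0 ?(ltW r0)//; apply: le_trans (ltW h) _.
  exact: norm_coord_le (enorm_ge0 _) (coord_le_enorm _). }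
 rewrite exprMn; have := ltW r20; lra.
- by move=> p; rewrite step_ge0 step_le1.
- by move=> p h; split; [apply: eta1; exact: ltW|exact: gin].
- move=> p; have [h|h] := pselect (rho p <= 2 * r ^+ 2); last first.
  rewrite gout// dotv0l; apply: divr_ge0; last exact: sqr_ge0.
  by apply: mulr_ge0 => //; exact: sqr_ge0.
 pose L := - (r ^+ 2)^-1 * g (2 + (r ^+ 2)^-1 - (r ^+ 2)^-1 * (1 ^+ 2 + rho p)).
 have DL : is_derive (1 ^+ 2 + rho p) (1 : R) (fun x => step (2 + (r ^+ 2)^-1 - (r ^+ 2)^-1 * x)) L.
 { have D1 : is_derive (1 ^+ 2 + rho p) (1 : R) (fun x : R => 2 + (r ^+ 2)^-1 - (r ^+ 2)^-1 * x) (- (r ^+ 2)^-1).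
   by apply: is_derive_eq; rewrite /GRing.scale /=; ring.
  have D2 := Dg (2 + (r ^+ 2)^-1 - (r ^+ 2)^-1 * (1 ^+ 2 + rho p)).
  have := is_derive1_comp (f := step) (g := fun x : R => 2 + (r ^+ 2)^-1 - (r ^+ 2)^-1 * x) D2 D1.
  by move=> D3; apply: is_derive_eq; rewrite /L; ring. }
 have -> : grad eta p = L *: (2 *: ((iota p - 0) *m tproj_at S iota p)).
  by rewrite -(grad_sqdist imm 0 1 p); exact: (grad_comp iota sr DL).
 rewrite !dotvZl !dotvZr.
 have := dotv_proj_le (iota p - 0) (tproj_at_sym S iota p) (tproj_at_idem imm p).
 rewrite -[X in _ <= X]enorm_sqr -sqdistE => hP.
 have P0 := dotv_ge0 ((iota p - 0) *m tproj_at S iota p).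
 move: (dotv _ _) P0 hP => P P0 hP.
 have LB : L ^+ 2 <= B ^+ 2 / (r ^+ 2) ^+ 2.
 { rewrite exprMn sqrrN exprVn mulrC ler_pM2r ?invr_gt0 ?exprn_gt0//; exact: sqr_le_sqr. }
 via (B ^+ 2 / (r ^+ 2) ^+ 2 * (4 * (2 * r ^+ 2))).
  have -> : L * (2 * (L * (2 * P))) = L ^+ 2 * (4 * P) by ring.
  apply: ler_pM => //; [exact: sqr_ge0|exact: mulr_ge0|].
  by lra.
 apply: le_of_eq; field; by lra.
Qed.

Hypothesis total_curvature : (\int[mu]_p (Num.sqrt (A2 S iota p) ^+ n)%:E < +oo)%E.

Lemma sqrt_A2_continuous : continuous (fun p => Num.sqrt (A2 S iota p)).
Proof.
by move=> p; apply: (@continuous_comp _ _ _ (A2 S iota) Num.sqrt); [exact: A2_continuous|exact: sqrt_continuous].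
Qed.

Lemma measurable_extrinsic_ball r : 0 < r -> measurable (extrinsic_ball r : set (borelType M)).
Proof. by move=> r0; have [] := mu_compact_lty imm Hmu (compact_extrinsic_ball r0). Qed.

(** Dominated convergence: every point is eventually inside the exhausting balls, and |A|^n is an
    integrable majorant. *)
Lemma curvature_tail (e : R) : 0 < e -> exists m : nat,
 (\int[mu]_p ((\1_(~` extrinsic_ball m.+1%:R) p * Num.sqrt (A2 S iota p)) ^+ n)%:E <= e%:E)%E.
Proof.
move=> e0; pose a p := Num.sqrt (A2 S iota p) ^+ n.
have ma : measurable_fun setT (a : borelType M -> R).
 by apply: measurable_funX; exact: measurable_continuous sqrt_A2_continuous.
have a0 p : 0 <= a p by rewrite exprn_ge0.
pose u (m : nat) (p : borelType M) := (((\1_(~` extrinsic_ball m.+1%:R) p : R) * Num.sqrt (A2 S iota p)) ^+ n)%:E.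
have mi m : measurable_fun setT (\1_(~` extrinsic_ball m.+1%:R) : borelType M -> R).
 by apply: (@measurable_indic _ (borelType M) R setT); apply: measurableC; exact: measurable_extrinsic_ball.
have mm m : measurable_fun setT (u m).
{ apply/measurable_EFinP; apply: measurable_funX; apply: measurable_funM => //.
 exact: measurable_continuous sqrt_A2_continuous. }
have ia : L1 mu (a : borelType M -> R).
{ apply/integrableP; split; first exact/measurable_EFinP.
 by under eq_integral do rewrite /= ger0_norm//. }
have le1 (m : nat) p : 0 <= (\1_(~` extrinsic_ball m.+1%:R) p : R) * Num.sqrt (A2 S iota p) <= Num.sqrt (A2 S iota p).
 rewrite indicE; case: (_ \in _); rewrite ?mul1r ?mul0r ?lexx ?sqrtr_ge0//.
have n0 : (0 < n)%N by apply: leq_trans n2.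
have [|||||_ _ cv] := @dominated_convergence _ _ R mu setT measurableT u (cst 0%E) (EFin \o a).
- exact: mm.
- exact: measurable_cst.
- apply/aeW => p _; have [k Hk] := compact_sub_extrinsic_ball (@compact_set1 M p).
 apply: cvg_near_cst; exists k => // m /= km; rewrite /u indicE memNset ?mul0r ?expr0n ?gtn_eqF//.
 by apply; apply: (Hk m km).
- exact: ia.
- apply/aeW => p m _; rewrite /u /= lee_fin; have /andP[h1 h2] := le1 m p.
 rewrite ger0_norm ?exprn_ge0//; by apply: lerXn2r; rewrite ?nnegrE.
move: cv; rewrite integral0 => /fine_cvgP[fE /cvgrPdist_le/(_ e e0) H].
have [k _ Hk] : \forall m \near \oo, (\int[mu]_p u m p)%E \is a fin_num /\ `|0 - fine (\int[mu]_p u m p)%E| <= e by exact: filterI.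
exists k; have [f1 f2] := Hk k (leqnn k); rewrite -[leLHS](fineK f1).
by move: f2; rewrite sub0r normrN; apply: le_trans; exact: ler_norm.
Qed.

Hypothesis minimal : is_minimal S iota.

Lemma indic_kappa (K : set M) : compact K -> exists2 kappa : R, 0 < kappa &
 (\int[mu]_p (((\1_K p : R) ^+ n)%:E) <= (kappa ^+ n)%:E)%E.
Proof.
move=> cK; have [mK Koo] := mu_compact_lty imm Hmu cK.
have KE : mu (K : set (borelType M)) = (fine (mu (K : set (borelType M))))%:E by rewrite fineK// ge0_fin_numE.
exists (1 + fine (mu (K : set (borelType M)))); first by [].
have n0 : (0 < n)%N by apply: leq_trans n2.
rewrite (_ : (fun p => _) = (fun p => (\1_K p : R)%:E)); last first.
 by apply/funext => p; rewrite indicE; case: (_ \in _); rewrite ?expr1n ?expr0n ?gtn_eqF.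
rewrite (@integral_indic _ (borelType M) R mu setT measurableT)// setIT KE.
via (1 + fine (mu (K : set (borelType M)))); first by lra.
by apply: ler_eXnr => //; rewrite lerDl.
Qed.

Definition L2on (K : set M) (f : M -> R) : R := \int[mu]_p (\1_K p * f p ^+ 2).

Lemma L2_indic (K : set M) (f : M -> R) : compact K -> L2 mu (f : borelType M -> R) ->
 L1 mu (fun p : borelType M => \1_K p * f p ^+ 2).
Proof.
move=> cK sf; have mi := measurable_indic_compact imm Hmu cK.
have := L2_int (L2_mul (B := 1) sf mi (fun p => ltac:(rewrite indicE; case: (_ \in _); rewrite ?normr1 ?normr0//))).
apply: eq_integrable => // p _; rewrite /= exprMn indicE; case: (_ \in _); by rewrite ?expr1n ?expr0n.
Qed.

Lemma integrable_indic_dotv (K : set M) (V : M -> 'rV[R]_n.+1) : compact K -> L2_field mu (V : borelType M -> _) ->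
 L1 mu (fun p : borelType M => \1_K p * dotv (V p) (V p)).
Proof.
move=> cK sV; have mi := measurable_indic_compact imm Hmu cK.
have sKV : L2_field mu (fun p : borelType M => (\1_K p : R) *: V p).
{ move=> j; rewrite (_ : (fun p => _) = (fun p : borelType M => \1_K p * V p 0 j)); last by apply/funext => p; rewrite mxE.
 apply: (L2_mul (B := 1) (sV j) mi) => p; rewrite indicE; case: (_ \in _); by rewrite ?normr1 ?normr0. }
have := integrable_dotv sKV sKV; apply: eq_integrable => // p _ /=.
rewrite dotvZl dotvZr indicE; case: (_ \in _); by rewrite ?mul1r ?mul0r.
Qed.

(** K is chosen so that |A| has small L^n norm off K. In the energy identity the potential off K is
    then absorbed through the weighted Sobolev inequality, the potential on K is bounded by its
    maximum, and the cutoff contributes order 1/r^2. Only F depends on the solution. *)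
Lemma jacobi_cut_energy : exists (K : set M) (L : R), [/\ compact K, 0 < L &
 forall f G, W12_grad S iota mu f G -> weak_jacobi S iota mu f G ->
 exists2 F : R, 0 <= F & forall r, 0 < r -> exists eta : M -> R,
 [/\ smooth_fun S eta, compactly_supported setT eta,
  forall p, rho p < r ^+ 2 -> eta p = 1 /\ grad eta p = 0 &
  \int[mu]_p dotv (cutgrad S iota f G eta p) (cutgrad S iota f G eta p) <= L * L2on K f + F / r ^+ 2]].
Proof.
have [C C0 Sob] := weighted_sobolev imm Hmu minimal n2.
(* Small enough that the constant 4 C kap^2 of [cut_sobolev] is at most 1/2. *)
pose kap := (8 * C + 1)^-1.
have D0 : 0 < 8 * C + 1 by lra.
have kap0 : 0 < kap by rewrite invr_gt0.
have kap1 : 4 * C * kap ^+ 2 <= 2^-1.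
{ have h : kap * (8 * C + 1) = 1 by rewrite mulVf// gt_eqF.
 have h2 : kap <= 1 by rewrite invf_le1//; lra.
 have h3 : kap * (C * kap) <= C * kap by apply: ler_piMl => //; rewrite mulr_ge0// ltW.
 lra. }
have [m Hm] := curvature_tail (exprn_gt0 n kap0).
pose K := extrinsic_ball m.+1%:R.
have cK : compact K by exact: compact_extrinsic_ball.
have [B B0 HB] := @compact_ubound R M K _ cK (fun p _ => A2_continuous imm (x := p)).
have [C1 C10 HC1] := cutoff_exists.
exists K, (2 * B); split => //; first exact: mulr_gt0.
move=> f G W J; have [sf _ _] := W.
exists (2 * (C1 * \int[mu]_p (f p ^+ 2))).
 by rewrite mulr_ge0// mulr_ge0 ?(ltW C10)//; apply: Rintegral_ge0 => p _; exact: sqr_ge0.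
move=> r r0; have [eta [se ce e01 e1 ge]] := HC1 r r0.
exists eta; split => //.
pose q p : R := \1_(~` K) p * Num.sqrt (A2 S iota p).
have mK : measurable (K : set (borelType M)) by exact: measurable_extrinsic_ball.
have mq : measurable_fun setT (q : borelType M -> R).
{ apply: measurable_funM; last exact: measurable_continuous sqrt_A2_continuous.
 by apply: (@measurable_indic _ (borelType M) R setT); apply: measurableC. }
have q0 p : 0 <= q p by rewrite mulr_ge0.
have qB K' : compact K' -> exists B', forall p, K' p -> q p <= B'.
{ move=> cK'; have [B' _ HB'] := @compact_ubound R M K' _ cK' (fun p _ => sqrt_A2_continuous (x := p)).
 exists B' => p Kp; apply: le_trans (HB' p Kp); apply: le_trans (ler_norm _).
 by rewrite /q indicE; case: (_ \in _); rewrite ?mul1r ?mul0r. }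
have H := cut_sobolev imm Hmu W Sob C0 mq q0 kap0 Hm qB se ce.
have E := cut_energy imm Hmu W J se ce.
set X := \int[mu]_p dotv _ _ in H E *.
have X0 : 0 <= X by apply: Rintegral_ge0 => p _; exact: dotv_ge0.
have sef := cut_L2 W se ce; have [mef _] := sef.
have iq : L1 mu (fun p : borelType M => q p ^+ 2 * (eta p * f p) ^+ 2).
{ apply/integrableP; split.
  by apply/measurable_EFinP; apply: measurable_funM; exact: measurable_funX.
 apply: le_lt_trans (ltry (4 * C * kap ^+ 2 * X)); apply: le_trans H; apply: le_of_eq.
 by apply: eq_integral => p _; rewrite /= ger0_norm// mulr_ge0 ?sqr_ge0. }
have H' : \int[mu]_p (q p ^+ 2 * (eta p * f p) ^+ 2) <= 2^-1 * X.
{ rewrite -lee_fin -EFin_Rintegral//; apply: le_trans H _.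
 by rewrite lee_fin ler_wpM2r. }
have iK := L2_indic cK sf; have iBK := L1Z B iK.
have [KE [cKE _] KE0] := ce.
have sAf : L1 mu (fun p : borelType M => A2 S iota p * (eta p * f p) ^+ 2).
{ have [B' B'0 HB'] := @compact_ubound R M KE _ cKE (fun p _ => A2_continuous imm (x := p)).
 have sA : L2 mu (fun p : borelType M => A2 S iota p * (eta p * f p)).
 { apply: (L2_bounded (B := B') sef).
   by apply: measurable_funM => //; exact: measurable_continuous (A2_continuous imm).
  move=> p; have [Kp|nK] := pselect (KE p); last by rewrite KE0// mul0r mulr0 normr0 mulr0.
  by rewrite normrM ler_wpM2r ?HB'. }
 have := L2_prod sA sef; apply: eq_integrable => // p _ /=; congr EFin; ring. }
have H1 : \int[mu]_p (A2 S iota p * (eta p * f p) ^+ 2) <= 2^-1 * X + B * L2on K f.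
{ via (\int[mu]_p (q p ^+ 2 * (eta p * f p) ^+ 2 + B * (\1_K p * f p ^+ 2))); last first.
  by rewrite RintegralD// lerD// RintegralZl.
 apply: le_Rintegral_L1 => //; first exact: L1D.
 move=> p; have u0 : 0 <= (eta p * f p) ^+ 2 by exact: sqr_ge0.
 have [Kp|nK] := pselect (K p).
  have -> : q p = 0 by rewrite /q indicE memNset ?mul0r.
  rewrite expr0n mul0r add0r indicE mem_set// mul1r.
  via (B * (eta p * f p) ^+ 2).
   by rewrite ler_wpM2r//; apply: le_trans (ler_norm _) (HB p Kp).
  rewrite ler_pM2l// exprMn; apply: ler_piMl; first exact: sqr_ge0.
  have /andP[? ?] := e01 p; by apply: exprn_ile1.
 have -> : q p = Num.sqrt (A2 S iota p) by rewrite /q indicE mem_set ?mul1r.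
 rewrite [\1_K p]indicE memNset// mul0r mulr0 addr0; apply: ler_wpM2r => //.
 (* For a negative value the real square root is 0 by convention, and the inequality holds
    trivially; so the sign of [A2] is not an issue here. *)
 have [A0|/ltW A0] := leP 0 (A2 S iota p); first by rewrite sqr_sqrtr.
 by apply: le_trans A0 _. }
have i2 := L2_int sf.
have ifg : L1 mu (fun p : borelType M => f p ^+ 2 * dotv (grad eta p) (grad eta p)).
{ have sfg := scaled_grad_L2 imm W se ce.
 have := integrable_dotv sfg sfg; apply: eq_integrable => // p _ /=.
 by rewrite dotvZl dotvZr mulrA. }
have H2 : \int[mu]_p (f p ^+ 2 * dotv (grad eta p) (grad eta p)) <= C1 / r ^+ 2 * \int[mu]_p (f p ^+ 2).
{ have j2 := L1Z (C1 / r ^+ 2) i2; rewrite -RintegralZl//; apply: le_Rintegral_L1 => //.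
 by move=> p; rewrite mulrC ler_wpM2r ?sqr_ge0. }
have -> : 2 * (C1 * \int[mu]_p (f p ^+ 2)) / r ^+ 2 = 2 * (C1 / r ^+ 2 * \int[mu]_p (f p ^+ 2)) by ring.
exact: absorb_arith E H1 H2.
Qed.

(** As r grows, the cutoff equals 1 on K' and the F-term disappears, which bounds the gradient on
    K'. The L^2 norm on K' follows from the Sobolev inequality with the indicator of K' as
    weight. *)
Lemma jacobi_local_bound : exists2 K : set M, compact K & forall K' : set M, compact K' ->
 exists2 L : R, 0 < L & forall f G, W12_grad S iota mu f G -> weak_jacobi S iota mu f G ->
 \int[mu]_p (\1_K' p * dotv (G p) (G p)) <= L * L2on K f /\ L2on K' f <= L * L2on K f.
Proof.
have [K [L [cK L0 HK]]] := jacobi_cut_energy.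
have [C C0 Sob] := weighted_sobolev imm Hmu minimal n2.
exists K => // K' cK'; have [kap kap0 Hkap] := indic_kappa cK'.
pose k := 4 * C * kap ^+ 2; have k0 : 0 < k by rewrite mulr_gt0 ?mulr_gt0// exprn_gt0.
exists (L + k * L); first by rewrite addr_gt0// mulr_gt0.
move=> f G W J; have [sf sG _] := W; have [F F0 HF] := HK f G W J.
have f0 : 0 <= L2on K f by apply: Rintegral_ge0 => p _; rewrite mulr_ge0 ?sqr_ge0// indicE.
have LK0 : 0 <= L * L2on K f by rewrite mulr_ge0// ltW.
have mi := measurable_indic_compact imm Hmu cK'.
have big e : 0 < e -> exists r : R, [/\ 0 < r, F / r ^+ 2 <= e & forall p, K' p -> rho p < r ^+ 2].
{ move=> e0; have [m Hm] := compact_sub_extrinsic_ball cK'.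
 pose r0 := n.+2%:R * m.+1%:R : R; have r00 : 0 < r0 by rewrite mulr_gt0.
 have e10 : 0 <= F / e by rewrite divr_ge0// ltW.
 (* r >= 1 gives r <= r^2, so F/e <= r makes F/r^2 at most e; r >= r0 puts K' where the cutoff is
    1. *)
 pose r := r0 + F / e + 1; have r1 : 1 <= r by rewrite /r lerDr addr_ge0// ltW.
 have r2 : r <= r ^+ 2 by rewrite expr2 ler_peMl// (le_trans ler01).
 exists r; split; first exact: lt_le_trans r1.
  rewrite ler_pdivrMr; last by apply: lt_le_trans r2; exact: lt_le_trans r1.
  have : F / e <= r by rewrite /r; lra.
  by rewrite ler_pdivrMr// => h; apply: le_trans h _; rewrite mulrC ler_pM2l.
 move=> p Kp; apply: lt_le_trans (extrinsic_ball_sqdist _ (Hm m (leqnn m) p Kp)) _ => //.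
 apply: lerXn2r; rewrite ?nnegrE ?(ltW r00)//; first exact: le_trans r1.
 by rewrite -/r0 /r; lra. }
split.
- via (L * L2on K f); last by rewrite mulrDl lerDl mulr_ge0// ltW// mulr_gt0.
 apply/ler_addgt0Pr => e e0; have [r [r0 rF rK]] := big e e0.
 have [eta [se ce e1 He]] := HF r r0.
 via (L * L2on K f + F / r ^+ 2); last by rewrite lerD2l.
 apply: le_trans He; have sV := cutgrad_field imm W se ce.
 have iKG := integrable_indic_dotv cK' sG.
 apply: le_Rintegral_L1 => //; first exact: integrable_dotv.
 move=> p; rewrite indicE; case: (boolP (p \in K')) => [|_]; last by rewrite mul0r dotv_ge0.
 rewrite inE => Kp; have [e1p g0p] := e1 p (rK p Kp).
 by rewrite mul1r /cutgrad e1p g0p scale1r scaler0 addr0.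
- via (k * L * L2on K f); last by rewrite mulrDl lerDr.
 have i0 p : 0 <= (\1_K' p : R) by [].
 apply/ler_addgt0Pr => e e0.
 have ek0 : 0 < e / k by rewrite divr_gt0.
 have [r [r0 rF rK]] := big _ ek0; have [eta [se ce e1 He]] := HF r r0.
 have qB K'' : compact K'' -> exists B, forall p, K'' p -> (\1_K' p : R) <= B.
  by exists 1 => p _.
 have H := cut_sobolev imm Hmu W Sob C0 mi i0 kap0 Hkap qB se ce.
 have i2 := L2_indic cK' sf.
 rewrite -lee_fin -EFin_Rintegral//.
 rewrite (_ : (fun p => _) = (fun p => ((\1_K' p : R) ^+ 2 * (eta p * f p) ^+ 2)%:E)); last first.
  apply/funext => p; rewrite indicE; case: (boolP (p \in K')) => [|_]; last by rewrite expr0n !mul0r.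
  by rewrite inE => Kp; have [-> _] := e1 p (rK p Kp); rewrite mul1r expr1n.
 apply: le_trans H _.
 via (k * (L * L2on K f + F / r ^+ 2)); first by rewrite ler_pM2l.
 rewrite mulrDr mulrA lerD2l; move: rF; by rewrite ler_pdivlMr// mulrC.
Qed.

(** The manifold is exhausted by countably many compact extrinsic balls, so the exceptional null
    sets can be united. *)
Lemma ae_zero_of_L2on (f : M -> R) : L2 mu (f : borelType M -> R) ->
 (forall K, compact K -> L2on K f = 0) -> \forall p \ae mu, f p = 0.
Proof.
move=> sf Z.
 have aeK m : \forall p \ae mu, ((\1_(extrinsic_ball m.+1%:R) p * f p ^+ 2)%:E = 0)%E.
 { have cK' : compact (extrinsic_ball m.+1%:R) by exact: compact_extrinsic_ball.
  have i2 := L2_indic cK' sf.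
  have mf := measurable_int _ i2.
  have [H _] := ae_eq_integral_abs mu measurableT mf.
  have : ae_eq mu setT (EFin \o (fun p : borelType M => \1_(extrinsic_ball m.+1%:R) p * f p ^+ 2)) (cst 0%E).
  { apply: H; have := EFin_Rintegral i2; rewrite -[X in _ = X%:E]/(L2on _ f) Z// => I0.
   rewrite -[RHS]/((0 : R)%:E) -I0; apply: eq_integral => p _; rewrite /= ger0_norm// mulr_ge0 ?sqr_ge0//. }
  by apply: (@filterS _ _ (ae_filter_ringOfSetsType mu)) => p /(_ I). }
 have : \forall p \ae mu, forall m, ((\1_(extrinsic_ball m.+1%:R) p * f p ^+ 2)%:E = 0)%E by apply: ae_foralln.
 apply: (@filterS _ _ (ae_filter_ringOfSetsType mu)) => p H; have [k Hk] := compact_sub_extrinsic_ball (@compact_set1 M p).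
 have := H k; rewrite indicE mem_set ?mul1r; last by apply: (Hk k).
 by move=> [] /eqP; rewrite sqrf_eq0 => /eqP.
Qed.

End Cutoffs.

(** * Finitely many tests control the local norm *)

Lemma le_of_le_add_sqr {R : rcfType} (x y C : R) : 0 <= C -> (forall e, 0 < e -> x <= y + e ^+ 2 * C) -> x <= y.
Proof.
move=> C0 H; apply/ler_addgt0Pr => d d0; have C1 : 0 < C + 1 by lra.
apply: le_trans (H (Num.sqrt (d / (C + 1))) _) _; first by rewrite sqrtr_gt0 divr_gt0.
rewrite sqr_sqrtr ?divr_ge0 ?(ltW d0) ?(ltW C1)// lerD2l -mulrA ler_piMr ?(ltW d0)// mulrC ler_pdivrMr//; lra.
Qed.

(** * Translation estimates and the rate of mollification *)

Section Translation.
Context {R : realType} {n : nat}.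
Local Notation Rm := (measurableTypeR R).
Implicit Types (u v : 'rV[R]_n -> R^o).

Definition ball_supp (rho : R) u := continuous u /\ forall x, rho < `|x| -> u x = 0.

Lemma ball_supp_integrable rho u : 0 < rho -> ball_supp rho u ->
 L1 (leb n) (fun t => u (rv t)).
Proof.
move=> r0 [cu u0]; apply: (compact_supp_integrable cu (compact_closed_ball r0)) => x /negP.
by rewrite -ltNge; exact: u0.
Qed.

Lemma ball_supp_measurable rho u : ball_supp rho u ->
 measurable_fun setT (fun t : n.-tuple Rm => u (rv t)).
Proof. by move=> [cu _]; exact: (measurable_comp_rv cu). Qed.

Lemma ball_supp_shift rho u (z : 'rV[R]_n) : ball_supp rho u -> ball_supp (rho + `|z|) (fun x => u (x + z)).
Proof.
move=> [cu u0]; split; first by move=> x; apply: (@continuous_comp _ _ _ (fun y : 'rV[R]_n => y + z) u); [exact: continuous_addr|exact: cu].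
move=> x h; apply: u0; have := ler_normB (x + z) z; rewrite addrK; lra.
Qed.

Lemma ball_supp_le rho rho' u : rho <= rho' -> ball_supp rho u -> ball_supp rho' u.
Proof. by move=> h [cu u0]; split => // x hx; apply: u0; exact: le_lt_trans hx. Qed.

Lemma ball_suppB rho u v : ball_supp rho u -> ball_supp rho v ->
 ball_supp rho (fun x => u x - v x).
Proof.
move=> [cu u0] [cv v0]; split; last by move=> x h; rewrite u0// v0// subrr.
by move=> x; exact: (@continuousB _ _ _ u v x (cu x) (cv x)).
Qed.

Lemma ball_suppM rho u v : ball_supp rho u -> continuous v ->
 ball_supp rho (fun x => u x * v x).
Proof.
move=> [cu u0] cv; split; last by move=> x h; rewrite u0// mul0r.
by move=> x; exact: (@continuousM _ _ u v x (cu x) (cv x)).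
Qed.

Lemma translate_int rho u (y z : 'rV[R]_n) : 0 < rho -> ball_supp rho u ->
 \int[leb n]_t ((u (rv t + y + z) - u (rv t + y)) ^+ 2) = \int[leb n]_t ((u (rv t + z) - u (rv t)) ^+ 2).
Proof.
move=> r0 su; have sz := ball_supp_shift z su.
have su' : ball_supp (rho + `|z|) u by apply: ball_supp_le su; rewrite lerDl.
have sd := ball_suppB sz su'.
have s2 : ball_supp (rho + `|z|) (fun x => (u (x + z) - u x) * (u (x + z) - u x)).
 by apply: ball_suppM => //; exact: sd.1.
have := Rintegral_leb_shift y (ball_supp_measurable s2).
by [].
Qed.

Lemma shift_diff_integrable rho u y z : 0 < rho -> ball_supp rho u ->
 L1 (leb n) (fun t => (u (rv t + y + z) - u (rv t + y)) ^+ 2).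
Proof.
move=> r0 su; pose r' := rho + `|y| + `|z|.
have r1 : 0 < r' by rewrite /r' -addrA ltr_pwDl//.
have s1 : ball_supp r' (fun x => u (x + y + z)).
{ apply: (ball_supp_le (rho := rho + `|y + z|)); first by rewrite /r' -addrA lerD2l ler_normD.
 have := ball_supp_shift (y + z) su; congr ball_supp; apply/funext => x; by rewrite addrA. }
have s2 : ball_supp r' (fun x => u (x + y)).
{ apply: (ball_supp_le (rho := rho + `|y|)); first by rewrite lerDl.
 exact: ball_supp_shift. }
have sd := ball_suppB s1 s2.
exact: (ball_supp_integrable r1 (ball_suppM sd sd.1)).
Qed.

Lemma shift_diff_integrable0 rho u z : 0 < rho -> ball_supp rho u ->
 L1 (leb n) (fun t => (u (rv t + z) - u (rv t)) ^+ 2).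
Proof. by move=> r0 su; have := shift_diff_integrable 0 z r0 su; apply: eq_integrable => // t _; rewrite /= addr0. Qed.

(** A translation is split into m successive ones; the square of a sum of m terms costs the factor
    m, and each step may be moved to the origin by invariance of the integral. *)
Lemma translate_telescope rho u (m : nat) (y : nat -> 'rV[R]_n) (b : 'I_m -> R) : 0 < rho -> ball_supp rho u ->
 y 0%N = 0 -> (forall i : 'I_m, \int[leb n]_t ((u (rv t + (y i.+1 - y i)) - u (rv t)) ^+ 2) <= b i) ->
 \int[leb n]_t ((u (rv t + y m) - u (rv t)) ^+ 2) <= m%:R * \sum_i b i.
Proof.
move=> r0 su y0 H.
pose a (i : 'I_m) (t : n.-tuple Rm) := u (rv t + y i + (y i.+1 - y i)) - u (rv t + y i).
have ia i : L1 (leb n) (fun t => a i t ^+ 2) by exact: shift_diff_integrable r0 su.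
have E t : u (rv t + y m) - u (rv t) = \sum_i a i t.
{ rewrite -(big_mkord xpredT (fun i => u (rv t + y i + (y i.+1 - y i)) - u (rv t + y i))).
 rewrite (eq_bigr (fun i => u (rv t + y i.+1) - u (rv t + y i))).
  by rewrite telescope_sumr// y0 addr0.
 by move=> i _; rewrite -addrA [y i + _]addrC subrK. }
have ims := L1Z m%:R (L1_sum (index_enum 'I_m) ia).
via (\int[leb n]_t (m%:R * \sum_i a i t ^+ 2)).
 apply: le_Rintegral_L1 => [|//|t]; [exact: shift_diff_integrable0 r0 su|rewrite E; exact: sqr_sum_le].
rewrite RintegralZl//; last exact: L1_sum.
by rewrite ler_wpM2l// Rintegral_sum//; apply: ler_sum => i _; rewrite (translate_int _ _ r0 su).
Qed.

(** Over a small step the difference quotient is uniformly close to the partial derivative.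
    Telescoping m steps of size s = h/m yields the factor m^2 s^2 = h^2, and the closeness e is
    arbitrary. *)
Lemma translate_coord rho v i (h : R) : 0 < rho -> Ck 1 setT v -> ball_supp rho v ->
 \int[leb n]_t ((v (rv t + h *: 'e_i) - v (rv t)) ^+ 2) <= 2 * h ^+ 2 * \int[leb n]_t (partial i v (rv t) ^+ 2).
Proof.
move=> r0 Cv sv; have [cv v0] := sv.
pose B := [set x : 'rV[R]_n | `|x| <= rho + 1].
have r1 : 0 < rho + 1 by lra.
have cB : compact B by exact: compact_closed_ball.
have [mB Boo] := leb_compact cB.
have vB x : ~ B x -> v x = 0 by move=> /negP; rewrite -ltNge => h'; apply: v0; lra.
have clB0 : closed [set x : 'rV[R]_n | `|x| <= rho].
 by apply: compact_closed; [exact: norm_hausdorff|exact: compact_closed_ball].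
have p0 (x : 'rV[R]_n) : rho < `|x| -> partial i v x = 0.
{ move=> hx; apply: (@partial_support R n v [set x | `|x| <= rho] i clB0) => [z /negP|]; first by rewrite -ltNge; exact: v0.
 by apply/negP; rewrite -ltNge. }
have sp : ball_supp rho (partial i v).
 by split => // x; exact: (Ck_continuous (CkS i Cv)).
have ip2 : L1 (leb n) (fun t => partial i v (rv t) ^+ 2).
 exact: (ball_supp_integrable r0 (ball_suppM sp sp.1)).
pose V := \int[leb n]_t (\1_(rv @^-1` B) t : R).
have iB := indic_compact_integrable cB.
have V0 : 0 <= V by apply: Rintegral_ge0 => t _; rewrite indicE.
pose P := \int[leb n]_t (partial i v (rv t) ^+ 2); rewrite -/P.
apply: (@le_of_le_add_sqr _ _ _ (2 * h ^+ 2 * V)) => [|e e0]; first by rewrite mulr_ge0// mulr_ge0 ?sqr_ge0.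
rewrite [e ^+ 2 * _]mulrCA.
have [d1 d10 Hd] := uniform_derivative i Cv cB vB e0.
(* |s| < d1 allows the uniform difference quotient, and |s| < 1 keeps the shifted support inside
   [B]. *)
have [m [s [m0 sm sd]]] : exists (m : nat) (s : R), [/\ (0 : R) < m%:R, s * m%:R = h & `|s| < Num.min 1 d1].
{ have mn : 0 < Num.min 1 d1 by rewrite lt_min ltr01.
 have m0 : (0 : R) < (Num.trunc (`|h| / Num.min 1 d1)).+1%:R by [].
 exists (Num.trunc (`|h| / Num.min 1 d1)).+1, (h / (Num.trunc (`|h| / Num.min 1 d1)).+1%:R).
 split => //; first by rewrite divfK// gt_eqF.
 by rewrite normrM normfV [`|_.+1%:R|]ger0_norm// ltr_pdivrMr// mulrC -ltr_pdivrMr//; exact: truncnS_gt. }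
have one : \int[leb n]_t ((v (rv t + s *: 'e_i) - v (rv t)) ^+ 2) <= 2 * s ^+ 2 * P + 2 * s ^+ 2 * (e ^+ 2 * V).
{ have i1 := L1Z (2 * s ^+ 2) ip2; have i2 := L1Z (2 * s ^+ 2 * e ^+ 2) iB.
 have -> : 2 * s ^+ 2 * (e ^+ 2 * V) = 2 * s ^+ 2 * e ^+ 2 * V by rewrite mulrA.
 rewrite /P /V -!RintegralZl// -RintegralD//; apply: le_Rintegral_L1.
 - exact: shift_diff_integrable0 r0 sv.
 - exact: L1D.
 - move=> t; move: sd; rewrite lt_min => /andP[s1 s2].
  have := Hd s (rv t) s2; have [Bt|nB] := pselect (B (rv t)); last first.
   have h1 : rho + 1 < `|rv t| by rewrite ltNge; apply/negP.
   have z1 : v (rv t) = 0 by apply: v0; lra.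
   have z2 : v (rv t + s *: 'e_i) = 0.
   { apply: v0; have nd : `|s *: 'e_i : 'rV[R]_n| <= `|s|.
     apply: norm_coord_le => // j; rewrite !mxE normrM /=; apply: ler_piMr => //.
     by case: (_ == _); rewrite ?normr1 ?normr0.
    have := ler_normB (rv t + s *: 'e_i) (s *: 'e_i); rewrite addrK; lra. }
   move=> _; rewrite z1 z2 subrr expr0n indicE memNset// mulr0 addr0; apply: mulr_ge0; last exact: sqr_ge0.
   by apply: mulr_ge0 => //; exact: sqr_ge0.
  rewrite indicE mem_set// mulr1 => h1.
  have h2 := sqrD_le (v (rv t + s *: 'e_i) - v (rv t) - s * partial i v (rv t)) (s * partial i v (rv t)).
  rewrite subrK in h2; apply: le_trans h2 _; rewrite addrC exprMn mulrA lerD2l -mulrA ler_pM2l// -exprMn.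
  rewrite -[leRHS]real_normK ?num_real//; apply: sqr_le_sqr.
  by rewrite normrM [`|e|]gtr0_norm. }
have := @translate_telescope rho v m (fun k => (k%:R * s) *: 'e_i) (fun=> 2 * s ^+ 2 * P + 2 * s ^+ 2 * (e ^+ 2 * V)) r0 sv.
rewrite [m%:R * s]mulrC sm => T; apply: le_trans (T _ _) _; first by rewrite mul0r scale0r.
 move=> k; rewrite -scalerBl (_ : k.+1%:R * s - k%:R * s = s)//; ring.
rewrite sumr_const card_ord -[X in _ * X <= _]mulr_natl.
have h2 : h ^+ 2 = s ^+ 2 * m%:R ^+ 2 by rewrite -exprMn sm.
have -> : m%:R * (m%:R * (2 * s ^+ 2 * P + 2 * s ^+ 2 * (e ^+ 2 * V))) = 2 * h ^+ 2 * P + 2 * h ^+ 2 * (e ^+ 2 * V).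
 have alg (c a b s' : R) : c * (c * (2 * s' * a + 2 * s' * b)) = 2 * (s' * c ^+ 2) * a + 2 * (s' * c ^+ 2) * b by ring.
 by rewrite h2.
by [].
Qed.

Lemma translate_L2 rho v (z : 'rV[R]_n) : 0 < rho -> Ck 1 setT v -> ball_supp rho v ->
 \int[leb n]_t ((v (rv t + z) - v (rv t)) ^+ 2) <=
 2 * n%:R * `|z| ^+ 2 * \sum_i \int[leb n]_t (partial i v (rv t) ^+ 2).
Proof.
move=> r0 Cv sv.
have := @translate_telescope rho v n (fun k => lead k z)
 (fun i => 2 * `|z| ^+ 2 * \int[leb n]_t (partial i v (rv t) ^+ 2)) r0 sv.
have -> : lead n z = z by apply/rowP => j; rewrite mxE ltn_ord.
move=> T; apply: le_trans (T _ _) _.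
- by apply/rowP => j; rewrite !mxE.
- move=> i; rewrite (@lead_succ _ _ i z i erefl) addrC addKr.
 apply: le_trans (translate_coord i _ r0 Cv sv) _; apply: ler_wpM2r; first by apply: Rintegral_ge0 => t _; exact: sqr_ge0.
 rewrite ler_pM2l//; apply: sqr_le_sqr; exact: coord_le_norm.
- by rewrite -mulr_sumr; apply: le_of_eq; ring.
Qed.

(** By Jensen the squared error at x is at most the average of (v(x + z) - v(x))^2 against eta(z);
    after Tonelli the inner integral is a translation estimate with |z| < r. *)
Lemma conv_rate_smooth rho v r eta : 0 < rho -> Ck 1 setT v -> ball_supp rho v -> mollifier r eta ->
 (\int[leb n]_x ((conv (fun t => v (rv t)) eta (rv x) - v (rv x)) ^+ 2)%:E <=
  (2 * n%:R * r ^+ 2 * \sum_i \int[leb n]_t (partial i v (rv t) ^+ 2))%:E)%E.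
Proof.
move=> r0 Cv sv me; have [k0 e0 es ev e1] := me; have [cv v0] := sv.
have iv := ball_supp_integrable r0 sv.
have s2 : ball_supp rho (fun x => v x * v x) by exact: ball_suppM.
have iv2 := ball_supp_integrable r0 s2.
have mv := ball_supp_measurable sv.
have ce := kernel_continuous k0.
have me' : measurable_fun setT (fun t : n.-tuple Rm => eta (rv t)).
 exact: (measurable_comp_rv ce).
have mc := conv_measurable iv k0.
set Q := \sum_i _.
pose f (z : n.-tuple Rm * n.-tuple Rm) := ((v (rv z.1 + rv z.2) - v (rv z.1)) ^+ 2 * eta (rv z.2))%:E.
have mf : measurable_fun setT f.
{ apply/measurable_EFinP; apply: measurable_funM; last exact: (measurableT_comp me' measurable_snd).
 apply: measurable_funX; apply: measurable_funB; last exact: (measurableT_comp mv measurable_fst).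
 rewrite (_ : (fun z => _) = (fun t : n.-tuple Rm => v (rv t)) \o
   (fun z : n.-tuple Rm * n.-tuple Rm => [tuple (tnth z.1 i + tnth z.2 i : Rm) | i < n])); last first.
  by apply/funext => z /=; congr (v _); apply/rowP => i; rewrite !mxE tnth_mktuple.
 apply: (measurableT_comp mv); apply/measurable_fun_tnthP => i.
 rewrite (_ : _ \o _ = (fun z : n.-tuple Rm * n.-tuple Rm => tnth z.1 i + tnth z.2 i : Rm)); last first.
  by apply/funext => z /=; rewrite tnth_mktuple.
 apply: measurable_funD.
  exact: (measurableT_comp (measurable_tnth i) measurable_fst).
 exact: (measurableT_comp (measurable_tnth i) measurable_snd). }
have f0 z : (0 <= f z)%E by rewrite lee_fin mulr_ge0 ?sqr_ge0.
via (\int[leb n]_x \int[leb n]_t f (x, t))%E.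
 apply: ge0_le_integral => //.
 - by move=> x _; rewrite lee_fin sqr_ge0.
 - by apply/measurable_EFinP; apply: measurable_funX; exact: measurable_funB.
 - exact: measurable_fun_fubini_tonelli_F.
 - move=> x _; have [ie ee] := mollifier_shift_integral (rv x) me.
  have i1 := kernel_integrable (rv x) iv k0; have i2 := kernel_integrable (rv x) iv2 k0.
  (* The integrand (v(y) - v(x))^2 eta(y - x), expanded so that its integral is expressed by
     convolutions. *)
  pose F (y : 'rV[R]_n) : R := v y * v y * eta (y - rv x) + (- (2 * v (rv x))) * (v y * eta (y - rv x)) + v (rv x) ^+ 2 * eta (y - rv x).
  have j2 := L1Z (- (2 * v (rv x))) i1; have j3 := L1Z (v (rv x) ^+ 2) ie.
  have iF : L1 (leb n) (fun t => F (rv t)).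
   by apply: L1D => //; exact: L1D.
  have FE : \int[leb n]_t F (rv t) = conv (fun t => v (rv t) * v (rv t)) eta (rv x) - 2 * v (rv x) * conv (fun t => v (rv t)) eta (rv x) + v (rv x) ^+ 2.
  { rewrite /F RintegralD//; last by exact: L1D.
   rewrite RintegralD// RintegralZl// RintegralZl// ee /conv; ring. }
  have mF : measurable_fun setT (fun t : n.-tuple Rm => F (rv t)) by apply/measurable_EFinP; exact: measurable_int iF.
  have sh := Rintegral_leb_shift (rv x) mF.
  have F0 y : 0 <= F y.
  { have -> : F y = (v y - v (rv x)) ^+ 2 * eta (y - rv x) by rewrite /F; ring.
   by rewrite mulr_ge0 ?sqr_ge0. }
  have -> : (\int[leb n]_t f (x, t) = (\int[leb n]_t F (rv t + rv x))%:E)%E.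
  { rewrite sh -EFin_Rintegral//.
   rewrite -(ge0_integral_leb_shift (f := fun t => (F (rv t))%:E) (rv x)); [|exact/measurable_EFinP|by move=> t; rewrite lee_fin].
   apply: eq_integral => t _; rewrite /f /= rv_shiftt; congr EFin; rewrite /F addrK [rv t + rv x]addrC; ring. }
  rewrite sh lee_fin FE.
  have cs := conv_sq_le (rv x) me iv (ltac:(apply: eq_integrable iv2 => // t _; rewrite /= expr2//)).
  have -> : conv (fun t => v (rv t) * v (rv t)) eta (rv x) = conv (fun t => v (rv t) ^+ 2) eta (rv x).
   by rewrite /conv; apply: eq_Rintegral => t _; rewrite expr2.
  rewrite sqrrB; move: cs; set c1 := conv _ _ _; set c2 := conv _ _ _; lra.
rewrite (@fubini_tonelli _ _ _ _ R (leb n) (leb n) f mf f0).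
have r2 : 0 <= r ^+ 2 by exact: sqr_ge0.
have Q0 : 0 <= Q by apply: sumr_ge0 => i _; apply: Rintegral_ge0 => t _; exact: sqr_ge0.
have c0 : 0 <= 2 * n%:R * r ^+ 2 * Q by apply: mulr_ge0 => //; apply: mulr_ge0 => //; exact: mulr_ge0.
via (\int[leb n]_z ((2 * n%:R * r ^+ 2 * Q) * eta (rv z))%:E)%E; last first.
 under eq_integral do rewrite EFinM.
 have ie : L1 (leb n) (fun t => eta (rv t)).
  have [ie _] := mollifier_shift_integral 0 me; by apply: eq_integrable ie => // t _; rewrite /= subr0.
 rewrite ge0_integralZl_EFin//; last 2 first.
 - by move=> z _; rewrite lee_fin.
 - exact/measurable_EFinP.
 by rewrite EFin_Rintegral// e1 mule1.
apply: ge0_le_integral => //.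
- by move=> z _; apply: integral_ge0.
- exact: measurable_fun_fubini_tonelli_G.
- by apply/measurable_EFinP; apply: measurable_funM.
- move=> z _; rewrite /f /=; under eq_integral do rewrite EFinM muleC.
 have iz := shift_diff_integrable0 (rv z) r0 sv.
 rewrite ge0_integralZl_EFin//; last 2 first.
 - by move=> t _; rewrite lee_fin sqr_ge0.
 - exact: measurable_int iz.
 rewrite EFin_Rintegral// lee_fin mulrC.
 have [zr|zr] := ltP `|rv z| r; last by rewrite es// !mulr0.
 apply: ler_wpM2r => //; apply: le_trans (translate_L2 _ r0 Cv sv) _.
 apply: ler_wpM2r => //; apply: ler_wpM2l => //.
 by apply: lerXn2r; rewrite ?nnegrE ?(ltW zr)// (le_trans _ (ltW zr)).
Qed.

End Translation.

(** * Finitely many point values control the L^2 norm *)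

Section FiniteRank.
Context {R : realType} {n : nat}.
Local Notation Rm := (measurableTypeR R).
Variable K1 : set 'rV[R]_n.
Hypothesis cK1 : compact K1.
Implicit Types (w : n.-tuple Rm -> R) (D : 'I_n -> n.-tuple Rm -> R).

Definition weak_pair w D := [/\ L2 (leb n) w, forall i, L2 (leb n) (D i),
 forall t, ~ K1 (rv t) -> w t = 0 /\ forall i, D i t = 0 &
 forall (psi : 'rV[R]_n -> R^o) i, smooth_on setT psi ->
  \int[leb n]_t (w t * partial i psi (rv t)) = - \int[leb n]_t (D i t * psi (rv t))].

(** The smooth rate is applied to a mollification v of w at a much finer scale, whose derivatives
    are bounded by those of w through contraction; the difference v - w costs an arbitrarily small
    amount. *)
Lemma conv_rate w D r eta (d : 'I_n -> R) : weak_pair w D -> mollifier r eta ->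
 (forall i, (\int[leb n]_t (D i t ^+ 2)%:E <= (d i)%:E)%E) ->
 (\int[leb n]_x ((conv w eta (rv x) - w x) ^+ 2)%:E <= (4 * n%:R * r ^+ 2 * \sum_i d i)%:E)%E.
Proof.
move=> [sw sD wK weak] me Dd; have [k0 _ _ _ _] := me.
have [rho rho0 Kr] := compact_bounded_rV cK1.
have far (t : n.-tuple Rm) : rho < `|rv t| -> ~ K1 (rv t) by move=> h /Kr; lra.
have [mw woo] := sw.
have [iw iw2] := L2_supported_L1 mw cK1 (fun t nK => (wK t nK).1) woo.
have iD i : L1 (leb n) (D i) /\ L1 (leb n) (fun t => D i t ^+ 2).
 have [mD Doo] := sD i; exact: L2_supported_L1 mD cK1 (fun t nK => (wK t nK).2 i) Doo.
apply/lee_addgt0Pr => e e0; have e8 : 0 < e / 8 by lra.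
have [s0 s00 Hs] := mollify_L2 mw rho0 (fun t h => (wK t (far t h)).1) woo e8.
pose s := Num.min s0 1 / 2.
have m0 : 0 < Num.min s0 1 by rewrite lt_min s00 ltr01.
have ss : s < Num.min s0 1 by rewrite ltr_pdivrMr// ltr_pMr ?ltr1n.
have [zeta mz] := @mollifier_exists R n s (ltac:(by rewrite divr_gt0)).
move: ss; rewrite lt_min => /andP[ss0 s1]; have [kz _ _ _ _] := mz.
have Hz := Hs s zeta ss0 mz.
pose v : 'rV[R]_n -> R^o := conv w zeta.
have sv : smooth_on setT v by exact: conv_smooth.
have r1 : 0 < rho + 1 by lra.
have bv : ball_supp (rho + 1) v.
{ split; first by exact: conv_continuous.
 move=> x hx; apply: (conv_support mz (ltW s1) _ hx) => t /far /wK[]//. }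
have iv := ball_supp_integrable r1 bv.
have mv := ball_supp_measurable bv.
have A := conv_rate_smooth r1 (sv 1%N) bv me.
have Pd i : \int[leb n]_t (partial i v (rv t) ^+ 2) <= d i.
{ have E t : partial i v (rv t) = conv (D i) zeta (rv t).
  by apply: partial_conv_weak => // psi sp; exact: weak.
 have pv : ball_supp (rho + 1) (partial i v).
 { split; first by move=> x; exact: (Ck_continuous (CkS i (sv 1%N))).
  move=> x hx; have -> : x = rv (vr x) by rewrite vrK.
  rewrite E; apply: (conv_support mz (ltW s1)) => [t /far /wK[_ ->]//|]; by rewrite vrK. }
 have ip := ball_supp_integrable r1 (ball_suppM pv pv.1).
 rewrite -lee_fin -EFin_Rintegral//; apply: le_trans (Dd i).
 apply: le_trans (conv_contraction mz (sD i).1 (iD i).1 (iD i).2).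
 by under eq_integral do rewrite E. }
have A' : (\int[leb n]_x ((conv (fun t => v (rv t)) eta (rv x) - v (rv x)) ^+ 2)%:E <= (2 * n%:R * r ^+ 2 * \sum_i d i)%:E)%E.
{ apply: le_trans A _; apply: ler_wpM2l; last by apply: ler_sum => i _.
 by apply: mulr_ge0; rewrite ?sqr_ge0//. }
have mwv : measurable_fun setT (fun t => v (rv t) - w t) by exact: measurable_funB.
have vwK t : ~ [set x : 'rV[R]_n | `|x| <= rho + 1] (rv t) -> v (rv t) - w t = 0.
{ move=> /negP; rewrite -ltNge => h; rewrite bv.2// (wK _ _).1 ?subrr//; apply: far; lra. }
have [i1 i2] := L2_supported_L1 mwv (compact_closed_ball r1) vwK (le_lt_trans Hz (ltry _)).
have Hc := le_trans (conv_contraction me mwv i1 i2) Hz.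
have mc := conv_measurable i1 k0; have mcv := conv_measurable iv k0.
have Hc' : (\int[leb n]_x ((- conv (fun t => v (rv t) - w t) eta (rv x)) ^+ 2)%:E <= (e / 8)%:E)%E.
 by under eq_integral do rewrite sqrrN.
have mnc : measurable_fun setT (fun x : n.-tuple Rm => - conv (fun t => v (rv t) - w t) eta (rv x)) by exact: measurableT_comp.
have S1 := integral_sqrD_le measurableT mwv mnc Hz Hc'.
have m1 : measurable_fun setT (fun x : n.-tuple Rm => conv (fun t => v (rv t)) eta (rv x) - v (rv x)) by exact: measurable_funB.
have m2 : measurable_fun setT (fun x : n.-tuple Rm => (v (rv x) - w x) + - conv (fun t => v (rv t) - w t) eta (rv x)).
 by apply: measurable_funD => //.
have S2 := integral_sqrD_le measurableT m1 m2 A' S1.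
via (2 * (2 * n%:R * r ^+ 2 * \sum_i d i) + 2 * (2 * (e / 8) + 2 * (e / 8)))%:E; last first.
 rewrite lee_fin; lra.
apply: le_trans S2; apply: le_of_eq; apply: eq_integral => x _; congr ((_ ^+ 2)%:E).
have -> : conv (fun t => v (rv t) - w t) eta (rv x) = conv (fun t => v (rv t)) eta (rv x) - conv w eta (rv x).
{ rewrite -RintegralB//; [|exact: kernel_integrable|exact: kernel_integrable].
 by apply: eq_Rintegral => t _; rewrite mulrBl. }
ring.
Qed.

(** A quantitative form of Rellich's theorem. At a fixed scale r the mollification differs from w by
    a small multiple of the energy. If it vanishes on a fine net, it is at most e1 times the L^1
    norm of w everywhere on B, hence small against the L^2 norm, and is absorbed. Kernel and net
    depend on K1 and e alone. *)
Lemma finite_rank (e : R) : 0 < e -> exists2 eta : 'rV[R]_n -> R^o, kernel_fun eta & exists s : seq 'rV[R]_n,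
 forall w D (d : 'I_n -> R), weak_pair w D -> (forall i, (\int[leb n]_t (D i t ^+ 2)%:E <= (d i)%:E)%E) ->
 (forall x, x \in s -> conv w eta x = 0) -> (\int[leb n]_t (w t ^+ 2)%:E <= (e * \sum_i d i)%:E)%E.
Proof.
move=> e0; have [rho rho0 Kr] := compact_bounded_rV cK1.
(* The final bound is W <= W/2 + 8 n r^2 times the energy, that is 16 n r^2 times the energy; r <= 1
   gives r^2 <= r. *)
pose r := Num.min 1 (e / (16 * n%:R + 1)).
have D0 : (0 : R) < 16 * n%:R + 1 by rewrite ltr_wpDl// mulr_ge0.
have r0 : 0 < r by rewrite lt_min ltr01 divr_gt0.
have r1 : r <= 1 by rewrite ge_min lexx.
have re : 16 * n%:R * r ^+ 2 <= e.
{ have h2 : r * (16 * n%:R + 1) <= e by rewrite -ler_pdivlMr// ge_min lexx orbT.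
 have h3 : 16 * n%:R * r ^+ 2 <= 16 * n%:R * r by rewrite expr2 mulrA; apply: ler_piMr => //; rewrite mulr_ge0 ?(ltW r0)// mulr_ge0.
 apply: le_trans h3 _; apply: le_trans h2; rewrite mulrDr mulr1 [r * _]mulrC; lra. }
have [eta me] := @mollifier_exists R n r r0; have [k0 eta0 es _ _] := me.
have rr : 0 < rho + 1 by lra.
pose B := [set x : 'rV[R]_n | `|x| <= rho + 1].
have cB : compact B by exact: compact_closed_ball.
have [mB Boo] := leb_compact cB.
pose V := \int[leb n]_t (\1_(rv @^-1` B) t : R).
have iB := indic_compact_integrable cB.
have V0 : 0 <= V by apply: Rintegral_ge0 => t _; rewrite indicE.
(* One V comes from Cauchy-Schwarz for the L^1 norm, the other from integrating over B; the choice
   makes 2 e1^2 V^2 at most 1/2. *)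
pose e1 := Num.min 1 (4 * V * V + 1)^-1.
have V4 : 0 < 4 * V * V + 1 by rewrite ltr_wpDl// mulr_ge0// mulr_ge0.
have e10 : 0 < e1 by rewrite lt_min ltr01 invr_gt0.
have e1V : 2 * (V * (e1 ^+ 2 * V)) <= 2^-1.
{ have h1 : e1 <= 1 by rewrite ge_min lexx.
 have h2 : e1 * (4 * V * V + 1) <= 1 by rewrite -ler_pdivlMr// mul1r ge_min lexx orbT.
 have h3 : e1 ^+ 2 * (V * V) <= e1 * (V * V) by rewrite expr2 -mulrA; apply: ler_piMl => //; rewrite mulr_ge0 ?mulr_ge0// ltW.
 have -> : 2 * (V * (e1 ^+ 2 * V)) = 2 * (e1 ^+ 2 * (V * V)) by ring.
 move: h2; rewrite mulrDr mulr1 -mulrA mulrCA; move: (e1 * (V * V)) (e1 ^+ 2 * (V * V)) h3 => x y; lra. }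
have [_ [Ke cKe Ke0]] := k0.
have [d0 d00 Hd] := compact_supp_unif_cont (kernel_continuous k0) cKe Ke0 e10.
have [||s [sB sc]] := @compact_seq_cover _ _ B B (fun x => (ball x d0)^°) cB.
- by move=> x _; exact: open_interior.
- by move=> x Bx; exists x => //; exact: nbhsx_ballx.
exists eta => //; exists s => w D d wp Dd ws; have [sw sD wK weak] := wp.
have wB t : ~ B (rv t) -> w t = 0.
{ by move=> nB; apply: (wK t _).1 => /Kr h; apply: nB; rewrite /B /=; lra. }
have [mw woo] := sw; have [iw iw2] := L2_supported_L1 mw cB wB woo.
pose I := \int[leb n]_t `|w t|; pose W := \int[leb n]_t (w t ^+ 2).
have ian : L1 (leb n) (fun t => `|w t|) by exact: integrable_norm.
have IW : I ^+ 2 <= V * W.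
{ apply: discriminant_le => // t.
 have j1 := L1Z (t ^+ 2) iB; have j2 := L1Z (- (2 * t)) ian.
 have -> : t ^+ 2 * V - 2 * t * I + W = \int[leb n]_y (t ^+ 2 * \1_(rv @^-1` B) y + (- (2 * t)) * `|w y| + w y ^+ 2).
 { rewrite RintegralD//; last exact: L1D.
  rewrite RintegralD// RintegralZl// RintegralZl// mulNr//. }
 apply: Rintegral_ge0 => y _; have [By|nB] := pselect (B (rv y)); last first.
  by rewrite wB// normr0 indicE memNset// expr0n !mulr0 !addr0.
 rewrite indicE mem_set// mulr1; have := sqr_ge0 (t - `|w y|); rewrite sqrrB real_normK ?num_real//; lra. }
have W0 : 0 <= W by apply: Rintegral_ge0 => t _; exact: sqr_ge0.
have cx x : B x -> conv w eta x ^+ 2 <= e1 ^+ 2 * (V * W).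
{ move=> /sc[y ys /interior_subset]; rewrite mx_norm_ball /ball_ /= => yx.
 have : `|conv w eta x| <= e1 * I.
 { rewrite -[conv w eta x]subr0 -(ws y ys) /conv -RintegralB//; [|exact: kernel_integrable|exact: kernel_integrable].
  apply: Rintegral_norm_le => //.
  - by apply: measurable_funB; apply: measurable_funM => //; apply: measurable_shift_fun; exact: kernel_continuous.
  - move=> t; rewrite -mulrBr normrM mulrC; apply: ler_wpM2r => //; apply: Hd.
   by rewrite (_ : rv t - x - (rv t - y) = y - x)// opprB addrC addrA subrK. }
 move=> h; via ((e1 * I) ^+ 2); last by rewrite exprMn ler_wpM2l ?sqr_ge0.
 exact: sqr_le_sqr. }
have mc := conv_measurable iw k0.
have C2 : (\int[leb n]_x (conv w eta (rv x) ^+ 2)%:E <= (e1 ^+ 2 * (V * W) * V)%:E)%E.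
{ apply: (@integral_le_of_le _ _ _ (leb n) setT measurableT _ (fun x => e1 ^+ 2 * (V * W) * \1_(rv @^-1` B) x)).
 - exact: measurable_funX.
 - by apply: measurable_funM.
 - move=> x _; rewrite sqr_ge0 /=; have [Bx|nB] := pselect (B (rv x)).
   by rewrite indicE mem_set// mulr1 cx.
  rewrite indicE memNset// mulr0 (conv_support me r1 (rho := rho)) ?expr0n//.
   by move=> t h; apply: (wK t _).1 => /Kr; lra.
  by rewrite ltNge; apply/negP.
 - rewrite EFin_Rintegral; last exact: L1Z.
  by rewrite RintegralZl. }
have C1 := conv_rate wp me Dd.
have mcw : measurable_fun setT (fun x : n.-tuple Rm => conv w eta (rv x) - w x) by exact: measurable_funB.
have C1' : (\int[leb n]_x ((- (conv w eta (rv x) - w x)) ^+ 2)%:E <= (4 * n%:R * r ^+ 2 * \sum_i d i)%:E)%E.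
 by under eq_integral do rewrite sqrrN.
have mnc : measurable_fun setT (fun x : n.-tuple Rm => - (conv w eta (rv x) - w x)) by exact: measurableT_comp.
have S := integral_sqrD_le measurableT mc mnc C2 C1'.
have WE : (\int[leb n]_t (w t ^+ 2)%:E = W%:E)%E by exact: EFin_Rintegral.
have S' : W <= 2 * (e1 ^+ 2 * (V * W) * V) + 2 * (4 * n%:R * r ^+ 2 * \sum_i d i).
{ rewrite -lee_fin -WE; apply: le_trans S; apply: le_of_eq.
 by apply: eq_integral => t _; rewrite opprB addrC subrK. }
have d0' : 0 <= \sum_i d i.
{ apply: sumr_ge0 => i _; rewrite -lee_fin; apply: le_trans (Dd i); apply: integral_ge0 => t _; exact: sqr_ge0. }
rewrite WE; via (16 * n%:R * r ^+ 2 * \sum_i d i); last by rewrite ler_wpM2r.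
have h : 2 * (V * (e1 ^+ 2 * V)) * W <= 2^-1 * W by rewrite ler_wpM2r.
have E1 : 2 * (e1 ^+ 2 * (V * W) * V) = 2 * (V * (e1 ^+ 2 * V)) * W by ring.
have E2 : 16 * n%:R * r ^+ 2 * \sum_i d i = 4 * (4 * n%:R * r ^+ 2 * \sum_i d i) by ring.
lra.
Qed.

End FiniteRank.

Lemma square_sum_arith {R : realFieldType} (a b x y c d : R) : a <= c -> b <= d -> 0 <= x -> 0 <= y -> 0 <= a -> 0 <= b ->
 2 * (a * x) + 2 * (y * b) <= (2 * c + 2 * d) * (x + y).
Proof.
move=> ac bd x0 y0 a0 b0.
have h1 := ler_wpM2r x0 ac; have h2 := ler_wpM2l y0 bd.
have h3 := mulr_ge0 x0 (le_trans b0 bd); have h4 := mulr_ge0 y0 (le_trans a0 ac); lra.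
Qed.

(** * The solution space and its testing functionals *)

Section JacobiSpace.
Context {R : realType} {n : nat} {M : ptopologicalType}.
Local Notation Rm := (measurableTypeR R).
Variables (S : smooth_manifold R n M) (iota : M -> 'rV[R]_n.+1).
Variable mu : {measure set (borelType M) -> \bar R}.
Hypothesis imm : is_immersion S iota.
Hypothesis Hmu : is_riemannian_volume S iota mu.
Local Notation grad := (grad S iota).
Local Notation sqi f := (L2 mu (f : borelType M -> R)).

Lemma L2_lin (a b : R) (f g : M -> R) : sqi f -> sqi g -> sqi (fun p => a * f p + b * g p).
Proof.
move=> sf sg; apply: L2D.
 exact: (L2_mul (B := `|a|) sf (@measurable_cst _ _ (borelType M) _ setT a)).
exact: (L2_mul (B := `|b|) sg (@measurable_cst _ _ (borelType M) _ setT b)).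
Qed.

Lemma Rintegral_lin {d} {T : measurableType d} (nu : {measure set T -> \bar R}) (D : set T) (a b : R) (u v : T -> R) :
 measurable D -> nu.-integrable D (EFin \o u) -> nu.-integrable D (EFin \o v) ->
 \int[nu]_(t in D) (a * u t + b * v t) = a * \int[nu]_(t in D) u t + b * \int[nu]_(t in D) v t.
Proof.
move=> mD iu iv; rewrite RintegralD ?RintegralZl//.
- by have := integrableZl mD a iu; apply: eq_integrable => // t _; rewrite /= EFinM.
- by have := integrableZl mD b iv; apply: eq_integrable => // t _; rewrite /= EFinM.
Qed.

Lemma W12_grad_lin (a b : R) f g F G : W12_grad S iota mu f F -> W12_grad S iota mu g G ->
 W12_grad S iota mu (fun p => a * f p + b * g p) (fun p => a *: F p + b *: G p).
Proof.
move=> [sf sF [TF wF]] [sg sG [TG wG]]; split; first exact: L2_lin.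
 move=> j; rewrite (_ : (fun p => _) = (fun p => a * F p 0 j + b * G p 0 j)); last by apply/funext => p; rewrite !mxE.
 exact: L2_lin (sF j) (sG j).
split; first by move=> c p Ac cp; rewrite addmx_sub// scalemx_sub//; [exact: TF|exact: TG].
move=> c i psi Ac sp cs; have [K [cK Kc] K0] := cs.
have mD := @measurable_cdomain R n M c.
have sT k (h : 'rV[R]_n -> R^o) : Ck k setT h -> Ck k (cimg c) h by apply: Ck_sub.
have p0 x : ~ K x -> partial i (psi : _ -> R^o) x = 0.
 by apply: (partial_support (K := K)) => //; apply: compact_closed => //.
have C1 := sT _ _ (CkS i (sp 1%N)).
have i1 := chart_integrable imm Hmu Ac cK Kc sf C1 p0; have i2 := chart_integrable imm Hmu Ac cK Kc sg C1 p0.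
pose H (V : M -> 'rV[R]_n.+1) (t : n.-tuple Rm) := dotv (V (cinv c (rv t))) (row i (tangent_mx iota c (rv t))) * psi (rv t).
have iH (V : M -> 'rV[R]_n.+1) : (forall j, sqi (fun p => V p 0 j)) -> (leb n).-integrable (cdomain c) (EFin \o H V).
{ by move=> sV; apply: (chart_dotv_integrable imm Hmu i Ac cK Kc sV (sT _ _ (sp 0%N))). }
have E1 : \int[leb n]_(t in cdomain c) ((a * f (cinv c (rv t)) + b * g (cinv c (rv t))) * partial i (psi : _ -> R^o) (rv t)) =
 a * \int[leb n]_(t in cdomain c) (f (cinv c (rv t)) * partial i (psi : _ -> R^o) (rv t)) +
 b * \int[leb n]_(t in cdomain c) (g (cinv c (rv t)) * partial i (psi : _ -> R^o) (rv t)).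
{ rewrite -Rintegral_lin//; apply: eq_Rintegral => t _; by lra. }
have E2 : \int[leb n]_(t in cdomain c) H (fun p => a *: F p + b *: G p) t =
 a * \int[leb n]_(t in cdomain c) H F t + b * \int[leb n]_(t in cdomain c) H G t.
{ rewrite -Rintegral_lin//; [|exact: iH|exact: iH]; apply: eq_Rintegral => t _.
 by rewrite /H dotvDl !dotvZl mulrDl !mulrA. }
have := wF c i psi Ac sp cs; have := wG c i psi Ac sp cs; rewrite -!/(H _ _) => h2 h1.
transitivity (a * \int[leb n]_(t in cdomain c) (f (cinv c (rv t)) * partial i (psi : _ -> R^o) (rv t)) +
 b * \int[leb n]_(t in cdomain c) (g (cinv c (rv t)) * partial i (psi : _ -> R^o) (rv t))); first exact: E1.
rewrite [X in a * X]h1 [X in b * X]h2 E2.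
ring.
Qed.

Lemma weak_jacobi_lin (a b : R) f g F G : W12_grad S iota mu f F -> W12_grad S iota mu g G ->
 weak_jacobi S iota mu f F -> weak_jacobi S iota mu g G ->
 weak_jacobi S iota mu (fun p => a * f p + b * g p) (fun p => a *: F p + b *: G p).
Proof.
move=> [sf sF _] [sg sG _] Jf Jg phi sp cs.
have sgr := grad_L2 imm Hmu sp cs; have [K [cK _] K0] := cs.
have cA := A2_continuous imm; have cp := smooth_continuous sp.
have sAp : sqi (fun p => A2 S iota p * phi p).
{ apply: (continuous_L2 imm Hmu _ cK); last by move=> p nK; rewrite K0// mulr0.
 by move=> p; apply: continuousM; [exact: cA|exact: cp]. }
have E1 : \int[mu]_p dotv (a *: F p + b *: G p) (grad phi p) =
 a * \int[mu]_p dotv (F p) (grad phi p) + b * \int[mu]_p dotv (G p) (grad phi p).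
{ rewrite -Rintegral_lin//; [|exact: integrable_dotv sF sgr|exact: integrable_dotv sG sgr].
 by apply: eq_Rintegral => p _; rewrite dotvDl !dotvZl. }
have iA h : sqi h -> L1 mu (fun p : borelType M => A2 S iota p * h p * phi p).
{ move=> sh; have := L2_prod sh sAp; apply: eq_integrable => // p _ /=; congr EFin; ring. }
have E2 : \int[mu]_p (A2 S iota p * (a * f p + b * g p) * phi p) =
 a * \int[mu]_p (A2 S iota p * f p * phi p) + b * \int[mu]_p (A2 S iota p * g p * phi p).
{ rewrite -Rintegral_lin//; [|exact: iA|exact: iA].
 by apply: eq_Rintegral => p _; ring. }
have := Jf phi sp cs; have := Jg phi sp cs; rewrite E1 E2.
move: (\int[mu]_p _) (\int[mu]_p _) (\int[mu]_p _) (\int[mu]_p _) => x1 x2 x3 x4 h1 h2.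
have -> : - (a * x2 + b * x4) + (a * x1 + b * x3) = a * (- x2 + x1) + b * (- x4 + x3) by ring.
by rewrite h1 h2 !mulr0 addr0.
Qed.

Lemma jacobi_null_lin (a b : R) f g : jacobi_null S iota mu f -> jacobi_null S iota mu g ->
 jacobi_null S iota mu (fun p => a * f p + b * g p).
Proof.
move=> [F WF JF] [G WG JG]; exists (fun p => a *: F p + b *: G p); first exact: W12_grad_lin.
exact: weak_jacobi_lin.
Qed.

Definition W12 f := exists G, W12_grad S iota mu f G.

Lemma jacobi_null_W12 f : jacobi_null S iota mu f -> W12 f.
Proof. by move=> [G ? _]; exists G. Qed.

(** Linearity is asked on W^{1,2} only, because the functionals are integrals and are additive only
    on integrable arguments. *)
Definition linear_on_W12 (l : (M -> R) -> R) := forall a b f g, W12 f -> W12 g ->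
 l (fun p => a * f p + b * g p) = a * l f + b * l g.

Definition finitely_tested (P : (M -> R) -> Prop) := exists (N : nat) (l : 'I_N -> (M -> R) -> R),
 (forall k, linear_on_W12 (l k)) /\ forall f, (forall k, l k f = 0) -> P f.

Lemma finitely_testedI P Q : finitely_tested P -> finitely_tested Q ->
 finitely_tested (fun f => P f /\ Q f).
Proof.
move=> [N [l [ll lP]]] [N' [l' [ll' lQ]]].
exists (N + N')%N, (fun k => match fintype.split k with inl i => l i | inr j => l' j end); split.
 by move=> k; case: fintype.split.
split.
 by apply: lP => i; have := H (lshift N' i); rewrite (unsplitK (inl _ i)).
by apply: lQ => j; have := H (rshift N j); rewrite (unsplitK (inr _ j)).
Qed.

Lemma finitely_tested_all (I : eqType) (s : seq I) (P : I -> (M -> R) -> Prop) :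
 (forall i, finitely_tested (P i)) -> finitely_tested (fun f => forall i, i \in s -> P i f).
Proof.
move=> H; elim: s => [|i s [N [l [ll lP]]]].
 by exists 0%N, (fun _ _ => 0); split => [[]//|f _ i].
have [N' [l' [ll' lP']]] := finitely_testedI (H i) (ex_intro _ N (ex_intro _ l (conj ll lP))).
exists N', l'; split => // f /lP'[h1 h2] j; rewrite inE => /orP[/eqP ->//|]; exact: h2.
Qed.

(** Among all finite families in the space, one is taken whose matrix of functional values has
    maximal rank, at most N. Adjoining f cannot raise the rank, so the values of f are a combination
    of those of the family; the corresponding difference is again a solution, is annihilated by all
    functionals and so vanishes almost everywhere. *)
Lemma finite_dim_of_tested : jacobi_null S iota mu (fun=> 0) ->
 finitely_tested (fun f => jacobi_null S iota mu f -> \forall p \ae mu, f p = 0) ->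
 finite_dim_ae mu (jacobi_null S iota mu).
Proof.
move=> V0 [N [l [ll lP]]]; pose V := jacobi_null S iota mu.
pose A m (b : 'I_m -> M -> R) : 'M[R]_(m, N) := \matrix_(i, k) l k (b i).
pose Q r := `[< exists m (b : 'I_m -> M -> R), (forall i, V (b i)) /\ \rank (A m b) = r >].
have Q0 : exists r, Q r.
 by exists (\rank (A 0%N (fun _ _ => 0))); apply/asboolP; exists 0%N, (fun _ _ => 0).
have QN r : Q r -> (r <= N)%N by move=> /asboolP[m [b [_ <-]]]; exact: rank_leq_col.
case: (ex_maxnP Q0 QN) => r /asboolP[m [b [Vb rb]]] rmax.
exists m, b; split => // f Vf.
pose b' (i : 'I_m.+1) := if unlift ord0 i is Some j then b j else f.
have Vb' i : V (b' i) by rewrite /b'; case: unliftP.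
have AA : (A m b <= A m.+1 b')%MS.
{ apply/row_subP => i; have -> : row i (A m b) = row (lift ord0 i) (A m.+1 b').
  by apply/rowP => k; rewrite !mxE /b' liftK.
 exact: row_sub. }
have r' : (\rank (A m.+1 b') <= \rank (A m b))%N.
 by rewrite rb; apply: rmax; apply/asboolP; exists m.+1, b'.
have A'A : (A m.+1 b' <= A m b)%MS by rewrite -(mxrank_leqif_sup AA) eqn_leq mxrankS.
have /submxP[D vD] : (row ord0 (A m.+1 b') <= A m b)%MS := submx_trans (row_sub _ _) A'A.
exists (fun i => D 0 i).
have sums (s : seq 'I_m) : V (fun p => \sum_(i <- s) D 0 i * b i p) /\
 forall k, l k (fun p => \sum_(i <- s) D 0 i * b i p) = \sum_(i <- s) D 0 i * l k (b i).
{ elim: s => [|i s [IV IL]].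
  have E : (fun p : M => \sum_(i <- [::]) D 0 i * b i p) = (fun=> 0) by apply/funext => p; rewrite big_nil.
  rewrite E; split => // k; rewrite big_nil.
  have := ll k 0 0 _ _ (jacobi_null_W12 V0) (jacobi_null_W12 V0).
  by rewrite !mul0r !addr0.
 have E : (fun p => \sum_(j <- i :: s) D 0 j * b j p) = (fun p => D 0 i * b i p + 1 * \sum_(j <- s) D 0 j * b j p).
  by apply/funext => p; rewrite big_cons mul1r.
 rewrite E; split; first exact: (jacobi_null_lin (D 0 i) 1 (Vb i) IV).
 move=> k; rewrite (ll k _ _ _ _ (jacobi_null_W12 (Vb i)) (jacobi_null_W12 IV)).
 by rewrite IL big_cons mul1r. }
have [IV IL] := sums (index_enum 'I_m).
have H : \forall p \ae mu, 1 * f p + -1 * \sum_i D 0 i * b i p = 0.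
{ apply: (lP (fun p => 1 * f p + -1 * \sum_i D 0 i * b i p)); last exact: (jacobi_null_lin 1 (-1) Vf IV).
 move=> k; rewrite (ll k _ _ _ _ (jacobi_null_W12 Vf) (jacobi_null_W12 IV)).
 rewrite IL; move/rowP: vD => /(_ k); rewrite !mxE /b' unlift_none => ->.
 by under eq_bigr do rewrite mxE; rewrite mul1r mulN1r subrr. }
apply: (@filterS _ _ (ae_filter_ringOfSetsType mu)) H => p; rewrite mul1r mulN1r => /eqP.
by lra.
Qed.

Local Notation L2on := (L2on mu).

Lemma cutgrad_energy_le chi (K : set M) : smooth_fun S chi -> compact K -> (forall p, ~ K p -> chi p = 0) ->
 exists2 C : R, 0 < C & forall f G, W12_grad S iota mu f G ->
 \int[mu]_p dotv (cutgrad S iota f G chi p) (cutgrad S iota f G chi p) <=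
 C * (\int[mu]_p (\1_K p * dotv (G p) (G p)) + L2on K f).
Proof.
move=> sc cK K0; have cc := smooth_continuous sc.
have cs : compactly_supported setT chi by exists K.
have [B B0 HB] := compact_support_bounded cc cs.
have cg2 : continuous (fun p => enorm (grad chi p)) by exact: enorm_grad_continuous.
have [B' B'0 HB'] := @compact_ubound R M K _ cK (fun p _ => cg2 p).
exists (2 * B ^+ 2 + 2 * B' ^+ 2); first by rewrite addr_gt0// mulr_gt0// exprn_gt0.
move=> f G W; have [sf sG _] := W.
have i1 := integrable_indic_dotv imm Hmu cK sG; have i2 := L2_indic imm Hmu cK sf.
have i3 := L1D i1 i2; have sV := cutgrad_field imm W sc cs.
rewrite /L2on -RintegralD// -RintegralZl//; apply: le_Rintegral_L1.
- exact: integrable_dotv.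
- exact: L1Z.
- move=> p; have [Kp|nK] := pselect (K p); last first.
  rewrite /cutgrad K0// (grad_support S iota (K := K))//; last exact: (closed_compact_manifold S cK).
  by rewrite scale0r scaler0 addr0 dotv0l indicE memNset// !mul0r addr0 mulr0.
 rewrite indicE mem_set// !mul1r.
 have dD (x y : 'rV[R]_n.+1) : dotv (x + y) (x + y) <= 2 * dotv x x + 2 * dotv y y.
 { have := dotv_ge0 (x + -1 *: y); rewrite !dotvDl !dotvDr !dotvZl !dotvZr; lra. }
 apply: le_trans (dD _ _) _.
 have -> : 2 * dotv (chi p *: G p) (chi p *: G p) + 2 * dotv (f p *: grad chi p) (f p *: grad chi p) =
  2 * (chi p ^+ 2 * dotv (G p) (G p)) + 2 * (f p ^+ 2 * dotv (grad chi p) (grad chi p)) by rewrite !dotvZl !dotvZr; ring.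
 have h1 : chi p ^+ 2 <= B ^+ 2.
  by apply: sqr_le_sqr.
 have h2 : dotv (grad chi p) (grad chi p) <= B' ^+ 2.
  rewrite -enorm_sqr; apply: lerXn2r; rewrite ?nnegrE ?(ltW B'0) ?enorm_ge0//; apply: le_trans (HB' p Kp); exact: ler_norm.
 by apply: square_sum_arith; rewrite ?sqr_ge0 ?dotv_ge0.
Qed.

(** The functionals are the values on a net of the mollified coordinate expression of chi f;
    [finite_rank] applies to it, and the bounds are carried back to the manifold. *)
Lemma chart_finitely_tested c chi (K0 : set M) : atlas S c -> smooth_fun S chi -> compact K0 -> K0 `<=` cdom c ->
 (forall p, ~ K0 p -> chi p = 0) ->
 forall e : R, 0 < e -> finitely_tested (fun f => forall G, W12_grad S iota mu f G ->
  \int[mu]_p ((chi p * f p) ^+ 2) <= e * (\int[mu]_p (\1_K0 p * dotv (G p) (G p)) + L2on K0 f)).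
Proof.
move=> Ac sc cK0 K0c chi0 e e0; pose K1 := cmap c @` K0.
have cs : compactly_supported setT chi by exists K0.
have cK1 : compact K1 by exact: compact_cmap.
have K1c : K1 `<=` cimg c by move=> _ [p Kp <-]; exact: cmap_img (K0c _ Kp).
have K01 p : ~ (cinv c @` K1) p -> ~ K0 p.
 by move=> nK Kp; apply: nK; exists (cmap c p); [exists p|exact: cmapK (K0c _ Kp)].
have K10 x : cimg c x -> ~ K1 x -> ~ K0 (cinv c x).
 by move=> cx nK Kx; apply: nK; exists (cinv c x) => //; rewrite cinvK.
have [C C0 HC] := chart_comparison imm Hmu Ac cK1 K1c.
have [E E0 HE] := cutgrad_energy_le sc cK0 chi0.
pose tsq x : R^o := \sum_i \sum_j tangent_mx iota c x i j * tangent_mx iota c x i j.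
have Ct : Ck 0 (cimg c) tsq.
{ apply: Ck_sum => [|i _]; first exact: open_cimg.
 apply: Ck_sum => [|j _]; first exact: open_cimg.
 by apply: CkM; [exact: open_cimg|exact: Ck_tangent (imm Ac).1 _ _ _|exact: Ck_tangent (imm Ac).1 _ _ _]. }
have [B B0 HB] := @compact_ubound _ _ _ tsq cK1 (fun x Kx => Ck_continuous Ct (K1c x Kx)).
(* The two factors C come from the two changes of variables, B from the tangent vectors, n from
   summing components and E from the gradient of the cut-off function. *)
pose e' := e / (C * (n%:R * (B * C * E)) + 1).
have D0 : 0 < C * (n%:R * (B * C * E)) + 1.
 by rewrite ltr_wpDl// mulr_ge0 ?(ltW C0)// mulr_ge0// ltW// !mulr_gt0.
have e'0 : 0 < e' by rewrite divr_gt0.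
have [eta ke [s Hs]] := finite_rank cK1 e'0.
have cutint f : W12 f -> L1 (leb n) (cut_chart f c chi).
{ move=> [G W]; apply: (integrable_of_chart cK0 K0c); first exact: (cut_chart_L2 imm Hmu W Ac sc cK0 K0c chi0).
 by move=> t nK; exact: (cut_chart_support S iota f G cK0 chi0 nK).1. }
exists (size s), (fun k f => conv (cut_chart f c chi) eta (tnth (in_tuple s) k)); split.
 move=> k a b f g sf sg; set x := tnth _ _.
 have i1 := kernel_integrable x (cutint f sf) ke; have i2 := kernel_integrable x (cutint g sg) ke.
 rewrite /conv -Rintegral_lin//; apply: eq_Rintegral => t _.
 rewrite /cut_chart !patchE; case: ifP => _; last by rewrite !mul0r !mulr0 addr0.
 ring.
move=> f H G W; have [sf sG [TG _]] := W.
have sV := cutgrad_field imm W sc cs; have iV := integrable_dotv sV sV.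
set X := \int[mu]_p dotv (cutgrad S iota f G chi p) (cutgrad S iota f G chi p) in HE *.
have cutgrad0 p : ~ K0 p -> cutgrad S iota f G chi p = 0.
{ move=> nK; rewrite /cutgrad chi0// (grad_support S iota (K := K0))//; last exact: (closed_compact_manifold S cK0).
 by rewrite scale0r scaler0 addr0. }
have wp : weak_pair K1 (cut_chart f c chi) (cutgrad_chart S iota f G c chi).
{ split.
 - exact: (cut_chart_L2 imm Hmu W Ac sc cK0 K0c chi0).
 - exact: (cutgrad_chart_L2 imm Hmu W Ac sc cK0 K0c chi0).
 - exact: (cut_chart_support S iota f G cK0 chi0).
 - move=> psi i sp; exact: (weak_cut imm Hmu W Ac sc cK0 K0c chi0). }
have mVV : measurable_fun setT (fun p : borelType M => dotv (cutgrad S iota f G chi p) (cutgrad S iota f G chi p)).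
 by apply/measurable_EFinP; exact: measurable_int iV.
have V0 p : ~ (cinv c @` K1) p -> dotv (cutgrad S iota f G chi p) (cutgrad S iota f G chi p) = 0.
 by move=> nK; rewrite cutgrad0 ?dotv0l//; exact: K01.
have [HV _] := HC _ mVV (fun p => dotv_ge0 _) V0.
have Dd i : (\int[leb n]_t (cutgrad_chart S iota f G c chi i t ^+ 2)%:E <= (B * (C * X))%:E)%E.
{ have [mD _] := cutgrad_chart_L2 imm Hmu W Ac sc cK0 K0c chi0 i.
 have mVc := measurable_chart_fun (c := c) mVV.
 have mcd := @measurable_cdomain R n M c.
 via (B%:E * \int[leb n]_(t in cdomain c) (dotv (cutgrad S iota f G chi (cpoint c t)) (cutgrad S iota f G chi (cpoint c t)))%:E)%E; last first.
  rewrite [(B * _)%:E]EFinM lee_pmul2l//; apply: le_trans HV _.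
  by rewrite EFinM lee_pmul2l ?lte_fin// EFin_Rintegral.
 rewrite -ge0_integralZl_EFin//; last 3 first.
 - by move=> t _; rewrite lee_fin dotv_ge0.
 - exact/measurable_EFinP.
 - exact: ltW.
 rewrite [leRHS]integral_mkcond; apply: ge0_le_integral => //.
 - by move=> t _; rewrite lee_fin sqr_ge0.
 - by apply/measurable_EFinP; exact: measurable_funX.
 - by apply/(measurable_restrictT _ mcd); apply/measurable_EFinP; apply: measurable_funM.
 - move=> t _; rewrite /cutgrad_chart !patchE; case: ifPn => [|_]; last by rewrite expr0n.
  rewrite inE => ct; rewrite lee_fin.
  have [Kt|nK] := pselect (K1 (rv t)); last first.
   by rewrite cutgrad0 ?dotv0l ?expr0n ?mulr0//; exact: K10.
  via (enorm (cutgrad S iota f G chi (cpoint c t)) ^+ 2 * enorm (row i (tangent_mx iota c (rv t))) ^+ 2).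
   by rewrite -exprMn; apply: sqr_le_sqr; exact: dotv_le_enorm.
  rewrite !enorm_sqr mulrC; apply: ler_wpM2r; first exact: dotv_ge0.
  apply: le_trans (HB _ Kt); apply: le_trans (ler_norm _).
  have -> : dotv (row i (tangent_mx iota c (rv t))) (row i (tangent_mx iota c (rv t))) =
   \sum_j tangent_mx iota c (rv t) i j * tangent_mx iota c (rv t) i j.
   by apply: eq_bigr => j _; rewrite ![row _ _ _ _]mxE.
  rewrite /tsq (bigD1 i)//= lerDl; apply: sumr_ge0 => i' _; apply: sumr_ge0 => j _; by rewrite sqr_ge0. }
have Hx x : x \in s -> conv (cut_chart f c chi) eta x = 0 by move=> /seq_tnthP[k ->].
have Wb := Hs _ _ _ wp Dd Hx.
have scf := cut_L2 W sc cs; have icf := L2_int scf.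
have mcf : measurable_fun setT (fun p : borelType M => (chi p * f p) ^+ 2) by apply: measurable_funX; case: scf.
have cf0 p : ~ (cinv c @` K1) p -> (chi p * f p) ^+ 2 = 0.
 by move=> /K01 nK; rewrite chi0// mul0r expr0n.
have [_ HW] := HC _ mcf (fun p => sqr_ge0 _) cf0.
have X1 := HE f G W.
set Y := _ + L2on K0 f in X1 *.
have Y0 : 0 <= Y.
{ by rewrite addr_ge0//; apply: Rintegral_ge0 => p _; apply: mulr_ge0; rewrite ?dotv_ge0 ?sqr_ge0//. }
have Z : \int[mu]_p ((chi p * f p) ^+ 2) <= C * (e' * \sum_(i < n) (B * (C * X))).
{ rewrite -lee_fin -EFin_Rintegral//; apply: le_trans HW _; rewrite EFinM lee_pmul2l ?lte_fin//.
 apply: le_trans Wb; rewrite integral_mkcond le_eqVlt; apply/orP; left; apply/eqP; apply: eq_integral => t _.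
 by rewrite /cut_chart !patchE; case: ifP => // _; rewrite expr0n. }
apply: le_trans Z _; rewrite sumr_const card_ord -[_ *+ n]mulr_natl.
via (C * (e' * (n%:R * (B * (C * (E * Y)))))).
 rewrite ler_pM2l// ler_pM2l//; apply: ler_wpM2l => //; rewrite ler_pM2l// ler_pM2l//.
have -> : C * (e' * (n%:R * (B * (C * (E * Y))))) = (C * (n%:R * (B * C * E)) * e') * Y by ring.
apply: ler_wpM2r => //; via ((C * (n%:R * (B * C * E)) + 1) * e').
 by rewrite ler_pM2r// lerDl.
by rewrite mulrC divfK// gt_eqF.
Qed.

(** Finitely many bumps equal to 1 on open sets covering K reduce to single charts; the tests are
    united and the small factor is divided among the bumps. *)
Lemma compact_finitely_tested (K : set M) : compact K -> exists2 K' : set M, compact K' &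
 forall e : R, 0 < e -> finitely_tested (fun f => forall G, W12_grad S iota mu f G ->
  L2on K f <= e * (\int[mu]_p (\1_K' p * dotv (G p) (G p)) + L2on K' f)).
Proof.
move=> cK.
have /choice[beta Hb] : forall p : M, exists b : (M -> R) * set M * set M,
 [/\ smooth_fun S b.1.1, compact b.1.2 /\ b.1.2 `<=` cdom (chart_at S p), forall q, ~ b.1.2 q -> b.1.1 q = 0 &
  [/\ open b.2, b.2 p & forall q, b.2 q -> b.1.1 q = 1]].
{ move=> p; have [Ap cp] := chart_atP S p.
 have [b [sb _ [L cL [Lc L0]] [U [oU Up U1]]]] := bump_exists Ap cp openT I.
 exists (b, L, U); split => //; split => //= q /Lc[]//. }
have [|p _|s [_ sK]] := @compact_seq_cover M M setT K (fun p => (beta p).2) cK.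
- by move=> p _; have [_ _ _ []] := Hb p.
- by exists p => //; have [_ _ _ []] := Hb p.
pose K' := \big[setU/set0]_(p <- s) (beta p).1.2.
have cK' : compact K'.
{ rewrite /K'; elim: (s) => [|p s' IH]; first by rewrite big_nil; exact: compact0.
 by rewrite big_cons; apply: compactU => //; have [_ []] := Hb p. }
have subK p : p \in s -> (beta p).1.2 `<=` K'.
{ rewrite /K'; elim: (s) => [//|p' s' IH]; rewrite big_cons => /orP[/eqP ->|/IH h] q bq; first by left.
 by right; exact: h. }
exists K' => // e e0; pose e' := e / (size s).+1%:R.
have e'0 : 0 < e' by rewrite divr_gt0.
have ft p : finitely_tested (fun f => forall G, W12_grad S iota mu f G ->
  \int[mu]_q (((beta p).1.1 q * f q) ^+ 2) <= e' * (\int[mu]_q (\1_((beta p).1.2) q * dotv (G q) (G q)) + L2on (beta p).1.2 f)).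
 by have [sb [cb bc] b0 _] := Hb p; exact: (chart_finitely_tested (chart_atP S p).1 sb cb bc b0).
have [N [l [ll lP]]] := finitely_tested_all s ft.
exists N, l; split => // f /lP H G W; have [sf sG _] := W.
set Y := _ + L2on K' f.
have Hp p : p \in s -> \int[mu]_q (((beta p).1.1 q * f q) ^+ 2) <= e' * Y.
{ move=> ps; apply: le_trans (H p ps G W) _; rewrite ler_pM2l//.
 have [_ [cb _] _ _] := Hb p.
 have ind q : (\1_((beta p).1.2) q : R) <= \1_K' q.
 { rewrite !indicE; have [bq|nb] := pselect ((beta p).1.2 q); last by rewrite memNset.
  by rewrite !mem_set//; exact: (subK p ps q bq). }
 apply: lerD.
  apply: (le_Rintegral_L1 (integrable_indic_dotv imm Hmu cb sG) (integrable_indic_dotv imm Hmu cK' sG)) => q.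
  by apply: ler_wpM2r; [exact: dotv_ge0|exact: ind].
 apply: (le_Rintegral_L1 (L2_indic imm Hmu cb sf) (L2_indic imm Hmu cK' sf)) => q.
 by apply: ler_wpM2r; [exact: sqr_ge0|exact: ind]. }
have ib p : L1 mu (fun q : borelType M => ((beta p).1.1 q * f q) ^+ 2).
{ have [sb [cb _] b0 _] := Hb p; apply: L2_int; apply: (cut_L2 W sb).
 by exists (beta p).1.2. }
have isum (s' : seq M) : L1 mu (fun q : borelType M => \sum_(p <- s') ((beta p).1.1 q * f q) ^+ 2) /\
 \int[mu]_q (\sum_(p <- s') ((beta p).1.1 q * f q) ^+ 2) = \sum_(p <- s') \int[mu]_q (((beta p).1.1 q * f q) ^+ 2).
{ elim: s' => [|p s' [I1 I2]].
  have -> : (fun q : borelType M => \sum_(p <- [::]) ((beta p).1.1 q * f q) ^+ 2) = cst 0 by apply/funext => q; rewrite big_nil.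
  by rewrite big_nil Rintegral_cst// mul0r; split => //; exact: integrable0.
 have -> : (fun q : borelType M => \sum_(j <- p :: s') ((beta j).1.1 q * f q) ^+ 2) =
  (fun q => ((beta p).1.1 q * f q) ^+ 2 + \sum_(j <- s') ((beta j).1.1 q * f q) ^+ 2) by apply/funext => q; rewrite big_cons.
 by rewrite big_cons RintegralD// I2; split => //; exact: L1D. }
have [I1 I2] := isum s.
have Y0 : 0 <= Y.
{ by rewrite addr_ge0//; apply: Rintegral_ge0 => p _; apply: mulr_ge0; rewrite ?dotv_ge0 ?sqr_ge0//. }
via (\sum_(p <- s) e' * Y).
 via (\int[mu]_q (\sum_(p <- s) ((beta p).1.1 q * f q) ^+ 2)).
  apply: (le_Rintegral_L1 (L2_indic imm Hmu cK sf) I1).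
  move=> q; have S0 (s' : seq M) : 0 <= \sum_(p <- s') ((beta p).1.1 q * f q) ^+ 2.
   by apply: sumr_ge0 => p _; exact: sqr_ge0.
  rewrite indicE; case: (boolP (q \in K)) => [|_]; last by rewrite mul0r.
  rewrite inE => /sK[p ps pq]; have [_ _ _ [_ _ b1]] := Hb p.
  by rewrite (big_rem p)//= b1// !mul1r lerDl.
 by rewrite I2 big_seq [leRHS]big_seq; apply: ler_sum => p ps; exact: Hp.
rewrite big_const_seq iter_addr_0 -mulr_natl mulrA; apply: ler_wpM2r => //.
via ((size s).+1%:R * e'); first by lra.
by rewrite mulrC divfK//.
Qed.

End JacobiSpace.

Lemma finite_nullity (R : realType) (n : nat) (M : ptopologicalType)
  (S : smooth_manifold R n M) (iota : M -> 'rV[R]_n.+1)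
  (mu : {measure set (borelType M) -> \bar R}) :
 (2 < n)%N -> is_immersion S iota -> is_riemannian_volume S iota mu ->
 is_proper iota -> is_minimal S iota ->
 (\int[mu]_p (Num.sqrt (A2 S iota p) ^+ n)%:E < +oo)%E ->
 finite_dim_ae mu (jacobi_null S iota mu).
Proof.
move=> n2 imm Hmu proper minimal curv.
have [K cK HK] := jacobi_local_bound imm Hmu proper n2 curv minimal.
have [K' cK' HK'] := compact_finitely_tested imm Hmu cK.
have [L L0 HL] := HK K' cK'.
(* Energy and L^2 norm on K' each cost L times the norm on K, so this factor gives a half of that
   norm, which must then be zero. *)
have e0 : 0 < (4 * L)^-1 by rewrite invr_gt0 mulr_gt0.
have z1 : L2 mu (fun _ : borelType M => (0 : R)) by exact: L2_0.
have i0 d (T : measurableType d) (nu : {measure set T -> \bar R}) (D : set T) (u : T -> R) :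
 (forall t, u t = 0) -> \int[nu]_(t in D) u t = 0.
 by move=> u0; rewrite /Rintegral integral0_eq// => t _; rewrite u0.
have Z : W12_grad S iota mu (fun=> 0) (fun=> 0).
{ split=> [//|j|]; first by rewrite mxE.
 split; first by move=> c p _ _; exact: sub0mx.
 move=> c i psi _ _ _; rewrite ?i0 ?oppr0// => t; last by lra.
 by rewrite dotv0l mul0r. }
have ZJ : weak_jacobi S iota mu (fun=> 0) (fun=> 0).
{ move=> phi _ _; rewrite ?i0 ?oppr0 ?addr0// => p; last by rewrite dotv0l.
 by lra. }
apply: (finite_dim_of_tested imm Hmu); first by exists (fun=> 0).
have [N [l [ll lP]]] := HK' _ e0; exists N, l; split => // f /lP H [G W J].
have [sf _ _] := W; have [b1 b2] := HL f G W J; have b3 := H G W.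
have f0 : L2on mu K f = 0.
{ have x0 : 0 <= L2on mu K f by apply: Rintegral_ge0 => p _; rewrite mulr_ge0 ?sqr_ge0//.
 have h : L2on mu K f <= 2^-1 * L2on mu K f.
 { apply: le_trans b3 _; via ((4 * L)^-1 * (L * L2on mu K f + L * L2on mu K f)).
   by rewrite ler_pM2l// lerD.
  by apply: le_of_eq; field; rewrite gt_eqF. }
 lra. }
apply: (ae_zero_of_L2on imm Hmu proper sf) => K'' cK''.
have [L'' L''0 HL''] := HK K'' cK''; have [_] := HL'' f G W J; rewrite f0 mulr0 => h.
apply/eqP; rewrite eq_le h; apply: Rintegral_ge0 => p _; rewrite mulr_ge0 ?sqr_ge0//.
Qed.

Theorem corollary2 (R : realType) (n : nat) (M : ptopologicalType)
    (S : smooth_manifold R n M) (iota : M -> 'rV[R]_n.+1)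
    (mu : {measure set (borelType M) -> \bar R}) :
  (3 <= n)%N ->
  connected [set: M] ->
  is_immersion S iota ->
  is_riemannian_volume S iota mu ->
  is_complete S iota ->
  two_sided S iota ->
  is_proper iota ->
  is_minimal S iota ->
  (\int[mu]_p (Num.sqrt (A2 S iota p) ^+ n)%:E < +oo)%E ->
  (limf_esup (fun r : R =>
       hausdorff_measure n (range iota `&` eball r) * ((r ^+ n)^-1)%:E)
     (pinfty_nbhs R) < +oo)%E ->
  finite_dim_ae mu (jacobi_null S iota mu).
Proof.
by move=> n3 _ imm Hmu _ _ proper minimal curv _; exact: (finite_nullity n3 imm Hmu proper minimal curv).
Qed.
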